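(* Let $\mathcal{HA}$ denote the Harmonic archipelago. Then its singular homology groups with integer coefficients satisfy $$H_1(\mathcal{HA};\mathbb{Z})\cong \Big(\prod_{i\in\mathbb{N}}\mathbb{Z}\Big)\Big/\Big(\sum_{i\in\mathbb{N}}\mathbb{Z}\Big),$$ and $H_n(\mathcal{HA};\mathbb{Z})\cong 0$ for all integers $n\ge 2$.
   Context: Here $\mathbb{N}=\{1,2,3,\dots\}$, $\prod_{i\in\mathbb{N}}\mathbb{Z}$ is the group of all integer sequences and $\sum_{i\in\mathbb{N}}\mathbb{Z}$ is its subgroup of finitely supported sequences (the direct sum). The Hawaiian earring is $\mathbb{H}=\bigcup_{n\in\mathbb{N}}K_n\subset\mathbb{R}^2$, where $K_n=\{(x,y)\in\mathbb{R}^2 : x^2+(y-\frac1n)^2=(\frac1n)^2\}$. The Harmonic archipelago $\mathcal{HA}$ is the noncompact subspace of $\mathbb{R}^3$ obtained from $\mathbb{H}$ by adjoining, for each $n$, a ''tall'' disk (of height $1$) between the consecutive loops $K_n$ and $K_{n+1}$. Concretely: let $D\subset\mathbb{R}^2$ be the closed disk bounded by $K_1$. For $n\in\mathbb{N}$ let $p_n=(0,\frac1n+\frac1{n+1})$ and $r_n=\frac{1}{2n(n+1)}$, so that the closed disk $B_n$ of center $p_n$ and radius $r_n$ lies in the open crescent-shaped region inside $K_n$ and outside $K_{n+1}$. Define $f:D\to\mathbb{R}$ by $f(p)=1-|p-p_n|/r_n$ if $p\in B_n$ for some $n$, and $f(p)=0$ otherwise. Then $\mathcal{HA}=\{(x,y,f(x,y))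 : (x,y)\in D\}\subset\mathbb{R}^3$ with the subspace topology (note that $f$ is discontinuous at the origin). *)

(* Defs.v *)
From HB Require Import structures.
From mathcomp Require Import all_boot all_order all_algebra.
From mathcomp Require Import all_classical all_reals all_analysis.
From mathcomp Require Import ring_quotient.
From mathcomp Require Import ring lra.
From mathcomp.multinomials Require Import freeg.

Set Implicit Arguments.
Unset Strict Implicit.
Unset Printing Implicit Defensive.

Import Order.TTheory GRing.Theory Num.Theory.
Import numFieldNormedType.Exports.

Local Open Scope classical_set_scope.
Local Open Scope ring_scope.

Lemma unit_addA : associative (fun _ _ : unit => tt). Proof. by []. Qed.
Lemma unit_addC : commutative (fun _ _ : unit => tt). Proof. by []. Qed.
Lemma unit_add0 : left_id tt (fun _ _ : unit => tt). Proof. by case. Qed.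
Lemma unit_addN : left_inverse tt (fun _ : unit => tt) (fun _ _ => tt).
Proof. by []. Qed.

HB.instance Definition _ :=
  GRing.isZmodule.Build unit unit_addA unit_addC unit_add0 unit_addN.

Definition zmod_isomorphic (A B : zmodType) : Prop :=
  exists f : {additive A -> B}, bijective f.

Section Simplex.
Variable R : realType.

Definition std_simplex (n : nat) : set 'rV[R]_n.+1 :=
  [set t | (forall i, 0 <= t 0 i) /\ \sum_i t 0 i = 1].
Arguments std_simplex : clear implicits.

(* Inserts the coordinate 0 at position i. *)
Definition insert0 (n : nat) (i : 'I_n.+2) (t : 'rV[R]_n.+1) : 'rV[R]_n.+2 :=
  \row_j (if unlift i j is Some k then t 0 k else 0).

Lemma insert0_simplex n (i : 'I_n.+2) (t : std_simplex n) :
  insert0 i (\val t) \in std_simplex n.+1.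
Proof.
case: t => t /= /set_mem[t0 t1]; apply/mem_set; split=> [j|].
  by rewrite mxE; case: unliftP.
rewrite (bigD1 i) //= mxE unlift_none add0r -[RHS]t1.
rewrite (reindex_onto (fintype.lift i) (fun j => odflt ord0 (unlift i j))) /=.
  apply: eq_big => [k|k _]; last by rewrite mxE liftK.
  by rewrite liftK eqxx andbT eq_sym neq_lift.
move=> j; case: (unliftP i j) => [k ->|->]; last by rewrite eqxx.
by [].
Qed.

Definition coface n (i : 'I_n.+2) (t : std_simplex n) : std_simplex n.+1 :=
  exist _ (insert0 i (\val t)) (insert0_simplex i t).

Lemma insert0_continuous n (i : 'I_n.+2) : continuous (@insert0 n i).
Proof.
move=> t A [P Pn sPA].
exists (fun _ k => P 0 (fintype.lift i k)) => [a k|u Pu].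
  by have := Pn 0 (fintype.lift i k); rewrite mxE liftK ord1.
apply: sPA => a j; have := Pn a j; rewrite !mxE ord1.
case: unliftP => [k ->|->] nP; last exact: nbhs_singleton nP.
exact: Pu.
Qed.

Lemma coface_continuous n (i : 'I_n.+2) : continuous (@coface n i).
Proof.
apply: continuous_comp_initial => t.
have -> : set_val \o coface i =
    insert0 i \o (set_val : std_simplex n -> 'rV_n.+1).
  by apply/funext => x; rewrite /= !set_valE.
apply: (@continuous_comp (std_simplex n) _ _ set_val (insert0 i)).
  exact: (@initial_continuous (std_simplex n) _ set_val).
exact: insert0_continuous.
Qed.

HB.instance Definition _ n (i : 'I_n.+2) :=
  isContinuous.Build _ _ (@coface n i) (@coface_continuous n i).

End Simplex.
Arguments std_simplex : clear implicits.

Section SingularHomology.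
Variables (R : realType) (T : topologicalType).

Definition singular_simplex (n : nat) : choiceType :=
  continuousType (std_simplex R n) T.

Definition singular_face n (i : 'I_n.+2) (s : singular_simplex n.+1) :
  singular_simplex n := s \o @coface R n i.

Definition singular_chain (n : nat) : lmodType int :=
  {freeg (singular_simplex n) / int}.

Definition boundary n : singular_chain n.+1 -> singular_chain n :=
  fglift (fun s : singular_simplex n.+1 =>
    \sum_(i < n.+2) (-1) ^+ i *: << singular_face i s >> : singular_chain n).

Lemma boundary_is_additive n : additive (@boundary n).
Proof. exact: lift_is_additive. Qed.

HB.instance Definition _ n :=
  GRing.isAdditive.Build _ _ (@boundary n) (@boundary_is_additive n).

(* Every 0-chain is a cycle. *)
Definition is_cycle (n : nat) : {pred singular_chain n} :=
  match n with
  | 0 => predT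
  | m.+1 => [pred c : singular_chain m.+1 | boundary c == 0]
  end.

Lemma is_cycle_zmod_closed n : zmod_closed (@is_cycle n).
Proof.
case: n => [|n]; split=> //; first by rewrite inE raddf0.
by move=> c d /eqP c0 /eqP d0; rewrite inE raddfB /= c0 d0 subr0.
Qed.

HB.instance Definition _ n :=
  GRing.isZmodClosed.Build _ (@is_cycle n) (@is_cycle_zmod_closed n).

Record cycle_group (n : nat) := Cycle {
  cycle_chain :> singular_chain n;
  _ : cycle_chain \in @is_cycle n
}.

HB.instance Definition _ n := [isSub for @cycle_chain n].
HB.instance Definition _ n := [Choice of cycle_group n by <:].
HB.instance Definition _ n :=
  [SubChoice_isSubZmodule of cycle_group n by <:].

Definition is_boundary (n : nat) : {pred cycle_group n} :=
  [pred z : cycle_group n | `[< exists c, boundary c = z >]].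

Lemma is_boundary_zmod_closed n : zmod_closed (@is_boundary n).
Proof.
split; first by apply/asboolP; exists 0; rewrite raddf0.
move=> y z /asboolP[c cy] /asboolP[d dz]; apply/asboolP; exists (c - d).
by rewrite !raddfB /= cy dz.
Qed.

HB.instance Definition _ n :=
  GRing.isZmodClosed.Build _ (@is_boundary n) (@is_boundary_zmod_closed n).

Definition homology (n : nat) : zmodType := Quotient.quot (@is_boundary n).

End SingularHomology.

(* Sequences are indexed by 0, 1, 2, ... instead of 1, 2, 3, ... *)
Definition finitely_supported : {pred (nat -> int)} :=
  [pred u | `[< finite_set [set i | u i != 0] >]].

Lemma finitely_supported_zmod_closed : zmod_closed finitely_supported.
Proof.
split.
  apply/asboolP; rewrite (_ : [set _ | _] = set0) //.
  by apply/seteqP; split=> i //=; rewrite eqxx.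
move=> u v /asboolP fu /asboolP fv; apply/asboolP.
apply: (@sub_finite_set _ _ ([set i | u i != 0] `|` [set i | v i != 0])).
  move=> i /= uv0; have [u0|] := eqVneq (u i) 0; last by left.
  right; apply: contra uv0 => /eqP v0.
  by rewrite !fctE u0 v0 subrr.
by rewrite finite_setU.
Qed.

HB.instance Definition _ :=
  GRing.isZmodClosed.Build _ finitely_supported finitely_supported_zmod_closed.

Definition product_mod_sum : zmodType := Quotient.quot finitely_supported.

Section HarmonicArchipelago.
Variable R : realType.

(* The library's norm on R * R is the sup norm. *)
Definition euclid_dist (p q : R * R) : R :=
  Num.sqrt ((p.1 - q.1) ^+ 2 + (p.2 - q.2) ^+ 2).

Definition base_disk : set (R * R) := [set p | euclid_dist p (0, 1) <= 1].

Definition hill_center (n : nat) : R * R := (0, n%:R^-1 + n.+1%:R^-1).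

Definition hill_radius (n : nat) : R := (2 * n%:R * n.+1%:R)^-1.

Definition hill (n : nat) : set (R * R) :=
  [set p | euclid_dist p (hill_center n) <= hill_radius n].

Definition on_hill (p : R * R) (n : nat) : Prop := (0 < n)%N /\ hill n p.

Definition height (p : R * R) : R :=
  match pselect (exists n, on_hill p n) with
  | left h => let n := projT1 (cid h) in
      1 - euclid_dist p (hill_center n) / hill_radius n
  | right _ => 0
  end.

(* The hills are pairwise disjoint, so the choice made in [height] is
   immaterial. *)
Lemma on_hill_inj (p : R * R) (m n : nat) :
  on_hill p m -> on_hill p n -> m = n.
Proof.
wlog mn : m n / (m <= n)%N.
  by move=> H; case: (leqP m n) => [|/ltnW] mn pm pn; [|symmetry]; apply: H.
move=> [m0 pm] [n0 pn]; apply/eqP; rewrite eqn_leq mn /= leqNgt.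
apply/negP => {}mn.
have dist2 q k : hill k q -> `|q.2 - (hill_center k).2| <= hill_radius k.
  apply: le_trans; rewrite -sqrtr_sqr ler_wsqrtr //.
  by rewrite lerDr sqr_ge0.
have radius k : (0 < k)%N ->
    hill_radius k = (k%:R^-1 - k.+1%:R^-1) / 2 :> R.
  move=> k0; rewrite /hill_radius; have k0' : k%:R != 0 :> R.
    by rewrite pnatr_eq0 -lt0n.
  have k1' : k.+1%:R != 0 :> R by rewrite pnatr_eq0.
  rewrite -addn1 natrD in k1' *.
  by field; rewrite k0' k1'.
move: (dist2 _ _ pm) (dist2 _ _ pn); rewrite !radius // /hill_center /=.
have inv_le a b : (0 < a)%N -> (a <= b)%N -> b%:R^-1 <= a%:R^-1 :> R.
  move=> a0 ab; rewrite lef_pV2 ?posrE ?ltr0n ?ler_nat //.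
  exact: leq_trans a0 ab.
have inv_lt a : (0 < a)%N -> a.+1%:R^-1 < a%:R^-1 :> R.
  by move=> a0; rewrite ltf_pV2 ?posrE ?ltr0n ?ltr_nat.
move: (inv_lt m m0) (inv_lt n n0) (inv_le m.+1 n isT mn).
rewrite !ler_norml; move: (m%:R^-1) (m.+1%:R^-1) (n%:R^-1) (n.+1%:R^-1).
move=> a b c d h1 h2 h3 /andP[h4 h5] /andP[h6 h7].
lra.
Qed.

Definition archipelago_set : set (R * R * R) :=
  [set q | base_disk q.1 /\ q.2 = height q.1].

Definition harmonic_archipelago : topologicalType := set_type archipelago_set.

End HarmonicArchipelago.

(* Main.v *)
Require Import Defs.
From HB Require Import structures.
From mathcomp Require Import all_boot all_order all_algebra.
From mathcomp Require Import all_classical all_reals all_analysis.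
From mathcomp Require Import ring_quotient generic_quotient.
From mathcomp Require Import ring lra zify.
From mathcomp.multinomials Require Import freeg.

Set Implicit Arguments.
Unset Strict Implicit.
Unset Printing Implicit Defensive.

Import Order.TTheory GRing.Theory Num.Theory.
Import numFieldNormedType.Exports.

(* A loop reads an infinite word in the letters [a_n] (crossings of the axis between consecutive
   peaks), recorded as a sequence of reduced words, one for each level [M], and conversely bounded
   infinite words are read along explicit loops. A simplex avoids all peaks of large index; the space
   without those peaks retracts onto paths determined by their words, which gives, for each simplex,
   a cone whose edges are determined by words. Comparing these cones with the action of the group of
   occurring words on the free group (a tower of finitely generated free images stabilises) shows
   that a chain whose boundary is divisible by [p] is a boundary plus a multiple of [p]. Hence
   [H_n = 0] for [n >= 2] and [H_1] is torsion free.

   Every class of [H_1] is the class of a loop whose letters have arbitrarily large index. Exponent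
   sums give a surjection of [H_1] onto [A], the product modulo the sum. In its kernel, as in [A],
   all systems [x_n = g_n + q_n x_(n+1)] are solvable, by the nested word
   [h_0 (h_1 (h_2 ...)^(q_1))^(q_0)]; so the kernel [K] is torsion free and cotorsion and
   [H_1 = K * A]. Finally [A] absorbs every such group [K] of at most continuum cardinality: [K], and
   [K^nat], embed purely, hence as direct factors, in [A^nat], by sending maximal independent sets
   modulo [p] to almost disjoint sequences. *)

(** * Free groups *)

(** The obstacle is the origin: arbitrarily small loops around it are essential, so there is no
    universal covering, and path classes are infinite words. Formal pairs of a simplex and the word
    at its first vertex take the place of a covering space. The words that occur in one finite chain
    generate a finitely generated group; since it embeds in a free group at a finite level, it acts
    freely on a tree. A tree has dimension one, so the equivariant comparison of chains with chains
    on the tree leaves nothing over in degrees at least 2. The comparison is additive, and this is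
    why divisibility of a boundary passes through it.

    On the algebraic side the kernel of the exponent sums is never identified up to isomorphism.
    Torsion freeness, solvability of the systems and cardinality suffice, because absorption needs
    only that a countable power of the kernel is a direct factor of a countable power of the product
    modulo the sum. *)

Section FreeGroup.

Definition letter : Type := (nat * bool)%type.
Implicit Types (a b : letter) (w v : seq letter).

Definition flip a : letter := (a.1, ~~ a.2).

Lemma flipK : involutive flip. Proof. by case=> n []. Qed.

(* Words are stored backwards: the head is the last letter. *)
Fixpoint reduced_word w : bool :=
  if w is a :: w' then
    (if w' is b :: _ then b != flip a else true) && reduced_word w'
  else true.

Definition push a w : seq letter :=
  if w is b :: w' then (if b == flip a then w' else a :: w) else [:: a].

Lemma reduced_word_tl a w : reduced_word (a :: w) -> reduced_word w.
Proof. by case/andP. Qed.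

Lemma reduced_push a w : reduced_word w -> reduced_word (push a w).
Proof.
case: w => [|b w] //= rw; case: ifPn => [_|ba].
  by case/andP: rw.
by rewrite /= ba rw.
Qed.

Lemma push_flipK a w : reduced_word w -> push (flip a) (push a w) = w.
Proof.
case: w => [|b w] /=; first by rewrite flipK eqxx.
case: (eqVneq b (flip a)) => [-> |ba] rw /=; last by rewrite flipK eqxx.
by case: w rw => [|c w] //= /andP[/negPf -> _].
Qed.

Record free_group := FreeWord { word : seq letter; _ : reduced_word word }.

HB.instance Definition _ := [isSub for word].
HB.instance Definition _ := [Choice of free_group by <:].

Implicit Types f g h : free_group.

Lemma wordP g : reduced_word (word g). Proof. by case: g. Qed.

Lemma reduced_foldr_push w v : reduced_word v -> reduced_word (foldr push v w).
Proof. by move=> rv; elim: w => //= a w; apply: reduced_push. Qed.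

Definition act_word g w : free_group :=
  FreeWord (reduced_foldr_push w (wordP g)).

Definition fg1 : free_group := @FreeWord [::] isT.
Definition fg_mul g h := act_word g (word h).
Definition fg_inv g := act_word fg1 (rev (map flip (word g))).

(** Only the cancelling case has content: there [push_flipK] undoes the push already made.
    Associativity rests on this. *)
Lemma foldr_push_push v a w : reduced_word v -> reduced_word w ->
  foldr push v (push a w) = push a (foldr push v w).
Proof.
move=> rv; case: w => [|b w] //= rw.
case: eqP => [->|] //=; rewrite -{1}[w]/(behead (flip a :: w)) /=.
have := push_flipK (flip a) (reduced_foldr_push w rv).
by rewrite flipK => ->.
Qed.

Lemma fg_mulA : associative fg_mul.
Proof.
move=> f g h; apply: val_inj => /=.
elim: (word h) (wordP h) => //= a w IH rw.
rewrite foldr_push_push ?IH ?wordP //; first exact: reduced_word_tl rw.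
by apply: reduced_foldr_push; apply: wordP.
Qed.

Lemma foldr_push_nil w : reduced_word w -> foldr push [::] w = w.
Proof.
elim: w => //= a w IH rw; rewrite IH; last exact: reduced_word_tl rw.
by case: w rw {IH} => [|b w] //= /andP[/negPf ->].
Qed.

Lemma fg_mul1 : left_id fg1 fg_mul.
Proof. by move=> g; apply: val_inj; apply: foldr_push_nil (wordP g). Qed.

Lemma fg_mulg1 : right_id fg1 fg_mul.
Proof. by move=> g; apply: val_inj. Qed.

Lemma fg_mulV : left_inverse fg1 fg_inv fg_mul.
Proof.
move=> g; apply: val_inj => /=.
have key w v : reduced_word v ->
    foldr push (foldr push v (rev (map flip w))) w = v.
  elim: w v => //= a w IH v rv.
  rewrite rev_cons foldr_rcons IH ?reduced_push //.
  by rewrite -{1}[a]flipK push_flipK.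
exact: key.
Qed.

Lemma fg_mulgV : right_inverse fg1 fg_inv fg_mul.
Proof.
move=> g; rewrite -[LHS]fg_mul1 -{1}(fg_mulV (fg_inv g)) -fg_mulA.
by rewrite (fg_mulA (fg_inv g)) fg_mulV fg_mul1 fg_mulV.
Qed.

HB.instance Definition _ := isGroup.Build free_group
  fg_mulA fg_mul1 fg_mulg1 fg_mulV fg_mulgV.

Local Open Scope group_scope.

Definition fletter a : free_group := @FreeWord [:: a] isT.

Lemma word_mul g h : word (g * h) = foldr push (word g) (word h).
Proof. by []. Qed.

Lemma word_mul_letter g a : word (g * fletter a) = push a (word g).
Proof. by []. Qed.

Lemma fletter_flip a : fletter (flip a) = (fletter a)^-1.
Proof. by apply: val_inj. Qed.

Lemma free_group_ind (P : free_group -> Prop) :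
  P 1 -> (forall g a, P g -> P (g * fletter a)) -> forall g, P g.
Proof.
move=> P1 PS [w rw]; elim: w rw => [|a w IH] rw.
  by have -> : FreeWord rw = 1 by apply: val_inj.
have rw' := reduced_word_tl rw.
have -> : FreeWord rw = FreeWord rw' * fletter a.
  by apply: val_inj => /=; move: (rw); case: (w) => [|b v] //= /andP[/negPf ->].
exact: PS.
Qed.

Section Extension.
Variables (G : groupType) (t : nat -> G).

Definition eval_letter a : G := if a.2 then t a.1 else (t a.1)^-1.
Definition eval_word w : G := foldr (fun a x => x * eval_letter a) 1 w.
Definition eval g : G := eval_word (word g).

Lemma eval_letter_flip a : eval_letter (flip a) = (eval_letter a)^-1.
Proof. by case: a => n [] //=; rewrite /eval_letter /= invgK. Qed.

Lemma eval_push a w : eval_word (push a w) = eval_word w * eval_letter a.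
Proof.
case: w => [|b w] //=; case: eqP => [->|] //=.
by rewrite eval_letter_flip mulgVK.
Qed.

Lemma evalM g h : eval (g * h) = eval g * eval h.
Proof.
rewrite /eval word_mul; elim: (word h) => /= [|a w IH]; first by rewrite mulg1.
by rewrite eval_push IH mulgA.
Qed.

Lemma evalV g : eval g^-1 = (eval g)^-1.
Proof. by apply: (mulgI (eval g)); rewrite -evalM !mulgV. Qed.

Lemma eval_fletter a : eval (fletter a) = eval_letter a.
Proof. exact: mul1g. Qed.

End Extension.

Definition kill_from (M : nat) (n : nat) : free_group :=
  if (n < M)%N then fletter (n, true) else 1.

(** Bonding maps of the inverse system through which infinite words are read. *)
Definition pr M : free_group -> free_group := eval (kill_from M).
Arguments pr : simpl never.

Lemma prM M : {morph pr M : g h / g * h}. Proof. exact: evalM. Qed.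

Lemma pr_letter M a : pr M (fletter a) = if (a.1 < M)%N then fletter a else 1.
Proof.
rewrite /pr eval_fletter /eval_letter /kill_from; case: a => n b /=.
by case: ltnP => _; case: b; rewrite ?invg1 // -fletter_flip.
Qed.

Definition labels_in (P : pred nat) g := all (fun a => P a.1) (word g).

Lemma labels_inM P g h :
  labels_in P g -> labels_in P h -> labels_in P (g * h).
Proof.
rewrite /labels_in word_mul => Pg; elim: (word h) => //= a w IH /andP[Pa Pw].
have {IH Pw} := IH Pw; case: (foldr _ _ _) => [|b v] /=; first by rewrite Pa.
by case: ifP => _ /= /andP[Pb Pv]; rewrite ?Pa ?Pb.
Qed.

Lemma free_hom_ext (G : groupType) (u v : free_group -> G) :
  {morph u : g h / g * h} -> {morph v : g h / g * h} ->
  (forall a, u (fletter a) = v (fletter a)) -> u =1 v.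
Proof.
move=> uM vM uv; elim/free_group_ind => [|g a IH]; last by rewrite uM vM IH uv.
have e1 (f : free_group -> G) : {morph f : g h / g * h} -> f 1 = 1.
  by move=> fM; apply: (mulgI (f 1)); rewrite -fM !mulg1.
by rewrite !e1.
Qed.

Lemma pr_pr M N g : (M <= N)%N -> pr M (pr N g) = pr M g.
Proof.
move=> MN; have: pr M \o pr N =1 pr M; last exact.
apply: free_hom_ext => [x h|x h|a]; [by rewrite /= !prM|exact: prM|].
rewrite /comp.
rewrite !pr_letter; case: ltnP => aN; rewrite ?pr_letter //.
by case: ltnP => // aM; have := leq_trans aM MN; rewrite ltnNge aN.
Qed.

Lemma word_pr M g :
  word (pr M g) = foldr push [::] [seq a <- word g | (a.1 < M)%N].
Proof.
rewrite /pr /eval; elim: (word g) => //= a w.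
move: (eval_word _ w) => x IH.
rewrite /eval_letter /kill_from; case: ltnP => _.
  rewrite /= -IH -word_mul_letter; congr (word (x * _)).
  by case: a => n []; rewrite // -fletter_flip.
rewrite [RHS]/= -IH; by case: a.2; rewrite ?invg1.
Qed.

Lemma foldr_push_subseq w : subseq (foldr push [::] w) w.
Proof.
elim: w => //= a w; case: (foldr _ _ _) => [|b v] /= IH.
  by rewrite eqxx sub0seq.
case: ifP => _; last by rewrite eqxx.
apply: subseq_trans (subseq_cons w a).
by apply: subseq_trans IH; apply: subseq_cons.
Qed.

Definition count_label i g := count (fun a : letter => a.1 == i) (word g).

Lemma count_push i a w :
  (count (fun a => a.1 == i) (push a w)
    <= (a.1 == i) + count (fun a => a.1 == i) w)%N.
Proof. by case: w => [|b w] //=; case: ifP => _ /=; lia. Qed.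

Lemma count_labelM i g h :
  (count_label i (g * h)%g <= count_label i g + count_label i h)%N.
Proof.
rewrite /count_label word_mul; elim: (word h) => [|a w IH] /=; first by rewrite addn0.
by apply: (leq_trans (count_push _ _ _)); lia.
Qed.

Lemma count_label_pr i M g : (count_label i (pr M g) <= count_label i g)%N.
Proof.
rewrite /count_label word_pr.
apply: leq_trans (leq_count_subseq _ (foldr_push_subseq _)) _.
exact: leq_count_subseq (filter_subseq _ _).
Qed.

Lemma labels_in_pr M g : labels_in (ltn^~ M) (pr M g).
Proof.
rewrite /labels_in word_pr; apply/allP => a /(mem_subseq (foldr_push_subseq _)).
by rewrite mem_filter => /andP[].
Qed.

Lemma labels_inS (P Q : pred nat) g :
  {subset P <= Q} -> labels_in P g -> labels_in Q g.
Proof. by move=> PQ; apply: sub_all => a; apply: PQ. Qed.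

(* Right multiplication by letters of label at least I only affects the part
   of a word after its last letter of label less than I. *)
Fixpoint core I w :=
  if w is a :: w' then (if (I <= a.1)%N then core I w' else w) else [::].

Lemma core_push I a w : (I <= a.1)%N -> core I (push a w) = core I w.
Proof.
move=> Ia; case: w => [|b w] /=; first by rewrite Ia.
by case: eqP => [->|_] /=; rewrite Ia.
Qed.

Lemma core_mul I g x : labels_in (leq I) x ->
  core I (word (g * x)) = core I (word g).
Proof.
by rewrite /labels_in word_mul; elim: (word x) => //= a w IH /andP[Ia /IH];
  rewrite core_push.
Qed.

(* A function on the vertices of the Cayley tree is determined by its
   increments along the edges. *)
Section Potential.
Variables (V : zmodType) (step : free_group -> letter -> V).
Hypothesis stepK : forall g a, (step g a + step (g * fletter a)%g (flip a) = 0)%R.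

Fixpoint potential_word w : V :=
  if w is a :: w' then (potential_word w' + step (act_word 1%g w') a)%R else 0%R.

Definition potential g : V := potential_word (word g).

Lemma act_word1 g : act_word 1 (word g) = g.
Proof. exact: fg_mul1. Qed.

Lemma potentialM g a : potential (g * fletter a) = (potential g + step g a)%R.
Proof.
rewrite /potential word_mul_letter.
case E : (word g) => [|b w] /=.
  by congr (_ + step _ _)%R; apply: val_inj; rewrite /= E.
case: eqP => [eb|_] /=; last by rewrite -E /= -[in RHS](act_word1 g) E.
have rw : reduced_word w by have := wordP g; rewrite E => /reduced_word_tl.
have gE : act_word 1 w = g * fletter a.
  apply: val_inj; rewrite /= E /= eb eqxx; exact: foldr_push_nil.
rewrite gE eb -addrA addrC.
have := stepK (g * fletter a) (flip a).
rewrite fletter_flip mulgK flipK => ->.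
by rewrite add0r.
Qed.

End Potential.

End FreeGroup.

(** * Magnus coefficients and towers of free groups *)

Section Magnus.
Local Open Scope ring_scope.
Implicit Types (a : letter) (w : seq letter) (u v : seq nat) (f g h : free_group).

Definition letter_sign a : int := if a.2 then 1 else -1.

(* Coefficient at the monomial [u] (stored backwards) of the image of [w] under
   the representation sending the generator i to 1 + X_i, where X_i^2 = 0. *)
Fixpoint magnus_word w u : int :=
  if w is a :: w' then
    (magnus_word w' u +
      (if u is i :: u' then
         (if i == a.1 then letter_sign a * magnus_word w' u' else 0) else 0))%R
  else (u == [::])%:R.

Lemma magnus_cons a w u : magnus_word (a :: w) u =
  magnus_word w u + (if u is i :: u' then
    (if i == a.1 then letter_sign a * magnus_word w u' else 0) else 0).
Proof. by []. Qed.

(** The monomials that survive [X_i^2 = 0]. The recursion of [magnus_word] does not impose this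
    relation, so it respects cancellation only on these. *)
Definition norep u : bool := sorted (fun i j => i != j) u.

Lemma norep_tl i u : norep (i :: u) -> norep u.
Proof. by rewrite /norep /=; apply: path_sorted. Qed.

Lemma norep_take k u : norep u -> norep (take k u).
Proof. exact: take_sorted. Qed.

Lemma norep_drop k u : norep u -> norep (drop k u).
Proof. exact: drop_sorted. Qed.

Definition magnus g u : int := magnus_word (word g) u.

Lemma magnus_push a w u : norep u ->
  magnus_word (push a w) u = magnus_word (a :: w) u.
Proof.
case: w => [|b w] //= nu; case: eqP => [->|] //=.
case: u nu => [|i u] nu; first by rewrite !addr0.
case: eqP => [ei|]; last by rewrite !addr0.
have -> : letter_sign (flip a) = - letter_sign a.
  by case: (a) => n []; rewrite /letter_sign /= ?opprK.
case: u nu => [|j u] nu; rewrite ?addr0; first by rewrite mulNr subrK.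
have -> : (j == a.1) = false.
  by move: nu; rewrite /norep /= ei => /andP[/negPf]; rewrite eq_sym.
by rewrite addr0 mulNr subrK.
Qed.

Lemma magnus1 u : magnus 1%g u = (u == [::])%:R.
Proof. by []. Qed.

Lemma magnus_letter g a u : norep u -> magnus (g * fletter a)%g u =
  magnus g u + (if u is i :: u' then
         (if i == a.1 then letter_sign a * magnus g u' else 0) else 0).
Proof. exact: magnus_push. Qed.

Lemma magnus_nil g : magnus g [::] = 1.
Proof.
elim/free_group_ind: g => // g a IH.
by rewrite magnus_letter // addr0.
Qed.

Lemma magnusM g h u : norep u -> magnus (g * h)%g u =
  \sum_(0 <= k < (size u).+1) magnus g (drop k u) * magnus h (take k u).
Proof.
elim/free_group_ind: h u => [|h a IH] u nu.
  rewrite mulg1 big_nat_recl // drop0 take0 magnus_nil mulr1 big1_seq ?addr0 //.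
  move=> k /andP[_]; rewrite mem_index_iota => /andP[_ ku].
  by rewrite magnus1; case: u ku {nu} => //= i u _; rewrite mulr0.
rewrite mulgA magnus_letter // IH //.
rewrite [RHS](eq_big_nat _ _ (F2 := fun k => magnus g (drop k u) * magnus h (take k u)
   + magnus g (drop k u) * (if take k u is i :: u' then
      (if i == a.1 then letter_sign a * magnus h u' else 0) else 0))); last first.
  by move=> k _; rewrite magnus_letter ?norep_take // mulrDr.
rewrite big_split /=; congr (_ + _).
case: u nu => [|i u] nu; first by rewrite big_nat1 mulr0.
rewrite big_nat_recl //= mulr0 add0r.
case: eqP => _; last by rewrite big1 // => k _; rewrite mulr0.
rewrite IH; last exact: norep_tl nu.
by rewrite mulr_sumr; apply: eq_bigr => k _; rewrite mulrCA.
Qed.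

(** [a.1 :: u] lists the labels of the syllables of the word, and its coefficient is the product of
    their signed exponents; the head syllable has length [n.+1]. The two vanishing clauses, above
    this degree and in this degree with another head, carry the induction. *)
Lemma magnus_word_neq0 a w : reduced_word (a :: w) ->
  exists u n, [/\ norep (a.1 :: u), magnus_word (a :: w) u != 0,
    magnus_word (a :: w) (a.1 :: u)
      = n.+1%:R * letter_sign a * magnus_word (a :: w) u,
    forall v, norep v -> (size u < (size v).-1)%N ->
      magnus_word (a :: w) v = 0 &
    forall i v, norep (i :: v) -> size v = size u -> i != a.1 ->
      magnus_word (a :: w) (i :: v) = 0].
Proof.
elim: w a => [|b w IH] a rw.
  exists [::], 0%N; split=> //.
  - by rewrite /= eqxx; ring.
  - by case=> [|i [|j v]] //= _ _; case: eqP; rewrite ?mulr0 addr0.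
  - by move=> i [] //= _ _ /negPf ->.
case/andP: rw => ba rb; have [u [n [nu C0 Cn V1 V2]]] := IH b rb.
have sz (i : nat) (v : seq nat) : norep (i :: v) -> (if v is j :: _ then j != i else true).
  by case: v => //= j v /andP[]; rewrite eq_sym.
have e0 (i : nat) (v : seq nat) : norep (i :: v) -> i = a.1 ->
    magnus_word [:: a, b & w] v = magnus_word (b :: w) v.
  move=> /sz iv ia; rewrite magnus_cons; case: v iv => [|j v].
    by rewrite addr0.
  by rewrite ia => /negPf ->; rewrite addr0.
(* Either the new letter prolongs the head syllable and [u] stays, or it opens a new one and [u]
   becomes [b.1 :: u]. *)
have [ab|nab] := eqVneq b.1 a.1.
  have {}ab : b = a.
    apply/eqP; rewrite -pair_eqE /pair_eq /= ab eqxx /=.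
    by move: ba; rewrite -pair_eqE /pair_eq /= ab eqxx /=; case: (a.2); case: (b.2).
  rewrite {}ab {b ba rb} in nu C0 Cn V1 V2 e0 *.
  exists u, n.+1; split=> //.
  - by rewrite (e0 a.1 u).
  - rewrite (e0 a.1 u) //.
    rewrite [LHS]magnus_cons eqxx Cn; rewrite -[n.+2]addn1 natrD; ring.
  - case=> [|i v] nv // sv; rewrite /= in sv.
    rewrite magnus_cons V1 // add0r; case: eqP => // ia.
    case: v nv sv => [|j v] nv // sv; rewrite /= in sv.
    have [e|ne] := eqVneq (size v) (size u).
      rewrite V2 ?mulr0 //; first exact: norep_tl nv.
      by rewrite -ia; have := sz _ _ nv.
    rewrite V1 ?mulr0 //; first exact: norep_tl nv.
    by rewrite /=; lia.
  - move=> i v nv sv ia.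
    by rewrite magnus_cons (negPf ia) addr0 V2.
have C1 : magnus_word [:: a, b & w] (b.1 :: u) = magnus_word (b :: w) (b.1 :: u).
  by rewrite magnus_cons (negPf nab) addr0.
exists (b.1 :: u), 0%N; split.
- by rewrite /norep /= eq_sym nab.
- rewrite C1 Cn !mulf_neq0 ?pnatr_eq0 //.
  by rewrite /letter_sign; case: (b.2).
- rewrite C1 magnus_cons eqxx V1 ?add0r ?mul1r //=.
  by rewrite /norep /= eq_sym nab.
- case=> [|i v] nv // sv; rewrite /= in sv.
  rewrite magnus_cons V1 //; last by rewrite /=; lia.
  rewrite add0r; case: eqP => // _; rewrite V1 ?mulr0 //; first exact: norep_tl nv.
  by lia.
- move=> i v nv sv ia; rewrite magnus_cons (negPf ia) addr0 V1 //=.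
  by rewrite sv /=.
Qed.

Lemma magnus_neq0 g : g != 1%g -> exists2 u, norep u & magnus g u != 0 /\ u != [::].
Proof.
move=> g1; have := wordP g; case E : (word g) => [|a w] rw.
  by case/eqP: g1; apply: val_inj.
have [u [n [nu C0 Cn _ _]]] := magnus_word_neq0 rw.
exists (a.1 :: u) => //; split=> //.
rewrite /magnus E Cn !mulf_neq0 ?pnatr_eq0 //.
by rewrite /letter_sign; case: (a.2).
Qed.

Section Lowest.
Variables (f g : free_group) (d : nat).
Hypothesis g_low : forall v, norep v -> (0 < size v < d)%N -> magnus g v = 0.

(** Every mixed term of the convolution contains a coefficient of [g] of positive degree below [d].
    So up to degree [d] the coefficients add, which is how homomorphisms to [int] are extracted. *)
Lemma magnus_mul_low u : norep u -> (0 < size u <= d)%N ->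
  magnus (f * g)%g u = magnus f u + magnus g u.
Proof.
move=> nu /andP[u0 ud]; rewrite magnusM // big_nat_recl //.
rewrite drop0 take0 magnus_nil mulr1; congr (_ + _).
have -> : size u = (size u).-1.+1 by rewrite prednK.
rewrite big_nat_recr //= prednK // drop_size take_size magnus_nil mul1r.
rewrite big1_seq ?add0r // => k /andP[_]; rewrite mem_index_iota => ku.
rewrite g_low ?mulr0 ?norep_take // size_take.
by case: ifP; lia.
Qed.

Lemma magnus_mul_low2 u : norep u -> (0 < size u <= d)%N ->
  magnus (g * f)%g u = magnus g u + magnus f u.
Proof.
move=> nu /andP[u0 ud]; rewrite magnusM // big_nat_recl //.
rewrite drop0 take0 magnus_nil mulr1; congr (_ + _).
have -> : size u = (size u).-1.+1 by rewrite prednK.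
rewrite big_nat_recr //= prednK // drop_size take_size magnus_nil mul1r.
rewrite big1_seq ?add0r // => k /andP[_]; rewrite mem_index_iota => ku.
rewrite g_low ?mul0r ?norep_drop // size_drop.
by lia.
Qed.

End Lowest.

End Magnus.

(** * Extending conjugation-invariant homomorphisms from a kernel *)

Section Extension.
Local Open Scope group_scope.
Variables (Phi : groupType) (q : Phi -> free_group) (chi : Phi -> int).
Hypothesis qM : {morph q : x y / x * y}.
Hypothesis chiM : forall x y, q x = 1 -> q y = 1 -> chi (x * y) = (chi x + chi y)%R.
Hypothesis chiJ : forall x y, q x = 1 -> chi (y * x * y^-1) = chi x.

Let q1 : q 1 = 1. Proof. by apply: (mulgI (q 1)); rewrite -qM !mulg1. Qed.
Let qV x : q x^-1 = (q x)^-1.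
Proof. by apply: (mulgI (q x)); rewrite -qM !mulgV q1. Qed.

Let same f : set free_group := [set f' | exists x, f = q x * f']%classic.
Let rep f : free_group := xget 1 (same f).
Let lft f : Phi := xget 1 [set x | f = q x * rep f]%classic.

Let lftE f : f = q (lft f) * rep f.
Proof.
have [x fx] : exists x, f = q x * rep f.
  rewrite /rep; case: xgetP => [f' _ [x ->]|/(_ f) []]; first by exists x.
  by exists 1; rewrite q1 mul1g.
by rewrite {1}/lft; case: xgetP => [y _ /= <-//|/(_ x)].
Qed.

Let repM x f : rep (q x * f) = rep f.
Proof.
congr xget; apply/seteqP; split=> f' /= [y e].
  by exists (x^-1 * y); rewrite qM qV -mulgA -e mulKg.
by exists (x * y); rewrite qM -mulgA -e.
Qed.

(** [Phi] acts on the free group by translations through [q], and [lft f] moves the chosen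
    representative of the orbit of [f] to [f]. The argument of [chi] lies in the kernel of [q] and
    measures how far [lft] is from being equivariant; [kapM] is a cocycle identity. *)
Let kap x f : int := chi ((lft (q x * f))^-1 * x * lft f).

Let lftM x f : q (lft (q x * f)) = q x * q (lft f).
Proof. by apply: (mulIg (rep f)); rewrite -mulgA -lftE -(repM x) -lftE. Qed.

Let kap_ker x f : q ((lft (q x * f))^-1 * x * lft f) = 1.
Proof. by rewrite !qM qV lftM -mulgA mulVg. Qed.

Let kapM x y f : kap (x * y) f = (kap x (q y * f) + kap y f)%R.
Proof.
rewrite -chiM ?kap_ker //; congr chi.
by rewrite qM -!mulgA mulVKg.
Qed.

Let kap_id k f : q k = 1 -> kap k f = chi k.
Proof.
move=> k1; rewrite /kap k1 mul1g -[in RHS](chiJ (lft f)^-1 k1) invgK //.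
Qed.

(** An edge function on the Cayley tree whose change under translation by [x] is the increment of
    [kap x] along the edge ([psiM]). *)
Let psi f i : int := (kap (lft f) (rep f * fletter (i, true)) - kap (lft f) (rep f))%R.

Let psiM x f i : (psi (q x * f) i - psi f i
  = kap x (f * fletter (i, true)) - kap x f)%R.
Proof.
rewrite /psi repM; set m := lft (q x * f); pose k := (x * lft f)^-1 * m.
have mE : m = x * lft f * k by rewrite /k mulVKg.
have k1 : q k = 1.
  by rewrite /k qM qV qM lftM mulVg.
rewrite mE !(kapM (x * lft f) k) !(kapM x) k1 !mul1g !(kap_id _ k1).
rewrite mulgA -lftE.
by ring.
Qed.

Let step f a : int := if a.2 then psi f a.1 else (- psi (f * fletter a) a.1)%R.

Let stepK f a : (step f a + step (f * fletter a)%g (flip a) = 0)%R.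
Proof.
case: a => i [] /=; rewrite /step /=; last by rewrite addNr.
by rewrite -[X in psi X](mulgK (fletter (i, true)) f) -fletter_flip subrr.
Qed.

Let phi := potential step.

(** Subtracting the coboundary of [phi] makes the increments along all edges vanish, so the
    corrected cocycle no longer depends on [f]; a constant cocycle is a homomorphism. *)
Let phi_indep x f : (kap x f - phi (q x * f)%g + phi f = kap x 1%g - phi (q x) + phi 1%g)%R.
Proof.
elim/free_group_ind: f => [|f a <-]; first by rewrite mulg1.
have pM g b : phi (g * fletter b) = (phi g + step g b)%R.
  by apply: potentialM; apply: stepK.
rewrite mulgA !pM; apply/eqP; rewrite -subr_eq0; apply/eqP.
case: a => i [] /=; rewrite /step /=.
  by have /eqP := psiM x f i; rewrite subr_eq => /eqP ->; ring.
have := psiM x (f * fletter (i, false)) i; rewrite mulgA.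
have -> : f * fletter (i, false) * fletter (i, true) = f.
  by rewrite -[(i, false)]/(flip (i, true)) fletter_flip mulgVK.
move=> /eqP; rewrite subr_eq => /eqP ->; ring.
Qed.

(** The image of [q], a subgroup of a free group, is free, so the kernel has a complement in [Phi].
    Instead of Nielsen-Schreier the proof trivialises a cocycle on a tree. *)
Lemma extend_hom : exists2 chi' : Phi -> int,
  forall x y, chi' (x * y) = (chi' x + chi' y)%R &
  forall x, q x = 1 -> chi' x = chi x.
Proof.
exists (fun x => kap x 1%g - phi (q x) + phi 1%g)%R => [x y|x x1].
  rewrite -[in RHS](phi_indep x (q y)) qM kapM mulg1; ring.
by rewrite x1 kap_id // subrK.
Qed.

End Extension.

Section StableSubspaces.
Local Open Scope ring_scope.

Lemma subspaces_stabilize (r : nat) (V : nat -> 'rV[rat]_r -> Prop) :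
  (forall M, V M 0) ->
  (forall M (c : rat) u v, V M u -> V M v -> V M (c *: u + v)) ->
  (forall M N u, (M <= N)%N -> V M u -> V N u) ->
  exists N, forall M u, V M u -> V N u.
Proof.
move=> V0 VL Vmono.
pose P k := `[< exists N (A : 'M[rat]_(k, r)), row_free A /\ forall i, V N (row i A) >].
have exP : exists k, P k.
  exists 0%N; apply/asboolP; exists 0%N, 0; split; last by case.
  by rewrite /row_free mxrank0.
have ubP k : P k -> (k <= r)%N.
  by move=> /asboolP[N [A [/eqP fA _]]]; rewrite -fA; apply: rank_leq_col.
case: (ex_maxnP exP ubP) => k /asboolP[N [A [fA VA]]] kmax.
have spanV M w : (N <= M)%N -> (w <= A)%MS -> V N w.
  move=> NM /submxP[B ->]; rewrite mulmx_sum_row.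
  apply: (big_ind (V N)) => //.
    by move=> u v Vu Vv; rewrite -[u]scale1r; apply: VL.
  by move=> i _; rewrite -[_ *: _]addr0; apply: VL.
exists N => M u Vu; have {}Vu := Vmono _ (maxn N M) _ (leq_maxr _ _) Vu.
apply: (spanV (maxn N M)); first exact: leq_maxl.
apply: contraT => uA.
suff : P (k + 1)%N by move/kmax; lia.
apply/asboolP; exists (maxn N M), (col_mx A u); split.
  rewrite /row_free eqn_leq rank_leq_row /=.
  have sub : (A < A + u)%MS.
    rewrite ltmxE addsmxSl /=; apply: contra uA => h.
    exact: submx_trans (addsmxSr _ _) h.
  have := rank_ltmx sub; rewrite addsmxE (eqP fA) => lt_k.
  by apply: leq_trans lt_k; rewrite addn1.
move=> i; case: (splitP i) => j ij.
  have -> : i = lshift 1 j by apply: val_inj.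
  by rewrite rowKu; apply: Vmono (leq_maxl _ _) (VA j).
have -> : i = rshift k j by apply: val_inj.
rewrite rowKd; have -> : row j u = u by apply/rowP => l; rewrite !mxE ord1.
exact: Vu.
Qed.

End StableSubspaces.

(** * Finitely generated subgroups of the inverse limit embed at a finite level *)

Section TowerInjectivity.
Local Open Scope group_scope.
Variables (r : nat) (t : nat -> nat -> free_group).
Hypothesis t_gen : forall j M, (r <= j)%N -> t j M = 1.
Hypothesis t_coh : forall j M, pr M (t j M.+1) = t j M.

Let ev M : free_group -> free_group := eval (fun j => t j M).

Let evM M : {morph ev M : x y / x * y}. Proof. exact: evalM. Qed.

Lemma eval_comp (G H : groupType) (s : nat -> G) (f : G -> H) :
  {morph f : x y / x * y} -> forall x, f (eval s x) = eval (fun j => f (s j)) x.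
Proof.
move=> fM; have f1 : f 1 = 1 by apply: (mulgI (f 1)); rewrite -fM !mulg1.
apply: (@free_hom_ext _ (f \o eval s)) => [x y|x y|a].
- by rewrite /= evalM fM.
- exact: evalM.
rewrite /= !eval_fletter /eval_letter; case: ifP => // _.
by apply: (mulgI (f (s a.1))); rewrite -fM !mulgV.
Qed.

Lemma coherent_pr (g : nat -> free_group) : (forall M, pr M (g M.+1) = g M) ->
  forall M N, (M <= N)%N -> pr M (g N) = g M.
Proof.
move=> gc M N; elim: N => [|N IH]; last rewrite leq_eqVlt => /predU1P[->|].
- rewrite leqn0 => /eqP ->; rewrite -(gc 0%N) pr_pr //.
- by rewrite -(gc N.+1) pr_pr.
by rewrite ltnS => MN; rewrite -(pr_pr (g N.+1) MN) gc IH.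
Qed.

Let pr_ev M N x : (M <= N)%N -> pr M (ev N x) = ev M x.
Proof.
move=> MN; rewrite (eval_comp _ (prM M)); congr (eval _ x).
by apply/funext => j; apply: coherent_pr.
Qed.

Definition expsum j (x : free_group) : int :=
  potential (fun _ a => (a.1 == j)%:R * letter_sign a)%R x.

Let expsum_step (j : nat) (g : free_group) (a : letter) :
  ((a.1 == j)%:R * letter_sign a + ((flip a).1 == j)%:R * letter_sign (flip a) = 0)%R.
Proof.
rewrite -mulrDr (_ : letter_sign a + _ = 0)%R ?mulr0 //.
by case: a => i []; rewrite /letter_sign.
Qed.

Lemma expsum_letter j g a :
  expsum j (g * fletter a) = (expsum j g + (a.1 == j)%:R * letter_sign a)%R.
Proof. exact: (potentialM (expsum_step j)). Qed.

Lemma expsum1 j : expsum j 1 = 0%R. Proof. by []. Qed.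

Lemma expsumM j g h : expsum j (g * h) = (expsum j g + expsum j h)%R.
Proof.
elim/free_group_ind: h => [|h a IH]; first by rewrite mulg1 addr0.
by rewrite mulgA !expsum_letter IH addrA.
Qed.

(** The kernels of the [ev M] decrease, so the linear forms on exponent sums that vanish on them
    increase inside a space of dimension [r]; [N] is where they stop growing. If [ev M] were
    nontrivial on the kernel at [N], a Magnus coefficient of lowest degree would be a
    conjugation-invariant homomorphism on that kernel. Extended by [extend_hom] it becomes a linear
    form that vanishes on the kernel at [M] but not on the one at [N]. *)
Theorem tower_injective : exists N, forall x, ev N x = 1 -> forall M, ev M x = 1.
Proof.
pose V M (v : 'rV[rat]_r) :=
  forall x, ev M x = 1 -> (\sum_(j < r) v 0 j * (expsum j x)%:~R = 0)%R.
have [N NV] : exists N, forall M u, V M u -> V N u.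
  apply: subspaces_stabilize.
  - by move=> M x _; rewrite big1 // => j _; rewrite mxE mul0r.
  - move=> M c u v Vu Vv x x1.
    under eq_bigr do rewrite !mxE mulrDl -mulrA.
    by rewrite big_split -mulr_sumr /= Vu // Vv // mulr0 addr0.
  - move=> M M' u MM' Vu x x1; apply: Vu.
    by rewrite -(pr_ev _ MM') x1.
exists N => x x1 M; apply: contrapT => /eqP xM1.
have [NM|/ltnW MN] := leqP N M; last first.
  by case/eqP: xM1; rewrite -(pr_ev _ MN) x1.
pose low d := `[< exists y u, [/\ ev N y = 1, norep u, size u = d.+1
   & magnus (ev M y) u != 0%R] >].
have exl : exists d, low d.
  have [u nu [mu u0]] := magnus_neq0 xM1.
  exists (size u).-1; apply/asboolP; exists x, u; split=> //.
  by case: (u) u0.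
case: (ex_minnP exl) => d /asboolP[y [u [y1 nu su mu]]] dmin.
have lowP z v : ev N z = 1 -> norep v -> (0 < size v < d.+1)%N -> magnus (ev M z) v = 0%R.
  move=> z1 nv sv; apply: contrapT => /eqP mv.
  suff /dmin : low (size v).-1 by lia.
  by apply/asboolP; exists z, v; split=> //; lia.
pose chi z := magnus (ev M z) u.
have us : (0 < size u <= d.+1)%N by rewrite su /= leqnn.
have chiM z w : ev N z = 1 -> ev N w = 1 -> chi (z * w) = (chi z + chi w)%R.
  move=> z1 w1; rewrite /chi evM (@magnus_mul_low _ _ d.+1) //.
  by move=> v nv sv; apply: lowP.
have chiJ z w : ev N z = 1 -> chi (w * z * w^-1) = chi z.
  move=> z1; have zw1 : ev N (w * z * w^-1) = 1 by rewrite !evM z1 mulg1 -evM mulgV.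
  have e1 := @magnus_mul_low2 (ev M w) _ _ (lowP _ ^~ zw1) u nu us.
  have e2 := @magnus_mul_low (ev M w) _ _ (lowP _ ^~ z1) u nu us.
  move: e1; rewrite -evM mulgVK evM e2 addrC /chi.
  by move/addIr.
have [chi' chi'M chi'E] := extend_hom (evM N) chiM chiJ.
pose v : 'rV[rat]_r := (\row_j (chi' (fletter (val j, true)))%:~R)%R.
have chi'1 : chi' 1 = 0%R.
  by apply: (addrI (chi' 1)); rewrite -chi'M mulg1 addr0.
have chi'sum z : ((chi' z)%:~R = \sum_(j < r) v 0 j * (expsum j z)%:~R :> rat)%R.
  elim/free_group_ind: z => [|z a IH].
    by rewrite chi'1 big1 // => j _; rewrite expsum1 mulr0.
  rewrite chi'M intrD IH; under [RHS]eq_bigr do rewrite expsum_letter intrD mulrDr.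
  rewrite big_split /=; congr (_ + _)%R.
  have sgnE : chi' (fletter a) = (letter_sign a * chi' (fletter (a.1, true)))%R.
    case: a => i [] /=; rewrite /letter_sign /= ?mul1r //.
    rewrite mulN1r -[(i, false)]/(flip (i, true)) fletter_flip.
    by apply: (addrI (chi' (fletter (i, true)))); rewrite -chi'M mulgV chi'1 subrr.
  have [ar|ra] := ltnP a.1 r.
    rewrite (bigD1 (Ordinal ar)) //= big1 ?addr0 => [|j ja].
      by rewrite mxE /= eqxx mul1r sgnE intrM mulrC.
    by rewrite (_ : (a.1 == j) = false) ?mul0r ?mulr0 //;
      apply: contraNF ja => /eqP aj; apply/eqP/val_inj.
  rewrite big1 => [|j _].
    rewrite sgnE chi'E ?mulr0 /chi; first last.
      by rewrite /ev eval_fletter /eval_letter /= t_gen.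
    rewrite /ev eval_fletter /eval_letter /= t_gen // magnus1.
    by case: (u) us => //= *; rewrite mulr0.
  by rewrite (_ : (a.1 == j) = false) ?mul0r ?mulr0 //; have := ltn_ord j; lia.
have /NV/(_ y y1) : V M v.
  move=> z z1; rewrite -chi'sum chi'E; last by rewrite -(pr_ev _ NM) z1.
  by rewrite /chi z1 magnus1; case: (u) us.
rewrite -chi'sum chi'E // => /eqP; rewrite intr_eq0.
by apply/negP.
Qed.

End TowerInjectivity.

(** * Geometry of the archipelago *)

Section SubtypeTopology.
Local Open Scope classical_set_scope.
Variables (T : topologicalType) (A : set T).

Lemma val_continuous : continuous (fun x : set_type A => \val x).
Proof.
have -> : (fun x : set_type A => \val x) = set_val by apply/funext => x; rewrite set_valE.
exact: initial_continuous.
Qed.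

Lemma cvg_set_type (S : Type) (F : set_system S) (FF : Filter F)
    (f : S -> set_type A) (x : set_type A) :
  (fun s => \val (f s)) @ F --> \val x -> f @ F --> x.
Proof.
move=> cvf B /= [_ [[C oC <-] Cx CB]].
have : nbhs (\val x) C by apply: open_nbhs_nbhs; split=> //; rewrite -set_valE.
move=> /cvf FC; rewrite /= nbhs_simpl /=; apply: (@filterS _ F FF _ _ _ FC) => s /= Cs.
by apply: CB => /=; rewrite set_valE.
Qed.

End SubtypeTopology.

Section RealLimits.
Local Open Scope classical_set_scope.
Local Open Scope ring_scope.
Variables (R : realType) (S : Type) (F : set_system S) (FF : Filter F).
Implicit Types (f g : S -> R) (a b : R).

Lemma cvg_maxr f g a b : f @ F --> a -> g @ F --> b ->
  (fun s => Num.max (f s) (g s)) @ F --> Num.max a b.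
Proof.
move=> cf cg; under eq_fun do rewrite maxr_absE; rewrite maxr_absE.
by apply: cvgM (cvg_cst _); apply: cvgD; [apply: cvgD|apply: cvg_norm; apply: cvgB].
Qed.

Lemma cvg_minr f g a b : f @ F --> a -> g @ F --> b ->
  (fun s => Num.min (f s) (g s)) @ F --> Num.min a b.
Proof.
move=> cf cg; under eq_fun do rewrite minr_absE; rewrite minr_absE.
by apply: cvgM (cvg_cst _); apply: cvgB; [apply: cvgD|apply: cvg_norm; apply: cvgB].
Qed.

Lemma cvg_sqr f a : f @ F --> a -> (fun s => f s ^+ 2) @ F --> a ^+ 2.
Proof. by move=> cf; rewrite expr2; under eq_fun do rewrite expr2; apply: cvgM. Qed.

End RealLimits.

Section Points.
Local Open Scope classical_set_scope.
Local Open Scope ring_scope.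
Variable R : realType.
Notation X := (harmonic_archipelago R).

Definition px (q : X) : R := (\val q).1.1.
Definition py (q : X) : R := (\val q).1.2.
Definition pxy (q : X) : R * R := (\val q).1.

Lemma val_pxy q : \val q = (pxy q, height (pxy q)).
Proof.
by have /set_mem [_ zE] := valP q; rewrite /pxy -zE -surjective_pairing.
Qed.

Lemma base_pxy q : base_disk (pxy q).
Proof. by have /set_mem [] := valP q. Qed.

Lemma pxy_inj : injective pxy.
Proof. by move=> p q e; apply: val_inj; rewrite /= !val_pxy e. Qed.

Lemma base_diskE (p : R * R) : base_disk p <-> p.1 ^+ 2 + p.2 ^+ 2 <= 2 * p.2.
Proof.
rewrite /base_disk /euclid_dist /= subr0.
have -> : p.1 ^+ 2 + (p.2 - 1) ^+ 2 = p.1 ^+ 2 + p.2 ^+ 2 - 2 * p.2 + 1 by ring.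
have p0 : 0 <= p.1 ^+ 2 + p.2 ^+ 2 - 2 * p.2 + 1.
  have -> : p.1 ^+ 2 + p.2 ^+ 2 - 2 * p.2 + 1 = p.1 ^+ 2 + (p.2 - 1) ^+ 2 by ring.
  by rewrite addr_ge0 ?sqr_ge0.
rewrite -[X in Num.sqrt _ <= X]sqrtr1 ler_psqrt ?qualifE //=.
by split => h; lra.
Qed.

Lemma base_disk0 : base_disk (0 : R * R).
Proof. by apply/base_diskE => /=; rewrite expr0n /=; lra. Qed.

Lemma base_disk_convex (p q : R * R) (s : R) : base_disk p -> base_disk q ->
  0 <= s <= 1 -> base_disk ((1 - s) * p.1 + s * q.1, (1 - s) * p.2 + s * q.2).
Proof.
move=> /base_diskE bp /base_diskE bq /andP[s0 s1]; apply/base_diskE => /=.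
have e1 := mulr_ge0 s0 (sqr_ge0 (p.1 - q.1)).
have e2 := mulr_ge0 s0 (sqr_ge0 (p.2 - q.2)).
have s1' : 0 <= 1 - s by lra.
have e3 := mulr_ge0 s1' (mulr_ge0 s0 (sqr_ge0 (p.1 - q.1))).
have e4 := mulr_ge0 s1' (mulr_ge0 s0 (sqr_ge0 (p.2 - q.2))).
have e5 : (1 - s) * (p.1 ^+ 2 + p.2 ^+ 2) <= (1 - s) * (2 * p.2) by rewrite ler_wpM2l.
have e6 : s * (q.1 ^+ 2 + q.2 ^+ 2) <= s * (2 * q.2) by rewrite ler_wpM2l.
nra.
Qed.

Definition emb (p : R * R) : X :=
  match pselect (base_disk p) with
  | left bp => exist _ (p, height p) (mem_set (conj bp erefl))
  | right _ => exist _ (0, height 0) (mem_set (conj base_disk0 erefl))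
  end.

Lemma pxy_emb p : base_disk p -> pxy (emb p) = p.
Proof. by rewrite /emb; case: pselect. Qed.

Definition origin : X := emb 0.

Lemma pxy_origin : pxy origin = 0. Proof. exact: pxy_emb base_disk0. Qed.

Lemma px_origin : px origin = 0.
Proof. by rewrite -[px _]/((pxy origin).1) pxy_origin. Qed.

Lemma py_origin : py origin = 0.
Proof. by rewrite -[py _]/((pxy origin).2) pxy_origin. Qed.

Lemma pxyE q : pxy q = (px q, py q).
Proof. exact: surjective_pairing. Qed.

Lemma disk_px_py q : px q ^+ 2 + py q ^+ 2 <= 2 * py q.
Proof. exact/(base_diskE (pxy q))/base_pxy. Qed.

Lemma py_ge0 q : 0 <= py q.
Proof.
by have := disk_px_py q; have := sqr_ge0 (px q); have := sqr_ge0 (py q); lra.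
Qed.

Lemma py_eq0 q : py q = 0 -> q = origin.
Proof.
move=> y0; apply: pxy_inj; rewrite pxy_origin pxyE y0.
have := disk_px_py q; rewrite y0 expr0n /= addr0 mulr0 => h.
have : px q ^+ 2 == 0 by rewrite eq_le h sqr_ge0.
by rewrite sqrf_eq0 => /eqP ->.
Qed.

Lemma px_continuous : continuous px.
Proof.
move=> q; apply: (@continuous_comp X _ _ (fun q => \val q) (fun v => v.1.1)).
  exact: val_continuous.
apply: (@continuous_comp _ _ _ fst fst); exact: cvg_fst.
Qed.

Lemma py_continuous : continuous py.
Proof.
move=> q; apply: (@continuous_comp X _ _ (fun q => \val q) (fun v => v.1.2)).
  exact: val_continuous.
by apply: (@continuous_comp _ _ _ fst snd); [exact: cvg_fst|exact: cvg_snd].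
Qed.

Lemma pz_continuous : continuous (fun q : X => height (pxy q)).
Proof.
have -> : (fun q : X => height (pxy q)) = (fun q => (\val q).2).
  by apply/funext => q; rewrite val_pxy.
move=> q; apply: (@continuous_comp X _ _ (fun q => \val q) snd).
  exact: val_continuous.
exact: cvg_snd.
Qed.

Lemma cvg_archipelago (S : Type) (F : set_system S) (FF : Filter F)
    (f : S -> X) (q : X) :
  (fun s => px (f s)) @ F --> px q -> (fun s => py (f s)) @ F --> py q ->
  (fun s => height (pxy (f s))) @ F --> height (pxy q) -> f @ F --> q.
Proof.
move=> cx cy cz; apply: cvg_set_type.
have -> : (fun s => \val (f s)) = (fun s => ((px (f s), py (f s)), height (pxy (f s)))).
  by apply/funext => s; rewrite val_pxy {1}pxyE.
rewrite val_pxy {1}pxyE.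
exact: (cvg_pair (cvg_pair cx cy) cz).
Qed.

Definition inv_nat (n : nat) : R := n%:R^-1.
Local Notation a := inv_nat.

Lemma inv_nat_gt0 n : (0 < n)%N -> 0 < a n.
Proof. by move=> n0; rewrite invr_gt0 ltr0n. Qed.

Lemma inv_nat_lt n : (0 < n)%N -> a n.+1 < a n.
Proof. by move=> n0; rewrite /a ltf_pV2 ?posrE ?ltr0n ?ltr_nat. Qed.

Lemma inv_nat_le n m : (0 < n)%N -> (n <= m)%N -> a m <= a n.
Proof.
move=> n0 nm; rewrite /a lef_pV2 ?posrE ?ltr0n ?ler_nat //.
exact: leq_trans n0 nm.
Qed.

Lemma inv_nat_sub n : (0 < n)%N -> a n - a n.+1 = a n * a n.+1.
Proof.
move=> n0; rewrite /a; have h : n%:R != 0 :> R by rewrite pnatr_eq0 -lt0n.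
have h1 : n.+1%:R != 0 :> R by rewrite pnatr_eq0.
rewrite -addn1 natrD in h1 *; field; by rewrite h h1.
Qed.

Lemma inv_nat_half n : (0 < n)%N -> a n <= 2 * a n.+1.
Proof.
move=> n0; have := inv_nat_sub n0; have a1 : a n <= 1.
  by have := @inv_nat_le 1 n isT n0; rewrite {2}/a invr1.
have := inv_nat_gt0 (ltn0Sn n).
by move: (a n) (a n.+1) a1 => u v; nra.
Qed.

Definition centre n : R := a n + a n.+1.

Lemma hill_centerE n : hill_center R n = (0, centre n). Proof. by []. Qed.

Lemma hill_radiusE n : (0 < n)%N -> hill_radius R n = (a n - a n.+1) / 2.
Proof.
by move=> n0; rewrite inv_nat_sub // /a /hill_radius !invfM -mulrA mulrC.
Qed.

Lemma hill_radius_gt0 n : (0 < n)%N -> 0 < hill_radius R n.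
Proof. by move=> n0; rewrite hill_radiusE //; have := inv_nat_lt n0; lra. Qed.

Lemma euclid_dist_ge0 p q : 0 <= euclid_dist p q :> R.
Proof. exact: sqrtr_ge0. Qed.

Lemma euclid_dist_ge1 (p q : R * R) : `|p.1 - q.1| <= euclid_dist p q.
Proof. by rewrite -sqrtr_sqr ler_wsqrtr // lerDl sqr_ge0. Qed.

Lemma euclid_dist_ge2 (p q : R * R) : `|p.2 - q.2| <= euclid_dist p q.
Proof. by rewrite -sqrtr_sqr ler_wsqrtr // lerDr sqr_ge0. Qed.

Lemma euclid_dist_le (p q c : R * R) : `|p.1 - c.1| <= `|q.1 - c.1| ->
  `|p.2 - c.2| <= `|q.2 - c.2| -> euclid_dist p c <= euclid_dist q c.
Proof.
move=> h1 h2; rewrite ler_wsqrtr // -[X in X + _]real_normK ?num_real //.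
rewrite -[X in _ + X <= _]real_normK ?num_real // -[X in _ <= X + _]real_normK ?num_real //.
rewrite -[X in _ <= _ + X]real_normK ?num_real //.
by apply: lerD; rewrite lerXn2r ?nnegrE.
Qed.

(** The radius of hill [n] is [a n * a n.+1 / 2], quadratic in the ordinate, so all hills lie in
    [|x| < y^2 / 2]. Whatever has to avoid the hills is moved across these two parabolas. *)
Lemma hill_bounds n p : (0 < n)%N -> hill n p ->
  [/\ 2 * a n.+1 < p.2, p.2 < 2 * a n, `|p.1| < p.2 ^+ 2 / 2
    & `|p.2 - centre n| <= hill_radius R n].
Proof.
move=> n0 h; have := le_trans (euclid_dist_ge1 p (hill_center R n)) h.
have h2 := le_trans (euclid_dist_ge2 p (hill_center R n)) h.
move: (h2); rewrite hill_centerE /= subr0 ler_norml => /andP[h3 h4] h1.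
have := inv_nat_gt0 n0; have := inv_nat_gt0 (ltn0Sn n).
have := inv_nat_lt n0; have := inv_nat_half n0; have := inv_nat_sub n0.
move: h1 h3 h4; rewrite hill_radiusE // /centre => h1 h3 h4 h5 h6 h7 h8 h9.
split; [lra|lra| |by rewrite h3 h4].
apply: le_lt_trans h1 _.
move: (a n) (a n.+1) (p.2) h3 h4 h5 h6 h7 h8 h9 => u v y h3 h4 h5 h6 h7 h8 h9.
have : 2 * v < y by lra.
nra.
Qed.

Definition bump n (p : R * R) : R :=
  Num.max 0 (1 - euclid_dist p (hill_center R n) / hill_radius R n).

Lemma bump_hill n p : (0 < n)%N -> hill n p ->
  bump n p = 1 - euclid_dist p (hill_center R n) / hill_radius R n.
Proof.
move=> n0 h; rewrite /bump max_r // subr_ge0 ler_pdivrMr ?hill_radius_gt0 //.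
by rewrite mul1r.
Qed.

Lemma bump_out n p : (0 < n)%N -> ~ hill n p -> bump n p = 0.
Proof.
move=> n0 /negP; rewrite -ltNge => h; rewrite /bump max_l //.
by rewrite subr_le0 ler_pdivlMr ?hill_radius_gt0 // mul1r ltW.
Qed.

Lemma height_hill n p : on_hill p n -> height p = bump n p.
Proof.
move=> hn; rewrite /height; case: pselect => [h|]; last by case; exists n.
case: (cid h) => /= k hk; rewrite (on_hill_inj hk hn).
by case: hn => n0 hn; rewrite bump_hill.
Qed.

Lemma height_out (p : R * R) : (forall n, (0 < n)%N -> ~ hill n p) -> height p = 0.
Proof.
move=> h; rewrite /height; case: pselect => // -[n [n0 hn]].
by have := h n n0 hn.
Qed.

Lemma bump_bounds n p : (0 < n)%N -> 0 <= bump n p <= 1.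
Proof.
move=> n0; rewrite /bump le_max lexx /= ge_max ler01 /= lerBlDr lerDl.
by rewrite divr_ge0 ?euclid_dist_ge0 // ltW ?hill_radius_gt0.
Qed.

Lemma heightP (p : R * R) : height p = 0 \/ exists2 n, (0 < n)%N & hill n p /\ height p = bump n p.
Proof.
have [[n [n0 hn]]|h] := pselect (exists n, on_hill p n).
  by right; exists n => //; split=> //; apply: height_hill.
by left; apply: height_out => n n0 hn; apply: h; exists n.
Qed.

Lemma height_bounds (p : R * R) : 0 <= height p <= 1.
Proof.
by case: (heightP p) => [->|[n n0 [_ ->]]]; [rewrite lexx ler01|apply: bump_bounds].
Qed.

Lemma bump_le_height n p : (0 < n)%N -> bump n p <= height p.
Proof.
move=> n0; have [h|h] := pselect (hill n p); first by rewrite (height_hill (conj n0 h)).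
by rewrite bump_out //; have /andP[] := height_bounds p.
Qed.

Lemma height_mono (p q : R * R) :
  (forall n, (0 < n)%N -> hill n q ->
    euclid_dist p (hill_center R n) <= euclid_dist q (hill_center R n)) ->
  height q <= height p.
Proof.
move=> h; case: (heightP q) => [->|[n n0 [hn ->]]].
  by have /andP[] := height_bounds p.
apply: le_trans (bump_le_height p n0); rewrite /bump.
have /hill_radius_gt0 r0 := n0.
rewrite ge_max le_max lexx /= le_max; apply/orP; right.
by apply: lerB => //; rewrite ler_pM2r; [apply: h|rewrite invr_gt0].
Qed.

Lemma height_wide (p : R * R) : p.2 ^+ 2 / 2 <= `|p.1| -> height p = 0.
Proof.
move=> h; apply: height_out => n n0 /(hill_bounds n0)[_ _ + _].
by rewrite ltNge h.
Qed.

Lemma height0 : height (0 : R * R) = 0.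
Proof. by apply: height_wide => /=; rewrite normr0 expr0n /= mul0r. Qed.

(** Away from the origin only finitely many hills matter; hence [height] is continuous there. *)
Lemma height_sum N (p : R * R) : 2 * a N.+1 <= p.2 ->
  height p = \sum_(i < N) bump i.+1 p.
Proof.
move=> h; case: (heightP p) => [h0|[n n0 [hn ->]]].
  rewrite h0 big1 // => i _; apply/eqP; rewrite eq_le.
  by rewrite -{1}h0 bump_le_height //=; have /andP[] := bump_bounds p (ltn0Sn i).
have nN : (n.-1 < N)%N.
  rewrite ltnNge; apply/negP => Nn.
  have [_ h2 _ _] := hill_bounds n0 hn.
  have := @inv_nat_le N.+1 n isT; rewrite -[n]prednK // ltnS => /(_ Nn).
  by rewrite prednK //; lra.
rewrite (bigD1 (Ordinal nN)) //= prednK // big1 ?addr0 // => i iN.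
apply: bump_out => // hi; case/eqP: iN; apply: val_inj => /=.
by rewrite -(on_hill_inj (conj (ltn0Sn i) hi) (conj n0 hn)).
Qed.

Lemma euclid_dist_cvg (p c : R * R) : (fun q => euclid_dist q c) @ p --> euclid_dist p c.
Proof.
rewrite /euclid_dist.
have sc : {for ((p.1 - c.1) ^+ 2 + (p.2 - c.2) ^+ 2), continuous (@Num.sqrt R)}.
  exact: sqrt_continuous.
apply: (@continuous_comp _ _ _ (fun q : R * R => (q.1 - c.1) ^+ 2 + (q.2 - c.2) ^+ 2)
   (@Num.sqrt R)) => //.
apply: cvgD; apply: cvg_sqr; apply: cvgB; try exact: cvg_cst.
  exact: cvg_fst.
exact: cvg_snd.
Qed.

Lemma bump_cvg n p : bump n @ p --> bump n p.
Proof.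
rewrite /bump; apply: cvg_maxr; first exact: cvg_cst.
by apply: cvgB; [exact: cvg_cst|apply: cvgM (cvg_cst _); apply: euclid_dist_cvg].
Qed.

Lemma inv_nat_small (e : R) : 0 < e -> exists N, forall n, (N <= n)%N -> a n < e.
Proof.
move=> e0; exists (Num.bound e^-1).+1 => n Nn.
have n0 : (0 < n)%N by apply: leq_trans Nn.
rewrite /a -[e]invrK ltf_pV2 ?posrE ?ltr0n ?invr_gt0 //.
apply: lt_le_trans (archi_boundP _) _; first by rewrite invr_ge0 ltW.
by rewrite ler_nat; apply: ltnW.
Qed.

Lemma height_cvg (p : R * R) : 0 < p.2 -> @height R @ p --> height p.
Proof.
move=> p0; have [N NP] : exists N, 2 * a N.+1 < p.2.
  have [|N /(_ N.+1 (leqnSn _)) h] := @inv_nat_small (p.2 / 2); first lra.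
  by exists N; lra.
rewrite (height_sum (ltW NP)).
apply: (cvg_trans _ (_ : (fun q : R * R => \sum_(i < N) bump i.+1 q) @ p --> _)).
  apply: near_eq_cvg; near=> q.
  rewrite -height_sum // ltW //.
  near: q; have : (fun q : R * R => q.2) @ p --> p.2 by apply: cvg_snd.
  by move/cvgr_gt; apply.
apply: cvg_big => [|i _]; last exact: bump_cvg.
exact: add_continuous.
Unshelve. all: by end_near. Qed.

End Points.

(** * Pushing points out to the loops *)

Section Deformation.
Local Open Scope classical_set_scope.
Local Open Scope ring_scope.
Variable R : realType.
Notation X := (harmonic_archipelago R).
Local Notation a := (@inv_nat R).
Implicit Types q : X.

(** Ordinate at which [K_n] crosses the axis. It separates hill [n], below it, from hill [n.-1],
    above it. *)
Definition ell n : R := 2 * a n.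

Lemma centre_bounds n : (0 < n)%N -> ell n.+1 < centre R n < ell n.
Proof.
by move=> n0; have := inv_nat_lt R n0; rewrite /centre /ell => h; apply/andP; split; lra.
Qed.

Lemma ell_lt n m : (0 < n)%N -> (n < m)%N -> ell m < ell n.
Proof.
move=> n0 nm; have := @inv_nat_le R n.+1 m isT nm; have := inv_nat_lt R n0.
by rewrite /ell; lra.
Qed.

Lemma ell_le n m : (0 < n)%N -> (n <= m)%N -> ell m <= ell n.
Proof. by move=> n0 nm; have := inv_nat_le R n0 nm; rewrite /ell; lra. Qed.

Lemma ell_gt0 n : (0 < n)%N -> 0 < ell n.
Proof. by move=> n0; have := inv_nat_gt0 R n0; rewrite /ell; lra. Qed.

Lemma height_peak (p : R * R) : height p = 1 -> exists2 n, (0 < n)%N & p = (0, centre R n).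
Proof.
case: (heightP p) => [->|[n n0 [hn ->]] b1]; first by move/esym/eqP; rewrite oner_eq0.
exists n => //; move: b1; rewrite bump_hill // => b1.
have r0 := hill_radius_gt0 R n0.
have : euclid_dist p (hill_center R n) / hill_radius R n = 0 by lra.
move/eqP; rewrite mulf_eq0 invr_eq0 (gt_eqF r0) orbF => /eqP d0.
have := euclid_dist_ge1 p (hill_center R n); have := euclid_dist_ge2 p (hill_center R n).
rewrite d0 !normr_le0 !subr_eq0 => /eqP e2 /eqP e1.
by rewrite [p]surjective_pairing e1 e2.
Qed.

Section Level.
Variable m : nat.
Hypothesis m8 : (8 <= m)%N.

Let m0 : (0 < m)%N. Proof. exact: leq_trans m8. Qed.

(* The part of the archipelago without the peaks of index at least m. *)
Definition good q := forall n, (m <= n)%N -> px q = 0 -> py q <> centre R n.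

(* Bands between consecutive peaks; everything above the peak m is band m. *)
Definition band n (y : R) :=
  [/\ (m <= n)%N, centre R n < y & n = m \/ y < centre R n.-1].

Lemma centre_lt n n' : (0 < n)%N -> (n < n')%N -> centre R n' < centre R n.
Proof.
move=> n0 nn'; have /andP[h _] := centre_bounds n0.
have n'0 : (0 < n')%N := leq_trans n0 (ltnW nn').
have /andP[_ h'] := centre_bounds n'0.
apply: lt_trans h' (le_lt_trans _ h); exact: ell_le.
Qed.

Lemma band_inj n n' y : band n y -> band n' y -> n = n'.
Proof.
wlog : n n' / (n < n')%N => [H|nn'].
  move=> b b'; case: (ltngtP n n') => //; first by move/H; apply.
  by move/H => H'; rewrite (H' b' b).
move=> [mn cy _] [mn' cy' [e|yc]]; first by move: nn'; rewrite e ltnNge mn.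
have n0 : (0 < n)%N by apply: leq_trans mn.
exfalso; suff : centre R n'.-1 <= centre R n by lra.
have [e|] := eqVneq n'.-1 n; first by rewrite e.
move=> ne; apply: ltW; apply: centre_lt => //; lia.
Qed.

(** Bands start at [m], so 0 marks the absence of a band: at the ordinate of a peak of index at
    least [m], and at ordinate 0. *)
Definition lab y : nat := xget 0%N [set n | band n y].

Lemma lab_band n y : band n y -> lab y = n.
Proof.
by move=> b; rewrite /lab; case: xgetP => [k _ /= bk|/(_ n)//]; apply: band_inj bk b.
Qed.

Lemma labP y : band (lab y) y \/ lab y = 0%N.
Proof. by rewrite /lab; case: xgetP => [k _|]; [left|right]. Qed.

Lemma band_or_centre y : 0 < y ->
  (exists n, band n y) \/ (exists2 n, (m <= n)%N & y = centre R n).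
Proof.
move=> y0; have [|N NP] := @inv_nat_small R (y / 2); first lra.
have exn : exists n, (m <= n)%N && (centre R n <= y).
  exists (maxn m N); rewrite leq_maxl /=.
  have := NP _ (leq_maxr m N).
  have /andP[_] := @centre_bounds (maxn m N) (leq_trans m0 (leq_maxl _ _)).
  by rewrite /ell; lra.
case: (ex_minnP exn) => n /andP[mn cn] nmin.
move: cn; rewrite le_eqVlt => /predU1P[cy|cn]; first by right; exists n.
left; exists n; split=> //.
have [->|nm] := eqVneq n m; [by left|right].
rewrite ltNge; apply/negP => yc.
have : (n <= n.-1)%N by apply: nmin; rewrite yc andbT; lia.
by move: mn nm m0; lia.
Qed.

Definition x1 q : R := Num.min 1 (ell m / py q) * px q.
Definition y1 q : R := Num.min (py q) (ell m).
(** Vanishes exactly at the ordinates of the peaks and at 0. *)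
Definition tau (y : R) : R := y ^+ 2 * (1 - height (0, y)).
(** Normalised horizontal coordinate: [x1] in units of [tau], cut off at 1. At the ordinate of a
    peak it is 1 or -1 off the axis, so bands change where [chi] is 0. *)
Definition xi q : R := x1 q / Num.max `|x1 q| (tau (y1 q)).
(** Chosen so that [xi q * wid q] lies outside the parabolas of [height_wide] as soon as
    [|xi q| >= 1/2]. *)
Definition wid q : R := Num.max `|x1 q| (y1 q ^+ 2).
Definition chi (t : R) : R := Num.min 1 (2 * (1 - `|t|)).
Definition lev q : R := ell (lab (py q)).

(** The source of the constant 8: ordinates up to 1/4 keep the stages inside the disk ([quartic_le])
    and give [y1 q ^+ 2 <= lev q] in a band ([band_lev]). *)
Lemma ell_m_le : ell m <= 1 / 4.
Proof.
have := @inv_nat_le R 8 m isT m8; rewrite /ell /inv_nat => h.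
have : (8%:R^-1 : R) = 1 / 8 by rewrite mul1r.
lra.
Qed.

Lemma y1E q : y1 q = Num.min 1 (ell m / py q) * py q.
Proof.
have := ell_gt0 m0; rewrite /y1 => l0.
have [->|y0] := eqVneq (py q) 0; first by rewrite mulr0 min_l // ltW.
have {}y0 : 0 < py q by rewrite lt_def y0 py_ge0.
rewrite minr_pMl ?mul1r ?divfK ?gt_eqF //; exact: ltW.
Qed.

Lemma tau_bounds y : 0 <= tau y <= y ^+ 2.
Proof.
have /andP[h0 h1] := height_bounds (0, y).
rewrite /tau mulr_ge0 ?sqr_ge0 ?subr_ge0 //= ler_piMr ?sqr_ge0 //; lra.
Qed.

Lemma scale_bounds q : 0 <= Num.min 1 (ell m / py q) <= 1.
Proof.
rewrite ge_min lexx /= le_min ler01 /= divr_ge0 ?py_ge0 //.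
exact/ltW/ell_gt0.
Qed.

Lemma x1_le q : `|x1 q| <= `|px q|.
Proof.
have /andP[h0 h1] := scale_bounds q.
by rewrite /x1 normrM ger0_norm // ler_piMl.
Qed.

Lemma y1_bounds q : 0 <= y1 q <= py q /\ y1 q <= ell m.
Proof.
rewrite /y1 !ge_min !lexx !orbT !andbT le_min py_ge0; split=> //.
exact/ltW/ell_gt0.
Qed.

Lemma disk1 q : x1 q ^+ 2 + y1 q ^+ 2 <= 2 * y1 q.
Proof.
rewrite y1E /x1; move: (scale_bounds q) (disk_px_py q) (py_ge0 q).
move: (Num.min 1 (ell m / py q)) => s; move: (px q) (py q) => x y /andP[s0 s1] h y0.
rewrite !exprMn -mulrDr.
apply: le_trans (_ : s ^+ 2 * (2 * y) <= _); first by rewrite ler_wpM2l ?sqr_ge0.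
by rewrite mulrCA ler_wpM2l // ler_wpM2r // expr2 ler_piMl.
Qed.

Lemma stage1_id q : py q <= ell m -> x1 q = px q /\ y1 q = py q.
Proof.
move=> h; rewrite /x1 /y1 (min_l h); split=> //.
have [y0|y0] := eqVneq (py q) 0.
  by rewrite (py_eq0 y0) px_origin mulr0.
by rewrite min_l ?mul1r // ler_pdivlMr ?mul1r // lt_def y0 py_ge0.
Qed.

Lemma scale_gt0 q : 0 < py q -> 0 < Num.min 1 (ell m / py q).
Proof. by move=> y0; rewrite lt_min ltr01 divr_gt0 // ell_gt0. Qed.

Lemma y1_gt0 q : 0 < py q -> 0 < y1 q.
Proof. by move=> y0; rewrite /y1 lt_min y0 ell_gt0. Qed.

Lemma x1_eq0 q : 0 < py q -> (x1 q == 0) = (px q == 0).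
Proof. by move=> y0; rewrite /x1 mulf_eq0 gt_eqF ?scale_gt0. Qed.

(** Here the removal of the peaks enters: off the origin the denominator of [xi] vanishes at the
    removed peaks alone. *)
Lemma den_gt0 q : good q -> 0 < py q -> 0 < Num.max `|x1 q| (tau (y1 q)).
Proof.
move=> gq y0; rewrite lt_max normr_gt0 x1_eq0 //.
have [x0 /=|//] := eqVneq (px q) 0.
rewrite /tau mulr_gt0 ?exprn_gt0 ?y1_gt0 // subr_gt0 lt_neqAle.
have /andP[_ ->] := height_bounds (0, y1 q); rewrite andbT.
apply/eqP => /height_peak[n n0 [yn]].
have [_ ym] := y1_bounds q.
have /andP[h1 h2] := centre_bounds n0.
have mn : (m <= n)%N.
  by rewrite leqNgt; apply/negP => nm; have := @ell_le n.+1 m isT nm; lra.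
apply: (gq n mn x0); rewrite -yn /y1.
have := @ell_le m n m0 mn; have := yn; rewrite /y1.
by case: (leP (py q) (ell m)) => //; lra.
Qed.

Lemma xi_le1 q : `|xi q| <= 1.
Proof.
rewrite /xi normrM normfV.
have d0 : 0 <= Num.max `|x1 q| (tau (y1 q)) by rewrite le_max normr_ge0.
rewrite (ger0_norm d0); move: d0; rewrite le_eqVlt => /predU1P[<-|d0].
  by rewrite invr0 mulr0.
by rewrite ler_pdivrMr // mul1r le_max lexx.
Qed.

Lemma chi_bounds t : `|t| <= 1 -> 0 <= chi t <= 1.
Proof. by move=> t1; rewrite /chi ge_min lexx le_min ler01 /=; lra. Qed.

Lemma chi_half t : `|t| <= 1 / 2 -> chi t = 1.
Proof. by move=> t1; rewrite /chi min_l //; lra. Qed.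

Lemma chi_gt0 t : 0 < chi t -> `|t| < 1.
Proof. by rewrite /chi lt_min => /andP[_]; lra. Qed.

Lemma xi_lt1 q : `|xi q| < 1 -> good q -> 0 < py q ->
  `|x1 q| < tau (y1 q) /\ `|x1 q| = `|xi q| * tau (y1 q).
Proof.
move=> h gq y0; have d0 := den_gt0 gq y0.
have e : `|x1 q| = `|xi q| * Num.max `|x1 q| (tau (y1 q)).
  by rewrite /xi [`|x1 q / _|]normrM normfV (gtr0_norm d0) divfK // gt_eqF.
case: (leP (tau (y1 q)) `|x1 q|) => [h2|h2].
  move: e d0; rewrite max_l // => e d0.
  by move: h; rewrite -(ltr_pM2r d0) -e mul1r ltxx.
by split=> //; move: e; rewrite max_r // ltW.
Qed.

Lemma xi_lt1_band q : `|xi q| < 1 -> good q -> 0 < py q -> exists n, band n (py q).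
Proof.
move=> h gq y0; case: (band_or_centre y0) => // -[n mn yc].
have n0 : (0 < n)%N := leq_trans m0 mn.
have [h1 _] := xi_lt1 h gq y0.
have yl : py q <= ell m.
  have /andP[_ h2] := centre_bounds n0; rewrite yc; apply: le_trans (ltW h2) _.
  exact: ell_le.
have [_ e1] := stage1_id yl.
suff t0 : tau (y1 q) = 0 by move: h1; rewrite t0 normr_lt0.
rewrite e1 yc /tau.
have -> : height (0, centre R n) = 1 :> R.
  have hn : hill n (0, centre R n).
    by rewrite /hill /= /euclid_dist /= !subrr expr0n addr0 sqrtr0 ltW ?hill_radius_gt0.
  rewrite (height_hill (conj n0 hn)) bump_hill //.
  by rewrite /euclid_dist /= !subrr expr0n addr0 sqrtr0 mul0r subr0.
by rewrite subrr mulr0.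
Qed.

Lemma lev_bounds q : 0 <= lev q <= 2 * py q /\ lev q <= ell m.
Proof.
rewrite /lev; case: (labP (py q)) => [[mn cy _]|->]; last first.
  have -> : ell 0 = 0 by rewrite /ell /inv_nat invr0 mulr0.
  rewrite lexx mulr_ge0 ?py_ge0 //; split=> //.
  exact/ltW/ell_gt0.
have n0 := leq_trans m0 mn; have l0 := ell_gt0 n0.
have := inv_nat_gt0 R n0; have := inv_nat_gt0 R (ltn0Sn (lab (py q))).
have := ell_le m0 mn; move: cy l0; rewrite /ell /centre => h1 h2 h3 h4 h5.
by split=> //; apply/andP; split; lra.
Qed.

Lemma band_lev q n : band n (py q) -> lev q = ell n /\ y1 q ^+ 2 <= lev q.
Proof.
move=> b; rewrite /lev (lab_band b); split=> //.
have [mn cy hy] := b; have n0 := leq_trans m0 mn.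
have [/andP[y10 _] y1m] := y1_bounds q; have lm := ell_m_le.
have key (u v : R) : 0 <= u -> u <= 4 * v -> v <= 1 / 8 -> u ^+ 2 <= 2 * v.
  move=> u0 uv v8; have v0 : 0 <= v by lra.
  by apply: le_trans (_ : (4 * v) ^+ 2 <= _); [rewrite lerXn2r ?nnegrE //; lra|nra].
have [e|nm] := eqVneq n m.
  rewrite /ell e; apply: key => //; move: y1m lm; rewrite /ell; lra.
case: hy => [/eqP|yc]; first by rewrite (negPf nm).
have nm' : (m < n)%N by rewrite ltn_neqAle eq_sym nm.
have h1 := ell_lt m0 nm'.
have n1 : (0 < n.-1)%N by lia.
have /andP[_ h2] := centre_bounds n1.
have h3 := inv_nat_half R n1; rewrite prednK // in h3.
have : y1 q <= py q by rewrite /y1 ge_min lexx.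
move: h1 lm h2; rewrite /ell => h1 lm h2 h4.
by apply: key => //; lra.
Qed.

(** Four straight moves: contract towards the origin until the ordinate is at most [ell m]; spread
    horizontally; contract to the origin whatever has [|xi| = 1]; slide vertically, inside a band,
    to the ordinate of its loop. [lev] jumps between bands, but it occurs only multiplied by
    [chi]. *)
Definition stage q (k : nat) : R * R :=
  match k with
  | 0 => pxy q
  | 1 => (x1 q, y1 q)
  | 2 => (xi q * wid q, y1 q)
  | 3 => (chi (xi q) * (xi q * wid q), chi (xi q) * y1 q)
  | _ => (chi (xi q) * (xi q * lev q), chi (xi q) * lev q)
  end.

Definition mix (s : R) (p p' : R * R) : R * R :=
  ((1 - s) * p.1 + s * p'.1, (1 - s) * p.2 + s * p'.2).

Definition clamp (s : R) : R := Num.max 0 (Num.min 1 s).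

Definition push_x q (t : R) : R :=
  (pxy q).1 + \sum_(k < 4) clamp (t - k%:R) * ((stage q k.+1).1 - (stage q k).1).
Definition push_y q (t : R) : R :=
  (pxy q).2 + \sum_(k < 4) clamp (t - k%:R) * ((stage q k.+1).2 - (stage q k).2).
Definition push_out q t : X := emb (push_x q t, push_y q t).

Lemma clamp_le0 s : s <= 0 -> clamp s = 0.
Proof. by move=> s0; rewrite /clamp max_l // ge_min s0 orbT. Qed.

Lemma clamp_ge1 s : 1 <= s -> clamp s = 1.
Proof. by move=> s1; rewrite /clamp min_l // max_r. Qed.

Lemma clamp_id s : 0 <= s <= 1 -> clamp s = s.
Proof. by case/andP=> s0 s1; rewrite /clamp min_r // max_r. Qed.

Lemma push_mix q t : exists k s, [/\ (k < 4)%N, 0 <= s <= 1,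
  (push_x q t, push_y q t) = mix s (stage q k) (stage q k.+1) & 2 <= t -> (2 <= k)%N].
Proof.
have sumE (f : nat -> R) : \sum_(k < 4) clamp (t - k%:R) * (f k.+1 - f k) =
    clamp t * (f 1%N - f 0%N) + clamp (t - 1) * (f 2 - f 1%N)
    + clamp (t - 2) * (f 3 - f 2) + clamp (t - 3) * (f 4 - f 3).
  by rewrite !big_ord_recl big_ord0 /= subr0 addr0 !addrA.
rewrite /push_x /push_y (sumE (fun k => (stage q k).1)) (sumE (fun k => (stage q k).2)).
pose P (f : nat -> R) := f 0%N + (clamp t * (f 1%N - f 0%N)
  + clamp (t - 1) * (f 2 - f 1%N) + clamp (t - 2) * (f 3 - f 2)
  + clamp (t - 3) * (f 4 - f 3)).
suff : exists k s, [/\ (k < 4)%N, 0 <= s <= 1,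
    (P (fun k => (stage q k).1), P (fun k => (stage q k).2))
      = mix s (stage q k) (stage q k.+1) & 2 <= t -> (2 <= k)%N] by [].
have eqn (s : R) k : (k < 4)%N -> 0 <= s <= 1 -> (2 <= t -> (2 <= k)%N) ->
    (forall f : nat -> R, P f = (1 - s) * f k + s * f k.+1) ->
    exists k s, [/\ (k < 4)%N, 0 <= s <= 1,
      (P (fun k => (stage q k).1), P (fun k => (stage q k).2))
      = mix s (stage q k) (stage q k.+1) & 2 <= t -> (2 <= k)%N].
  by move=> k4 s01 t2 E; exists k, s; split=> //; rewrite !E.
have [t0|t0] := leP t 0.
  apply: (eqn 0 0%N); rewrite ?lexx ?ler01 //; first lra.
  move=> f; rewrite /P !clamp_le0; [ring|lra|lra|lra|lra].
have [t1|t1] := leP t 1.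
  apply: (eqn t 0%N) => //; [lra|lra|].
  move=> f; rewrite /P (clamp_id (s := t)) ?clamp_le0; [ring|lra|lra|lra|lra].
have [t2|t2] : t < 2 \/ 2 <= t by case: (ltP t 2); [left|right].
  apply: (eqn (t - 1) 1%N) => //; [lra|lra|].
  move=> f; rewrite /P (clamp_id (s := t - 1)) ?(clamp_ge1 (s := t)) ?clamp_le0; [ring|lra|lra|lra|lra].
have [t3|t3] := leP t 3.
  apply: (eqn (t - 2) 2) => //; [lra|].
  move=> f; rewrite /P (clamp_id (s := t - 2)) ?(clamp_ge1 (s := t)) ?(clamp_ge1 (s := t - 1)) ?clamp_le0; [ring|lra|lra|lra|lra].
have [t4|t4] := leP t 4.
  apply: (eqn (t - 3) 3) => //; [lra|].
  move=> f; rewrite /P (clamp_id (s := t - 3)) ?clamp_ge1; [ring|lra|lra|lra|lra].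
apply: (eqn 1 3); rewrite ?lexx ?ler01 //.
move=> f; rewrite /P !clamp_ge1; [ring|lra|lra|lra|lra].
Qed.

End Level.
End Deformation.

Section DeformationProperties.
Local Open Scope classical_set_scope.
Local Open Scope ring_scope.
Variable R : realType.
Notation X := (harmonic_archipelago R).
Implicit Types q : X.
Variable m : nat.
Hypothesis m8 : (8 <= m)%N.

Let m0 : (0 < m)%N. Proof. exact: leq_trans m8. Qed.

Local Notation x1 := (x1 m).
Local Notation y1 := (y1 m).
Local Notation xi := (xi m).
Local Notation wid := (wid m).
Local Notation lev := (lev m).
Local Notation stage := (stage m).
Local Notation good := (good m).
Local Notation band := (band m).

Lemma base_disk_scale (p : R * R) s : base_disk p -> 0 <= s <= 1 ->
  base_disk (s * p.1, s * p.2).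
Proof.
move=> bp s01; have := base_disk_convex (base_disk0 R) bp s01.
by rewrite /= !mulr0 !add0r.
Qed.

Lemma y1_le1 q : 0 <= y1 q <= 1 / 4.
Proof.
by have [/andP[h1 h2] h3] := y1_bounds m8 q; have := @ell_m_le R m m8; lra.
Qed.

Lemma y1_sqr_le q : y1 q ^+ 2 <= y1 q.
Proof. by have /andP[h0 h1] := y1_le1 q; rewrite expr2 ler_piMl //; lra. Qed.

Lemma wid_bounds q : 0 <= wid q <= `|px q| + py q /\ y1 q ^+ 2 <= wid q.
Proof.
have h := x1_le m8 q; have h1 := y1_sqr_le q.
have [/andP[h2 h3] _] := y1_bounds m8 q; have h4 := py_ge0 q.
rewrite /wid le_max normr_ge0 le_max lexx orbT ge_max.
by split=> //; apply/andP; split => //=; rewrite ?normr_ge0; have := normr_ge0 (px q); lra.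
Qed.

Lemma xi_mul_le q (b : R) : 0 <= b -> `|xi q * b| <= b.
Proof. by move=> b0; rewrite normrM (ger0_norm b0) ler_piMl // xi_le1. Qed.

Lemma quartic_le (u y : R) : 0 <= y <= 1 / 4 ->
  u <= (y ^+ 2) ^+ 2 -> u + y ^+ 2 <= 2 * y.
Proof.
move=> /andP[y0 y1] h; have h1 : y ^+ 2 <= y by rewrite expr2 ler_piMl //; lra.
have h2 : (y ^+ 2) ^+ 2 <= y ^+ 2 by rewrite expr2 ler_piMl ?sqr_ge0 //; lra.
lra.
Qed.

Lemma stage_disk q k : base_disk (stage q k).
Proof.
have c01 := chi_bounds (xi_le1 m q).
have [/andP[y0 _] y14] := y1_bounds m8 q; have lm := @ell_m_le R m m8.
case: k => [|[|[|[|k]]]].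
- exact: base_pxy.
- by apply/base_diskE/disk1.
- have [/andP[w0 _] _] := wid_bounds q.
  apply/base_diskE => /=; have h := xi_mul_le q w0.
  have {h} : (xi q * wid q) ^+ 2 <= wid q ^+ 2.
    by rewrite -real_normK ?num_real // lerXn2r ?nnegrE.
  have := disk1 m8 q; rewrite {1}/wid; case: (leP (y1 q ^+ 2) `|x1 q|) => h1 h2 h3.
    by move: h3; rewrite /wid max_l // real_normK ?num_real //; lra.
  move: h3; rewrite /wid max_r ?(ltW h1) // => h3; apply: quartic_le h3; lra.
- have := base_disk_scale (_ : base_disk (stage q 2)) c01; apply.
  apply/base_diskE => /=; have [/andP[w0 _] _] := wid_bounds q.
  have h := xi_mul_le q w0.
  have {h} : (xi q * wid q) ^+ 2 <= wid q ^+ 2.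
    by rewrite -real_normK ?num_real // lerXn2r ?nnegrE.
  have := disk1 m8 q; rewrite {1}/wid; case: (leP (y1 q ^+ 2) `|x1 q|) => h1 h2 h3.
    by move: h3; rewrite /wid max_l // real_normK ?num_real //; lra.
  move: h3; rewrite /wid max_r ?(ltW h1) // => h3; apply: quartic_le h3; lra.
- have [/andP[l0 _] l14] := lev_bounds m8 q.
  have := @base_disk_scale (xi q * lev q, lev q) _ _ c01; apply.
  apply/base_diskE => /=; have h := xi_mul_le q l0.
  have {h} : (xi q * lev q) ^+ 2 <= lev q ^+ 2.
    by rewrite -real_normK ?num_real // lerXn2r ?nnegrE.
  have : lev q ^+ 2 <= lev q by rewrite expr2 ler_piMl //; lra.
  lra.
Qed.

Lemma push_disk q t : base_disk (push_x m q t, push_y m q t).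
Proof.
have [k [s [_ s01 -> _]]] := push_mix m q t.
exact: base_disk_convex (stage_disk q k) (stage_disk q k.+1) s01.
Qed.

Lemma pxy_push q t : pxy (push_out m q t) = (push_x m q t, push_y m q t).
Proof. exact/pxy_emb/push_disk. Qed.

Lemma wide_mul (u w y mu : R) : 1 / 2 <= `|u| -> 0 <= y -> y ^+ 2 <= w -> 0 <= mu <= 1 ->
  (mu * y) ^+ 2 / 2 <= `|mu * (u * w)|.
Proof.
move=> hu y0 yw /andP[h0 h1]; have w0 : 0 <= w := le_trans (sqr_ge0 y) yw.
rewrite !normrM (ger0_norm h0) (ger0_norm w0) exprMn.
have e1 : mu ^+ 2 <= mu by rewrite expr2 ler_piMl.
have e2 : mu ^+ 2 * y ^+ 2 <= mu * w by rewrite ler_pM ?sqr_ge0.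
have e3 : mu * w * (1 / 2) <= mu * w * `|u| by rewrite ler_wpM2l ?mulr_ge0.
rewrite mulrA [mu * `|u|]mulrC -mulrA [`|u| * _]mulrC.
by lra.
Qed.

(** For [|xi| >= 1/2] the last two moves run outside all hills; convexity of the square takes care
    of the mixture. *)
Lemma mix_wide q k s : 1 / 2 <= `|xi q| -> (2 <= k < 4)%N -> 0 <= s <= 1 ->
  height (mix s (stage q k) (stage q k.+1)) = 0.
Proof.
move=> hx k2 s01; have [/andP[y0 _] y14] := y1_bounds m8 q.
have [/andP[l0 _] l14] := lev_bounds m8 q; have lm := @ell_m_le R m m8.
have [/andP[w0 _] wy] := wid_bounds q.
have /andP[c0 c1] := chi_bounds (xi_le1 m q).
have /andP[s0 s1] := s01.
have s1' : 0 <= 1 - s by lra.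
apply: height_wide; rewrite /mix.
case: k k2 => [|[|[|[|k]]]] // _ /=.
- have -> : (1 - s) * (xi q * wid q) + s * (chi (xi q) * (xi q * wid q)) =
    ((1 - s) + s * chi (xi q)) * (xi q * wid q) by ring.
  have -> : (1 - s) * y1 q + s * (chi (xi q) * y1 q) = ((1 - s) + s * chi (xi q)) * y1 q by ring.
  apply: wide_mul => //; have := mulr_ge0 s0 c0.
  have : s * chi (xi q) <= s by rewrite ler_piMr.
  by move=> h1 h2; apply/andP; split; lra.
- have -> : (1 - s) * (chi (xi q) * (xi q * wid q)) + s * (chi (xi q) * (xi q * lev q)) =
    chi (xi q) * (xi q * ((1 - s) * wid q + s * lev q)) by ring.
  have -> : (1 - s) * (chi (xi q) * y1 q) + s * (chi (xi q) * lev q) =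
    chi (xi q) * ((1 - s) * y1 q + s * lev q) by ring.
  apply: wide_mul => //; last by rewrite c0.
    by apply: addr_ge0; apply: mulr_ge0.
  have e1 : (1 - s) * y1 q ^+ 2 <= (1 - s) * wid q by rewrite ler_wpM2l.
  have e2 : s * lev q ^+ 2 <= s * lev q.
    by rewrite ler_wpM2l // expr2 ler_piMl //; lra.
  have e3 : 0 <= (1 - s) * s * (y1 q - lev q) ^+ 2.
    by rewrite mulr_ge0 ?sqr_ge0 ?mulr_ge0.
  have -> : ((1 - s) * y1 q + s * lev q) ^+ 2 =
    (1 - s) * y1 q ^+ 2 + s * lev q ^+ 2 - (1 - s) * s * (y1 q - lev q) ^+ 2 by ring.
  lra.
Qed.

Lemma x1E q : good q -> 0 < py q -> x1 q = xi q * Num.max `|x1 q| (tau (y1 q)).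
Proof. by move=> gq y0; rewrite /xi divfK // gt_eqF // den_gt0. Qed.

Lemma den_le_wid q : Num.max `|x1 q| (tau (y1 q)) <= wid q.
Proof.
rewrite /wid ge_max !le_max lexx /=; apply/orP; right.
by have /andP[] := tau_bounds (y1 q).
Qed.

Lemma height_mono_x (y x x' : R) : `|x| <= `|x'| -> height (x', y) <= height (x, y).
Proof.
move=> h; apply: height_mono => n n0 _; apply: euclid_dist_le => //=.
by rewrite !subr0.
Qed.

Lemma mix1_height q s : good q -> 0 < py q -> 0 <= s <= 1 ->
  height (mix s (stage q 1) (stage q 2)) <= height (x1 q, y1 q).
Proof.
move=> gq y0 /andP[s0 s1]; rewrite /mix /=.
have -> : (1 - s) * y1 q + s * y1 q = y1 q by ring.
apply: height_mono_x; have d0 := den_gt0 m8 gq y0; have dw := den_le_wid q.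
rewrite [in X in _ <= X](x1E gq y0) {1}(x1E gq y0); move: (Num.max _ _) d0 dw => d d0 dw.
have -> : (1 - s) * (xi q * d) + s * (xi q * wid q) = xi q * ((1 - s) * d + s * wid q) by ring.
rewrite !normrM ler_wpM2l // (gtr0_norm d0).
have : s * d <= s * wid q by rewrite ler_wpM2l.
by move=> h; apply: le_trans (ler_norm _); lra.
Qed.

(** Sliding towards [ell n] inside band [n] meets hill [n] above its centre and hill [n.-1] below
    its centre, and in both cases moves away from the centre. *)
Lemma slide_cases n k (y s : R) : (0 < m)%N -> (m <= n)%N ->
  n = m \/ y < centre R n.-1 -> y <= ell R m -> centre R n < y -> 0 <= s <= 1 ->
  (0 < k)%N -> ell R k.+1 < (1 - s) * y + s * ell R n ->
  (1 - s) * y + s * ell R n < ell R k ->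
  [\/ k = n /\ y <= (1 - s) * y + s * ell R n,
     (1 - s) * y + s * ell R n = y |
     [/\ k.+1 = n, (1 - s) * y + s * ell R n <= y & y < centre R k]].
Proof.
move=> m0' mn nc ym yc /andP[s0 s1] k0; set Y := _ + _ => hk1 hk2.
have eY : Y - y = s * (ell R n - y) by rewrite /Y; ring.
have eY' : ell R n - Y = (1 - s) * (ell R n - y) by rewrite /Y; ring.
have n0 : (0 < n)%N := leq_trans m0' mn.
have /andP[cn1 cn2] := centre_bounds R n0.
have s1' : 0 <= 1 - s by lra.
clearbody Y.
have [hy|hy] := leP y (ell R n).
  have hy0 : 0 <= ell R n - y by lra.
  have h1 : 0 <= Y - y by rewrite eY mulr_ge0.
  have h2 : 0 <= ell R n - Y by rewrite eY' mulr_ge0.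
  constructor 1; split; last lra; apply/eqP; rewrite eqn_leq; apply/andP; split.
    rewrite -ltnS ltnNge; apply/negP => nk.
    by have := @ell_le R n.+1 k isT nk; lra.
  rewrite leqNgt; apply/negP => kn; have := @ell_le R k.+1 n isT kn; lra.
have [e|nm] := eqVneq n m; first by exfalso; move: hy ym; rewrite e; lra.
case: nc => [/eqP|nc]; first by rewrite (negPf nm).
have hy0 : ell R n - y <= 0 by lra.
have h1 : Y - y <= 0 by rewrite eY mulr_ge0_le0.
have h2 : ell R n - Y <= 0 by rewrite eY' mulr_ge0_le0.
have n1 : (0 < n.-1)%N by move: nm mn (m8); clear; lia.
have /andP[_ cn3] := centre_bounds R n1.
have kn : k = n.-1.
  apply/eqP; rewrite eqn_leq; apply/andP; split.
    rewrite -ltnS prednK // ltnNge; apply/negP => nk.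
    by have := @ell_le R n k n0 nk; lra.
  rewrite leqNgt; apply/negP => kn; have := @ell_le R k.+1 n.-1 isT kn; lra.
constructor 3; rewrite kn prednK //; split=> //; lra.
Qed.

(** From stage 1 on, the third coordinate never exceeds its value at stage 1. Continuity at the
    origin, where this coordinate must tend to 0, and the avoidance of peaks both come from here. *)
Lemma mix_height q k s : good q -> 0 < py q -> (1 <= k < 4)%N -> 0 <= s <= 1 ->
  height (mix s (stage q k) (stage q k.+1)) <= height (x1 q, y1 q).
Proof.
move=> gq y0 k14 s01; have /andP[h0 _] := height_bounds (x1 q, y1 q).
case: k k14 => [|[|k]] // k14; first exact: mix1_height.
have [hx|hx] := leP (1 / 2) `|xi q|; first by rewrite mix_wide.
have c1 : chi (xi q) = 1 by rewrite chi_half // ltW.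
case: k k14 => [|[|k]] // _.
  have := @mix1_height q 1 gq y0; rewrite lexx ler01 => /(_ isT).
  congr (height _ <= _); rewrite /mix /= c1 !mul1r subrr !mul0r !add0r.
  by congr pair; ring.
have hx1 : `|xi q| < 1 by lra.
have [n bn] := xi_lt1_band m8 hx1 gq y0.
have [lE ly] := band_lev m8 bn; have [/andP[t0 t1]] := (tau_bounds (y1 q), xi_lt1 m8 hx1 gq y0).
case=> xt xE; have [wp ww] := wid_bounds q; have s01' := s01; case/andP: s01 => s0 s1.
have [mn cn nc'] := bn; have n0 : (0 < n)%N := leq_trans m0 mn.
have nc : n = m \/ y1 q < centre R n.-1.
  case: nc' => [e|h]; [by left|right; apply: le_lt_trans h].
  by rewrite /y1 ge_min lexx.
have [_ y1m] := y1_bounds m8 q; have y1p : y1 q <= py q by rewrite /y1 ge_min lexx.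
have yc : centre R n < y1 q.
  rewrite /y1 lt_min cn /=; have /andP[_ h1] := centre_bounds R n0.
  by apply: lt_le_trans h1 _; apply: ell_le.
rewrite /mix /= c1 !mul1r lE; rewrite lE in ly.
set Y := (1 - s) * y1 q + s * ell R n.
have -> : (1 - s) * (xi q * wid q) + s * (xi q * ell R n) =
  xi q * ((1 - s) * wid q + s * ell R n) by ring.
apply: height_mono => k k0 hk; apply: euclid_dist_le => /=.
  rewrite !subr0 xE [X in _ <= X]normrM ler_wpM2l //.
  have e1 : (1 - s) * tau (y1 q) <= (1 - s) * wid q by rewrite ler_wpM2l //; lra.
  have e2 : s * tau (y1 q) <= s * ell R n by rewrite ler_wpM2l //; lra.
  by apply: le_trans (ler_norm _); lra.
have [/= hk1 hk2 _ _] := hill_bounds k0 hk.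
rewrite -/(ell R k.+1) in hk1; rewrite -/(ell R k) in hk2.
have /andP[ck1 ck2] := centre_bounds R k0.
have := slide_cases m0 mn nc y1m yc s01' k0 hk1 hk2.
rewrite -/Y => kn; rewrite -[k%:R^-1 + _]/(centre R k).
case: kn => [[-> h]|->//|[_ h1 h2]].
  by rewrite !ger0_norm; lra.
by rewrite !ler0_norm; lra.
Qed.

(** During the first move the point is either fixed or stays at ordinate at least [ell m], above the
    removed peaks. Later a peak would force height 1 at stage 1, that is a zero denominator in
    [xi]. *)
Lemma good_push q t : good q -> good (push_out m q t).
Proof.
move=> gq n mn; have n0 : (0 < n)%N := leq_trans m0 mn.
have cpos : 0 < centre R n.
  have /andP[h _] := centre_bounds R n0.
  by apply: lt_trans h; apply: ell_gt0.
have /andP[_ cl] := centre_bounds R n0; have lm := ell_le R m0 mn.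
rewrite -[px _]/((pxy _).1) -[py _]/((pxy _).2) pxy_push.
have [k [s [k4 s01 e _]]] := push_mix m q t.
have [y0|y0] := leP (py q) 0.
  move=> _; suff -> : (push_x m q t, push_y m q t).2 = 0 by lra.
  have {}y0 : py q = 0 by apply/eqP; rewrite eq_le y0 py_ge0.
  have y1z : y1 q = 0 by rewrite /y1 y0 min_l //; apply/ltW/ell_gt0.
  have lz : lev q = 0.
    have [] := lev_bounds m8 q; rewrite y0 mulr0 => h _.
    by apply/eqP; rewrite eq_le andbC.
  have sz j : (stage q j).2 = 0.
    by case: j => [|[|[|[|j]]]] //=; rewrite ?y1z ?lz ?mulr0.
  by rewrite e -[LHS]/((1 - s) * (stage q k).2 + s * (stage q k.+1).2) !sz !mulr0 addr0.
rewrite e; case: k k4 e => [|k] k4 e.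
  rewrite /mix => xz yz; case/andP: s01 => s0 s1.
  have [yl|yl] := leP (py q) (ell R m).
    have [e1 e2] := stage1_id yl.
    apply: (gq n mn); first by move: xz; rewrite /= e1 -mulrDl subrK mul1r.
    by move: yz; rewrite /= e2 -mulrDl subrK mul1r.
  move: yz; rewrite /= /y1 (min_r (ltW yl)) => yz.
  have : (1 - s) * ell R m <= (1 - s) * (pxy q).2.
    by rewrite ler_wpM2l //; [lra|apply: ltW].
  lra.
have := @mix_height q k.+1 s gq y0; rewrite k4 => /(_ isT s01).
case: (mix _ _ _) => u v /= h xz yz; rewrite xz yz in h.
have h1 : height (0, centre R n) = 1 :> R.
  have hn : hill n (0, centre R n).
    by rewrite /hill /= /euclid_dist /= !subrr expr0n addr0 sqrtr0 ltW ?hill_radius_gt0.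
  rewrite (height_hill (conj n0 hn)) bump_hill //.
  by rewrite /euclid_dist /= !subrr expr0n addr0 sqrtr0 mul0r subr0.
have /height_peak[j j0 [xj yj]] : height (x1 q, y1 q) = 1.
  by apply/eqP; rewrite eq_le -{2}h1 h andbT; have /andP[] := height_bounds (x1 q, y1 q).
have := den_gt0 m8 gq y0; rewrite xj normr0 yj /tau.
have hj : hill j (0, centre R j).
  by rewrite /hill /= /euclid_dist /= !subrr expr0n addr0 sqrtr0 ltW ?hill_radius_gt0.
have -> : height (0, centre R j) = 1 :> R.
  rewrite (height_hill (conj j0 hj)) bump_hill //.
  by rewrite /euclid_dist /= !subrr expr0n addr0 sqrtr0 mul0r subr0.
by rewrite subrr mulr0 maxxx ltxx.
Qed.

End DeformationProperties.

(** * Continuity of the retraction *)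

Section DeformationContinuity.
Local Open Scope classical_set_scope.
Local Open Scope ring_scope.
Variable R : realType.
Notation X := (harmonic_archipelago R).
Implicit Types q : X.
Variable m : nat.
Hypothesis m8 : (8 <= m)%N.

Let m0 : (0 < m)%N. Proof. exact: leq_trans m8. Qed.

Local Notation x1 := (x1 m).
Local Notation y1 := (y1 m).
Local Notation xi := (xi m).
Local Notation wid := (wid m).
Local Notation lev := (lev m).
Local Notation stage := (stage m).
Local Notation good := (good m).
Local Notation band := (band m).

Lemma px_push q t : px (push_out m q t) = push_x m q t.
Proof. by rewrite -[px _]/((pxy _).1) pxy_push. Qed.

Lemma py_push q t : py (push_out m q t) = push_y m q t.
Proof. by rewrite -[py _]/((pxy _).2) pxy_push. Qed.

Lemma stage_bound q k : `|(stage q k).1| <= `|px q| + 2 * py q /\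
  `|(stage q k).2| <= `|px q| + 2 * py q.
Proof.
have h1 := x1_le m8 q; have [/andP[h2 h3] _] := y1_bounds m8 q.
have h4 := py_ge0 q; have h5 := normr_ge0 (px q).
have [/andP[w0 w1] _] := wid_bounds m8 q.
have [/andP[l0 l1] _] := lev_bounds m8 q.
have /andP[c0 c1] := chi_bounds (xi_le1 m q).
have cz z b : `|z| <= b -> `|chi (xi q) * z| <= b.
  move=> zb; rewrite normrM (ger0_norm c0); apply: le_trans zb.
  by rewrite ler_piMl.
have xw := xi_mul_le m q w0; have xl := xi_mul_le m q l0.
case: k => [|[|[|[|k]]]] /=.
- split; first by rewrite -/(px q); lra.
  by rewrite -/(py q) ger0_norm //; lra.
- split; first lra.
  by rewrite ger0_norm //; lra.
- split; first lra.
  by rewrite ger0_norm //; lra.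
- split; first by apply: cz; lra.
  by apply: cz; rewrite ger0_norm //; lra.
- split; first by apply: cz; lra.
  by apply: cz; rewrite ger0_norm //; lra.
Qed.

Lemma mix_bound (s u v b : R) : 0 <= s <= 1 -> `|u| <= b -> `|v| <= b ->
  `|(1 - s) * u + s * v| <= b.
Proof.
move=> /andP[s0 s1] ub vb; apply: le_trans (ler_normD _ _) _.
rewrite !normrM (ger0_norm s0) ger0_norm; last lra.
have e1 : (1 - s) * `|u| <= (1 - s) * b by rewrite ler_wpM2l //; lra.
have e2 : s * `|v| <= s * b by rewrite ler_wpM2l.
lra.
Qed.

Lemma push_bound q t : `|px (push_out m q t)| <= `|px q| + 2 * py q /\
  `|py (push_out m q t)| <= `|px q| + 2 * py q.
Proof.
rewrite px_push py_push; have [k [s [_ s01 e _]]] := push_mix m q t.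
have [e1 e2] := stage_bound q k; have [e3 e4] := stage_bound q k.+1.
case: e => -> ->; split; exact: mix_bound.
Qed.

Lemma push_origin t : push_out m (origin R) t = origin R.
Proof.
apply: py_eq0; have [_] := push_bound (origin R) t.
by rewrite px_origin py_origin normr0 mulr0 addr0 normr_le0 => /eqP.
Qed.

Lemma push_height q t : good q -> py q <= ell R m ->
  height (pxy (push_out m q t)) <= height (pxy q).
Proof.
move=> gq yl; have [y0|y0] := eqVneq (py q) 0.
  by rewrite (py_eq0 y0) push_origin.
have {}y0 : 0 < py q by rewrite lt_def y0 py_ge0.
rewrite (pxy_push m8); have [k [s [k4 s01 -> _]]] := push_mix m q t.
have [e1 e2] := stage1_id yl; have pq : pxy q = (x1 q, y1 q) by rewrite e1 e2 pxyE.
rewrite [in X in _ <= X]pq.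
case: k k4 => [|k] k4; last by apply: mix_height.
by rewrite /mix /= pq /= -!mulrDl !subrK !mul1r.
Qed.

Lemma lev_gt0 q : good q -> 0 < py q -> `|xi q| < 1 -> 0 < lev q.
Proof.
move=> gq y0 hx; have [n bn] := xi_lt1_band m8 hx gq y0.
have [-> _] := band_lev m8 bn; have [mn _ _] := bn.
exact/ell_gt0/(leq_trans m0 mn).
Qed.

Section Limit.
Variables (S : Type) (F : set_system S) (FF : Filter F).
Variables (f : S -> X) (t : S -> R) (q : X) (t0 : R).
Hypothesis gf : forall s, good (f s).
Hypothesis gq : good q.
Hypothesis cf : f @ F --> q.
Hypothesis ct : t @ F --> t0.

Let cpx : (fun s => px (f s)) @ F --> px q.
Proof. exact: (cvg_comp _ _ cf (@px_continuous R q)). Qed.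

Let cpy : (fun s => py (f s)) @ F --> py q.
Proof. exact: (cvg_comp _ _ cf (@py_continuous R q)). Qed.

Let cpz : (fun s => height (pxy (f s))) @ F --> height (pxy q).
Proof. exact: (cvg_comp _ _ cf (@pz_continuous R q)). Qed.

Lemma push_cvg_origin : q = origin R ->
  (fun s => push_out m (f s) (t s)) @ F --> push_out m q t0.
Proof.
move=> qo; rewrite qo push_origin; apply: cvg_archipelago.
- rewrite px_origin; apply/cvgr0Pnorm_le => /= e e0.
  have : (fun s => `|px (f s)| + 2 * py (f s)) @ F --> (0 : R).
    have -> : (0 : R) = `|px q| + 2 * py q.
      by rewrite qo px_origin py_origin normr0 mulr0 addr0.
    by apply: cvgD; [apply: cvg_norm|apply: cvgM (cvg_cst _) _].
  move/cvgr_le => /(_ e e0); apply: filterS => s; apply: le_trans.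
  by have [] := push_bound (f s) (t s).
- rewrite py_origin; apply/cvgr0Pnorm_le => /= e e0.
  have : (fun s => `|px (f s)| + 2 * py (f s)) @ F --> (0 : R).
    have -> : (0 : R) = `|px q| + 2 * py q.
      by rewrite qo px_origin py_origin normr0 mulr0 addr0.
    by apply: cvgD; [apply: cvg_norm|apply: cvgM (cvg_cst _) _].
  move/cvgr_le => /(_ e e0); apply: filterS => s; apply: le_trans.
  by have [] := push_bound (f s) (t s).
- rewrite pxy_origin height0; apply/cvgr0Pnorm_le => /= e e0.
  have h1 : \forall s \near F, py (f s) <= ell R m.
    by move: cpy; rewrite qo py_origin => /cvgr_le; apply; apply: ell_gt0.
  have h2 : \forall s \near F, height (pxy (f s)) <= e.
    by move: cpz; rewrite qo pxy_origin height0 => /cvgr_le; apply.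
  apply: filterS2 h1 h2 => s h1 h2.
  have /andP[h _] := height_bounds (pxy (push_out m (f s) (t s))).
  by rewrite ger0_norm //; apply: le_trans h2; apply: push_height.
Qed.

Hypothesis y0 : 0 < py q.

Let cy1 : (fun s => y1 (f s)) @ F --> y1 q.
Proof. by apply: cvg_minr => //; apply: cvg_cst. Qed.

Let cx1 : (fun s => x1 (f s)) @ F --> x1 q.
Proof.
apply: cvgM => //; apply: cvg_minr; first exact: cvg_cst.
by apply: cvgM; [exact: cvg_cst|apply: cvgV; rewrite ?gt_eqF].
Qed.

Let ctau : (fun s => tau (y1 (f s))) @ F --> tau (y1 q).
Proof.
apply: cvgM; first exact: cvg_sqr.
apply: cvgB; first exact: cvg_cst.
apply: (cvg_comp (fun s => (0 : R, y1 (f s))) (@height R)); last first.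
  by apply: height_cvg => /=; apply: y1_gt0.
exact: (cvg_pair (cvg_cst _) cy1).
Qed.

Lemma xi_cvg : (fun s => xi (f s)) @ F --> xi q.
Proof.
apply: cvgM => //; apply: cvgV; first by rewrite gt_eqF // den_gt0.
by apply: cvg_maxr => //; apply: cvg_norm.
Qed.

Let cwid : (fun s => wid (f s)) @ F --> wid q.
Proof. by apply: cvg_maxr; [apply: cvg_norm|apply: cvg_sqr]. Qed.

Let cchi : (fun s => chi (xi (f s))) @ F --> chi (xi q).
Proof.
apply: cvg_minr; first exact: cvg_cst.
apply: cvgM; first exact: cvg_cst.
apply: cvgB; first exact: cvg_cst.
by apply: cvg_norm; exact: xi_cvg.
Qed.

Lemma band_near n : band n (py q) -> \forall s \near F, band n (py (f s)).
Proof.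
case=> mn cn nc; have h1 : \forall s \near F, centre R n < py (f s) by move/cvgr_gt: cpy; apply.
case: nc => [e|nc]; first by apply: filterS h1 => s h1; split=> //; left.
have h2 : \forall s \near F, py (f s) < centre R n.-1 by move/cvgr_lt: cpy; apply.
by apply: filterS2 h1 h2 => s h1 h2; split=> //; right.
Qed.

(** Inside a band [lev] is locally constant. At an ordinate without band [|xi| = 1], so [chi] tends
    to 0 while [lev] stays bounded. *)
Let cchil : (fun s => chi (xi (f s)) * lev (f s)) @ F --> chi (xi q) * lev q.
Proof.
have [[n bn]|nb] := pselect (exists n, band n (py q)).
  have [-> _] := band_lev m8 bn; apply: cvgM => //.
  apply: cvg_near_cst; apply: filterS (band_near bn) => s bs.
  by have [] := band_lev m8 bs.
have x1q : `|xi q| = 1.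
  apply/eqP; rewrite eq_le xi_le1 leNgt; apply/negP => hx.
  exact: nb (xi_lt1_band m8 hx gq y0).
have c0 : chi (xi q) = 0 by rewrite /chi x1q subrr mulr0 min_r.
rewrite c0 mul0r; apply/cvgr0Pnorm_le => /= e e0.
have : (fun s => chi (xi (f s))) @ F --> (0 : R) by rewrite -c0.
move/cvgr_le => /(_ e e0); apply: filterS => s.
have /andP[h1 h2] := chi_bounds (xi_le1 m (f s)).
have [/andP[l0 _] lm] := lev_bounds m8 (f s); have lm' := @ell_m_le R m m8.
move=> ce; rewrite ger0_norm; last exact: mulr_ge0.
by apply: le_trans ce; rewrite ler_piMr //; lra.
Qed.

Let cstage k : (fun s => (stage (f s) k).1) @ F --> (stage q k).1 /\
  (fun s => (stage (f s) k).2) @ F --> (stage q k).2.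
Proof.
have cx := xi_cvg; case: k => [|[|[|[|k]]]] /=; split=> //.
- by apply: cvgM.
- by apply: cvgM => //; apply: cvgM.
- by apply: cvgM.
- rewrite mulrCA; under eq_fun do rewrite mulrCA.
  by apply: cvgM.
Qed.

Let cclamp k : (fun s => clamp (t s - k)) @ F --> clamp (t0 - k).
Proof.
apply: cvg_maxr; first exact: cvg_cst.
by apply: cvg_minr; [exact: cvg_cst|apply: cvgB => //; apply: cvg_cst].
Qed.

Let cpush_x : (fun s => push_x m (f s) (t s)) @ F --> push_x m q t0.
Proof.
apply: cvgD; first by case: (cstage 0).
apply: cvg_big => [|k _]; first exact: add_continuous.
by apply: cvgM => //; apply: cvgB; [case: (cstage k.+1)|case: (cstage k)].
Qed.

Let cpush_y : (fun s => push_y m (f s) (t s)) @ F --> push_y m q t0.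
Proof.
apply: cvgD; first by case: (cstage 0).
apply: cvg_big => [|k _]; first exact: add_continuous.
by apply: cvgM => //; apply: cvgB; [case: (cstage k.+1)|case: (cstage k)].
Qed.

(** A point other than the origin arrives there only after time 2 and with [|xi| > 1/2], hence from
    outside the hills: the third coordinate is then locally 0, and the discontinuity of [height] at
    the origin does no harm. *)
Lemma push_eq0 : push_y m q t0 = 0 -> 2 < t0 /\ 1 / 2 < `|xi q|.
Proof.
have y1p := y1_gt0 m8 y0; have /andP[c0 c1] := chi_bounds (xi_le1 m q).
have cpos : 1 / 2 < `|xi q| \/ (0 < chi (xi q) /\ 0 < lev q).
  have [h|h] := ltP (1 / 2) `|xi q|; [by left|right].
  by rewrite chi_half // ltr01 lev_gt0 //; lra.
have t2 : t0 <= 2 -> 0 < push_y m q t0.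
  move=> t2; rewrite /push_y !big_ord_recl big_ord0 /= -/(py q).
  have e0 : clamp (t0 - 0) * (y1 q - py q) >= y1 q - py q.
    have : 0 <= clamp (t0 - 0) <= 1 by rewrite /clamp le_max lexx /= ge_max ler01 ge_min lexx.
    have [/andP[_ h] _] := y1_bounds m8 q.
    move: (clamp _) => c /andP[h1 h2]; have h3 : y1 q - py q <= 0 by lra.
    by rewrite -[leLHS]mul1r ler_wnM2r.
  rewrite subrr mulr0 (clamp_le0 (s := t0 - 2)) ?(clamp_le0 (s := t0 - 3)); [|lra|lra].
  by rewrite !mul0r !addr0; lra.
move=> p0; have t2' : 2 < t0 by rewrite ltNge; apply/negP => /t2; rewrite p0 ltxx.
split=> //; case: cpos => // -[cp lp].
have [k [s [k4 /andP[s0 s1] [_ pE] k2]]] := push_mix m q t0.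
have {}k2 := k2 (ltW t2').
exfalso; suff : 0 < push_y m q t0 by rewrite p0 ltxx.
have mixp u v : 0 < u -> 0 < v -> 0 < (1 - s) * u + s * v.
  move=> u0 v0; have [->|sn] := eqVneq s 0; first by rewrite subr0 mul1r mul0r addr0.
  have sp : 0 < s by rewrite lt_def sn.
  apply: ltr_wpDl; last exact: mulr_gt0.
  by apply: mulr_ge0; [lra|apply: ltW].
rewrite pE; case: k k4 k2 {pE} => [|[|[|[|k]]]] //= _ _; apply: mixp => //; exact: mulr_gt0.
Qed.

Lemma push_cvg_off : (fun s => push_out m (f s) (t s)) @ F --> push_out m q t0.
Proof.
apply: cvg_archipelago.
- by rewrite px_push; under eq_fun do rewrite px_push.
- by rewrite py_push; under eq_fun do rewrite py_push.
rewrite pxy_push //; under eq_fun do rewrite pxy_push //.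
have yy := py_ge0 (push_out m q t0); rewrite py_push in yy.
move: yy; rewrite le_eqVlt => /predU1P[yy|yy]; last first.
  apply: (cvg_comp (fun s => (push_x m (f s) (t s), push_y m (f s) (t s))) (@height R)).
    exact: (cvg_pair cpush_x cpush_y).
  exact: height_cvg.
have [t2 hx] := push_eq0 (esym yy).
have wide q' t' : 2 < t' -> 1 / 2 < `|xi q'| -> height (push_x m q' t', push_y m q' t') = 0.
  move=> h1 h2; have [k [s [k4 s01 -> k2]]] := push_mix m q' t'.
  by rewrite mix_wide // ?(ltW h2) // k2 ?(ltW h1).
rewrite (wide q t0) //; apply: cvg_near_cst.
have h1 : \forall s \near F, 2 < t s by move/cvgr_gt: ct; apply.
have h2 : \forall s \near F, 1 / 2 < `|xi (f s)|.
  by have /cvg_norm/cvgr_gt := xi_cvg; apply.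
by apply: filterS2 h1 h2 => s; apply: wide.
Qed.

End Limit.

Lemma push_cvg (S : Type) (F : set_system S) (FF : Filter F)
    (f : S -> X) (t : S -> R) q (t0 : R) :
  (forall s, good (f s)) -> good q -> f @ F --> q -> t @ F --> t0 ->
  (fun s => push_out m (f s) (t s)) @ F --> push_out m q t0.
Proof.
move=> gf gq cf ct; have [y0|y0] := eqVneq (py q) 0.
  exact: push_cvg_origin (py_eq0 y0).
by apply: push_cvg_off => //; rewrite lt_def y0 py_ge0.
Qed.

End DeformationContinuity.

(** * The loops on which the retraction ends *)

Section Loops.
Local Open Scope classical_set_scope.
Local Open Scope ring_scope.
Variable R : realType.
Notation X := (harmonic_archipelago R).
Implicit Types q : X.

(** For [u = (1 + xi) / 2] this is the factor [chi xi] of the last stage, so the retraction ends at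
    the point of [rho n] with parameter [u] ([push4_in]). *)
Definition bend (u : R) : R := Num.max 0 (chi (2 * u - 1)).

(* The n-th loop, based at the origin and crossing the axis at height 2/n. *)
Definition rho (n : nat) (u : R) : X :=
  emb (bend u * ((2 * u - 1) * ell R n), bend u * ell R n).

Lemma bend_bounds u : 0 <= bend u <= 1 /\ `|bend u * (2 * u - 1)| <= bend u.
Proof.
have b0 : 0 <= bend u by rewrite /bend le_max lexx.
split; first by rewrite b0 ge_max ler01 /= /chi ge_min lexx.
rewrite /bend; have [h|h] := ltP 0 (chi (2 * u - 1)); last by rewrite mul0r normr0.
rewrite normrM (gtr0_norm h) ler_piMr ?(ltW h) // ltW //.
exact: chi_gt0.
Qed.

Lemma ell_le1 n : (2 <= n)%N -> 0 < ell R n <= 1.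
Proof.
move=> n2; rewrite ell_gt0 ?(leq_trans _ n2) //=.
by have := @inv_nat_le R 2 n isT n2; rewrite /ell /inv_nat; lra.
Qed.

Lemma rho_disk n u : (2 <= n)%N ->
  base_disk (bend u * ((2 * u - 1) * ell R n), bend u * ell R n).
Proof.
move=> /ell_le1/andP[l0 l1]; apply/base_diskE => /=.
have [/andP[b0 b1] h] := bend_bounds u.
rewrite mulrA; have {}h : (bend u * (2 * u - 1)) ^+ 2 <= bend u ^+ 2.
  by rewrite -real_normK ?num_real // lerXn2r ?nnegrE.
move: (bend u * (2 * u - 1)) h => z h.
move: (ell R n) (bend u) l0 l1 b0 b1 h => l b l0 l1 b0 b1 h; rewrite !exprMn -mulrDl.
have e1 : b ^+ 2 <= b by rewrite expr2 ler_piMl.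
have e2 : l ^+ 2 <= l by rewrite expr2 ler_piMl // ltW.
have e3 : (b ^+ 2 + b ^+ 2) * l ^+ 2 <= 2 * b * l.
  by apply: ler_pM; rewrite ?sqr_ge0 ?addr_ge0 ?sqr_ge0 //; lra.
rewrite [X in _ <= X]mulrA; apply: le_trans e3; rewrite ler_wpM2r ?sqr_ge0 //.
by rewrite lerD2r.
Qed.

Lemma px_rho n u : (2 <= n)%N -> px (rho n u) = bend u * ((2 * u - 1) * ell R n).
Proof. by move=> n2; rewrite -[px _]/((pxy _).1) pxy_emb //; apply: rho_disk. Qed.

Lemma py_rho n u : (2 <= n)%N -> py (rho n u) = bend u * ell R n.
Proof. by move=> n2; rewrite -[py _]/((pxy _).2) pxy_emb //; apply: rho_disk. Qed.

Lemma height_ell n x : height (x, ell R n) = 0.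
Proof.
apply: height_out => k k0 /(hill_bounds k0)[/= h1 h2 _ _].
rewrite -/(ell R k.+1) in h1; rewrite -/(ell R k) in h2.
have [n0|n0] := posnP n.
  have e0 : ell R 0 = 0 by rewrite /ell /inv_nat invr0 mulr0.
  move: h1; rewrite n0 e0.
  by have := @ell_gt0 R k.+1 isT; lra.
have [kn|nk] := ltnP k n; first by have := @ell_le R k.+1 n isT kn; lra.
by have := @ell_le R n k n0 nk; lra.
Qed.

Lemma rho_height n u : (2 <= n)%N -> height (pxy (rho n u)) = 0.
Proof.
move=> n2; rewrite pxyE px_rho // py_rho //; have [b01 hb] := bend_bounds u.
have /andP[l0 l1] := ell_le1 n2.
have [h|h] := leP (1 / 2) `|2 * u - 1|.
  apply: height_wide => /=; apply: wide_mul => //; first exact: ltW.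
  by rewrite expr2 ler_piMl // ltW.
have -> : bend u = 1 by rewrite /bend chi_half ?max_r // ltW.
by rewrite !mul1r height_ell.
Qed.

Lemma rho_bound n u : (2 <= n)%N -> `|px (rho n u)| <= ell R n /\ 0 <= py (rho n u) <= ell R n.
Proof.
move=> n2; rewrite px_rho // py_rho //; have [/andP[b0 b1] hb] := bend_bounds u.
have /andP[l0 l1] := ell_le1 n2; rewrite mulrA normrM (gtr0_norm l0).
split; first by apply: ler_piMl; [exact: ltW|exact: le_trans hb b1].
by apply/andP; split; [apply: mulr_ge0 => //; exact: ltW|apply: ler_piMl => //; exact: ltW].
Qed.

Lemma rho_out n u : u <= 0 \/ 1 <= u -> rho n u = origin R.
Proof.
move=> h; rewrite /rho; have -> : bend u = 0.
  rewrite /bend max_l // /chi ge_min; apply/orP; right.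
  by case: h => h; [rewrite ler0_norm; lra|rewrite ger0_norm; lra].
by rewrite !mul0r.
Qed.

Lemma bend_cvg (S : Type) (F : set_system S) (FF : Filter F) (f : S -> R) (u : R) :
  f @ F --> u -> (fun s => bend (f s)) @ F --> bend u.
Proof.
move=> cf; have c2 : (fun s => 2 * f s - 1) @ F --> 2 * u - 1.
  by apply: cvgB; [apply: cvgM (cvg_cst _) cf|exact: cvg_cst].
apply: cvg_maxr; first exact: cvg_cst.
apply: cvg_minr; first exact: cvg_cst.
apply: cvgM; first exact: cvg_cst.
by apply: cvgB; [exact: cvg_cst|exact: cvg_norm].
Qed.

Lemma rho_cvg (S : Type) (F : set_system S) (FF : Filter F) (f : S -> R) n (u : R) :
  (2 <= n)%N -> f @ F --> u -> (fun s => rho n (f s)) @ F --> rho n u.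
Proof.
move=> n2 cf; have cb := bend_cvg FF cf; apply: cvg_archipelago.
- rewrite px_rho //; under eq_fun do rewrite px_rho //.
  apply: cvgM => //; apply: cvgM; last exact: cvg_cst.
  by apply: cvgB; [apply: cvgM (cvg_cst _) cf|exact: cvg_cst].
- rewrite py_rho //; under eq_fun do rewrite py_rho //.
  by apply: cvgM => //; apply: cvg_cst.
- by rewrite rho_height //; under eq_fun do rewrite rho_height //; exact: cvg_cst.
Qed.

(** The loops shrink to the origin and avoid the hills, so the convergence also holds in the third
    coordinate, uniformly along each loop. *)
Lemma rho_near (A : set X) : nbhs (origin R) A ->
  exists2 N, (2 <= N)%N & forall n u, (N <= n)%N -> A (rho n u).
Proof.
move=> oA; pose bad k (p : nat * R) := rho p.1 p.2.
pose F : set_system (nat * R) := fun B => exists N, forall n u, (N <= n)%N -> B (n, u).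
have FF : Filter F.
  split; first by exists 0%N.
    move=> B C [N NB] [M MC]; exists (maxn N M) => n u; rewrite geq_max => /andP[h1 h2].
    by split; [apply: NB|apply: MC].
  by move=> B C BC [N NB]; exists N => n u Nn; apply/BC/NB.
have small (e : R) : 0 < e -> exists2 N, (2 <= N)%N & forall n, (N <= n)%N -> ell R n < e.
  move=> e0; have [|N NP] := @inv_nat_small R (e / 2); first lra.
  exists (maxn 2 N); first by rewrite leq_maxl.
  by move=> n; rewrite geq_max => /andP[_ /NP]; rewrite /ell; lra.
have : (fun p : nat * R => rho p.1 p.2) @ F --> origin R.
  apply: cvg_archipelago.
  - rewrite px_origin; apply/cvgr0Pnorm_le => /= e /small[N N2 NP]; exists N => n u Nn /=.
    have [h _] := rho_bound u (leq_trans N2 Nn); apply: le_trans h _.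
    exact/ltW/NP.
  - rewrite py_origin; apply/cvgr0Pnorm_le => /= e /small[N N2 NP]; exists N => n u Nn /=.
    have [_ /andP[h0 h]] := rho_bound u (leq_trans N2 Nn); rewrite ger0_norm //.
    apply: le_trans h _; exact/ltW/NP.
  - rewrite pxy_origin height0; apply/cvgr0Pnorm_le => /= e e0; exists 2 => n u Nn /=.
    by rewrite rho_height // normr0 ltW.
move=> /(_ A oA) [N NP]; exists (maxn 2 N); first by rewrite leq_maxl.
by move=> n u; rewrite geq_max => /andP[_ Nn]; apply: (NP n u Nn).
Qed.

Lemma rho_good m n u : (8 <= m)%N -> (2 <= n)%N -> good m (rho n u).
Proof.
move=> m8 n2 k mk x0 yk; have k0 : (0 < k)%N := leq_trans (leq_trans _ m8) mk.
have := rho_height u n2; rewrite pxyE x0 yk.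
have hk : hill k (0, centre R k).
  by rewrite /hill /= /euclid_dist /= !subrr expr0n addr0 sqrtr0 ltW ?hill_radius_gt0 ?k0.
rewrite (height_hill (conj (k0 isT) hk)) bump_hill ?k0 //.
rewrite /euclid_dist /= !subrr expr0n addr0 sqrtr0 mul0r subr0 => /eqP.
by rewrite oner_eq0.
Qed.

Section Final.
Variable m : nat.
Hypothesis m8 : (8 <= m)%N.

Let m0 : (0 < m)%N. Proof. exact: leq_trans m8. Qed.

Lemma push0 q : push_out m q 0 = q.
Proof.
have h k : clamp (0 - k%:R) = 0 :> R by rewrite clamp_le0 // sub0r oppr_le0.
by apply: pxy_inj; rewrite pxy_push // /push_x /push_y !big1 ?addr0 -?surjective_pairing //
  => k _; rewrite h mul0r.
Qed.

Lemma pxy_push4 q : pxy (push_out m q 4) = (stage m q 4).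
Proof.
rewrite pxy_push // /push_x /push_y.
have h (k : 'I_4) : clamp (4 - k%:R) = 1 :> R.
  rewrite clamp_ge1 //; have : (k%:R : R) <= 3 by rewrite (ler_nat _ _ 3) -ltnS.
  lra.
under eq_bigr do rewrite h mul1r; under [X in (_, _ + X)]eq_bigr do rewrite h mul1r.
rewrite !big_ord_recl !big_ord0 /=; congr pair; ring.
Qed.

Lemma push4_in q n : good m q -> band m n (py q) -> `|xi m q| < 1 ->
  push_out m q 4 = rho n ((1 + xi m q) / 2).
Proof.
move=> gq bn hx; have [lE _] := band_lev m8 bn; have [mn _ _] := bn.
have n2 : (2 <= n)%N by apply: leq_trans mn; apply: leq_trans m8.
apply: pxy_inj; rewrite pxy_push4 pxyE px_rho // py_rho //= lE.
have -> : 2 * ((1 + xi m q) / 2) - 1 = xi m q by field.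
rewrite /bend; have -> : 2 * ((1 + xi m q) / 2) - 1 = xi m q by field.
by rewrite max_r //; have /andP[] := chi_bounds (xi_le1 m q).
Qed.

Lemma push4_out q : good m q -> (py q = 0 \/ `|xi m q| = 1) ->
  push_out m q 4 = origin R.
Proof.
move=> gq [y0|hx]; first by rewrite (py_eq0 y0) push_origin.
apply: pxy_inj; rewrite pxy_push4 pxy_origin /= /chi hx subrr mulr0 min_r //.
by rewrite !mul0r.
Qed.

Lemma xi_sign q : good m q -> 0 < py q -> (0 <= xi m q) = (0 <= px q).
Proof.
move=> gq y0; rewrite /xi pmulr_lge0 ?invr_gt0 ?den_gt0 //.
by rewrite /x1 pmulr_rge0 // scale_gt0.
Qed.

Lemma axis_band q : good m q -> 0 < py q -> px q = 0 -> exists n, band m n (py q).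
Proof.
move=> gq y0 x0; case: (band_or_centre m8 y0) => // -[n mn yn].
by have := gq n mn x0 yn.
Qed.

Lemma axis_xi q : px q = 0 -> xi m q = 0.
Proof. by move=> x0; rewrite /xi /x1 x0 mulr0 mul0r. Qed.

End Final.

Lemma band_ell m n : (8 <= m)%N -> (m <= n)%N -> band m n (ell R n).
Proof.
move=> m8 mn; have n0 : (0 < n)%N by apply: leq_trans mn; apply: leq_trans m8.
have /andP[_ h] := centre_bounds R n0; split=> //.
have [->|nm] := eqVneq n m; [by left|right].
have n1 : (0 < n.-1)%N by lia.
by have /andP[h1 _] := centre_bounds R n1; rewrite prednK // in h1.
Qed.

End Loops.

(** * Words read along simplices *)

Section SimplexGeometry.
Local Open Scope classical_set_scope.
Local Open Scope ring_scope.
Variables (R : realType).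
Notation Delta n := (set_type (std_simplex R n)).

Lemma simplex_ge0 n (t : Delta n) i : 0 <= \val t 0 i.
Proof. by have /set_mem [] := valP t. Qed.

Lemma simplex_sum n (t : Delta n) : \sum_i \val t 0 i = 1.
Proof. by have /set_mem [] := valP t. Qed.

Lemma simplex_le1 n (t : Delta n) i : \val t 0 i <= 1.
Proof.
rewrite -(simplex_sum t) (bigD1 i) //= lerDl sumr_ge0 // => j _.
exact: simplex_ge0.
Qed.

Lemma norm_le_entries n (u : 'rV[R]_n.+1) (e : R) : 0 <= e ->
  (forall i, `|u 0 i| <= e) -> `|u| <= e.
Proof.
move=> e0 h; rewrite /Num.norm /= mx_normrE; apply/bigmax_leP; split=> //.
by case=> i j _ /=; rewrite ord1.
Qed.

Lemma entry_le_norm n (u : 'rV[R]_n.+1) i : `|u 0 i| <= `|u|.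
Proof. by rewrite {2}/Num.norm /= mx_normrE; apply: (le_bigmax _ _ (0, i)). Qed.

Lemma compact_simplex n : compact (std_simplex R n).
Proof.
have cB : compact [set v : 'rV[R]_n.+1 | forall i, `[0, 1]%classic (v 0 i)].
  exact: (@rV_compact R n.+1 (fun=> `[0, 1]%classic)) (fun=> @segment_compact R 0 1).
apply: subclosed_compact cB _; last first.
  move=> v [v0 v1] i /=; rewrite in_itv /= v0 -v1 (bigD1 i) //= lerDl.
  by rewrite sumr_ge0.
have -> : std_simplex R n = (\bigcap_(i in [set: 'I_n.+1]) [set t : 'rV[R]_n.+1 | 0 <= t 0 i])
    `&` [set t | \sum_i t 0 i = 1].
  by apply/seteqP; split=> t /= [h1 h2]; split=> // i; [move=> _|]; apply: h1.
have cc i : continuous (fun t : 'rV[R]_n.+1 => t 0 i) by exact: coord_continuous.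
apply: closedI.
  apply: closed_bigI => i _.
  exact: (closed_comp (fun x _ => cc i x) (@closed_ge R 0)).
apply: (@closed_comp _ _ (fun t : 'rV[R]_n.+1 => \sum_i t 0 i) [set 1]); last exact: closed_eq.
move=> x _; apply: (@cvg_big _ _ _ _ _ _ _ (nbhs x)) => [|i _]; last exact: cc.
exact: add_continuous.
Qed.

Definition sdist n (t s : Delta n) : R := `|\val t - \val s|.

Lemma sdist_le1 n (t s : Delta n) : sdist t s <= 1.
Proof.
apply: norm_le_entries => // i; rewrite !mxE ler_norml.
have := simplex_ge0 t i; have := simplex_ge0 s i.
by have := simplex_le1 t i; have := simplex_le1 s i; lra.
Qed.

Lemma sdist_trans n (s t r : Delta n) : sdist t r <= sdist t s + sdist s r.
Proof. exact: ler_distD. Qed.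

Lemma sdist0 n (t : Delta n) : sdist t t = 0.
Proof. by rewrite /sdist subrr normr0. Qed.

Lemma nbhs_simplex n (t : Delta n) (A : set (Delta n)) :
  nbhs t A <-> exists2 e, 0 < e & forall s, sdist t s < e -> A s.
Proof.
split=> [[/= _ [[C oC <-] Ct CA]]|[e e0 eA]].
  have : nbhs (\val t) C by apply: open_nbhs_nbhs; split=> //; rewrite -set_valE.
  move=> /nbhs_normP[e /= e0 eC]; exists e => // s st; apply: CA => /=.
  by rewrite set_valE; apply: eC.
have /cvgrPdist_lt /(_ e e0) := @val_continuous _ (std_simplex R n) t.
by apply: filterS => s; apply: eA.
Qed.

Lemma lebesgue_number n (Z : topologicalType) (f : Delta n -> Z) (I : Type)
    (O : I -> set Z) : continuous f -> (forall i, open (O i)) ->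
  (forall t, exists i, O i (f t)) ->
  exists2 d, 0 < d & forall t, exists i, forall s, sdist t s < d -> O i (f s).
Proof.
move=> cf oO cover.
pose P (d : R) (x : 'rV[R]_n.+1) := exists i, forall s : Delta n, `|x - \val s| < d -> O i (f s).
have nc := (compact_near_coveringP _).1 (compact_simplex (n := n)).
have : \forall d \near 0^'+, std_simplex R n `<=` P d.
  apply: nc => x Kx.
  have [i Oi] := cover (exist _ x (mem_set Kx)).
  have /nbhs_simplex[e e0 eO] : nbhs (exist _ x (mem_set Kx) : Delta n) (f @^-1` O i).
    by apply: cf; apply: open_nbhs_nbhs; split.
  exists ([set y | `|x - y| < e / 2], [set d | d < e / 2]).
    split => /=; first by apply: (iffRL (nbhs_normP (x : 'rV[R]_n.+1) _)); exists (e / 2) => //=; lra.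
    by apply: nbhs_right_lt; lra.
  move=> [y d] [/= xy de]; exists i => s ys; apply: eO; rewrite /sdist /=.
  by apply: le_lt_trans (ler_distD y _ _) _; lra.
move=> h; have [d [d0 dP]] : exists d : R, 0 < d /\ std_simplex R n `<=` P d.
  apply: (@filter_ex R (0^'+) _); apply: filterI; last exact: h.
  exact: nbhs_right_gt.
exists d => // t; have [|i iP] := dP (\val t); first exact/set_mem/valP.
by exists i => s; apply: iP.
Qed.

Lemma seg_mem n (t s : Delta n) (r : R) :
  (1 - clamp r) *: \val t + clamp r *: \val s \in std_simplex R n.
Proof.
have /andP[r0 r1] : 0 <= clamp r <= 1.
  by rewrite /clamp le_max lexx /= ge_max ler01 ge_min lexx.
apply/mem_set; split=> [i|].
  by rewrite !mxE addr_ge0 // mulr_ge0 ?simplex_ge0 //; lra.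
under eq_bigr do rewrite !mxE.
by rewrite big_split -!mulr_sumr /= !simplex_sum !mulr1 subrK.
Qed.

Definition seg n (t s : Delta n) (r : R) : Delta n :=
  exist _ ((1 - clamp r) *: \val t + clamp r *: \val s) (seg_mem t s r).

Lemma seg0 n (t s : Delta n) : seg t s 0 = t.
Proof.
by apply: val_inj => /=; rewrite clamp_le0 // subr0 scale1r scale0r addr0.
Qed.

Lemma seg1 n (t s : Delta n) : seg t s 1 = s.
Proof.
by apply: val_inj => /=; rewrite clamp_ge1 // subrr scale0r scale1r add0r.
Qed.

Lemma clamp_lip (r r' : R) : `|clamp r - clamp r'| <= `|r - r'|.
Proof.
have key (u v : R) : u <= v -> `|clamp u - clamp v| <= `|u - v|.
  move=> uv; rewrite distrC [X in _ <= X]distrC (ger0_norm (_ : 0 <= v - u)); last lra.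
  have cP (w : R) : [\/ w <= 0 /\ clamp w = 0, [/\ 0 <= w, w <= 1 & clamp w = w]
      | 1 <= w /\ clamp w = 1].
    have [w0|w0] := leP w 0; first by constructor 1; rewrite clamp_le0.
    have [w1|w1] := leP w 1; last by constructor 3; rewrite clamp_ge1 // ltW.
    by constructor 2; rewrite clamp_id ?(ltW w0) ?w1.
  case: (cP u) => [[h1 ->]|[h0 h1 ->]|[h1 ->]]; case: (cP v) => [[h2 ->]|[h3 h2 ->]|[h2 ->]];
    rewrite ler_norml; apply/andP; split; lra.
by case: (leP r r') => [|/ltW] /key //; rewrite distrC [X in _ <= X]distrC.
Qed.

Lemma sdist_seg n (t s : Delta n) (r r' : R) :
  sdist (seg t s r) (seg t s r') <= `|r - r'|.
Proof.
rewrite /sdist /=.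
have -> : (1 - clamp r) *: \val t + clamp r *: \val s -
  ((1 - clamp r') *: \val t + clamp r' *: \val s) = (clamp r' - clamp r) *: (\val t - \val s).
  by apply/rowP => i; rewrite !mxE; ring.
rewrite normrZ; apply: le_trans (_ : `|clamp r' - clamp r| * 1 <= _).
  by rewrite ler_wpM2l //; apply: sdist_le1.
by rewrite mulr1 [X in _ <= X]distrC clamp_lip.
Qed.

Lemma sdist_seg2 n (t s s' : Delta n) (r : R) :
  sdist (seg t s r) (seg t s' r) <= sdist s s'.
Proof.
rewrite /sdist /=.
have -> : (1 - clamp r) *: \val t + clamp r *: \val s -
  ((1 - clamp r) *: \val t + clamp r *: \val s') = clamp r *: (\val s - \val s').
  by apply/rowP => i; rewrite !mxE; ring.
rewrite normrZ ler_piMl // ger0_norm.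
  by rewrite /clamp ge_max ler01 ge_min lexx.
by rewrite /clamp le_max lexx.
Qed.

Lemma sdist_segl n (t s : Delta n) (r : R) : sdist t (seg t s r) <= sdist t s.
Proof.
rewrite /sdist /=.
have -> : \val t - ((1 - clamp r) *: \val t + clamp r *: \val s) = clamp r *: (\val t - \val s).
  by apply/rowP => i; rewrite !mxE; ring.
rewrite normrZ ler_piMl // ger0_norm.
  by rewrite /clamp ge_max ler01 ge_min lexx.
by rewrite /clamp le_max lexx.
Qed.

Lemma vertex_mem n (j : 'I_n.+1) : (delta_mx 0 j : 'rV[R]_n.+1) \in std_simplex R n.
Proof.
apply/mem_set; split=> [i|]; first by rewrite mxE ler0n.
by rewrite (bigD1 j) //= big1 ?addr0 ?mxE ?eqxx // => i ij; rewrite mxE eqxx (negPf ij).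
Qed.

Definition vertex n (j : 'I_n.+1) : Delta n := exist _ (delta_mx 0 j) (vertex_mem j).

Lemma coface_vertex n (i : 'I_n.+2) (j : 'I_n.+1) :
  coface i (vertex j) = vertex (fintype.lift i j).
Proof.
apply: val_inj; apply/rowP => k /=; rewrite !mxE eqxx /=.
case: unliftP => [l ->|->]; last by rewrite (negPf (neq_lift _ _)).
by rewrite mxE eqxx /= (inj_eq (@lift_inj _ _)).
Qed.

Lemma sdist_coface n (i : 'I_n.+2) (t s : Delta n) : sdist (coface i t) (coface i s) <= sdist t s.
Proof.
apply: norm_le_entries => [|k]; first exact: normr_ge0.
rewrite /= !mxE; case: unliftP => [l _|_]; last by rewrite subrr normr0 normr_ge0.
by have := entry_le_norm (\val t - \val s) l; rewrite !mxE.
Qed.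

End SimplexGeometry.

(** * Primitives of local cocycles on a simplex *)

Section Lifting.
Local Open Scope classical_set_scope.
Local Open Scope ring_scope.
Variables (R : realType) (G : groupType).
Notation Delta n := (set_type (std_simplex R n)).

Definition local_cocycle n (g : Delta n -> Delta n -> G) (d : R) :=
  forall t s r, sdist t s < d -> sdist s r < d -> sdist t r < d ->
    (g t s * g s r = g t r)%g.

Definition is_lift n (g : Delta n -> Delta n -> G) (l : Delta n -> G) :=
  exists2 d, 0 < d & forall t s, sdist t s < d -> (l s = l t * g t s)%g.

Let steps n (g : Delta n -> Delta n -> G) (N : nat) (t : Delta n) (k : nat) : G :=
  iteri k (fun j x => x * g (seg (vertex R ord0) t (j%:R / N%:R))
                       (seg (vertex R ord0) t (j.+1%:R / N%:R)))%g 1%g.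

Lemma small_step (d : R) : 0 < d -> exists2 N, (0 < N)%N &
  forall j : nat, `|j%:R / N%:R - j.+1%:R / N%:R| < d :> R.
Proof.
move=> d0; have [N NP] := inv_nat_small d0; exists N.+1 => // j.
rewrite -mulrBl -addn1 natrD opprD addNKr mulN1r normrN.
have := NP N.+1 (leqnSn _); rewrite /inv_nat => h.
by rewrite ger0_norm // invr_ge0.
Qed.

(** The cocycle is multiplied along [N] small steps of the segment from vertex 0; for nearby end
    points the ladder of quadrilaterals between the two segments telescopes. The mesh [d / 2] keeps
    its diagonals below [d]. *)
Lemma lift_exists n (g : Delta n -> Delta n -> G) (d : R) : 0 < d -> local_cocycle g d ->
  exists l, l (vertex R ord0) = 1%g /\ is_lift g l.
Proof.
move=> d0 gc; have [|N N0 NP] := @small_step (d / 2); first lra.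
have gid t : g t t = 1%g.
  have := gc t t t; rewrite !sdist0 => /(_ d0 d0 d0) h.
  by apply: (mulgI (g t t)); rewrite h mulg1.
have tel t s k : sdist t s < d / 2 ->
    (steps g N t k * g (seg (vertex R ord0) t (k%:R / N%:R)) (seg (vertex R ord0) s (k%:R / N%:R))
     = steps g N s k)%g.
  move=> ts; elim: k => [|k IH]; first by rewrite mul0r !seg0 gid mulg1.
  rewrite /steps !iteriS -!/(steps _ _ _ _).
  set p := seg _ t (k%:R / _); set p' := seg _ t (k.+1%:R / _).
  set q := seg _ s (k%:R / _); set q' := seg _ s (k.+1%:R / _).
  have pp : sdist p p' < d / 2 by apply: le_lt_trans (sdist_seg _ _ _ _) (NP k).
  have qq : sdist q q' < d / 2 by apply: le_lt_trans (sdist_seg _ _ _ _) (NP k).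
  have pq : sdist p q < d / 2 by apply: le_lt_trans (sdist_seg2 _ _ _ _) ts.
  have pq' : sdist p' q' < d / 2 by apply: le_lt_trans (sdist_seg2 _ _ _ _) ts.
  have pq2 : sdist p q' < d by apply: le_lt_trans (sdist_trans q _ _) _; lra.
  rewrite -IH -/p -/q -!mulgA gc //; [|lra|lra].
  by rewrite gc //; lra.
have NN : N%:R / N%:R = 1 :> R by rewrite divff // pnatr_eq0 -lt0n.
exists (fun t => steps g N t N); split.
  have tel0 k : steps g N (vertex R ord0) k = 1%g.
    elim: k => // k IH; rewrite /steps iteriS -/(steps _ _ _ _) IH mul1g.
    have segid r : seg (vertex R ord0) (vertex R ord0) r = vertex R ord0 :> Delta n.
      by apply: val_inj => /=; rewrite -scalerDl subrK scale1r.
    by rewrite !segid.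
  exact: tel0.
exists (d / 2); first lra.
by move=> t s ts; rewrite -(tel t s N ts) NN !seg1.
Qed.

Lemma lift_along n (g : Delta n -> Delta n -> G) (l : Delta n -> G) (P : G -> Prop) t s :
  is_lift g l -> P 1%g -> (forall x y, P x -> P y -> P (x * y)%g) ->
  (forall r r', P (g (seg t s r) (seg t s r'))) -> P ((l t)^-1 * l s)%g.
Proof.
move=> [d d0 lP] P1 PM Pg; have [N N0 NP] := small_step d0.
have NN : N%:R / N%:R = 1 :> R by rewrite divff // pnatr_eq0 -lt0n.
have key k : P ((l t)^-1 * l (seg t s (k%:R / N%:R)))%g.
  elim: k => [|k IH]; first by rewrite mul0r seg0 mulVg.
  rewrite (lP (seg t s (k%:R / N%:R)) (seg t s (k.+1%:R / N%:R))) ?mulgA.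
    by apply: PM.
  exact: le_lt_trans (sdist_seg _ _ _ _) (NP k).
by have := key N; rewrite NN seg1.
Qed.

Lemma lift_unique n (g : Delta n -> Delta n -> G) (l l' : Delta n -> G) t :
  is_lift g l -> is_lift g l' -> l t = l' t -> l =1 l'.
Proof.
move=> [d d0 lP] [d' d'0 lP'] ll s.
have [|N N0 NP] := @small_step (Num.min d d'); first by rewrite lt_min d0.
have NN : N%:R / N%:R = 1 :> R by rewrite divff // pnatr_eq0 -lt0n.
suff key k : l (seg t s (k%:R / N%:R)) = l' (seg t s (k%:R / N%:R)).
  by have := key N; rewrite NN seg1.
elim: k => [|k IH]; first by rewrite mul0r seg0.
have := le_lt_trans (sdist_seg t s _ _) (NP k); rewrite lt_min => /andP[h h'].
by rewrite (lP _ _ h) (lP' _ _ h') IH.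
Qed.

End Lifting.

(** All sequences of reduced words, multiplied levelwise; membership in the inverse limit is the
    separate predicate [coherent]. *)
Definition profree : Type := nat -> free_group.

HB.instance Definition _ := Choice.on profree.

Section Profree.
Local Open Scope group_scope.
Implicit Types g h : profree.

Definition pf_mul g h : profree := fun M => g M * h M.
Definition pf_one : profree := fun=> 1.
Definition pf_inv g : profree := fun M => (g M)^-1.

Lemma pf_mulA : associative pf_mul.
Proof. by move=> f g h; apply/funext => M; apply: mulgA. Qed.
Lemma pf_mul1 : left_id pf_one pf_mul.
Proof. by move=> g; apply/funext => M; apply: mul1g. Qed.
Lemma pf_mulg1 : right_id pf_one pf_mul.
Proof. by move=> g; apply/funext => M; apply: mulg1. Qed.
Lemma pf_mulV : left_inverse pf_one pf_inv pf_mul.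
Proof. by move=> g; apply/funext => M; apply: mulVg. Qed.
Lemma pf_mulgV : right_inverse pf_one pf_inv pf_mul.
Proof. by move=> g; apply/funext => M; apply: mulgV. Qed.

HB.instance Definition _ := isGroup.Build profree
  pf_mulA pf_mul1 pf_mulg1 pf_mulV pf_mulgV.

Lemma profreeM g h M : (g * h) M = g M * h M. Proof. by []. Qed.
Lemma profreeV g M : g^-1 M = (g M)^-1. Proof. by []. Qed.
Lemma profree1 M : (1 : profree) M = 1. Proof. by []. Qed.

Definition coherent g := forall M, pr M (g M.+1) = g M.

(** For a coherent sequence the number of letters of each index then stabilises, so an infinite word
    has a definite finite number of them. *)
Definition bounded_labels g :=
  forall i, exists B, forall M, (count_label i (g M) <= B)%N.

End Profree.

(** * Letters read at crossings of the axis *)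

Section Crossings.
Local Open Scope classical_set_scope.
Local Open Scope ring_scope.
Variable R : realType.
Notation X := (harmonic_archipelago R).
Notation Delta n := (set_type (std_simplex R n)).
Variable m : nat.
Hypothesis m8 : (8 <= m)%N.
Implicit Types p q : X.

Definition right_side q : bool := 0 <= px q.

Definition cross (n : nat) (b b' : bool) : free_group :=
  if b == b' then 1%g else fletter (n, b').

Lemma word_inj : injective word. Proof. exact: val_inj. Qed.

Lemma crossM n b b' b'' : (cross n b b' * cross n b' b'' = cross n b b'')%g.
Proof.
by case: b b' b'' => [] [] []; rewrite /cross /= ?mulg1 ?mul1g //;
  apply: word_inj; rewrite word_mul /= !eqxx.
Qed.

(* The letter read between two nearby points, truncated at level M. *)
Definition trans (M : nat) p q : free_group :=
  let n := lab m (py p) in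
  if (lab m (py q) == n) && (0 < n < M)%N then cross n (right_side p) (right_side q)
  else 1%g.

Lemma trans_band M n p q : band m n (py p) -> band m n (py q) ->
  trans M p q = if (n < M)%N then cross n (right_side p) (right_side q) else 1%g.
Proof.
move=> bp bq; rewrite /trans (lab_band m8 bp) (lab_band m8 bq) eqxx /=.
by have [mn _ _] := bp; have -> : (0 < n)%N by apply: leq_trans mn; apply: leq_trans m8.
Qed.

Lemma pr_trans M p q : pr M (trans M.+1 p q) = trans M p q.
Proof.
have pr1 K : pr K 1%g = 1%g by apply: (mulgI (pr K 1%g)); rewrite -prM !mulg1.
rewrite /trans /cross; move: (lab m (py p)) (lab m (py q)) => n n'.
case: (n' == n); rewrite ?pr1 //=; case: (0 < n)%N; rewrite ?pr1 //=.
case: (right_side p == right_side q); rewrite ?pr1 //= ?if_same //.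
rewrite ltnS leq_eqVlt; case: ltnP => nM; rewrite ?orbT ?pr_letter /= ?nM //.
by case: eqP => _; rewrite ?pr1 // pr_letter /= ltnNge nM.
Qed.

Lemma trans_side M p q : right_side p = right_side q -> trans M p q = 1%g.
Proof. by move=> e; rewrite /trans /cross e eqxx; case: ifP. Qed.

Definition deep (I : nat) q : Prop := (m < I)%N -> py q < centre R I.-1.

Lemma deep_band I n q : deep I q -> band m n (py q) -> (I <= n)%N.
Proof.
move=> dI [mn cn _]; rewrite leqNgt; apply/negP => nI.
have mI : (m < I)%N by apply: leq_ltn_trans nI.
have n0 : (0 < n)%N by apply: leq_trans mn; apply: leq_trans m8.
have := dI mI; have : centre R I.-1 <= centre R n; last by lra.
by have [->//|ne] := eqVneq I.-1 n; apply/ltW/centre_lt => //; lia.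
Qed.

Lemma trans_deep M I p q : deep I p -> labels_in (leq I) (trans M p q).
Proof.
move=> dp; rewrite /trans; case: ifP => // /andP[_ /andP[n0 _]].
rewrite /cross; case: ifP => // _; rewrite /labels_in /= andbT.
have [b|e] := labP m (py p); first exact: deep_band dp b.
by rewrite e in n0.
Qed.

Lemma trans_deep_low M I p q : deep I p -> (M <= I)%N -> trans M p q = 1%g.
Proof.
move=> dp MI; rewrite /trans; case: ifP => // /andP[_ /andP[n0 nM]].
have [b|e] := labP m (py p); last by rewrite e in n0.
by have := deep_band dp b; rewrite leqNgt (leq_trans nM MI).
Qed.

(** Open sets covering the good points, on each of which transitions multiply: on one side of the
    axis nothing is read, within a band only changes of side count, and in the deep zone, around the
    origin, letters have index at least [I] and are invisible up to level [I]. *)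
Inductive zone := Left | Right | Band of nat | Deep.

Definition in_zone (I : nat) (z : zone) : set X :=
  match z with
  | Left => [set q | px q < 0]
  | Right => [set q | 0 < px q]
  | Band n => [set q | band m n (py q)]
  | Deep => [set q | deep I q]
  end.

Lemma open_zone I z : open (in_zone I z).
Proof.
have cx := (continuousP (@px R)).1 (@px_continuous R).
have cy := (continuousP (@py R)).1 (@py_continuous R).
case: z => [||n|].
- by apply: (cx [set x : R | x < 0]); apply: open_lt.
- by apply: (cx [set x : R | 0 < x]); apply: open_gt.
- have [mn|nm] := leqP m n; last first.
    rewrite (_ : in_zone _ _ = set0); first exact: open0.
    by apply/seteqP; split=> q // [mn]; move: nm; rewrite ltnNge mn.
  have [e|ne] := eqVneq n m.
    rewrite (_ : in_zone _ _ = [set q | centre R n < py q]); first by apply: (cy [set y : R | centre R n < y]); apply: open_gt.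
    by apply/seteqP; split=> q /= => [[] //|h]; split => //; left.
  rewrite (_ : in_zone _ _ = [set q | centre R n < py q] `&` [set q | py q < centre R n.-1]).
    apply: openI; first by apply: (cy [set y : R | centre R n < y]); apply: open_gt.
    by apply: (cy [set y : R | y < centre R n.-1]); apply: open_lt.
  apply/seteqP; split=> q /=; last by case=> h1 h2; split=> //; right.
  by case=> _ h1 [/eqP|//]; rewrite (negPf ne).
- have [mI|Im] := ltnP m I.
    rewrite (_ : in_zone _ _ = [set q | py q < centre R I.-1]); first by apply: (cy [set y : R | y < centre R I.-1]); apply: open_lt.
    by apply/seteqP; split=> q /=; [apply|move=> h _].
  rewrite (_ : in_zone _ _ = setT); first exact: openT.
  by apply/seteqP; split=> q //= _; rewrite /deep ltnNge Im.
Qed.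

Lemma zone_cover I q : good m q -> exists z, in_zone I z q.
Proof.
move=> gq; have [x0|x0|x0] := ltgtP (px q) 0; [by exists Left|by exists Right|].
have [y0|ny0] := eqVneq (py q) 0.
  exists Deep => /= mI; rewrite y0.
  have I0 : (0 < I.-1)%N by move: mI (m8); clear; lia.
  have /andP[h _] := centre_bounds R I0.
  by apply: lt_trans h; apply: ell_gt0.
have y0 : 0 < py q by rewrite lt_def ny0 py_ge0.
by have [n bn] := axis_band m8 gq y0 x0; exists (Band n).
Qed.

Variables (k : nat) (sigma : Delta k -> X).
Hypothesis csigma : continuous sigma.
Hypothesis gsigma : forall t, good m (sigma t).

Lemma zone_mesh I : exists2 d, 0 < d &
  forall t, exists z, forall s, sdist t s < d -> in_zone I z (sigma s).
Proof.
apply: lebesgue_number => //; first exact: open_zone.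
by move=> t; apply: zone_cover.
Qed.

Lemma trans_cocycle M : exists2 d, 0 < d &
  local_cocycle (fun t s => trans M (sigma t) (sigma s)) d.
Proof.
have [d d0 dz] := zone_mesh M; exists d => // t s r ts sr tr.
have [z zP] := dz t; have := zP t; rewrite sdist0 => /(_ d0).
move: (zP s ts) (zP r tr); case: z {zP} => [||n|] /= hs hr ht.
- by rewrite !trans_side ?mulg1 // /right_side; rewrite !leNgt ?hs ?hr ?ht.
- by rewrite !trans_side ?mulg1 // /right_side; rewrite !ltW.
- by rewrite !(trans_band _ (n := n)) //; case: ifP => _; rewrite ?crossM ?mulg1.
- by rewrite !(trans_deep_low _ (I := M)) ?mulg1.
Qed.

Lemma lift_exists_all : exists l : Delta k -> profree, l (vertex R ord0) = 1%g /\
  forall M, is_lift (fun t s => trans M (sigma t) (sigma s)) (fun t => l t M).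
Proof.
have /choice[l lP] : forall M, exists l : Delta k -> free_group, l (vertex R ord0) = 1%g /\
    is_lift (fun t s => trans M (sigma t) (sigma s)) l.
  by move=> M; have [d d0 dc] := trans_cocycle M; apply: lift_exists dc.
exists (fun t M => l M t); split; first by apply/funext => M; have [] := lP M.
by move=> M; have [] := lP M.
Qed.

End Crossings.

Section Labels.
Local Open Scope classical_set_scope.
Local Open Scope ring_scope.
Variable R : realType.
Notation X := (harmonic_archipelago R).
Notation Delta n := (set_type (std_simplex R n)).
Variable m : nat.
Hypothesis m8 : (8 <= m)%N.

Definition is_label k (sigma : Delta k -> X) (l : Delta k -> profree) :=
  l (vertex R ord0) = 1%g /\
  forall M, is_lift (fun t s => trans m M (sigma t) (sigma s)) (fun t => l t M).

Definition label k (sigma : Delta k -> X) : Delta k -> profree :=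
  xget (fun=> 1%g) [set l | is_label sigma l].

Definition tame k (sigma : Delta k -> X) := continuous sigma /\ forall t, good m (sigma t).

Section OneSimplex.
Variables (k : nat) (sigma : Delta k -> X).
Hypothesis tsigma : tame sigma.

Lemma labelP : is_label sigma (label sigma).
Proof.
rewrite /label; case: xgetP => // h.
have [cs gs] := tsigma; have [l [l0 lP]] := lift_exists_all m8 cs gs.
by have := h l; case.
Qed.

Lemma label0 : label sigma (vertex R ord0) = 1%g.
Proof. by have [] := labelP. Qed.

Lemma label_lift M : is_lift (fun t s => trans m M (sigma t) (sigma s))
  (fun t => label sigma t M).
Proof. by have [] := labelP. Qed.

Lemma label_uniq (l : Delta k -> profree) :
  (forall M, is_lift (fun t s => trans m M (sigma t) (sigma s)) (fun t => l t M)) ->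
  forall t, l t = (l (vertex R ord0) * label sigma t)%g.
Proof.
move=> lP t; apply/funext => M; rewrite profreeM.
apply: (@lift_unique R _ k _ (fun t => l t M)
  (fun t => l (vertex R ord0) M * label sigma t M)%g (vertex R ord0)); first exact: lP.
  have [d d0 dP] := label_lift M; exists d => // u v uv; rewrite /= (dP u v) // mulgA //.
by rewrite /= label0 mulg1.
Qed.

Lemma label_coherent t : coherent (label sigma t).
Proof.
move=> M; apply: (@lift_unique R _ k (fun t s => trans m M (sigma t) (sigma s))
  (fun t => pr M (label sigma t M.+1)) (fun t => label sigma t M) (vertex R ord0)).
- have [d d0 dP] := label_lift M.+1; exists d => // u v uv; rewrite /= (dP u v) // prM.
  by rewrite pr_trans.
- exact: label_lift.
- by rewrite label0.
Qed.

Lemma label_along (P : free_group -> Prop) M t s :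
  P 1%g -> (forall x y, P x -> P y -> P (x * y)%g) ->
  (forall r r', P (trans m M (sigma (seg t s r)) (sigma (seg t s r')))) ->
  P ((label sigma t M)^-1 * label sigma s M)%g.
Proof. exact: (lift_along (label_lift M)). Qed.

(* Near a point, either the label is constant, or it only records the side of
   the axis within one band, or only letters of label at least I are added. *)
Lemma label_zone (I : nat) t d z : (forall s, sdist t s < d -> in_zone m I z (sigma s)) ->
  forall s, sdist t s < d ->
  match z with
  | Left | Right => label sigma s = label sigma t
  | Band n => forall M, label sigma s M = (label sigma t M *
      if (n < M)%N then cross n (right_side (sigma t)) (right_side (sigma s)) else 1)%g
  | Deep => forall M, exists2 x, labels_in (leq I) x & label sigma s M = (label sigma t M * x)%g
  end.
Proof.
move=> zP s ts; have d0 : 0 < d by apply: le_lt_trans ts; apply: normr_ge0.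
have zseg r : in_zone m I z (sigma (seg t s r)).
  by apply: zP; apply: le_lt_trans (sdist_segl _ _ _) ts.
have key M x : ((label sigma t M)^-1 * label sigma s M = x)%g ->
    label sigma s M = (label sigma t M * x)%g by move=> <-; rewrite mulVKg.
case: z zP zseg => [||n|] zP zseg.
- apply/funext => M; rewrite (key M 1%g) ?mulg1 //.
  apply: (label_along (P := fun x => x = 1%g)) => [//|x y -> ->|r r']; first by rewrite mulg1.
  apply: trans_side; rewrite /right_side !leNgt.
  by have := zseg r; have := zseg r' => /= -> ->.
- apply/funext => M; rewrite (key M 1%g) ?mulg1 //.
  apply: (label_along (P := fun x => x = 1%g)) => [//|x y -> ->|r r']; first by rewrite mulg1.
  by apply: trans_side; rewrite /right_side !ltW //; apply: zseg.
- move=> M; have [d' d'0 dP] := label_lift M.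
  have [N N0 NP] := @small_step R d' d'0.
  have NN : N%:R / N%:R = 1 :> R by rewrite divff // pnatr_eq0 -lt0n.
  have bt : band m n (py (sigma t)) by have := zseg 0; rewrite seg0.
  have bs : band m n (py (sigma s)) by have := zseg 1; rewrite seg1.
  rewrite -(trans_band m8 M bt bs).
  suff E j : label sigma (seg t s (j%:R / N%:R)) M =
      (label sigma t M * trans m M (sigma t) (sigma (seg t s (j%:R / N%:R))))%g.
    by have := E N; rewrite NN seg1.
  elim: j => [|j IH]; first by rewrite mul0r seg0 trans_side // mulg1.
  rewrite (dP _ _ (le_lt_trans (sdist_seg t s _ _) (NP j))) IH -mulgA.
  by rewrite !(trans_band m8 M (n := n)) //; do ?[exact: zseg]; case: ifP => _; rewrite ?crossM ?mulg1.
- move=> M; exists ((label sigma t M)^-1 * label sigma s M)%g; last by rewrite mulVKg.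
  apply: (label_along (P := fun x => labels_in (leq I) x)) => // [x y|r r'].
    exact: labels_inM.
  exact: trans_deep (zseg _).
Qed.

(** A step of a fine subdivision stays in one zone and, with [I = i.+1], adds at most one letter of
    index [i]. The number of steps depends neither on the level nor on the point. *)
Lemma label_bounded i : exists B, forall M t, (count_label i (label sigma t M) <= B)%N.
Proof.
have [cs gs] := tsigma; have [d d0 dz] := zone_mesh m8 cs gs i.+1.
have [N N0 NP] := @small_step R d d0.
have NN : N%:R / N%:R = 1 :> R by rewrite divff // pnatr_eq0 -lt0n.
exists N => M t; rewrite -[t](seg1 (vertex R ord0)) -NN.
elim: {-2}N => [|j IH]; first by rewrite mul0r seg0 label0.
set s := seg _ _ (j%:R / _) in IH *; set s' := seg _ _ _.
have ss : sdist s s' < d by apply: le_lt_trans (sdist_seg _ _ _ _) (NP j).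
have [z zP] := dz s; have := label_zone zP ss; case: z {zP} => [||n|].
- by move=> ->; apply: leqW.
- by move=> ->; apply: leqW.
- move=> /(_ M) ->; apply: leq_trans (count_labelM _ _ _) _; rewrite -(addn1 j) leq_add //.
  by case: ifP => // _; rewrite /cross; case: ifP => // _; rewrite /count_label /=; case: eqP.
- move=> /(_ M)[x lx ->]; apply: leq_trans (count_labelM _ _ _) _.
  rewrite -(addn1 j) leq_add // (_ : count_label i x = 0%N) //.
  apply/eqP; rewrite -leqn0 leqNgt -has_count; apply/hasPn => a /(allP lx) /= ia.
  by apply/eqP => e; rewrite e ltnn in ia.
Qed.

End OneSimplex.

Lemma label_comp j k (sigma : Delta k -> X) (phi : Delta j -> Delta k) (C : R) :
  tame sigma -> tame (sigma \o phi) -> 0 < C ->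
  (forall t s, sdist (phi t) (phi s) <= C * sdist t s) ->
  forall t, label (sigma \o phi) t
    = ((label sigma (phi (vertex R ord0)))^-1 * label sigma (phi t))%g.
Proof.
move=> ts tsp C0 phiC t.
suff -> : label sigma (phi t) =
    (label sigma (phi (vertex R ord0)) * label (sigma \o phi) t)%g by rewrite mulKg.
apply: (label_uniq tsp (l := label sigma \o phi)) => M.
have [d d0 dP] := label_lift ts M.
exists (d / C); first exact: divr_gt0.
move=> u v uv; apply: dP; apply: le_lt_trans (phiC _ _) _.
by rewrite mulrC -ltr_pdivlMr.
Qed.

Lemma label_const k (sigma : Delta k -> X) : tame sigma ->
  (forall M t s, trans m M (sigma t) (sigma s) = 1%g) -> forall t, label sigma t = 1%g.
Proof.
move=> ts h t; apply/funext => M.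
have : ((label sigma (vertex R ord0) M)^-1 * label sigma t M)%g = 1%g.
  by apply: (label_along ts (P := fun x => x = 1%g)) => // x y -> ->; rewrite mulg1.
by rewrite label0 // profree1 invg1 mul1g.
Qed.

End Labels.

(** * Loops reading infinite words *)

Section LetterPositions.
Implicit Types (w v u : seq letter) (i k : nat).

Local Notation red := (foldr push [::]).
Local Notation cnt i := (count (fun a : letter => a.1 == i)).

(* The initial segment (a suffix, since words are stored backwards) ending with
   the k-th letter of label i. *)
Fixpoint upto i k w : seq letter :=
  if w is a :: w' then
    (if (a.1 == i) && (cnt i w' == k) then w else upto i k w')
  else [::].

Definition before i k w := behead (upto i k w).
Definition sign_at i k w := (head (0%N, true) (upto i k w)).2.

Lemma uptoP i k w : (k < cnt i w)%N ->
  upto i k w = (i, sign_at i k w) :: before i k w /\ cnt i (before i k w) = k.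
Proof.
rewrite /before /sign_at; elim: w => //= a w IH.
have [ai|ai] /= := eqVneq a.1 i; last by rewrite add0n.
rewrite add1n ltnS leq_eqVlt; have [e _|ne] := eqVneq (cnt i w) k.
  by rewrite e /=; case: a ai => ? ? /= ->.
exact: IH.
Qed.

Lemma upto_cat i k w : exists u, w = u ++ upto i k w.
Proof.
elim: w => [|a w [u uP]] /=; first by exists [::].
by case: ifP => _; [exists [::]|exists (a :: u); rewrite {1}uP].
Qed.

Lemma upto_total i k i' k' w : (k < cnt i w)%N -> (k' < cnt i' w)%N ->
  [\/ i = i' /\ k = k', exists u, before i k w = u ++ upto i' k' w
    | exists u, before i' k' w = u ++ upto i k w].
Proof.
rewrite /before; elim: w => //= a w IH.
have E j l : (l < (a.1 == j) + cnt j w)%N ->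
    (a.1 == j) && (cnt j w == l) \/
    ((a.1 == j) && (cnt j w == l) = false /\ (l < cnt j w)%N).
  case: (a.1 == j) => /=; last by rewrite add0n; right.
  by rewrite add1n ltnS leq_eqVlt eq_sym; case: eqP => /= _; [left|right].
move=> /E[/andP[/eqP ai /eqP ck]|[-> kc]] /E[/andP[/eqP ai' /eqP ck']|[-> kc']].
- by constructor 1; split; rewrite -?ai -?ai' // -ck -ck' -ai -ai'.
- rewrite ai ck !eqxx /=; constructor 2; exact: upto_cat.
- rewrite ai' ck' !eqxx /=; constructor 3; exact: upto_cat.
- exact: IH.
Qed.

Lemma upto_filter i k (P : pred nat) w : P i -> (k < cnt i w)%N ->
  upto i k [seq a <- w | P a.1]
    = (i, sign_at i k w) :: [seq a <- before i k w | P a.1].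
Proof.
move=> Pi; have cf v : cnt i [seq a <- v | P a.1] = cnt i v.
  rewrite count_filter; apply: eq_count => a /=.
  by case: eqP => // ->; rewrite Pi.
rewrite /sign_at /before; elim: w => //= a w IH.
have [ai|ai] /= := eqVneq a.1 i.
  rewrite ai Pi /= ai eqxx cf /= add1n ltnS leq_eqVlt.
  have [e _|ne] := eqVneq (cnt i w) k; first by case: a ai => ? ? /= ->.
  exact: IH.
by rewrite add0n; case: (P a.1) => //=; rewrite (negPf ai).
Qed.

(* Reducing a word without cancelling letters of label i reduces the initial
   segments ending with such letters separately. *)
Lemma upto_red i k w : cnt i (red w) = cnt i w -> (k < cnt i w)%N ->
  upto i k (red w) = (i, sign_at i k w) :: red (before i k w).
Proof.
rewrite /sign_at /before; elim: w => //= a w IH.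
have le : (cnt i (red w) <= cnt i w)%N by apply: leq_count_subseq; apply: foldr_push_subseq.
have pushE : push a (red w) = a :: red w \/ exists2 v, red w = flip a :: v & push a (red w) = v.
  case: (red w) => [|b v] /=; first by left.
  by case: eqP => [->|]; [right; exists v|left].
case: pushE => [->|[v vE ->]] /=.
  move=> /addnI e kc; rewrite e; move: kc; have [ai|ai] /= := eqVneq a.1 i.
    rewrite add1n ltnS leq_eqVlt; have [e' _|ne] := eqVneq (cnt i w) k.
      by case: a ai {IH} => ? ? /= ->.
    by move=> /= kc; apply: IH.
  by rewrite add0n => kc; apply: IH.
move: le IH; rewrite vE /=; have [ai|ai] /= := eqVneq a.1 i => le IH e kc.
  by exfalso; move: le e; rewrite !add1n => h1 h2; rewrite h2 ltnNge leqnSn in h1.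
by apply: IH.
Qed.

Lemma upto_core i k I w : (i < I)%N -> upto i k (core I w) = upto i k w.
Proof.
move=> iI; elim: w => //= a w IH; case: ltnP => //= Ia; rewrite IH.
by case: eqP => // ai; move: Ia; rewrite ai leqNgt iI.
Qed.

Lemma cnt_core i I w : (i < I)%N -> cnt i (core I w) = cnt i w.
Proof.
move=> iI; elim: w => //= a w IH; case: ltnP => //= Ia; rewrite IH.
by case: eqP => // ai; move: Ia; rewrite ai leqNgt iI.
Qed.

End LetterPositions.

Section WordLength.
Local Open Scope ring_scope.
Variable R : realType.
Implicit Types (w v : seq letter) (i k M : nat).
Local Notation cnt i := (count (fun a : letter => a.1 == i)).
Local Notation h := (2^-1 : R).

(** For fixed [i] the widths sum to [2^-(i+1)], and over all [i] to 1, so disjoint windows for all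
    letters fit into [[0, 1]]. *)
Definition width i k : R := h ^+ (i + 2 + k)%N.

(* The total width of the letters of w: its k-th letter of label i has width
   2^-(i+2+k). *)
Definition extent M w : R := \sum_(j < M) h ^+ j.+1 * (1 - h ^+ cnt j w).

Lemma half_bounds n : 0 < h ^+ n <= 1.
Proof. by rewrite exprn_gt0 ?invr_gt0 //= exprn_ile1 ?invr_ge0 // invf_le1 // ler1n. Qed.

Lemma width_gt0 i k : 0 < width i k.
Proof. by have /andP[] := half_bounds (i + 2 + k)%N. Qed.

Lemma extent_ge0 M w : 0 <= extent M w.
Proof.
apply: sumr_ge0 => j _; have /andP[h1 _] := half_bounds j.+1.
by have /andP[_ h2] := half_bounds (cnt j w); rewrite mulr_ge0 ?subr_ge0 // ltW.
Qed.

Lemma extent_le1 M w : extent M w <= 1.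
Proof.
apply: (@le_trans _ _ (1 - h ^+ M)); last first.
  by have /andP[h1 _] := half_bounds M; rewrite gerBl ltW.
apply: (@le_trans _ _ (\sum_(j < M) h ^+ j.+1)).
  apply: ler_sum => j _; have /andP[h1 _] := half_bounds j.+1.
  by have /andP[h2 _] := half_bounds (cnt j w); rewrite ler_piMr ?gerBl // ltW.
elim: M => [|M IH]; first by rewrite big_ord0 expr0 subrr.
rewrite big_ord_recr /=; apply: (le_trans (lerD IH (lexx _))).
by rewrite exprS; move: (h ^+ M) => z; lra.
Qed.

Lemma extent_mono M v w : (forall j, (cnt j v <= cnt j w)%N) -> extent M v <= extent M w.
Proof.
move=> vw; apply: ler_sum => j _; have /andP[h1 _] := half_bounds j.+1.
rewrite ler_pM2l // lerD2l lerN2 ler_wiXn2l ?invr_ge0 //.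
by rewrite invf_le1 // ler1n.
Qed.

Lemma extentS M w : extent M w <= extent M.+1 w.
Proof.
rewrite /extent big_ord_recr /= lerDl; have /andP[h1 _] := half_bounds M.+1.
by have /andP[_ h2] := half_bounds (cnt M w); rewrite mulr_ge0 ?subr_ge0 // ltW.
Qed.

Lemma extent_cons M a w : (a.1 < M)%N ->
  extent M (a :: w) = extent M w + width a.1 (cnt a.1 w).
Proof.
move=> aM; suff <- : extent M (a :: w) - extent M w = width a.1 (cnt a.1 w) by lra.
rewrite /extent -sumrB (bigD1 (Ordinal aM)) //= eqxx big1 => [|j ja]; last first.
  have -> : (a.1 == j :> nat) = false.
    by apply/negbTE; apply: contra ja => /eqP e; apply/eqP/val_inj.
  by rewrite add0n subrr.
rewrite addr0 add1n /width !exprD !exprS !expr0.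
by move: (h ^+ _) (h ^+ _) => y z; field.
Qed.

End WordLength.

(** * Time windows of the letters of an infinite word *)

Section Windows.
Local Open Scope classical_set_scope.
Local Open Scope ring_scope.
Variable R : realType.
Implicit Types (g : profree) (i k M : nat) (s : R).
Local Notation cnt i := (count (fun a : letter => a.1 == i)).

Definition nice g := [/\ coherent g, bounded_labels g &
  forall M, labels_in (leq 2) (g M)].

Definition has_letter g i k := exists M, (k < count_label i (g M))%N.

Lemma nat_stable (u : nat -> nat) B : (forall n, (u n <= u n.+1)%N) ->
  (forall n, (u n <= B)%N) -> exists N, forall n, (N <= n)%N -> u n = u N.
Proof.
move=> um ub; pose P v := `[< exists n, u n = v >].
have exP : exists v, P v by exists (u 0%N); apply/asboolP; exists 0%N.
have Pb v : P v -> (v <= B)%N by move=> /asboolP[n <-].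
case: (ex_maxnP exP Pb) => v /asboolP[N <-] max; exists N => n Nn.
apply/eqP; rewrite eqn_leq max ?(homo_leq leqnn leq_trans um) //.
by apply/asboolP; exists n.
Qed.

Lemma count_mono g i M : coherent g -> (count_label i (g M) <= count_label i (g M.+1))%N.
Proof. by move=> cg; rewrite -(cg M) count_label_pr. Qed.

Lemma count_stable g i : nice g ->
  exists N, forall M, (N <= M)%N -> count_label i (g M) = count_label i (g N).
Proof. by move=> [cg /(_ i)[B gB] _]; apply: nat_stable gB => M; apply: count_mono. Qed.

Lemma label_ltM g M a : coherent g -> a \in word (g M) -> (a.1 < M)%N.
Proof. by move=> cg; rewrite -(cg M); apply: (allP (labels_in_pr M (g M.+1))). Qed.

Lemma cnt_lt g i k M : coherent g -> (k < count_label i (g M))%N -> (i < M)%N.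
Proof.
move=> cg kM; have : has (fun a : letter => a.1 == i) (word (g M)).
  by rewrite has_count; apply: leq_ltn_trans kM.
by case/hasP => a aM /eqP <-; apply: label_ltM aM.
Qed.

(** Once the number of letters of index [i] is stable, lowering the level cancels none of them, so
    the segment before such a letter is filtered and reduced on its own. *)
Lemma letter_stable g i k : nice g -> has_letter g i k ->
  exists N, forall M, (N <= M)%N -> (k < count_label i (g M))%N /\
   upto i k (word (g M)) = (i, sign_at i k (word (g M.+1))) ::
     foldr push [::] [seq a <- before i k (word (g M.+1)) | (a.1 < M)%N].
Proof.
move=> ng [M1 kM1]; have [cg _ _] := ng; have [N NP] := count_stable i ng.
have kM M : (maxn M1 N <= M)%N -> (k < count_label i (g M))%N.
  rewrite geq_max => /andP[M1M NM]; apply: leq_trans kM1 _.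
  by apply: (homo_leq (f := fun M => count_label i (g M)) leqnn leq_trans _ M1M) => K;
    apply: count_mono.
exists (maxn M1 N) => M MP; split; first exact: kM.
have iM := cnt_lt cg (kM _ MP).
have kM' : (k < count_label i (g M.+1))%N by apply: kM; apply: leqW.
have cf : cnt i [seq a <- word (g M.+1) | (a.1 < M)%N] = count_label i (g M.+1).
  rewrite count_filter; apply: eq_count => a /=; by case: eqP => // ->; rewrite iM.
have eg : word (g M) = foldr push [::] [seq a <- word (g M.+1) | (a.1 < M)%N].
  by rewrite -word_pr cg.
have uf := upto_filter (P := fun j => (j < M)%N) iM kM'.
rewrite eg upto_red; last by rewrite cf.
  by rewrite /sign_at /before uf.
rewrite cf -eg; move: MP; rewrite geq_max => /andP[_ NM].
by rewrite -[LHS]/(count_label i (g M)) !NP //; apply: leqW.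
Qed.

(** The extents are eventually nondecreasing and at most 1 ([window_stable]), so the limit exists as
    soon as the letter does. *)
Definition start g i k : R := limn (fun M => extent R M (before i k (word (g M)))).
Definition sign_of g i k := `[< \forall M \near \oo, sign_at i k (word (g M)) >].

Lemma window_stable g i k : nice g -> has_letter g i k ->
  exists N, forall M, (N <= M)%N ->
   [/\ (k < count_label i (g M))%N,
      upto i k (word (g M)) = (i, sign_of g i k) :: before i k (word (g M)) &
      extent R M (before i k (word (g M)))
        <= extent R M.+1 (before i k (word (g M.+1)))].
Proof.
move=> ng hl; have [N NP] := letter_stable ng hl.
have sg M : (N <= M)%N -> sign_at i k (word (g M)) = sign_at i k (word (g N)).
  move=> /subnK <-; elim: (M - N)%N => // d IH; rewrite addSn -IH.
  by have [_ e] := NP _ (leq_addl d N); rewrite [in RHS]/sign_at e.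
have sE : sign_of g i k = sign_at i k (word (g N)).
  rewrite /sign_of; case E : (sign_at _ _ (word (g N))).
    by apply/asboolP; exists N => // M /= /sg ->.
  apply/negP => /asboolP[N' _ N'P]; have := N'P (maxn N N') (leq_maxr _ _).
  by rewrite sg ?leq_maxl ?E.
exists N => M NM; have [kM e] := NP M NM; have [e2 _] := uptoP kM; split => //.
  by rewrite {1}e2 sg // sE.
have -> : before i k (word (g M)) =
    foldr push [::] [seq a <- before i k (word (g M.+1)) | (a.1 < M)%N].
  by rewrite /before e.
apply: le_trans (extentS _ _ _); apply: extent_mono => j.
apply: (leq_trans (leq_count_subseq _ (foldr_push_subseq _))).
exact: leq_count_subseq (filter_subseq _ _).
Qed.

Lemma start_cvg g i k : nice g -> has_letter g i k ->
  extent R M (before i k (word (g M))) @[M --> \oo] --> start g i k.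
Proof.
move=> ng hl; have [N NP] := window_stable ng hl.
suff /cvg_ex[l] : cvgn (fun M => extent R (M + N) (before i k (word (g (M + N)%N)))).
  by rewrite (cvg_shiftn N (fun M => extent R M (before i k (word (g M))))) => /cvgP.
apply: nondecreasing_is_cvgn.
    apply/nondecreasing_seqP => M; rewrite addSn.
    by have [_ _] := NP _ (leq_addl M N).
by exists 1 => _ [M _ <-]; apply: extent_le1.
Qed.

Lemma start_bounds g i k : nice g -> has_letter g i k ->
  0 <= start g i k /\ start g i k + width R i k <= 1.
Proof.
move=> ng hl; have sc := start_cvg ng hl; have [N NP] := window_stable ng hl.
have [cg _ _] := ng; split.
  by apply: limr_ge; [apply: cvgP sc|near=> M; apply: extent_ge0].
rewrite -lerBrDr; apply: limr_le; first exact: cvgP sc.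
near=> M; have NM : (N <= M)%N by near: M; exists N.
have [kM e _] := NP M NM; rewrite lerBrDr.
rewrite -[X in width R i X](uptoP kM).2 -(@extent_cons R M (i, sign_of g i k)) /=.
  exact: extent_le1.
exact: cnt_lt kM.
Unshelve. all: by end_near. Qed.

(** If two windows overlapped, the strict inequalities would hold between extents at some large
    level; but there one of the letters precedes the other. *)
Lemma start_ordered g i k i' k' : nice g -> has_letter g i k -> has_letter g i' k' ->
  [\/ i = i' /\ k = k', start g i' k' + width R i' k' <= start g i k
    | start g i k + width R i k <= start g i' k'].
Proof.
move=> ng hl hl'; have [N NP] := window_stable ng hl; have [N' NP'] := window_stable ng hl'.
have [cg _ _] := ng.
have [c1|c1] := leP (start g i' k' + width R i' k') (start g i k); first by constructor 2.
have [c2|c2] := leP (start g i k + width R i k) (start g i' k'); first by constructor 3.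
constructor 1; apply: contrapT => ne.
have sc := start_cvg ng hl; have sc' := start_cvg ng hl'.
have upto_extent j l M : has_letter g j l -> (l < count_label j (g M))%N ->
    extent R M (upto j l (word (g M))) = extent R M (before j l (word (g M))) + width R j l.
  move=> _ lM; have [-> eq] := uptoP lM.
  by rewrite extent_cons /= ?eq //; apply: cnt_lt lM.
have cat_extent M u v w : u = v ++ w -> extent R M w <= extent R M u.
  by move=> ->; apply: extent_mono => j; rewrite count_cat leq_addl.
have E1 : \forall M \near \oo, - width R i' k' <
    extent R M (before i' k' (word (g M))) - extent R M (before i k (word (g M))).
  apply: (cvgr_gt (start g i' k' - start g i k)); first exact: cvgB sc' sc.
  by move: c1; lra.
have E2 : \forall M \near \oo, - width R i k <
    extent R M (before i k (word (g M))) - extent R M (before i' k' (word (g M))).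
  apply: (cvgr_gt (start g i k - start g i' k')); first exact: cvgB sc sc'.
  by move: c2; lra.
have [n _ nP] := filterI E1 E2.
pose M := maxn n (maxn N N').
have [l1 l2] := nP M (leq_maxl _ _).
have [kM _ _] := NP M (leq_trans (leq_maxl N N') (leq_maxr _ _)).
have [kM' _ _] := NP' M (leq_trans (leq_maxr N N') (leq_maxr _ _)).
have e1 := upto_extent _ _ _ hl kM; have e2 := upto_extent _ _ _ hl' kM'.
case: (upto_total kM kM') => [//|[u /(cat_extent M)]|[u /(cat_extent M)]].
  by rewrite e2; move: l1; lra.
by rewrite e1; move: l2; lra.
Qed.

End Windows.

Section WordPaths.
Local Open Scope classical_set_scope.
Local Open Scope ring_scope.
Variable R : realType.
Notation X := (harmonic_archipelago R).
Implicit Types (g h : profree) (i k n M : nat) (s : R).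

Definition par g i k s : R :=
  let u := (s - start R g i k) / width R i k in if sign_of g i k then u else 1 - u.

Definition in_window g s (ik : nat * nat) : Prop :=
  has_letter g ik.1 ik.2 /\
  start R g ik.1 ik.2 < s < start R g ik.1 ik.2 + width R ik.1 ik.2.

(* Runs through the loops [rho i] as prescribed by the letters of g, each one
   during its own window. *)
Definition word_path g s : X :=
  match pselect (exists ik, in_window g s ik) with
  | left ex => let ik := projT1 (cid ex) in rho ik.1 (par g ik.1 ik.2 s)
  | right _ => origin R
  end.

Lemma word_pathE g s i k : nice g -> in_window g s (i, k) ->
  word_path g s = rho i (par g i k s).
Proof.
move=> ng [/= hl /andP[s1 s2]]; rewrite /word_path.
case: pselect => [ex|no]; last by case: no; exists (i, k); split=> //=; rewrite s1 s2.
case: (cid ex) => -[i' k'] /= [/= hl' /andP[s1' s2']].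
case: (start_ordered R ng hl hl') => [[<- <-] //|h|h].
  by have := lt_trans (le_lt_trans h s1) s2'; rewrite ltxx.
by have := lt_trans (le_lt_trans h s1') s2; rewrite ltxx.
Qed.

Lemma word_path_out g s : (forall ik, ~ in_window g s ik) -> word_path g s = origin R.
Proof. by move=> no; rewrite /word_path; case: pselect => // ex; exfalso; have [ik /no] := ex. Qed.

Lemma letter_ge2 g i k : nice g -> has_letter g i k -> (2 <= i)%N.
Proof.
move=> [_ _ l2] [M kM]; have : has (fun a : letter => a.1 == i) (word (g M)).
  by rewrite has_count; apply: leq_ltn_trans kM.
by case/hasP => a aM /eqP <-; apply: (allP (l2 M) a aM).
Qed.

Lemma word_path_rho g s : nice g ->
  word_path g s = origin R \/ exists n u, (2 <= n)%N /\ word_path g s = rho n u.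
Proof.
move=> ng; rewrite /word_path; case: pselect => [ex|_]; last by left.
case: (cid ex) => -[i k] /= [/= hl _]; right; exists i, (par g i k s); split=> //.
exact: letter_ge2 hl.
Qed.

Lemma word_path_le0 g s : nice g -> s <= 0 -> word_path g s = origin R.
Proof.
move=> ng s0; apply: word_path_out => -[i k] [/= hl /andP[s1 _]].
by have [h _] := start_bounds R ng hl; have := lt_le_trans (le_lt_trans h s1) s0; rewrite ltxx.
Qed.

Lemma word_path_ge1 g s : nice g -> 1 <= s -> word_path g s = origin R.
Proof.
move=> ng s1; apply: word_path_out => -[i k] [/= hl /andP[_ s2]].
by have [_ h] := start_bounds R ng hl; have := lt_le_trans (le_lt_trans s1 s2) h; rewrite ltxx.
Qed.

Lemma par_out g i k s : has_letter g i k -> ~ in_window g s (i, k) ->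
  par g i k s <= 0 \/ 1 <= par g i k s.
Proof.
move=> hl no; have w0 := width_gt0 R i k; rewrite /par.
have : s <= start R g i k \/ start R g i k + width R i k <= s.
  have [s1|s1] := leP s (start R g i k); first by left.
  have [s2|s2] := leP (start R g i k + width R i k) s; first by right.
  by case: no; split=> //=; rewrite s1 s2.
case=> h.
  have u0 : (s - start R g i k) / width R i k <= 0.
    by rewrite pmulr_lle0 ?invr_gt0 // subr_le0.
  by case: sign_of; [left|right; lra].
have u1 : 1 <= (s - start R g i k) / width R i k by rewrite ler_pdivlMr //; lra.
by case: sign_of; [right|left; lra].
Qed.

Lemma par_cvg g i k s : par g i k s' @[s' --> s] --> par g i k s.
Proof.
have h : (s' - start R g i k) / width R i k @[s' --> s] --> (s - start R g i k) / width R i k.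
  by apply: cvgM; [apply: cvgB; [exact: cvg_id|exact: cvg_cst]|exact: cvg_cst].
by rewrite /par; case: sign_of => //; apply: cvgB => //; apply: cvg_cst.
Qed.

(** Equality up to a tail of letters of index at least [I], the relation between the words at nearby
    points of a deep zone. *)
Definition agree I g h := forall M, core I (word (g M)) = core I (word (h M)).

Lemma agree_letter I g h i k : agree I g h -> (i < I)%N ->
  [/\ has_letter g i k <-> has_letter h i k, start R g i k = start R h i k &
      par g i k = par h i k].
Proof.
move=> gh iI.
have uE M : upto i k (word (g M)) = upto i k (word (h M)).
  by rewrite -(upto_core _ _ iI) gh upto_core.
have st : start R g i k = start R h i k.
  rewrite /start (_ : (fun M => _) = (fun M => extent R M (before i k (word (h M))))) //.
  by apply/funext => M; rewrite /before uE.
have sg : sign_of g i k = sign_of h i k.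
  rewrite /sign_of (_ : (\forall M \near \oo, sign_at i k (word (g M)))
    = (\forall M \near \oo, sign_at i k (word (h M)))) //.
  by congr (nbhs _ _); apply/funext => M; rewrite /sign_at uE.
split=> //; last by apply/funext => s; rewrite /par st sg.
split=> -[M kM]; exists M; move: kM;
  by rewrite /count_label -(cnt_core (word (g M)) iI) -(cnt_core (word (h M)) iI) gh.
Qed.

Lemma agree_window I g h i k s : agree I g h -> (i < I)%N ->
  in_window g s (i, k) <-> in_window h s (i, k).
Proof.
by move=> gh iI; have [e1 e2 _] := agree_letter k gh iI; rewrite /in_window /= e1 e2.
Qed.

(** Joint continuity in the time and the word. Inside a window only its own letter matters. At a
    time outside all windows, the windows of index below [N], finitely many since counts are
    bounded, are treated one by one, and loops of index at least [N] lie in the given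
    neighbourhood. *)
Lemma word_path_near g s (A : set X) : nice g -> nbhs (word_path g s) A ->
  exists I, \forall s' \near s, forall h, nice h -> agree I g h -> A (word_path h s').
Proof.
move=> ng; have [[[i k] win]|no] := pselect (exists ik, in_window g s ik).
  have /= hl := win.1; have i2 := letter_ge2 ng hl.
  rewrite (word_pathE ng win) => nA; exists i.+1.
  have near1 := @rho_cvg R _ (nbhs s) (nbhs_filter s) (par g i k) i _ i2 (@par_cvg g i k s) A nA.
  have near2 : \forall s' \near s, in_window g s' (i, k).
    have [_ /andP[s1 s2]] := win.
    near=> s'; split=> //; apply/andP; split; near: s'; [exact: lt_nbhsr|exact: lt_nbhsl].
  near=> s' => h nh gh; have win' : in_window g s' (i, k) by near: s'.
  rewrite (word_pathE nh ((agree_window k s' gh (ltnSn i)).1 win')).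
  have [_ _ <-] := agree_letter k gh (ltnSn i).
  by near: s'.
rewrite word_path_out => [nA|ik win]; last by apply: no; exists ik.
have [N N2 NP] := rho_near nA.
have [_ /choice[B BP] _] := ng.
exists N.
have H (i : 'I_N) (k : 'I_(B i)) : \forall s' \near s, in_window g s' (i : nat, k : nat) ->
    A (rho i (par g i k s')).
  have [hl|nhl] := pselect (has_letter g i k); last by near=> s' => -[].
  have i2 := letter_ge2 ng hl.
  have no' : ~ in_window g s (i : nat, k : nat) by move=> w; apply: no; exists (i : nat, k : nat).
  have := @rho_cvg R _ (nbhs s) (nbhs_filter s) (par g i k) i _ i2 (@par_cvg g i k s) A.
  rewrite /= (rho_out _ (par_out hl no')) => /(_ nA) near1.
  by near=> s' => _; near: s'.
have {}H : \forall s' \near s, forall i : 'I_N, forall k : 'I_(B i),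
    in_window g s' (i : nat, k : nat) -> A (rho i (par g i k s')).
  pose f (i : 'I_N) (k : 'I_(B i)) : set R :=
    [set s' | in_window g s' (i : nat, k : nat) -> A (rho i (par g i k s'))].
  have Hf (i : 'I_N) : nbhs s [set s' | forall k : 'I_(B i), f i k s'].
    exact: (@filter_forall R 'I_(B i) (f i) (nbhs s) (nbhs_filter s) (H i)).
  have := @filter_forall R 'I_N (fun i : 'I_N => [set s' | forall k : 'I_(B i), f i k s'])
    (nbhs s) (nbhs_filter s) Hf.
  by apply: filterS => s' E i k; apply: (E i k).
near=> s' => h nh gh; have A0 : A (origin R) by apply: nbhs_singleton.
have [[[i k] win]|nowin] := pselect (exists ik, in_window h s' ik); last first.
  by rewrite word_path_out // => ik win; apply: nowin; exists ik.
rewrite (word_pathE nh win); have [iN|Ni] := ltnP i N; last exact: NP.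
have [_ _ <-] := agree_letter k gh iN.
have win' := (agree_window k s' gh iN).2 win.
have kB : (k < B i)%N by have [[M kM] _] := win'; apply: leq_trans kM (BP i M).
have : forall i : 'I_N, forall k : 'I_(B i),
  in_window g s' (i : nat, k : nat) -> A (rho i (par g i k s')) by near: s'.
by move=> /(_ (Ordinal iN) (Ordinal kB) win').
Unshelve. all: by end_near. Qed.

Definition appends n b g h := exists N, forall M, (N <= M)%N ->
  word (h M) = (n, b) :: word (g M).

Definition last_index n g : nat :=
  xget 0%N [set k | exists N, forall M, (N <= M)%N -> count_label n (g M) = k].

Section Append.
Variables (n : nat) (b : bool) (g h : profree).
Hypotheses (ng : nice g) (nh : nice h) (gh : appends n b g h).
Let k := last_index n g.

Lemma last_indexP : exists N, forall M, (N <= M)%N -> count_label n (g M) = k.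
Proof.
rewrite /k /last_index; case: xgetP => // no.
by have [N NP] := count_stable n ng; case: (no (count_label n (g N))); exists N.
Qed.

Lemma appends_upto : exists N, forall M, (N <= M)%N ->
  [/\ (k < count_label n (h M))%N, upto n k (word (h M)) = (n, b) :: word (g M) &
    forall i l, has_letter g i l ->
     (l < count_label i (h M))%N -> upto i l (word (h M)) = upto i l (word (g M))].
Proof.
have [N1 P1] := last_indexP; have [N2 P2] := gh; exists (maxn N1 N2) => M.
rewrite geq_max => /andP[M1 M2]; split.
- by rewrite /count_label P2 //= eqxx -[count _ _]/(count_label n (g M)) P1.
- by rewrite P2 //= -[count _ _]/(count_label n (g M)) P1 // !eqxx.
move=> i l hl _; rewrite P2 //=; case: eqP => //= <- {i} in hl *.
case: eqP => // e; have {}e : k = l by rewrite -e -[RHS]/(count_label n (g M)) P1.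
have [M' lM'] := hl; have [cg _ _] := ng.
have := P1 (maxn M' N1) (leq_maxr _ _) => e'.
have : (count_label n (g M') <= k)%N.
  rewrite -e'; apply: (homo_leq (f := fun M => count_label n (g M)) leqnn leq_trans).
    by move=> K; apply: count_mono.
  exact: leq_maxl.
by rewrite e leqNgt lM'.
Qed.

Lemma appends_letter : has_letter h n k /\ sign_of h n k = b.
Proof.
have [N NP] := appends_upto; have hl : has_letter h n k.
  by exists N; have [] := NP N (leqnn N).
split=> //; have [N' NP'] := window_stable R nh hl.
have [_ e _] := NP (maxn N N') (leq_maxl _ _).
by have [_ e' _] := NP' (maxn N N') (leq_maxr _ _); move: e'; rewrite e => -[].
Qed.

Lemma has_letter_appends i l : has_letter g i l -> has_letter h i l.
Proof.
move=> [M lM]; have [N NP] := gh; have [cg _ _] := ng; exists (maxn M N).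
rewrite /count_label NP ?leq_maxr //=; apply: ltn_addl; apply: leq_trans lM _.
apply: (homo_leq (f := fun M => count_label i (g M)) leqnn leq_trans).
  by move=> K; apply: count_mono.
exact: leq_maxl.
Qed.

Lemma has_letter_split i l : has_letter h i l ->
  (i = n /\ l = k) \/ has_letter g i l.
Proof.
move=> [M lM]; have [N NP] := gh; have [N1 P1] := last_indexP; have [ch _ _] := nh.
have : (l < count_label i (h (maxn M (maxn N N1))))%N.
  apply: leq_trans lM _.
  apply: (homo_leq (f := fun M => count_label i (h M)) leqnn leq_trans).
    by move=> K; apply: count_mono.
  exact: leq_maxl.
set K := maxn _ _; have KN : (N <= K)%N by rewrite !leq_max leqnn orbT.
have KN1 : (N1 <= K)%N by rewrite !leq_max leqnn !orbT.
rewrite /count_label NP //=; have [e|ne] := eqVneq n i; last first.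
  by rewrite add0n => lK; right; exists K.
subst i; rewrite add1n ltnS leq_eqVlt => /orP[/eqP e|lK]; last by right; exists K.
by left; split=> //; rewrite e -[LHS]/(count_label n (g K)) P1.
Qed.

(** The initial segment ending at a letter of [g] is the same in both words, so its window is
    unchanged; the appended letter comes after all of them. *)
Lemma appends_start i l : has_letter g i l ->
  [/\ start R h i l = start R g i l, par h i l = par g i l &
    start R g i l + width R i l <= start R h n k].
Proof.
move=> hl; have hl' := has_letter_appends hl; have [hk _] := appends_letter.
have [N NP] := appends_upto; have [N' NP'] := window_stable R nh hl'.
have [N1 NP1] := window_stable R ng hl.
have uE M : (maxn N (maxn N' N1) <= M)%N -> upto i l (word (h M)) = upto i l (word (g M)).
  rewrite !geq_max => /and3P[NM N'M N1M]; have [_ _ e] := NP M NM; apply: e => //.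
  by have [] := NP' M N'M.
have st : start R h i l = start R g i l.
  have c := start_cvg (R := R) ng hl; apply: (cvg_lim (@Rhausdorff R)); apply: cvg_trans c.
  apply: near_eq_cvg; exists (maxn N (maxn N' N1)) => // M /= MP.
  by rewrite /before uE.
have sg : sign_of h i l = sign_of g i l.
  set K := maxn N (maxn N' N1); have := uE K (leqnn _).
  have [_ -> _] := NP' K (leq_trans (leq_maxl _ _) (leq_maxr _ _)).
  by have [_ -> _] := NP1 K (leq_trans (leq_maxr _ _) (leq_maxr _ _)) => -[].
split=> //; first by apply/funext => s; rewrite /par st sg.
rewrite -st; have := start_ordered R nh hl' hk => -[[ei ek]|h1|//].
  have [Mg] := hl; rewrite ei ek => lt; have [N2 P2] := last_indexP.
  have [cg _ _] := ng; move: lt; rewrite ltnNge -(P2 (maxn Mg N2)) ?leq_maxr //.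
  rewrite (homo_leq (f := fun M => count_label n (g M)) leqnn leq_trans) ?leq_maxl //.
  by move=> K; apply: count_mono.
suff : start R h i l <= start R h n k by have := width_gt0 R n k; move: h1; lra.
apply: (ler_cvg_to (start_cvg (R := R) nh hl') (start_cvg (R := R) nh hk)).
exists (maxn N (maxn N' N1)) => // M /= MP.
have [NM _] := andP (etrans (esym (geq_max _ _ _)) MP).
have [_ e _] := NP M NM; rewrite {2}/before e /= /before uE //.
apply: extent_mono => j; have [u {2}->] := upto_cat i l (word (g M)).
by rewrite count_cat; apply: leq_trans (leq_addl _ _); case: upto => //= ? ?; apply: leq_addl.
Qed.

Lemma appends_before s : s <= start R h n k -> word_path h s = word_path g s.
Proof.
move=> sk; have [[[i l] win]|no] := pselect (exists il, in_window g s il).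
  have [hl] := win; have [e1 e2 _] := appends_start hl; rewrite -e1 => ss.
  rewrite (word_pathE ng win) (@word_pathE h s i l) ?e2 //.
  by split=> //; apply: has_letter_appends.
rewrite [RHS]word_path_out => [|il win]; last by apply: no; exists il.
apply: word_path_out => -[i l] [/= hl ss].
have [[ei ek]|hl'] := has_letter_split hl.
  by move: ss; rewrite ei ek ltNge sk.
by apply: no; exists (i, l); split=> //=; have [<- _ _] := appends_start hl'.
Qed.

Lemma appends_after s : start R h n k <= s ->
  word_path g s = origin R /\ word_path h s = rho n (par h n k s).
Proof.
move=> ks; have no i l : ~ in_window g s (i, l).
  move=> [/= hl /andP[_ s2]]; have [_ _ le] := appends_start hl.
  by have := lt_le_trans (lt_le_trans s2 le) ks; rewrite ltxx.
split; first by apply: word_path_out => -[i l]; apply: no.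
have [hk _] := appends_letter.
have [win|nowin] := pselect (in_window h s (n, k)); first exact: word_pathE.
rewrite rho_out; last exact: par_out.
apply: word_path_out => -[i l] win; have [/= hl ss] := win.
have [[ei ek]|hl'] := has_letter_split hl; first by apply: nowin; rewrite -ei -ek.
by apply: (no i l); split=> //=; have [<- _ _] := appends_start hl'.
Qed.

End Append.

End WordPaths.

Section NiceGroup.
Local Open Scope group_scope.
Implicit Types (g h : profree) (n M : nat).

Lemma word_inv (x : free_group) : word x^-1 = foldr push [::] (rev (map flip (word x))).
Proof. by []. Qed.

Lemma count_labelV i (x : free_group) : (count_label i x^-1 <= count_label i x)%N.
Proof.
rewrite /count_label word_inv.
apply: (leq_trans (leq_count_subseq _ (foldr_push_subseq _))).
by rewrite count_rev count_map.
Qed.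

Lemma labels_inV P (x : free_group) : labels_in P x -> labels_in P x^-1.
Proof.
rewrite /labels_in word_inv => /allP Px; apply/allP => a.
move/(mem_subseq (foldr_push_subseq _)); rewrite mem_rev => /mapP[b bx ->].
exact: Px bx.
Qed.

Lemma pr1 M : pr M 1 = 1.
Proof. by apply: (mulgI (pr M 1)); rewrite -prM !mulg1. Qed.

Lemma prV M (x : free_group) : pr M x^-1 = (pr M x)^-1.
Proof. by apply: (mulgI (pr M x)); rewrite -prM !mulgV pr1. Qed.

Lemma nice1 : nice 1.
Proof. by split=> [M|i|M]; [exact: pr1|exists 0%N|]. Qed.

Lemma niceM g h : nice g -> nice h -> nice (g * h).
Proof.
move=> [cg bg lg] [ch bh lh]; split=> [M|i|M].
- by rewrite profreeM prM cg ch.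
- have [B BP] := bg i; have [C CP] := bh i; exists (B + C)%N => M.
  by apply: (leq_trans (count_labelM _ _ _)); apply: leq_add.
- exact: labels_inM.
Qed.

Lemma niceV g : nice g -> nice g^-1.
Proof.
move=> [cg bg lg]; split=> [M|i|M].
- by rewrite profreeV prV cg.
- by have [B BP] := bg i; exists B => M; apply: leq_trans (count_labelV _ _) (BP M).
- exact: labels_inV.
Qed.

Definition pletter n b : profree := fun M => if (n < M)%N then fletter (n, b) else 1.

Lemma nice_pletter n b : (2 <= n)%N -> nice (pletter n b).
Proof.
move=> n2; split=> [M|i|M].
- rewrite /pletter ltnS leq_eqVlt; case: ltnP => nM; first by rewrite orbT pr_letter /= nM.
  by case: eqP => _; rewrite ?pr1 // pr_letter /= ltnNge nM.
- exists 1%N => M; rewrite /pletter; case: ifP => // _.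
  by rewrite /count_label /= addn0; case: eqP.
- by rewrite /pletter; case: ifP => // _; rewrite /labels_in /= n2.
Qed.

Lemma pletterK n b g : g * pletter n b * pletter n (~~ b) = g.
Proof.
apply/funext => M; rewrite !profreeM /pletter; case: ifP => _; last by rewrite !mulg1.
by rewrite -[(n, ~~ b)]/(flip (n, b)) fletter_flip mulgK.
Qed.

(** At each large level the new letter either lengthens the word or cancels its last letter. Since
    the counts of index [n] are stable, the same alternative holds at all large levels. *)
Lemma appends_pletter n c : nice c -> (2 <= n)%N ->
  appends n true c (c * pletter n true) \/ appends n false (c * pletter n true) c.
Proof.
move=> nc n2; have ncp := niceM nc (nice_pletter true n2).
have [N NP] := count_stable n nc; have [N' NP'] := count_stable n ncp.
pose K := maxn n.+1 (maxn N N').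
have step M : (K <= M)%N ->
    (word ((c * pletter n true) M) = (n, true) :: word (c M) /\
     count_label n ((c * pletter n true) M) = (count_label n (c M)).+1) \/
    (word (c M) = (n, false) :: word ((c * pletter n true) M) /\
     count_label n (c M) = (count_label n ((c * pletter n true) M)).+1).
  rewrite !geq_max => /and3P[nM _ _].
  rewrite /count_label profreeM /pletter nM word_mul_letter.
  case: (word (c M)) => [|a w] /=; first by rewrite eqxx; left.
  by case: eqP => [->|_] /=; rewrite eqxx; [right|left].
have cK M : (K <= M)%N -> count_label n (c M) = count_label n (c K).
  rewrite !geq_max => /and3P[_ NM _]; rewrite !NP //.
  by rewrite !leq_max leqnn orbT.
have cK' M : (K <= M)%N ->
    count_label n ((c * pletter n true) M) = count_label n ((c * pletter n true) K).
  rewrite !geq_max => /and3P[_ _ NM]; rewrite !NP' //.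
  by rewrite !leq_max leqnn !orbT.
case: (step K (leqnn K)) => -[_ eK]; [left|right]; exists K => M KM;
  case: (step M KM) => -[e] //; rewrite cK // cK' // eK.
- by move=> /eqP; rewrite eqn_leq => /andP[_]; rewrite ltnNge leqW.
- by move=> /eqP; rewrite eqn_leq => /andP[_]; rewrite ltnNge leqW.
Qed.

End NiceGroup.

(** * Paths from the origin to the points of the retract *)

Section Geodesics.
Local Open Scope classical_set_scope.
Local Open Scope ring_scope.
Variable R : realType.
Notation X := (harmonic_archipelago R).
Variable m : nat.
Hypothesis m8 : (8 <= m)%N.
Implicit Types (c g : profree) (q : X) (s : R) (n : nat).

Definition longer_right n c : bool := `[< appends n true c (c * pletter n true)%g >].

(** A point of the diamond in band [n] corresponds to a point of the tree edge joining [c] and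
    [c * a_n]. The geodesic from 1 passes the end with the shorter word and stops inside the last
    letter of the longer one. *)
Definition longer n c : profree :=
  if longer_right n c then (c * pletter n true)%g else c.
Definition shorter n c : profree :=
  if longer_right n c then c else (c * pletter n true)%g.

Lemma longerP n c : nice c -> (2 <= n)%N ->
  [/\ nice (shorter n c), nice (longer n c) &
    appends n (longer_right n c) (shorter n c) (longer n c)].
Proof.
move=> nc n2; have ncp := niceM nc (nice_pletter true n2).
rewrite /shorter /longer /longer_right; case: asboolP => // h.
by case: (appends_pletter nc n2).
Qed.

(** The end of that edge on the left of the axis, recovered from the word [g] at [q]. It does not
    change when [q] crosses the axis, although [g] does. *)
Definition base_label n q g : profree :=
  if right_side q then (g * pletter n false)%g else g.

Lemma base_labelE n q g : g =
  if right_side q then (base_label n q g * pletter n true)%g else base_label n q g.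
Proof. by rewrite /base_label; case: (right_side q); rewrite ?(pletterK n false). Qed.

Definition target q : R := (1 + xi m q) / 2.

(** Time at which the last letter of [longer n c] reaches parameter [T] on [rho n]; an inverse
    letter runs through the loop backwards, whence [1 - T]. *)
Definition stop n c (T : R) : R :=
  let k := last_index n (shorter n c) in
  start R (longer n c) n k
    + width R n k * (if longer_right n c then T else 1 - T).

Definition in_diamond q : Prop := exists n, band m n (py q) /\ `|xi m q| < 1.

(* A path that follows g from the origin, and in the diamond of band n ends at
   [push_out m q 4], a point of the loop [rho n]. *)
Definition geodesic g q s : X :=
  if `[< in_diamond q >] then
    let n := lab m (py q) in let c := base_label n q g in
    word_path (longer n c) (Num.min s (stop n c (target q)))
  else word_path g s.

Lemma not_diamond q : good m q -> ~ in_diamond q -> py q = 0 \/ `|xi m q| = 1.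
Proof.
move=> gq nd; have [y0|y0] := eqVneq (py q) 0; [by left|right].
have := xi_le1 m q; rewrite le_eqVlt => /orP[/eqP //|lt].
case: nd; have yp : 0 < py q by rewrite lt_def y0 py_ge0.
by have [n bn] := xi_lt1_band m8 lt gq yp; exists n.
Qed.

Section Diamond.
Variables (g : profree) (q : X) (n : nat).
Hypotheses (ng : nice g) (gq : good m q) (bn : band m n (py q)) (xq : `|xi m q| < 1).
Let c := base_label n q g.
Let T := target q.
Let k := last_index n (shorter n c).

Lemma diamond_ge2 : (2 <= n)%N.
Proof. by have [mn _ _] := bn; apply: leq_trans mn; apply: leq_trans m8. Qed.

Lemma nice_base : nice c.
Proof.
rewrite /c /base_label; case: ifP => // _.
by apply: niceM => //; apply/nice_pletter/diamond_ge2.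
Qed.

Lemma target01 : 0 < T < 1.
Proof. by move: xq; rewrite /T /target ltr_norml => /andP[]; lra. Qed.

Lemma geodesic_in s : geodesic g q s = word_path (longer n c) (Num.min s (stop n c T)).
Proof.
rewrite /geodesic asboolT; last by exists n.
by rewrite (lab_band m8 bn).
Qed.

Lemma stop_bounds : start R (longer n c) n k < stop n c T
  < start R (longer n c) n k + width R n k.
Proof.
have w0 := width_gt0 R n k; have T01 := target01; rewrite /stop -/k.
rewrite ltrDl ltrD2l; case: longer_right; rewrite mulr_gt0 //= ?gtr_pMr //; lra.
Qed.

Lemma par_stop : par (longer n c) n k (stop n c T) = T.
Proof.
have [ns nl ap] := longerP nice_base diamond_ge2.
have [_ sg] := appends_letter R ns nl ap.
have w0 : width R n k != 0 by rewrite gt_eqF // width_gt0.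
rewrite /par -/k sg /stop -/k addrAC subrr add0r mulrAC divff // mul1r.
by case: longer_right; lra.
Qed.

Lemma par_le (s s' : R) : s <= s' -> if longer_right n c
  then par (longer n c) n k s <= par (longer n c) n k s'
  else par (longer n c) n k s' <= par (longer n c) n k s.
Proof.
move=> ss; have [ns nl ap] := longerP nice_base diamond_ge2.
have [_ sg] := appends_letter R ns nl ap; rewrite /par -/k sg.
have h : (s - start R (longer n c) n k) / width R n k
    <= (s' - start R (longer n c) n k) / width R n k.
  by rewrite ler_pM2r ?invr_gt0 ?width_gt0 // lerD2r.
by case: longer_right => //; rewrite lerD2l lerN2.
Qed.

(** The geodesic and the path of the word [g] differ at most on [rho n], between the target and the
    end of the loop on the side of [q]. Near the border of the diamond this arc is close to the
    origin, which gives continuity there. *)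
Lemma geodesic_compare s : geodesic g q s = word_path g s \/
  exists u u', [/\ geodesic g q s = rho n u, word_path g s = rho n u' &
    if right_side q then T <= u /\ T <= u' else u <= T /\ u' <= T].
Proof.
have [ns nl ap] := longerP nice_base diamond_ge2.
have /andP[st1 st2] := stop_bounds; have ps := par_stop; have /andP[T0 T1] := target01.
have gl : if right_side q == longer_right n c then longer n c = g else shorter n c = g.
  rewrite /longer /shorter; have := base_labelE n q g; rewrite -/c.
  by case: (right_side q); case: (longer_right n c) => /= e; symmetry.
rewrite geodesic_in; have [sk|ks] := leP s (start R (longer n c) n k).
  have ss : s <= stop n c T by apply: le_trans sk (ltW st1).
  rewrite min_l //; left; have e := appends_before ns nl ap sk.
  by move: gl; case: ifP => _ <-.
have [w0 w1] := appends_after ns nl ap (ltW ks).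
have o0 : origin R = rho n 0 by rewrite rho_out //; left.
have o1 : origin R = rho n 1 by rewrite rho_out //; right.
have [ss|ss] := leP s (stop n c T).
  have := par_le ss; rewrite ps -/k in w1 *; move: gl.
  case: (right_side q); case: (longer_right n c) => /= e le; rewrite -[in word_path g]e;
    try by left.
    by right; exists (par (longer n c) n k s), 1; split; rewrite ?w0 //; split=> //; apply: ltW.
  by right; exists (par (longer n c) n k s), 0; split; rewrite ?w0 //; split=> //; apply: ltW.
have [_ w2] := appends_after ns nl ap (ltW st1).
have := par_le (ltW ss); rewrite ps -/k in w1 w2 *; rewrite w2; move: gl.
case: (right_side q); case: (longer_right n c) => /= e le; rewrite -[in word_path g]e;
  right; exists T.
- by exists (par (longer n c) n k s).
- by exists 1; split; rewrite ?w0 //; split=> //; apply: ltW.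
- by exists 0; split; rewrite ?w0 //; split=> //; apply: ltW.
- by exists (par (longer n c) n k s).
Qed.

Lemma geodesic_stop s : 1 <= s -> geodesic g q s = rho n T.
Proof.
move=> s1; have [ns nl ap] := longerP nice_base diamond_ge2.
have /andP[st1 st2] := stop_bounds; have [hl _] := appends_letter R ns nl ap.
have [_ le1] := start_bounds R nl hl.
rewrite geodesic_in min_r; last by apply: le_trans s1; apply: le_trans (ltW st2) le1.
by have [_ ->] := appends_after ns nl ap (ltW st1); rewrite par_stop.
Qed.

End Diamond.

Lemma geodesic_le0 g q s : nice g -> good m q -> s <= 0 -> geodesic g q s = origin R.
Proof.
move=> ng gq s0; have [[n [bn xq]]|nd] := pselect (in_diamond q); last first.
  by rewrite /geodesic asboolF // word_path_le0.
have [_ nl _] := longerP (nice_base ng bn) (diamond_ge2 bn).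
by rewrite (geodesic_in g bn xq) word_path_le0 // ge_min s0.
Qed.

Lemma geodesic_ge1 g q s : nice g -> good m q -> 1 <= s ->
  geodesic g q s = push_out m q 4.
Proof.
move=> ng gq s1; have [[n [bn xq]]|nd] := pselect (in_diamond q).
  by rewrite (geodesic_stop ng bn xq s1) (push4_in m8 gq bn xq).
rewrite /geodesic asboolF // word_path_ge1 // push4_out //.
exact: not_diamond.
Qed.

Lemma geodesic_rho g q s : nice g -> good m q ->
  geodesic g q s = origin R \/ exists n u, (2 <= n)%N /\ geodesic g q s = rho n u.
Proof.
move=> ng gq; have [[n [bn xq]]|nd] := pselect (in_diamond q); last first.
  by rewrite /geodesic asboolF //; apply: word_path_rho.
have [_ nl _] := longerP (nice_base ng bn) (diamond_ge2 bn).
by rewrite (geodesic_in g bn xq); apply: word_path_rho.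
Qed.

End Geodesics.

(** * Cones *)

Section Cones.
Local Open Scope classical_set_scope.
Local Open Scope ring_scope.
Variable R : realType.
Notation X := (harmonic_archipelago R).
Notation Delta n := (set_type (std_simplex R n)).
Implicit Types (q : X) (s : R).

(** Loops of large index lie in the neighbourhood entirely, and the finitely many others are near
    the origin at both ends; so one [e] serves all. *)
Lemma rho_near_ends (A : set X) : nbhs (origin R) A ->
  exists2 e, 0 < e & forall n u, (2 <= n)%N -> u < e \/ 1 - e < u -> A (rho n u).
Proof.
move=> oA; have [N N2 NP] := rho_near oA.
have near0 (n : 'I_N) : \forall e \near (0 : R), (2 <= n)%N -> A (rho n e) /\ A (rho n (1 - e)).
  have [n2|n2] := leqP 2 n; last by near=> e.
  have h0 := @rho_cvg R _ (nbhs (0:R)) (nbhs_filter _) id n 0 n2 cvg_id A.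
  have c1 : (1 - e : R) @[e --> (0 : R)] --> (1 - 0 : R).
    by apply: cvgB; [exact: cvg_cst|exact: cvg_id].
  have h1 := @rho_cvg R _ (nbhs (0:R)) (nbhs_filter _) (fun e => 1 - e) n (1 - 0) n2 c1 A.
  move: h0 h1; rewrite !rho_out; [|by right; rewrite subr0|by left].
  move=> /(_ oA) h0 /(_ oA) h1; near=> e => _.
  by split; near: e; [exact: h0|exact: h1].
have [e /= e0 eP] := @filter_forall R 'I_N _ (nbhs (0:R)) (nbhs_filter _) near0.
exists e => // n u n2; have [nN|Nn] := ltnP n N; last by move=> _; apply: NP.
have o : A (origin R) by apply: nbhs_singleton.
case=> h.
  have [u0|u0] := leP u 0; first by rewrite rho_out //; left.
  have bu : ball_ Num.norm 0 e u by rewrite /= sub0r normrN gtr0_norm.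
  by have [] := eP u bu (Ordinal nN) n2.
have [u1|u1] := leP 1 u; first by rewrite rho_out //; right.
have bu : ball_ Num.norm 0 e (1 - u) by rewrite /= sub0r normrN gtr0_norm; lra.
by have [_] := eP (1 - u) bu (Ordinal nN) n2; rewrite /= subKr.
Unshelve. all: by end_near. Qed.

(** Allows a path to be replaced by another one that differs from it only by points close to the
    origin. *)
Lemma origin_sep (p : X) (A : set X) : nbhs p A ->
  exists A' B, [/\ nbhs p A', nbhs (origin R) B &
    forall x x', A' x -> B x -> B x' -> A x'].
Proof.
move=> pA; have [y0|y0] := eqVneq (py p) 0.
  exists setT, A; split=> //; first exact: filterT.
  by have <- : p = origin R by apply: py_eq0.
have yp : 0 < py p by rewrite lt_def y0 py_ge0.
exists [set x | py p / 2 < py x], [set x | py x < py p / 2]; split.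
- have h : py p / 2 < py p by lra.
  exact: (@py_continuous R p _ (lt_nbhsr h)).
- have h : py (origin R) < py p / 2 by rewrite py_origin; lra.
  exact: (@py_continuous R (origin R) _ (lt_nbhsl h)).
- by move=> x x' /= h1 h2; have := lt_trans h1 h2; rewrite ltxx.
Qed.

Variable m : nat.
Hypothesis m8 : (8 <= m)%N.

Lemma trans_labels M p q : labels_in (leq m) (trans m M p q).
Proof. by apply: trans_deep => //; rewrite /deep ltnn. Qed.

Section LabelNice.
Variables (k : nat) (sigma : Delta k -> X).
Hypothesis ts : tame m sigma.

Lemma label_labels t M : labels_in (leq m) (label m sigma t M).
Proof.
have := @label_along R m m8 k sigma ts (fun x => labels_in (leq m) x) M (vertex R ord0) t.
rewrite label0 // profree1 invg1 mul1g; apply=> // [x y|r r']; first exact: labels_inM.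
exact: trans_labels.
Qed.

Lemma nice_label t : nice (label m sigma t).
Proof.
split=> [|i|M]; first exact: label_coherent.
  by have [B BP] := label_bounded m8 ts i; exists B => M; apply: BP.
apply: labels_inS (label_labels t M) => i /=; apply: leq_trans.
exact: leq_trans m8.
Qed.

Lemma label_near I z t : in_zone m I z (sigma t) -> exists2 d, 0 < d &
  forall t', sdist t t' < d -> in_zone m I z (sigma t').
Proof.
move=> zt; have [cs _] := ts; apply/nbhs_simplex; apply: (cs t).
by apply: open_nbhs_nbhs; split=> //; apply: open_zone.
Qed.

End LabelNice.

Section Continuity.
Variables (k : nat) (sigma : Delta k -> X) (g : profree).
Hypotheses (ts : tame m sigma) (ng : nice g).

Definition lam t : profree := (g * label m sigma t)%g.

Lemma nice_lam t : nice (lam t).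
Proof. by apply: niceM => //; apply: nice_label. Qed.

Lemma geodesic_near_diamond t s : in_diamond m (sigma t) ->
  geodesic m (lam p.1) (sigma p.1) p.2 @[p --> (t, s)] --> geodesic m (lam t) (sigma t) s.
Proof.
move=> [n [bn xq]]; have [cs gs] := ts; have n2 := diamond_ge2 m8 bn.
have y0 : 0 < py (sigma t).
  have [_ cy _] := bn; apply: lt_trans cy.
  have /andP[+ _] := centre_bounds R (ltnW n2); apply: lt_trans; exact: ell_gt0.
have cst : sigma p.1 @[p --> (t, s)] --> sigma t.
  by apply: (cvg_comp _ _ cvg_fst); apply: cs.
have [d d0 dz] := @label_near k sigma ts 0%N (Band n) t bn.
have lz := label_zone m8 ts dz.
set c := base_label n (sigma t) (lam t).
have bE t' : sdist t t' < d -> base_label n (sigma t') (lam t') = c.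
  move=> tt'; have lE := lz t' tt'; apply/funext => M; rewrite /c /base_label /lam.
  move: (lE M); case: (right_side (sigma t)); case: (right_side (sigma t'));
   rewrite !profreeM /pletter /cross /= => ->; case: ifP => _; rewrite ?mulg1 ?mulgA //.
  by rewrite -[(n, false)]/(flip (n, true)) fletter_flip mulgK.
have [_ nl _] := longerP (nice_base m8 (nice_lam t) bn) n2; rewrite -/c in nl.
have nearE : \forall p \near (t, s), geodesic m (lam p.1) (sigma p.1) p.2 =
    word_path (longer n c) (Num.min p.2 (stop n c (target m (sigma p.1)))).
  have n1 : \forall p \near (t, s), sdist t p.1 < d.
    have : nbhs t [set t' | sdist t t' < d] by apply/nbhs_simplex; exists d.
    by move/(@cvg_fst _ _ (nbhs t) (nbhs s) _).
  have n3 : \forall p \near (t, s), `|xi m (sigma p.1)| < 1.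
    have := cvg_norm (xi_cvg m8 (nbhs_filter (t, s)) (gs t) cst y0); move/(_ (nbhs_filter (t, s)) [set x | x < 1]); apply.
    exact: lt_nbhsl.
  near=> p; have pd : sdist t p.1 < d by near: p.
  have bp : band m n (py (sigma p.1)) by apply: dz.
  have xp : `|xi m (sigma p.1)| < 1 by near: p.
  by rewrite (geodesic_in m8 _ bp xp) bE.
rewrite (geodesic_in m8 _ bn xq) -/c.
apply: cvg_trans (near_eq_cvg _) _; first by apply: filterS nearE => p ->.
set s1 := Num.min s _.
have cm : Num.min p.2 (stop n c (target m (sigma p.1))) @[p --> (t, s)] --> s1.
  apply: cvg_minr; first exact: cvg_snd.
  rewrite /stop; apply: cvgD; first exact: cvg_cst.
  apply: cvgM; first exact: cvg_cst.
  have ct : target m (sigma p.1) @[p --> (t, s)] --> target m (sigma t).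
    apply: cvgM; last exact: cvg_cst.
    by apply: cvgD; [exact: cvg_cst|exact: (xi_cvg m8 (nbhs_filter (t, s)) (gs t) cst y0)].
  by case: longer_right => //; apply: cvgB => //; apply: cvg_cst.
move=> A nA; have [I nI] := word_path_near nl nA.
have h : nbhs (t, s) [set p | forall h, nice h -> agree I (longer n c) h ->
  A (word_path h (Num.min p.2 (stop n c (target m (sigma p.1)))))] := cm _ nI.
suff : nbhs (t, s)
  [set p | A (word_path (longer n c) (Num.min p.2 (stop n c (target m (sigma p.1)))))] by [].
by apply: (@filterS _ _ (nbhs_filter (t, s)) _ _ _ h) => p /=; apply.
Unshelve. all: by end_near. Qed.

(** Outside the diamonds, the word changes nearby at most by a tail of deep letters. The geodesic
    differs from the word path at most by points of [rho n] close to the origin, because [n] is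
    large or the parameter is near 0 or 1. *)
Lemma geodesic_near t s :
  geodesic m (lam p.1) (sigma p.1) p.2 @[p --> (t, s)] --> geodesic m (lam t) (sigma t) s.
Proof.
have [|nd] := pselect (in_diamond m (sigma t)); first exact: geodesic_near_diamond.
have [cs gs] := ts.
have cst : sigma p.1 @[p --> (t, s)] --> sigma t.
  by apply: (cvg_comp _ _ cvg_fst); apply: cs.
rewrite {2}/geodesic asboolF // => A nA.
have [A' [B [nA' oB sepAB]]] := origin_sep nA.
have [I nI] := word_path_near (nice_lam t) (filterI nA nA').
have nfst (P : set (Delta k)) : nbhs t P -> \forall p \near (t, s), P p.1.
  by move/(@cvg_fst _ _ (nbhs t) (nbhs s) _).
have nsnd (P : set R) : nbhs s P -> \forall p \near (t, s), P p.2.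
  by move/(@cvg_snd _ _ (nbhs t) (nbhs s) _).
suff [nag nB] : (\forall p \near (t, s), agree I (lam t) (lam p.1)) /\
  (\forall p \near (t, s), forall n u, band m n (py (sigma p.1)) -> `|xi m (sigma p.1)| < 1 ->
    (if right_side (sigma p.1) then target m (sigma p.1) <= u else u <= target m (sigma p.1)) ->
    B (rho n u)).
  have nI' := nsnd _ nI.
  suff : \forall p \near (t, s), A (geodesic m (lam p.1) (sigma p.1) p.2) by [].
  near=> p.
  have [Ap A'p] : (A `&` A') (word_path (lam p.1) p.2).
    have ag : agree I (lam t) (lam p.1) by near: p.
    have : forall h, nice h -> agree I (lam t) h -> (A `&` A') (word_path h p.2) by near: p.
    by apply => //; apply: nice_lam.
  have [[n [bn xp]]|ndp] := pselect (in_diamond m (sigma p.1)); last first.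
    by rewrite /= /geodesic asboolF.
  case: (geodesic_compare m8 (nice_lam p.1) bn xp p.2) => [/= ->//|[u [u' [gE wE uu']]]].
  have Bp : forall n u, band m n (py (sigma p.1)) -> `|xi m (sigma p.1)| < 1 ->
    (if right_side (sigma p.1) then target m (sigma p.1) <= u else u <= target m (sigma p.1)) ->
    B (rho n u) by near: p.
  rewrite /= gE; apply: (sepAB (word_path (lam p.1) p.2)) => //.
    by rewrite wE; apply: Bp bn xp _; move: uu'; case: right_side => -[].
  by apply: Bp bn xp _; move: uu'; case: right_side => -[].
have [y0|x1] := not_diamond m8 (gs t) nd.
  have [N N2 NP] := rho_near oB; pose J := maxn I N.
  have dJ : in_zone m J Deep (sigma t).
    move=> mJ; rewrite y0; have J1 : (0 < J.-1)%N by move: mJ m8; clear; lia.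
    have /andP[+ _] := centre_bounds R J1; apply: lt_trans; exact: ell_gt0.
  have [d d0 dz] := label_near ts dJ.
  have nd' : nbhs t [set t' | sdist t t' < d] by apply/nbhs_simplex; exists d.
  split; apply: filterS (nfst _ nd') => p /= pd.
    move=> M; have [x lx lE] := label_zone m8 ts dz pd M.
    rewrite /lam !profreeM lE mulgA [RHS]core_mul //.
    by apply: labels_inS lx => i /=; apply: leq_trans; apply: leq_maxl.
  move=> n u bn _ _; apply: NP; apply: leq_trans (leq_maxr I N) _.
  exact: (deep_band m8 (dz _ pd : deep m J (sigma p.1)) bn).
have x0 : px (sigma t) != 0.
  by apply/eqP => /axis_xi e; move: x1; rewrite e normr0 => /eqP; rewrite eq_sym oner_eq0.
have y0 : 0 < py (sigma t).
  rewrite lt_def py_ge0 andbT; apply: contra x0 => /eqP /py_eq0 ->.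
  by rewrite px_origin.
split.
  have [z [zt zz]] : exists z, in_zone m 0 z (sigma t) /\ (z = Left \/ z = Right).
    have [h|h|h] := ltgtP (px (sigma t)) 0; last by rewrite h eqxx in x0.
      by exists Left; split; [|left].
    by exists Right; split; [|right].
  have [d d0 dz] := label_near ts zt.
  have nd' : nbhs t [set t' | sdist t t' < d] by apply/nbhs_simplex; exists d.
  apply: filterS (nfst _ nd') => p /= pd M.
  have := label_zone m8 ts dz pd.
  by case: zz => -> lE; rewrite /lam lE.
have [e e0 eP] := rho_near_ends oB.
have : \forall p \near (t, s), 1 - e < `|xi m (sigma p.1)|.
  have := cvg_norm (xi_cvg m8 (nbhs_filter (t, s)) (gs t) cst y0); move/(_ (nbhs_filter (t, s)) [set x | 1 - e < x]); apply.
  by rewrite x1; apply: lt_nbhsr; lra.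
apply: filterS => p xe n u bn xp.
have n2 := diamond_ge2 m8 bn.
have yp : 0 < py (sigma p.1).
  have [_ cy _] := bn; apply: lt_trans cy.
  have /andP[+ _] := centre_bounds R (ltnW n2); apply: lt_trans; exact: ell_gt0.
rewrite /right_side -(xi_sign m8 (gs p.1) yp) /target => h; apply: eP => //.
move: h; have [xx|xx] := leP 0 (xi m (sigma p.1)) => h.
  by right; move: xe xp; rewrite ger0_norm //; move: h; clear; lra.
by left; move: xe xp; rewrite ltr0_norm //; move: h; clear; lra.
Unshelve. all: by end_near. Qed.

End Continuity.
End Cones.

Section ConeMap.
Local Open Scope classical_set_scope.
Local Open Scope ring_scope.
Variable R : realType.
Notation X := (harmonic_archipelago R).
Notation Delta n := (set_type (std_simplex R n)).
Variable m : nat.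
Hypothesis m8 : (8 <= m)%N.

Definition bary k (t : Delta k) (j : 'I_k.+1) : R := \val t 0 j.

Definition base_row k (t : Delta k.+1) : 'rV[R]_k.+1 :=
  if bary t 0 < 1 then \row_j (bary t (fintype.lift ord0 j) / (1 - bary t 0))
  else delta_mx 0 ord0.

Lemma base_row_mem k (t : Delta k.+1) : base_row t \in std_simplex R k.
Proof.
rewrite /base_row; have [t1|_] := ltP; last exact: vertex_mem.
have d0 : 0 < 1 - bary t 0 by rewrite subr_gt0.
apply/mem_set; split=> [i|].
  by rewrite mxE divr_ge0 ?(ltW d0) //; apply: simplex_ge0.
under eq_bigr do rewrite mxE.
rewrite -mulr_suml; have := simplex_sum t; rewrite big_ord_recl -/(bary t ord0) => h.
have -> : \sum_(i < k.+1) bary t (fintype.lift ord0 i) = 1 - bary t 0 by move: h; rewrite /bary; lra.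
by rewrite divff // gt_eqF.
Qed.

Definition base_pt k (t : Delta k.+1) : Delta k := exist _ (base_row t) (base_row_mem t).

Lemma coord_cvg k (t : Delta k) (j : 'I_k.+1) :
  bary s j @[s --> t] --> bary t j.
Proof.
have c1 : \val s @[s --> t] --> \val t.
  exact: (@initial_continuous _ _ (set_val : Delta k -> 'rV[R]_k.+1) t).
have c2 := @coord_continuous R 1 k.+1 0 j (\val t).
exact: (cvg_comp _ _ c1 c2).
Qed.

Lemma near_eq_lim (T Y : topologicalType) (f f' : T -> Y) (t : T) (y : Y) :
  (\forall s \near t, f s = f' s) -> f @ t --> y -> f' @ t --> y.
Proof.
by move=> n c; apply: cvg_trans c; apply: near_eq_cvg; apply: filterS n => s ->.
Qed.

Lemma near_eq_const (T Y : topologicalType) (f : T -> Y) (t : T) (y : Y) :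
  (\forall s \near t, f s = y) -> f @ t --> y.
Proof. by move=> n; apply: cvg_near_cst. Qed.

Section RealLimits.
Variables (S : Type) (F : set_system S).
Context (FF : Filter F).
Implicit Types (f g : S -> R) (a b c : R).

Lemma cvg_scale c f a : f @ F --> a -> c * f s @[s --> F] --> c * a.
Proof. by move=> fa; apply: cvgM => //; apply: cvg_cst. Qed.

Lemma cvg_sub c f a : f @ F --> a -> c - f s @[s --> F] --> c - a.
Proof. by move=> fa; apply: cvgB => //; apply: cvg_cst. Qed.

Lemma cvg_shift c f a : f @ F --> a -> f s - c @[s --> F] --> a - c.
Proof. by move=> fa; apply: cvgB => //; apply: cvg_cst. Qed.

Lemma cvg_ratio f g a b : f @ F --> a -> g @ F --> b -> 1 - b != 0 ->
  f s / (1 - g s) @[s --> F] --> a / (1 - b).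
Proof. by move=> fa gb b1; apply: cvgM => //; apply: cvgV => //; apply: cvg_sub. Qed.

End RealLimits.

Lemma base_pt_cvg k (t : Delta k.+1) : bary t 0 < 1 -> base_pt s @[s --> t] --> base_pt t.
Proof.
move=> t1; have near1 : \forall s \near t, bary s 0 < 1.
  exact: (@coord_cvg _ t 0 _ (lt_nbhsl t1)).
have d0 : 1 - bary t 0 != 0 by rewrite gt_eqF // subr_gt0.
move=> A /nbhs_simplex[e e0 eA].
have H (j : 'I_k.+1) : \forall s \near t,
   `|bary t (fintype.lift ord0 j) / (1 - bary t 0)
     - bary s (fintype.lift ord0 j) / (1 - bary s 0)| < e / 2.
  have c : bary s (fintype.lift ord0 j) / (1 - bary s 0) @[s --> t] -->
      bary t (fintype.lift ord0 j) / (1 - bary t 0).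
    exact: (cvg_ratio (nbhs_filter t) (@coord_cvg _ t (fintype.lift ord0 j)) (@coord_cvg _ t 0) d0).
  have e2 : 0 < e / 2 by rewrite divr_gt0.
  exact: (c _ (@nbhsx_ballx _ _ _ (e / 2) e2)).
have H' := @filter_forall _ 'I_k.+1 _ (nbhs t) (nbhs_filter t) H.
suff : \forall s \near t, A (base_pt s) by [].
near=> s; apply: eA; rewrite /sdist /=.
have s1 : bary s 0 < 1 by near: s.
apply: (@le_lt_trans _ _ (e / 2)); last by lra.
apply: norm_le_entries => [|j]; first by rewrite divr_ge0 // ltW.
rewrite !mxE /base_row t1 s1 !mxE; apply: ltW; move: j.
by near: s.
Unshelve. all: by end_near. Qed.

(** For [s <= 1/3] the value is the origin, which hides the discontinuity of [base_pt] at the apex.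
    Up to [s = 2/3] the geodesic is followed to its end [push_out m _ 4]; then the retraction is run
    backwards, from time 4 at [2/3] to time 0 at 1. *)
Definition cone_map k (sigma : Delta k -> X) (g : profree) (t : Delta k.+1) : X :=
  let q := base_pt t in let s := 1 - bary t 0 in
  if 3 * s <= 2 then geodesic m (lam m sigma g q) (sigma q) (3 * s - 1)
  else push_out m (sigma q) (12 - 12 * s).

Section Fixed.
Variables (k : nat) (sigma : Delta k -> X) (g : profree).
Hypotheses (ts : tame m sigma) (ng : nice g).

Lemma cone_good t : good m (cone_map sigma g t).
Proof.
have [_ gs] := ts; rewrite /cone_map; case: ifP => _; last exact: good_push.
have nl := nice_lam m8 ts ng (base_pt t).
have go : good m (origin R).
  have o : rho 2 0 = origin R by rewrite rho_out //; left.
  by rewrite -o; apply: rho_good.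
by case: (geodesic_rho m8 (3 * (1 - bary t 0) - 1) nl (gs (base_pt t))) => [->|[n [u [n2 ->]]]] //;
  apply: rho_good.
Qed.

Lemma cone_apex t : 2 <= 3 * bary t 0 -> cone_map sigma g t = origin R.
Proof.
have [_ gs] := ts; move=> t1; rewrite /cone_map ifT; last by lra.
by rewrite geodesic_le0 //; [exact: nice_lam|lra].
Qed.

Lemma cone_continuous : continuous (cone_map sigma g).
Proof.
have [cs gs] := ts; move=> t.
suff : cone_map sigma g s @[s --> t] --> cone_map sigma g t by [].
have ct := @coord_cvg _ t 0.
have [t1|t1] := ltP 2 (3 * bary t 0).
  rewrite cone_apex; last exact: ltW.
  have n1 : \forall s \near t, 2 < 3 * bary s 0.
    have c : 3 * bary s 0 @[s --> t] --> 3 * bary t 0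
      := cvg_scale (nbhs_filter t) ct.
    exact: (c _ (lt_nbhsr t1)).
  apply: near_eq_const.
  by apply: (@filterS _ _ (nbhs_filter t) _ _ _ n1) => s /ltW /cone_apex.
have cb : base_pt s @[s --> t] --> base_pt t by apply: base_pt_cvg; lra.
have c1 : geodesic m (lam m sigma g (base_pt s)) (sigma (base_pt s)) (3 * (1 - bary s 0) - 1)
    @[s --> t] --> geodesic m (lam m sigma g (base_pt t)) (sigma (base_pt t)) (3 * (1 - bary t 0) - 1).
  have cp : (base_pt s, 3 * (1 - bary s 0) - 1) @[s --> t] -->
      (base_pt t, 3 * (1 - bary t 0) - 1).
    exact: (cvg_pair cb (cvg_shift _ (cvg_scale _ (cvg_sub (nbhs_filter t) ct)))).
  exact: (cvg_comp _ _ cp (@geodesic_near R m m8 k sigma g ts ng (base_pt t) (3 * (1 - bary t 0) - 1))).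
have c2 : push_out m (sigma (base_pt s)) (12 - 12 * (1 - bary s 0)) @[s --> t] -->
    push_out m (sigma (base_pt t)) (12 - 12 * (1 - bary t 0)).
  have cs2 : sigma (base_pt s) @[s --> t] --> sigma (base_pt t).
    exact: (cvg_comp _ _ cb (cs (base_pt t))).
  apply: (push_cvg m8 (nbhs_filter t) _ _ cs2 _) => //.
  exact: (cvg_sub _ (cvg_scale _ (cvg_sub (nbhs_filter t) ct))).
have cl : 3 * (1 - bary s 0) @[s --> t] --> 3 * (1 - bary t 0).
  exact: (cvg_scale _ (cvg_sub (nbhs_filter t) ct)).
rewrite {2}/cone_map; case: ltgtP => h.
- have n1 : \forall s \near t, 3 * (1 - bary s 0) < 2 by exact: (cl _ (lt_nbhsl h)).
  apply: near_eq_lim c1.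
  by apply: (@filterS _ _ (nbhs_filter t) _ _ _ n1) => s /ltW h'; rewrite /cone_map h'.
- have n1 : \forall s \near t, 2 < 3 * (1 - bary s 0) by exact: (cl _ (lt_nbhsr h)).
  apply: near_eq_lim c2.
  by apply: (@filterS _ _ (nbhs_filter t) _ _ _ n1) => s h'; rewrite /cone_map leNgt h'.
- have e : push_out m (sigma (base_pt t)) (12 - 12 * (1 - bary t 0)) =
      geodesic m (lam m sigma g (base_pt t)) (sigma (base_pt t)) (3 * (1 - bary t 0) - 1).
    rewrite geodesic_ge1 //; [|exact: nice_lam|lra].
    by congr (push_out _ _ _); lra.
  move=> A nA; have nA' := nA; rewrite -e in nA'.
  have n1 := c1 _ nA; have n2 := c2 _ nA'.
  suff : \forall s \near t, A (cone_map sigma g s) by [].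
  by apply: (@filterS2 _ _ (nbhs_filter t) _ _ _ _ n1 n2) => s h1 h2; rewrite /cone_map; case: ifP.
Qed.

Lemma cone_tame : tame m (cone_map sigma g).
Proof. by split; [exact: cone_continuous|exact: cone_good]. Qed.

Lemma cone_coface0 t : cone_map sigma g (coface ord0 t) = sigma t.
Proof.
have t0 : bary (coface ord0 t) 0 = 0 :> R by rewrite /bary /= mxE unlift_none.
rewrite /cone_map t0 subr0 ifF; last by apply/negbTE; rewrite -ltNge; lra.
have -> : base_pt (coface ord0 t) = t.
  apply: val_inj => /=; rewrite /base_row t0 ltr01; apply/rowP => j.
  by rewrite mxE subr0 divr1 /bary /= mxE liftK.
have -> : 12 - 12 * 1 = 0 :> R by lra.
exact: push0.
Qed.

End Fixed.

Lemma base_pt_coface k (i : 'I_k.+2) (t : Delta k.+1) : bary t 0 < 1 ->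
  base_pt (coface (fintype.lift ord0 i) t) = coface i (base_pt t).
Proof.
move=> t1; have e0 : bary (coface (fintype.lift ord0 i) t) 0 = bary t 0 :> R.
  rewrite /bary /= mxE (_ : 0 = fintype.lift (fintype.lift ord0 i) 0) ?liftK //.
  by apply: val_inj.
have le l : fintype.lift ord0 (fintype.lift i l) =
    fintype.lift (fintype.lift ord0 i) (fintype.lift ord0 l).
  by apply: ord_inj; rewrite lift0 /= /fintype.bump !leq0n !add1n ltnS addnS.
apply: val_inj => /=; apply/rowP => j; rewrite /base_row e0 t1 !mxE.
case: (unliftP i j) => [l ->|->].
  by rewrite mxE le /bary /= mxE liftK.
by rewrite /bary /= mxE unlift_none mul0r.
Qed.

Lemma tame_face k (sigma : Delta k.+1 -> X) (i : 'I_k.+2) : tame m sigma ->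
  tame m (sigma \o coface i).
Proof.
move=> [cs gs]; split=> s; last exact: gs.
exact: (cvg_comp _ _ (@coface_continuous R _ i s) (cs _)).
Qed.

Lemma label_face k (sigma : Delta k.+1 -> X) (i : 'I_k.+2) t : tame m sigma ->
  label m (sigma \o coface i) t =
    ((label m sigma (coface i (vertex R ord0)))^-1 * label m sigma (coface i t))%g.
Proof.
move=> ts; apply: (label_comp m8 ts _ ltr01) => [|t' s]; last first.
  by rewrite mul1r; apply: sdist_coface.
exact: tame_face.
Qed.

(** Labels are normalised at the first vertex of the base. If the face omits that vertex, the word
    of the new first vertex has to be put in by hand, whence the factor. *)
Lemma cone_coface k (sigma : Delta k.+1 -> X) g (i : 'I_k.+2) t : tame m sigma -> nice g ->
  cone_map sigma g (coface (fintype.lift ord0 i) t) =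
  cone_map (sigma \o coface i) (g * label m sigma (coface i (vertex R ord0)))%g t.
Proof.
move=> ts ng; have e0 : bary (coface (fintype.lift ord0 i) t) 0 = bary t 0 :> R.
  rewrite /bary /= mxE (_ : 0 = fintype.lift (fintype.lift ord0 i) 0) ?liftK //.
  by apply: val_inj.
have tf := tame_face i ts.
have [t1|t1] := ltP (bary t 0) 1; last first.
  rewrite !cone_apex //; try by rewrite ?e0; lra.
  by apply: niceM => //; apply: nice_label.
rewrite /cone_map e0 base_pt_coface // /lam label_face //.
by rewrite mulgA mulgK.
Qed.

Lemma cone_coface_pt (sigma : Delta 0 -> X) g t : tame m sigma -> nice g ->
  cone_map sigma g (coface (fintype.lift ord0 ord0) t) = origin R.
Proof.
move=> ts ng; apply: cone_apex => //.
rewrite /bary /= mxE (_ : 0 = fintype.lift (fintype.lift ord0 ord0) ord0) ?liftK //; last by apply: val_inj.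
by have := simplex_sum t; rewrite big_ord1 => ->; lra.
Qed.

End ConeMap.

(** * Words that the edges of cones read faithfully *)

Section Realizable.
Local Open Scope classical_set_scope.
Local Open Scope ring_scope.
Variable R : realType.
Notation X := (harmonic_archipelago R).
Notation Delta n := (set_type (std_simplex R n)).
Variable m : nat.
Hypothesis m8 : (8 <= m)%N.
Implicit Types (p q v : X) (s : R).

(** The origin counts for both sides: it lies in no band, so no letter is read there. *)
Definition sided b p := right_side p = b \/ py p = 0.

Lemma trans_sided b M p q : sided b p -> sided b q -> trans m M p q = 1%g.
Proof.
have lab0 p' : py p' = 0 -> lab m (py p') = 0%N.
  move=> y0; case: (labP m (py p')) => // -[mn cy _].
  have n0 : (0 < lab m (py p'))%N by apply: leq_trans mn; apply: leq_trans m8.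
  have /andP[h _] := centre_bounds R n0.
  have := lt_trans (lt_trans (ell_gt0 R (ltn0Sn _)) h) cy.
  by rewrite y0 ltxx.
move=> [bp|yp]; last by move=> _; rewrite /trans (lab0 _ yp) andbF.
move=> [bq|yq]; first by apply: trans_side => //; rewrite bp bq.
by rewrite /trans (lab0 _ yq); case: eqP => //= <-.
Qed.

Definition negp (u : R * R) := u.1 < 0 \/ (u.1 = 0 /\ u.2 = 0).

Lemma negp_scale c (u : R * R) : 0 <= c -> negp u -> negp (c * u.1, c * u.2).
Proof.
rewrite le_eqVlt => /orP[/eqP <- _|c0]; first by right; rewrite /= !mul0r.
by case=> [u0|[-> ->]]; [left|right]; rewrite /= ?mulr0 // pmulr_rlt0.
Qed.

Lemma negp_add (u u' : R * R) : negp u -> negp u' -> negp (u.1 + u'.1, u.2 + u'.2).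
Proof.
move=> [u0|[u1 u2]] [u0'|[u1' u2']]; rewrite /negp /=; [left; lra|left; lra|left; lra|].
by right; rewrite u1 u2 u1' u2' addr0.
Qed.

Lemma push_sided q t : good m q -> sided (right_side q) (push_out m q t).
Proof.
move=> gq; rewrite /sided /right_side -[px (push_out m q t)]/((pxy _).1)
  -[py (push_out m q t)]/((pxy _).2) pxy_push //.
have [k [s [_ s01 -> _]]] := push_mix m q t.
have /andP[s0 s1] := s01; have s1' : 0 <= 1 - s by lra.
have m0 : (0 < m)%N by apply: leq_trans m8.
have lm0 := ell_gt0 R m0; have y0 := py_ge0 q.
have /andP[c0 _] := chi_bounds (xi_le1 m q).
have [/andP[l0 _] _] := lev_bounds m8 q.
have w0 : 0 <= wid m q by rewrite /wid le_max normr_ge0.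
have d0 : 0 <= Num.max `|x1 m q| (tau (y1 m q)) by rewrite le_max normr_ge0.
have [x0|x0] := leP 0 (px q).
  have a0 : 0 <= x1 m q.
    by rewrite /x1 mulr_ge0 // le_min ler01 divr_ge0 // ltW.
  have b0 : 0 <= xi m q by rewrite /xi divr_ge0.
  have st j : 0 <= (stage m q j).1.
    case: j => [|[|[|[|j]]]]; [exact: x0|exact: a0|exact: mulr_ge0| |];
      by apply: mulr_ge0 => //; apply: mulr_ge0.
  by left; apply: addr_ge0; apply: mulr_ge0.
have yp : 0 < py q.
  rewrite lt_def y0 andbT; apply/eqP => /py_eq0 e.
  by move: x0; rewrite e px_origin ltxx.
have a0 : x1 m q < 0 by rewrite /x1 pmulr_rlt0 // lt_min ltr01 divr_gt0.
have b0 : xi m q < 0.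
  rewrite /xi pmulr_llt0 // invr_gt0 lt_max; apply/orP; left.
  by rewrite normr_gt0 lt_eqF.
have w1 : 0 < wid m q by rewrite /wid lt_max normr_gt0 lt_eqF.
have st j : negp (stage m q j).
  have n2 : negp (xi m q * wid m q, y1 m q) by left; rewrite /= pmulr_llt0.
  case: j => [|[|[|[|j]]]] /=; [by left|by left|exact: n2| |].
    exact: (negp_scale c0 n2).
  have n4 : negp (xi m q * lev m q, lev m q).
    have [l1|l1] := ltP 0 (lev m q); first by left; rewrite /= pmulr_llt0.
    have -> : lev m q = 0 by apply/eqP; rewrite eq_le l1 l0.
    by right; rewrite /= mulr0.
  exact: (negp_scale c0 n4).
have := negp_add (negp_scale s1' (st k)) (negp_scale s0 (st k.+1)).
by case=> /= [h|[h1 h2]]; [left; rewrite leNgt h|right].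
Qed.

Lemma word_path1 s : word_path 1%g s = origin R.
Proof. by apply: word_path_out => -[i k] [[M]]. Qed.

Lemma geodesic_sided q s : good m q -> sided (right_side q) (geodesic m 1%g q s).
Proof.
move=> gq; have so : sided (right_side q) (origin R) by right; rewrite py_origin.
have [[n [bn xq]]|nd] := pselect (in_diamond m q); last first.
  by rewrite /geodesic asboolF // word_path1.
have n2 := diamond_ge2 m8 bn.
have yp : 0 < py q.
  have [_ cy _] := bn; apply: lt_trans cy.
  have /andP[+ _] := centre_bounds R (ltnW n2); apply: lt_trans; exact: ell_gt0.
case: (geodesic_compare m8 nice1 bn xq s) => [->|[u [u' [-> _]]]]; first by rewrite word_path1.
have l0 : 0 < ell R n by apply: ell_gt0; apply: ltnW.
have [/andP[b0 _] _] := bend_bounds u.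
rewrite /sided /right_side px_rho // py_rho //; have := xi_sign m8 gq yp.
rewrite /right_side /target; case: (leP 0 (px q)) => _ xs [] h _.
  by left; rewrite mulr_ge0 // mulr_ge0 ?(ltW l0) //; lra.
have xn : xi m q < 0 by rewrite ltNge xs.
move: b0; rewrite le_eqVlt => /orP[/eqP <-|b0]; first by right; rewrite mul0r.
left; apply/negbTE; rewrite -ltNge pmulr_rlt0 // pmulr_llt0 //.
by move: h xn; clear; lra.
Qed.

Lemma simplex0 (t : Delta 0) : t = vertex R ord0.
Proof.
apply: val_inj; apply/rowP => j; rewrite ord1 /= mxE !eqxx.
by have := simplex_sum t; rewrite big_ord1.
Qed.

Lemma tame_cst k v : good m v -> tame m (fun _ : Delta k => v).
Proof. by move=> gv; split=> // t; apply: cst_continuous. Qed.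

Definition edge v g : Delta 1 -> X := cone_map m (fun _ : Delta 0 => v) g.

Lemma edge_tame v g : good m v -> nice g -> tame m (edge v g).
Proof. by move=> gv ng; apply: cone_tame => //; apply: tame_cst. Qed.

Definition edge_label v g : profree := label m (edge v g) (vertex R ord_max).

Lemma edge_label1 v t : good m v -> label m (edge v 1%g) t = 1%g.
Proof.
move=> gv; apply: label_const => //; first exact: edge_tame nice1.
have sd t' : sided (right_side v) (edge v 1%g t').
  rewrite /edge /cone_map /lam; case: ifP => _; last exact: push_sided.
  by rewrite (simplex0 (base_pt _)) label0 ?mulg1; [exact: geodesic_sided|exact: m8|exact: tame_cst].
by move=> M t1 t2; apply: trans_sided.
Qed.

Lemma vertex_lift k (i : 'I_k.+2) j : coface i (vertex R j) = vertex R (fintype.lift i j).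
Proof. exact: coface_vertex. Qed.

(** The labels along the edges of the cone over [tau] multiply. So the discrepancy between the word
    prescribed for an edge and the word it reads is the same at both ends of [tau]. *)
Lemma edge_labelM (tau : Delta 1 -> X) g : tame m tau -> nice g ->
  edge_label (tau (vertex R ord_max)) (g * label m tau (vertex R ord_max))%g =
  (edge_label (tau (vertex R ord0)) g * label m tau (vertex R ord_max))%g.
Proof.
move=> tt ng; set C := cone_map m tau g; have tC : tame m C by apply: cone_tame.
have l0 : fintype.lift ord0 ord0 = ord_max :> 'I_2 by apply: val_inj.
have f0 : C \o coface ord0 = tau by apply/funext => t; apply: cone_coface0.
have f1 : C \o coface (fintype.lift ord0 ord0) =
    edge (tau (vertex R ord_max)) (g * label m tau (vertex R ord_max))%g.
  apply/funext => t; rewrite /C /= cone_coface // vertex_lift l0.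
  congr (cone_map m _ _ t); apply/funext => t'.
  by rewrite /= (simplex0 t') vertex_lift l0.
have f2 : C \o coface (fintype.lift ord0 ord_max) = edge (tau (vertex R ord0)) g.
  have l1 : fintype.lift ord_max ord0 = ord0 :> 'I_2 by apply: val_inj.
  apply/funext => t; rewrite /C /= cone_coface // vertex_lift l1 label0 // mulg1.
  congr (cone_map m _ _ t); apply/funext => t'.
  by rewrite /= (simplex0 t') vertex_lift l1.
have e0 := label_face m8 ord0 (vertex R ord_max) tC.
have e1 := label_face m8 (fintype.lift ord0 ord0) (vertex R ord_max) tC.
have e2 := label_face m8 (fintype.lift ord0 ord_max) (vertex R ord_max) tC.
move: e0 e1 e2; rewrite f0 f1 f2 !vertex_lift /edge_label => -> -> ->.
have v00 : fintype.lift (fintype.lift ord0 ord0) ord0 = ord0 :> 'I_3 by apply: val_inj.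
have v01 : fintype.lift (fintype.lift ord0 ord_max) ord0 = ord0 :> 'I_3 by apply: val_inj.
have v1 : fintype.lift (fintype.lift ord0 ord_max) ord_max = fintype.lift ord0 ord0 :> 'I_3.
  by apply: val_inj.
have v2 : fintype.lift (fintype.lift ord0 ord0) ord_max = fintype.lift ord0 ord_max :> 'I_3.
  by apply: val_inj.
by rewrite v00 v01 v1 v2 label0 // invg1 !mul1g mulVKg.
Qed.

Lemma edge0 v g : good m v -> nice g -> edge v g (vertex R ord0) = origin R.
Proof.
move=> gv ng; apply: cone_apex => //; first exact: tame_cst.
have -> : bary (vertex R ord0 : Delta 1) 0 = 1 by rewrite /bary /= mxE !eqxx.
by lra.
Qed.

Lemma edge1 v g : good m v -> edge v g (vertex R ord_max) = v.
Proof.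
move=> gv; have -> : vertex R ord_max = coface ord0 (vertex R ord0) :> Delta 1.
  by rewrite vertex_lift; congr (vertex R _); apply: val_inj.
by rewrite /edge cone_coface0 //; apply: tame_cst.
Qed.

(** The group generated by the words of tame simplices. For its elements the edge with a prescribed
    word reads this word by an induction that analyses no explicit loop. *)
Inductive realizable : profree -> Prop :=
| realizable1 : realizable 1%g
| realizableM g k (sigma : Delta k -> X) t : realizable g -> tame m sigma ->
    realizable (g * label m sigma t)%g
| realizableMV g k (sigma : Delta k -> X) t : realizable g -> tame m sigma ->
    realizable (g * (label m sigma t)^-1)%g.

Lemma realizable_nice g : realizable g -> nice g.
Proof.
elim=> [|{}g k sigma t _ ng ts|{}g k sigma t _ ng ts]; first exact: nice1.
  by apply: niceM => //; apply: nice_label.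
by apply: niceM => //; apply/niceV/nice_label.
Qed.

Lemma realizable_mul g h : realizable g -> realizable h -> realizable (g * h)%g.
Proof.
move=> rg; elim=> [|{}h k sigma t _ rh ts|{}h k sigma t _ rh ts]; first by rewrite mulg1.
  by rewrite mulgA; apply: realizableM.
by rewrite mulgA; apply: realizableMV.
Qed.

Lemma realizable_label k (sigma : Delta k -> X) t : tame m sigma ->
  realizable (label m sigma t).
Proof. by move=> ts; rewrite -[label m sigma t]mul1g; apply: realizableM => //; apply: realizable1. Qed.

Lemma realizable_inv g : realizable g -> realizable g^-1%g.
Proof.
elim=> [|{}h k sigma t _ rh ts|{}h k sigma t _ rh ts]; first by rewrite invg1; apply: realizable1.
  rewrite invgM; apply: realizable_mul => //.
  by rewrite -[(label m sigma t)^-1%g]mul1g; apply: realizableMV => //; apply: realizable1.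
by rewrite invgM invgK; apply: realizable_mul => //; apply: realizable_label.
Qed.

(** The edge with the trivial word stays on one side of the axis. [edge_labelM] along such an edge
    moves the end point to the origin; along a path with the label of a given simplex it gives the
    induction step. *)
Lemma edge_labelE g v : realizable g -> good m v -> edge_label v g = g.
Proof.
have go : good m (origin R).
  have o : rho 2 0 = origin R by rewrite rho_out //; left.
  by rewrite -o; apply: rho_good.
have indep u h : good m u -> nice h -> edge_label u h = edge_label (origin R) h.
  move=> gu nh; have := @edge_labelM (edge u 1%g) h (edge_tame gu nice1) nh.
  by rewrite (edge1 1%g gu) (edge0 gu nice1) (edge_label1 _ gu) !mulg1.
pose path k (sigma : Delta k -> X) t (u : Delta 1) := sigma (seg (vertex R ord0) t (bary u ord_max)).
have pathP k (sigma : Delta k -> X) t : tame m sigma ->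
    tame m (path k sigma t) /\
    label m (path k sigma t) (vertex R ord_max) = label m sigma t.
  move=> ts; have [cs gs] := ts.
  have lip (u u' : Delta 1) : sdist (seg (vertex R ord0) t (bary u ord_max))
      (seg (vertex R ord0) t (bary u' ord_max)) <= 1 * sdist u u'.
    rewrite mul1r; apply: le_trans (sdist_seg _ _ _ _) _.
    by have := entry_le_norm (\val u - \val u') ord_max; rewrite !mxE.
  have tp : tame m (path k sigma t).
    split=> u; last exact: gs.
    have cseg : (fun u' : Delta 1 => seg (vertex R ord0) t (bary u' ord_max)) @ u -->
        seg (vertex R ord0) t (bary u ord_max).
      move=> A /nbhs_simplex[e e0 eA].
      suff : nbhs u [set u' | A (seg (vertex R ord0) t (bary u' ord_max))] by [].
      apply/nbhs_simplex; exists e => // u' uu'; apply: eA; apply: le_lt_trans (lip _ _) _.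
      by rewrite mul1r.
    exact: (cvg_comp _ _ cseg (cs _)).
  split=> //; rewrite (label_comp m8 ts tp ltr01 lip).
  have -> : bary (vertex R ord0 : Delta 1) ord_max = 0 by rewrite /bary /= mxE.
  have -> : bary (vertex R ord_max : Delta 1) ord_max = 1 by rewrite /bary /= mxE !eqxx.
  by rewrite seg0 seg1 label0 // invg1 mul1g.
move=> rg gv; rewrite indep //; last exact: realizable_nice.
elim: rg => [|{}g k sigma t rg IH ts|{}g k sigma t rg IH ts].
- exact: edge_label1.
- have [tp lp] := pathP _ _ t ts; have ng := realizable_nice rg; have [_ gp] := tp.
  have := edge_labelM tp ng; rewrite lp !indep // ?IH //.
  by apply: niceM => //; apply: nice_label.
have [tp lp] := pathP _ _ t ts; have ng := realizable_nice rg; have [_ gp] := tp.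
have nh : nice (g * (label m sigma t)^-1)%g by apply: niceM => //; apply/niceV/nice_label.
have := edge_labelM tp nh; rewrite lp mulgVK !indep // IH => e.
by apply: (mulIg (label m sigma t)); rewrite -e mulgVK.
Qed.

Lemma cone_label k (sigma : Delta k -> X) g : tame m sigma -> realizable g ->
  label m (cone_map m sigma g) (vertex R (fintype.lift ord0 ord0)) = g.
Proof.
move=> ts rg; have ng := realizable_nice rg.
elim: k sigma ts g rg ng => [|k IH] sigma ts g rg ng.
  have -> : sigma = (fun _ => sigma (vertex R ord0)).
    by apply/funext => t; rewrite {1}(simplex0 t).
  rewrite -[RHS](edge_labelE (v := sigma (vertex R ord0)) rg); last by have [] := ts.
  by rewrite /edge_label; congr (label _ _ (vertex R _)); apply: val_inj.
have tC : tame m (cone_map m sigma g) by apply: cone_tame.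
have l0 : fintype.lift ord_max ord0 = ord0 :> 'I_k.+2 by apply: val_inj.
have f : cone_map m sigma g \o coface (fintype.lift ord0 ord_max) =
    cone_map m (sigma \o coface ord_max) g.
  apply/funext => t; rewrite -[LHS]/(cone_map m sigma g (coface (fintype.lift ord0 ord_max) t)).
  by rewrite cone_coface // vertex_lift l0 label0 // mulg1.
have := label_face m8 (fintype.lift ord0 ord_max) (vertex R (fintype.lift ord0 ord0)) tC.
rewrite f IH //; last exact: tame_face.
rewrite !vertex_lift (_ : fintype.lift (fintype.lift ord0 ord_max) ord0 = ord0 :> 'I_k.+3); last by apply: val_inj.
rewrite label0 // invg1 mul1g => e; rewrite [RHS]e.
by congr (label _ _ (vertex R _)); apply: val_inj.
Qed.

End Realizable.

(** * Chains with word labels *)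

Section FreeExtension.
Local Open Scope ring_scope.
Variable K : choiceType.
Implicit Types (V : lmodType int) (c : {freeg K / int}).

Definition lin V (F : K -> V) : {freeg K / int} -> V := fglift F.

Lemma lin_is_additive V (F : K -> V) : additive (lin F).
Proof. exact: lift_is_additive. Qed.

HB.instance Definition _ V (F : K -> V) :=
  GRing.isAdditive.Build _ _ (lin F) (lin_is_additive F).

Lemma linU V (F : K -> V) x : lin F << x >> = F x.
Proof. by rewrite /lin liftU scale1r. Qed.

Lemma scale_sign n V (v : V) : (-1 : int) ^+ n *: v = if odd n then - v else v.
Proof. by rewrite -signr_odd; case: odd; rewrite ?expr0 ?expr1 ?scaleN1r ?scale1r. Qed.

Definition span (P : K -> Prop) c := forall x, coeff x c != 0 -> P x.

Lemma span0 P : span P 0. Proof. by move=> x; rewrite coeff0 eqxx. Qed.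

Lemma spanN P c : span P c -> span P (- c).
Proof. by move=> h x; rewrite coeffN oppr_eq0; apply: h. Qed.

Lemma spanD P c d : span P c -> span P d -> span P (c + d).
Proof.
move=> hc hd x; rewrite coeffD; have [c0|nc0] := eqVneq (coeff x c) 0; last by move=> _; apply: hc.
by rewrite c0 add0r; apply: hd.
Qed.

Lemma spanB P c d : span P c -> span P d -> span P (c - d).
Proof. by move=> hc hd; apply: spanD => //; apply: spanN. Qed.

Lemma spanU (P : K -> Prop) x : P x -> span P << x >>.
Proof. by move=> Px y; rewrite coeffU mul1r; case: (eqVneq x y) => [<-|_] //=; rewrite eqxx. Qed.

Lemma span_mulz P c (k : int) : span P c -> span P (c *~ k).
Proof.
move=> h x; rewrite raddfMz; have [e|nc _] := eqVneq (coeff x c) 0; last exact: h.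
by rewrite [X in X *~ _]e mul0rz eqxx.
Qed.

Lemma span_sum P (I : Type) (r : seq I) (Q : pred I) (F : I -> {freeg K / int}) :
  (forall i, Q i -> span P (F i)) -> span P (\sum_(i <- r | Q i) F i).
Proof. by move=> h; elim/big_ind: _ => //; [exact: span0|move=> *; apply: spanD]. Qed.

Lemma spanS (P Q : K -> Prop) c : (forall x, P x -> Q x) -> span P c -> span Q c.
Proof. by move=> PQ h x /h /PQ. Qed.

Lemma freeg_ext (V : zmodType) (A B : {additive {freeg K / int} -> V}) (P : K -> Prop) c :
  (forall x, P x -> A << x >> = B << x >>) -> span P c -> A c = B c.
Proof.
move=> h sc; rewrite -[c]freeg_sumE !raddf_sum /=.
apply: eq_big_seq => x; rewrite mem_dom => /sc /h e.
have -> : << coeff x c *g x >> = << x >> *~ coeff x c.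
  by rewrite freegU_mulz intz.
by rewrite !raddfMz e.
Qed.

End FreeExtension.

Lemma span_lin (K K' : choiceType) (P : K -> Prop) (Q : K' -> Prop)
    (F : K -> {freeg K' / int}) c :
  (forall x, P x -> span Q (F x)) -> span P c -> span Q (lin F c).
Proof.
move=> h sc; rewrite -[c]freeg_sumE raddf_sum /=; rewrite big_seq.
apply: span_sum => x; rewrite mem_dom => /sc /h e.
by rewrite -[<< _ *g _ >>]/(Freeg _) /lin liftU -[coeff x c]intz scaler_int; apply: span_mulz.
Qed.

Section AlternatingSums.
Local Open Scope ring_scope.
Variable V : zmodType.

Definition alt n (v : V) : V := if odd n then - v else v.

(** The cancellation behind [d d = 0], stated once for chains with words and for singular chains. *)
Lemma alt_double (N : nat) (F : nat -> nat -> V) :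
  (forall i j, (j < i <= N)%N -> F i j = F j i.-1) ->
  \sum_(i < N.+1) alt i (\sum_(j < N) alt j (F i j)) = 0.
Proof.
move=> FE; have altS k v : alt k.+1 v = - alt k v.
  by rewrite /alt /=; case: odd => //=; rewrite opprK.
have altC k l v : alt k (alt l v) = alt l (alt k v).
  by rewrite /alt; case: odd; case: odd.
have alt_sum k (I : finType) (f : I -> V) : alt k (\sum_i f i) = \sum_i alt k (f i).
  by rewrite /alt; case: odd; rewrite // sumrN.
under eq_bigr do rewrite alt_sum.
pose a i j := alt i (alt j (F i j)).
have split i : \sum_(j < N) a i j =
    \sum_(j < N) (if (j < i)%N then a i j else 0) + \sum_(j < N) (if (j < i)%N then 0 else a i j).
  by rewrite -big_split /=; apply: eq_bigr => j _; case: ifP; rewrite ?addr0 ?add0r.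
under eq_bigr do rewrite -/(a _ _) split.
rewrite big_split /= big_ord_recl /= big1 // add0r.
rewrite [X in _ + X]big_ord_recr /= [X in _ + (_ + X)]big1 => [|j _]; last by rewrite ltn_ord.
rewrite addr0 [X in _ + X]exchange_big /= -big_split big1 // => i _ /=.
rewrite -big_split big1 // => j _ /=.
rewrite /fintype.bump /= add1n ltnS; case: (leqP j i) => ij; rewrite ?addr0 //.
by rewrite /a FE /= ?ltnS ?ij ?ltn_ord // altS altC addNr.
Qed.

End AlternatingSums.

Section CoverChains.
Local Open Scope classical_set_scope.
Local Open Scope ring_scope.
Variable R : realType.
Notation X := (harmonic_archipelago R).
Notation Delta n := (set_type (std_simplex R n)).
Notation S n := (singular_simplex R X n).
Notation G := profree.
Notation KC n := {freeg (S n * G)%type / int}.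
Variable m : nat.
Hypothesis m8 : (8 <= m)%N.

Definition origin_cts k : S k := cst (origin R).

Definition bundle k (f : Delta k -> X) : S k :=
  xget (origin_cts k) [set s : S k | (s : Delta k -> X) = f].

Lemma bundleE k (f : Delta k -> X) : continuous f -> (bundle f : Delta k -> X) = f.
Proof.
move=> cf; rewrite /bundle; case: xgetP => // no.
by case: (no (mkcts cf : S k)).
Qed.

Lemma simplex_ext k (s s' : S k) : (s : Delta k -> X) = s' -> s = s'.
Proof. by move=> e; apply/continuousEP => t; rewrite e. Qed.

Definition tame_s k (s : S k) := tame m (s : Delta k -> X).

(** A pair [(s, g)] stands for a lift of [s] to a covering space, [g] being the word at its first
    vertex. A face with another first vertex must carry the word of that vertex. *)
Definition face k (i : 'I_k.+2) (x : S k.+1 * G) : S k * G :=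
  (singular_face i x.1, x.2 * label m x.1 (coface i (vertex R ord0)))%g.

Definition bgen k (x : S k.+1 * G) : KC k := \sum_(i < k.+2) alt i << face i x >>.

(** The apex lies over the origin and carries the word [h]. The edge to the first vertex of [x] has
    to read [h^-1 * x.2] for that vertex to keep its word. *)
Definition cone k (h : G) (x : S k * G) : S k.+1 * G :=
  (bundle (cone_map m x.1 (h^-1 * x.2)%g), h).
Definition cgen k (h : G) (x : S k * G) : KC k.+1 := << cone h x >>.

Definition admissible k (x : S k * G) := tame_s x.1 /\ realizable R m x.2.

Lemma label_vertex k (s : S k.+1) (i : 'I_k.+2) j : tame_s s ->
  label m (singular_face i s) (vertex R j) =
  ((label m s (vertex R (fintype.lift i ord0)))^-1 * label m s (vertex R (fintype.lift i j)))%g.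
Proof. by move=> ts; have := label_face m8 i (vertex R j) ts; rewrite !vertex_lift. Qed.

Lemma face_tame k (i : 'I_k.+2) (s : S k.+1) : tame_s s -> tame_s (singular_face i s).
Proof. exact: tame_face. Qed.

Lemma lift_lift k (i : 'I_k.+3) (j : 'I_k.+2) (j' : 'I_k.+3) (i' : 'I_k.+2) (l : 'I_k.+1) :
  j' = j :> nat -> i = i'.+1 :> nat -> (j <= i')%N ->
  fintype.lift i (fintype.lift j l) = fintype.lift j' (fintype.lift i' l).
Proof.
move=> ej ei ji; apply: ord_inj; rewrite /= ej ei /fintype.bump.
by move: (j : nat) (i' : nat) (l : nat) ji => a b c ab; do 4 case: leqP; lia.
Qed.

Lemma coface_coface k (i : 'I_k.+3) (j : 'I_k.+2) (j' : 'I_k.+3) (i' : 'I_k.+2)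
    (t : Delta k) :
  j' = j :> nat -> i = i'.+1 :> nat -> (j <= i')%N ->
  coface i (coface j t) = coface j' (coface i' t).
Proof.
move=> ej ei ji; have e1 : i = fintype.lift j' i'.
  by apply: ord_inj; rewrite /= ej ei /fintype.bump ji add1n.
have e2 : j' = fintype.lift i j.
  by apply: ord_inj; rewrite /= ej ei /fintype.bump ltnNge ji.
apply: val_inj; apply/rowP => c; rewrite /= !mxE.
case: (unliftP i c) => [c' ->|->].
  rewrite mxE; case: (unliftP j c') => [l ->|->].
    by rewrite (lift_lift l ej ei ji) liftK mxE liftK.
  by rewrite -e2 unlift_none.
by rewrite e1 liftK mxE unlift_none.
Qed.

Lemma face_face k (i : 'I_k.+3) (j : 'I_k.+2) (j' : 'I_k.+3) (i' : 'I_k.+2) x :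
  tame_s x.1 -> j' = j :> nat -> i = i'.+1 :> nat -> (j <= i')%N ->
  face j (face i x) = face i' (face j' x).
Proof.
move=> ts ej ei ji; rewrite /face /=; congr (_, _).
  by apply: simplex_ext; apply/funext => t; rewrite /= (coface_coface t ej ei ji).
rewrite !vertex_lift !label_vertex // -!mulgA !mulVKg.
by rewrite (lift_lift ord0 ej ei ji).
Qed.

Lemma boundary_bgen k (x : S k.+2 * G) : tame_s x.1 -> lin (@bgen k) (bgen x) = 0.
Proof.
case: x => s g /= ts.
have altr (V W : zmodType) (A : {additive V -> W}) n v : A (alt n v) = alt n (A v).
  by rewrite /alt; case: odd; rewrite ?raddfN.
pose F (i j : nat) : KC k := << face (inord j : 'I_k.+2) (face (inord i : 'I_k.+3) (s, g)) >>.
transitivity (\sum_(i < k.+3) alt i (\sum_(j < k.+2) alt j (F i j))).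
  rewrite /bgen raddf_sum; apply: eq_bigr => i _; rewrite altr /= linU; congr (alt _ _).
  by apply: eq_bigr => j _; rewrite /F !inord_val.
apply: alt_double => i j /andP[ji ik]; rewrite /F; congr << _ >>.
have i0 : (0 < i)%N by apply: leq_ltn_trans ji.
have jk : (j < k.+2)%N by apply: leq_trans ji ik.
by apply: face_face; rewrite //= !inordK //; move: ji ik i0 jk; clear; lia.
Qed.

Lemma altr (V W : zmodType) (A : {additive V -> W}) n v : A (alt n v) = alt n (A v).
Proof. by rewrite /alt; case: odd; rewrite ?raddfN. Qed.

Lemma face_cone k h (x : S k.+1 * G) (i : 'I_k.+2) : admissible x -> realizable R m h ->
  face (fintype.lift ord0 i) (cone h x) = cone h (face i x).
Proof.
case: x => s g [/= ts rg] rh.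
have rhg : realizable R m (h^-1 * g)%g.
  by apply: realizable_mul => //; apply: realizable_inv.
have nh := realizable_nice m8 rhg.
have tc : tame m (cone_map m s (h^-1 * g)%g) by apply: cone_tame.
have [cc _] := tc; have bE := bundleE cc.
rewrite /face /cone /=; congr (_, _).
  have tf := face_tame i ts.
  have [cc' _] : tame m (cone_map m (singular_face i s)
      (h^-1 * (g * label m s (coface i (vertex R ord0))))%g).
    apply: cone_tame => //; rewrite mulgA; apply: niceM => //; exact: nice_label.
  apply: simplex_ext; rewrite (bundleE cc'); apply/funext => t /=.
  by rewrite bE cone_coface // mulgA.
rewrite bE vertex_lift (_ : fintype.lift (fintype.lift ord0 i) ord0 = ord0 :> 'I_k.+3).
  by rewrite label0 // mulg1.
by apply: val_inj.
Qed.

Lemma face0_cone k h (x : S k * G) : admissible x -> realizable R m h ->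
  face ord0 (cone h x) = x.
Proof.
case: x => s g [/= ts rg] rh.
have rhg : realizable R m (h^-1 * g)%g.
  by apply: realizable_mul => //; apply: realizable_inv.
have nh := realizable_nice m8 rhg.
have tc : tame m (cone_map m s (h^-1 * g)%g) by apply: cone_tame.
have [cc _] := tc; have bE := bundleE cc.
rewrite /face /cone /=; congr (_, _).
  apply: simplex_ext; apply/funext => t /=.
  by rewrite bE cone_coface0.
by rewrite bE vertex_lift cone_label // mulVKg.
Qed.

Lemma face1_cone h (x : S 0 * G) : admissible x -> realizable R m h ->
  face (fintype.lift ord0 ord0) (cone h x) = (origin_cts 0, h).
Proof.
case: x => s g [/= ts rg] rh.
have rhg : realizable R m (h^-1 * g)%g.
  by apply: realizable_mul => //; apply: realizable_inv.
have nh := realizable_nice m8 rhg.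
have tc : tame m (cone_map m s (h^-1 * g)%g) by apply: cone_tame.
have [cc _] := tc; have bE := bundleE cc.
rewrite /face /cone /=; congr (_, _).
  apply: simplex_ext; apply/funext => t /=.
  by rewrite bE cone_coface_pt.
rewrite bE vertex_lift (_ : fintype.lift (fintype.lift ord0 ord0) ord0 = ord0 :> 'I_2).
  by rewrite label0 // mulg1.
by apply: val_inj.
Qed.

Lemma boundary_cone0 h (x : S 0 * G) : admissible x -> realizable R m h ->
  lin (@bgen 0) << cone h x >> = << x >> - << (origin_cts 0, h) >>.
Proof.
move=> ax rh; rewrite linU /bgen big_ord_recl big_ord_recl big_ord0 addr0.
by rewrite face0_cone // face1_cone.
Qed.

Lemma boundary_coneS k h (c : KC k.+1) : span (@admissible k.+1) c -> realizable R m h ->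
  lin (@bgen k.+1) (lin (cgen h) c) = c - lin (cgen h) (lin (@bgen k) c).
Proof.
move=> sc rh.
apply: (freeg_ext (A := lin (@bgen k.+1) \o lin (cgen h))
  (B := idfun \- (lin (cgen h) \o lin (@bgen k)))) sc => x ax /=.
rewrite !linU /bgen big_ord_recl face0_cone //; congr (_ + _).
rewrite raddf_sum -sumrN; apply: eq_bigr => i _.
have aS v : alt (fintype.lift ord0 i) v = - alt i v :> KC k.+1.
  by rewrite /alt lift0 /=; case: odd; rewrite ?opprK.
by rewrite aS face_cone // [in RHS]altr /= linU.
Qed.

Lemma admissible_cone k h (x : S k * G) : admissible x -> realizable R m h ->
  admissible (cone h x).
Proof.
case: x => s g [/= ts rg] rh; split=> //=.
have rhg : realizable R m (h^-1 * g)%g.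
  by apply: realizable_mul => //; apply: realizable_inv.
have tc : tame m (cone_map m s (h^-1 * g)%g).
  exact: (cone_tame m8 ts (realizable_nice m8 rhg)).
by have [cc _] := tc; rewrite /tame_s (bundleE cc).
Qed.

End CoverChains.

(** * Equivariant comparison of chains with words and chains on a tree *)

Section Contraction.
Local Open Scope classical_set_scope.
Local Open Scope ring_scope.
Variable R : realType.
Notation X := (harmonic_archipelago R).
Notation Delta n := (set_type (std_simplex R n)).
Notation S n := (singular_simplex R X n).
Notation G := profree.
Notation KC n := {freeg (S n * G)%type / int}.
Variable m : nat.
Hypothesis m8 : (8 <= m)%N.
Variables (r : nat) (t : nat -> G).
Hypothesis t_gen : forall j, (r <= j)%N -> t j = 1%g.
Hypothesis t_real : forall j, realizable R m (t j).

(** The map from the free group determined by the generators [t], later the finitely many words at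
    the vertices of a chain; its image [in_lab] is the group they generate. *)
Definition comb (x : free_group) : G := fun M => eval (fun j => t j M) x.
Definition in_lab (g : G) := exists x, g = comb x.

Lemma combM x y : comb (x * y)%g = (comb x * comb y)%g.
Proof. by apply/funext => M; apply: evalM. Qed.

Lemma in_lab1 : in_lab 1%g.
Proof. by exists 1%g. Qed.

Lemma in_labM g h : in_lab g -> in_lab h -> in_lab (g * h)%g.
Proof. by move=> [x ->] [y ->]; exists (x * y)%g; rewrite combM. Qed.

Lemma in_labV g : in_lab g -> in_lab g^-1%g.
Proof.
by move=> [x ->]; exists x^-1%g; apply/funext => M; rewrite profreeV /comb evalV.
Qed.

Lemma in_lab_gen j : in_lab (t j).
Proof.
exists (fletter (j, true)); apply/funext => M.
by rewrite /comb eval_fletter.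
Qed.

Lemma in_lab_real g : in_lab g -> realizable R m g.
Proof.
move=> [x ->]; elim/free_group_ind: x => [|x a IH]; first exact: realizable1.
rewrite combM; apply: realizable_mul => //.
have -> : comb (fletter a) = if a.2 then t a.1 else (t a.1)^-1%g.
  by apply/funext => M; rewrite /comb eval_fletter /eval_letter; case: ifP.
by case: ifP => _; [exact: t_real|apply: realizable_inv].
Qed.

Lemma in_lab_inj : exists N, forall g h, in_lab g -> in_lab h -> g N = h N -> g = h.
Proof.
have [||N NP] := @tower_injective r (fun j M => t j M).
- by move=> j M rj; rewrite t_gen.
- by move=> j M; have [c _ _] := realizable_nice m8 (t_real j); apply: c.
exists N => _ _ [x ->] [y ->] e; apply/funext => M.
apply: (mulIg (comb y M)^-1%g); rewrite mulgV.
have := NP (x * y^-1)%g; rewrite evalM evalV -/(comb x N) -/(comb y N).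
rewrite e mulgV => /(_ erefl M).
by rewrite evalM evalV.
Qed.

Definition level : nat := xget 0%N
  [set N | forall g h, in_lab g -> in_lab h -> g N = h N -> g = h].
Local Notation N := level.

Lemma level_inj g h : in_lab g -> in_lab h -> g N = h N -> g = h.
Proof.
rewrite /level; case: xgetP => [N' _ h'|no]; first exact: h'.
by have [N' N'P] := in_lab_inj; case: (no N').
Qed.

(* The group of labels acts freely on the free group; [quot] is an equivariant
   map back to that group, built from orbit representatives. *)
Definition orbit_rep (f : free_group) : free_group :=
  xget 1%g [set f' | exists2 h, in_lab h & f' = (h N * f)%g].
Definition quot (f : free_group) : G :=
  xget 1%g [set h | in_lab h /\ f = (h N * orbit_rep f)%g].

Lemma quot_spec f : in_lab (quot f) /\ f = (quot f N * orbit_rep f)%g.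
Proof.
rewrite /quot; case: xgetP => [h _ //|no].
have : [set f' | exists2 h, in_lab h & f' = (h N * f)%g] (orbit_rep f).
  rewrite /orbit_rep; case: xgetP => [f' _ //|no'].
  by case: (no' f); exists 1%g; [exact: in_lab1|rewrite profree1 mul1g].
case=> h lh e; case: (no h^-1%g); split; first exact: in_labV.
by rewrite e profreeV mulKg.
Qed.

Lemma in_lab_quot f : in_lab (quot f). Proof. by have [] := quot_spec f. Qed.

Lemma quotM h f : in_lab h -> quot (h N * f)%g = (h * quot f)%g.
Proof.
move=> lh; have eo : orbit_rep (h N * f)%g = orbit_rep f.
  rewrite /orbit_rep; congr (xget _ _); apply/seteqP; split=> f' /= [h' lh' ->].
    by exists (h' * h)%g; [exact: in_labM|rewrite profreeM mulgA].
  exists (h' * h^-1)%g; first by apply: in_labM => //; apply: in_labV.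
  by rewrite profreeM profreeV mulgA mulgVK.
have [l1 e1] := quot_spec (h N * f)%g; have [l2 e2] := quot_spec f.
apply: level_inj => //; first exact: in_labM.
apply: (mulIg (orbit_rep f)); rewrite -{1}eo -e1 profreeM -mulgA.
by rewrite -e2.
Qed.

Local Notation o0 := (origin_cts R 0).

(** [quot] sends the ends of a tree edge to two words, which a cone over the origin joins. The
    reversed edge gives minus the same cone, not the cone with the words exchanged, as [stepK]
    requires. *)
Definition step (f : free_group) (a : letter) : KC 1 :=
  if a.2 then << cone m (quot f) (o0, quot (f * fletter a)%g) >>
  else - << cone m (quot (f * fletter a)%g) (o0, quot f) >>.

Lemma stepK f a : step f a + step (f * fletter a)%g (flip a) = 0.
Proof.
by rewrite /step fletter_flip mulgK; case: a => i [] /=; rewrite ?subrr ?addNr.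
Qed.

Definition pathc : free_group -> KC 1 := potential step.

Lemma tame_origin k : tame_s m (origin_cts R k).
Proof.
apply: tame_cst; have o : rho 2 0 = origin R by rewrite rho_out //; left.
by rewrite -o; apply: rho_good.
Qed.

Lemma admissible_o f : admissible m (o0, quot f).
Proof. by split; [exact: tame_origin|apply/in_lab_real/in_lab_quot]. Qed.

Lemma real_quot f : realizable R m (quot f).
Proof. exact/in_lab_real/in_lab_quot. Qed.

Lemma span_path f : span (@admissible R m 1) (pathc f).
Proof.
elim/free_group_ind: f => [|f a IH]; first exact: span0.
rewrite /pathc (potentialM stepK); apply: spanD => //; rewrite /step.
case: ifP => _; last apply: spanN; apply: spanU; apply: admissible_cone => //;
  by [exact: admissible_o|exact: real_quot].
Qed.

Lemma boundary_path f : lin (@bgen R m 0) (pathc f)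
  = << (o0, quot f) >> - << (o0, quot 1%g) >>.
Proof.
elim/free_group_ind: f => [|f a IH]; first by rewrite raddf0 subrr.
rewrite /pathc (potentialM stepK) raddfD /= -/pathc IH /step.
case: ifP => _; rewrite ?raddfN /= boundary_cone0 //;
  try exact: admissible_o; try exact: real_quot.
  by rewrite addrC addrA subrK.
by rewrite opprB addrC addrA subrK.
Qed.

Definition shift k (h : G) (x : S k * G) : S k * G := (x.1, h * x.2)%g.
Definition act k (h : G) : KC k -> KC k := lin (fun x => << shift h x >>).

HB.instance Definition _ k h := GRing.isAdditive.Build _ _ (@act k h) (lin_is_additive _).

Lemma actU k h (x : S k * G) : act h << x >> = << shift h x >>.
Proof. exact: linU. Qed.

Lemma shift_cone k h l (x : S k * G) :
  shift h (cone m l x) = cone m (h * l)%g (shift h x).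
Proof. by rewrite /shift /cone /= invgM -mulgA mulKg. Qed.

Lemma shift_face k h (i : 'I_k.+2) x : shift h (face m i x) = face m i (shift h x).
Proof. by rewrite /shift /face /= mulgA. Qed.

Lemma act_bgen k h (x : S k.+1 * G) : act h (bgen m x) = bgen m (shift h x).
Proof.
rewrite /bgen raddf_sum; apply: eq_bigr => i _.
by rewrite altr /= actU shift_face.
Qed.

Lemma act_cone k h l (c : KC k) : act h (lin (cgen m l) c) = lin (cgen m (h * l)%g) (act h c).
Proof.
apply: (freeg_ext (A := @act _ h \o lin (cgen m l))
  (B := lin (cgen m (h * l)%g) \o @act _ h) (P := fun=> True)) => // x _.
rewrite -[LHS]/(act h (lin (cgen m l) << x >>)) -[RHS]/(lin (cgen m (h * l)%g) (act h << x >>)).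
by rewrite actU !linU /cgen actU shift_cone.
Qed.

Lemma act_step h f a : in_lab h -> act h (step f a) = step (h N * f)%g a.
Proof.
move=> lh; rewrite /step -mulgA !(quotM _ lh); case: ifP => _.
  by rewrite actU shift_cone.
by rewrite raddfN /= actU shift_cone.
Qed.

Lemma act_path h f : in_lab h -> act h (pathc f) = pathc (h N * f)%g - pathc (h N).
Proof.
move=> lh; elim/free_group_ind: f => [|f a IH].
  by rewrite raddf0 mulg1 subrr.
rewrite /pathc mulgA !(potentialM stepK) raddfD /= -/pathc IH act_step //.
by rewrite addrAC.
Qed.

(** A chain map through the tree: vertices go to points over the origin, edges to tree paths between
    the words of their ends, and higher simplices to 0 because a tree has dimension one. *)
Definition kappa k : S k * G -> KC k :=
  match k with
  | 0 => fun x => << (o0, quot (x.2 N)) >>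
  | 1 => fun x => pathc ((x.2 * label m x.1 (vertex R ord_max))%g N) - pathc (x.2 N)
  | _ => fun=> 0
  end.

(** Homotopy from [kappa] to the identity, built by coning. In positive degree the apex carries the
    word of [x] itself, so that the construction commutes with the action. *)
Fixpoint contr k : S k * G -> KC k.+1 :=
  match k with
  | 0 => fun x => cgen m (quot (x.2 N)) x
  | k'.+1 => fun x => lin (cgen m x.2) (<< x >> - kappa x - lin (@contr k') (bgen m x))
  end.

Definition good_s k (s : S k) := tame_s m s /\ forall j, in_lab (label m s (vertex R j)).
Definition good_pair k (x : S k * G) := good_s x.1 /\ in_lab x.2.

Lemma good_admissible k (x : S k * G) : good_pair x -> admissible m x.
Proof. by move=> [[ts _] lx]; split=> //; apply: in_lab_real. Qed.

Lemma good_s_face k (i : 'I_k.+2) (s : S k.+1) : good_s s -> good_s (singular_face i s).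
Proof.
move=> [ts ls]; split=> [|j]; first exact: face_tame.
by rewrite label_vertex //; apply: in_labM => //; apply: in_labV.
Qed.

Lemma good_face k (i : 'I_k.+2) (x : S k.+1 * G) : good_pair x -> good_pair (face m i x).
Proof.
move=> [gs lx]; split; first exact: good_s_face.
by rewrite /face /= vertex_lift; apply: in_labM => //; have [_] := gs.
Qed.

Lemma span_alt (K : choiceType) (P : K -> Prop) n (c : {freeg K / int}) :
  span P c -> span P (alt n c).
Proof. by rewrite /alt; case: odd => // sc; apply: spanN. Qed.

Lemma span_bgen k (x : S k.+1 * G) : good_pair x -> span (@good_pair k) (bgen m x).
Proof.
by move=> gx; apply: span_sum => i _; apply: span_alt; apply: spanU; apply: good_face.
Qed.

Lemma act_kappa k h (x : S k * G) : in_lab h -> act h (kappa x) = kappa (shift h x).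
Proof.
case: k x => [|[|k]] x lh /=; last by rewrite raddf0.
  by rewrite actU /shift /= profreeM (quotM _ lh).
by rewrite raddfB /= !act_path // !profreeM -!mulgA opprB addrA subrK.
Qed.

Lemma span_kappa k (x : S k * G) : good_pair x -> span (@admissible R m k) (kappa x).
Proof.
case: k x => [|[|k]] x gx /=; last exact: span0.
  by apply: spanU; apply: admissible_o.
by apply: spanB; apply: span_path.
Qed.

Lemma kappa_boundary k (x : S k.+1 * G) : good_pair x ->
  lin (@kappa k) (bgen m x) = lin (@bgen R m k) (kappa x).
Proof.
move=> [[ts ls] lx]; case: k x ts ls lx => [|[|k]] x ts ls lx.
- rewrite /= raddfB /= !boundary_path opprB addrA subrK.
  rewrite /bgen !big_ord_recl big_ord0 addr0 raddfD /= /alt /= raddfN /= !linU /=.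
  rewrite !vertex_lift (_ : fintype.lift ord0 ord0 = ord_max :> 'I_2); last exact: val_inj.
  rewrite (_ : fintype.lift ord_max ord0 = ord0 :> 'I_2); last exact: val_inj.
  by rewrite label0 // mulg1.
- rewrite raddf0 /bgen !big_ord_recl big_ord0 addr0 !raddfD /= /alt /= raddfN /= !linU /=.
  rewrite !vertex_lift !label_vertex // -!mulgA !mulVKg.
  rewrite (_ : fintype.lift ord0 ord_max = ord_max :> 'I_3); last exact: val_inj.
  rewrite (_ : fintype.lift (fintype.lift ord0 ord0) ord0 = ord0 :> 'I_3); last exact: val_inj.
  rewrite (_ : fintype.lift (fintype.lift ord0 ord0) ord_max = ord_max :> 'I_3); last exact: val_inj.
  rewrite (_ : fintype.lift (fintype.lift ord0 (fintype.lift ord0 ord0)) ord0 = ord0 :> 'I_3);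
    last exact: val_inj.
  rewrite (_ : fintype.lift (fintype.lift ord0 (fintype.lift ord0 ord0)) ord_max
    = fintype.lift ord0 ord0 :> 'I_3); last exact: val_inj.
  by rewrite opprB [X in _ + X = _]addrC !subrKA subrr.
- rewrite raddf0 /bgen raddf_sum big1 // => i _; by rewrite altr /= linU /alt; case: odd; rewrite ?oppr0.
Qed.

Definition lower k : S k * G -> KC k :=
  match k with
  | 0 => fun=> 0
  | k'.+1 => fun x => lin (@contr k') (bgen m x)
  end.

Lemma lower_bgen k (x : S k.+1 * G) : tame_s m x.1 -> lin (@lower k) (bgen m x) = 0.
Proof.
case: k x => [|k] x ts.
  by rewrite /bgen raddf_sum big1 // => i _; rewrite altr /= linU /alt; case: odd; rewrite ?oppr0.
have -> : lin (@lower k.+1) (bgen m x) = lin (@contr k) (lin (@bgen R m k) (bgen m x)).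
  rewrite /bgen !raddf_sum; apply: eq_bigr => i _.
  by rewrite !altr /= !linU.
by rewrite boundary_bgen // raddf0.
Qed.

(** By the previous degree [<< x >> - kappa x - lower x] is a cycle, and the cone over a cycle of
    positive degree has that cycle as its boundary. *)
Lemma contrP k (x : S k * G) : good_pair x -> span (@admissible R m k.+1) (contr x) /\
  lin (@bgen R m k) (contr x) = << x >> - kappa x - lower x.
Proof.
elim: k x => [|k IH] x gx.
  rewrite subr0; have ax := good_admissible gx; have rq := real_quot (x.2 N).
  by split; [apply: spanU; apply: admissible_cone|exact: boundary_cone0].
have rx : realizable R m x.2 by have [_ /in_lab_real] := gx.
set y := << x >> - kappa x - lin (@contr k) (bgen m x).
have sy : span (@admissible R m k.+1) y.
  apply: spanB; first apply: spanB.
  - by apply: spanU; apply: good_admissible.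
  - exact: span_kappa.
  - by apply: span_lin (span_bgen gx) => z gz; have [] := IH z gz.
split.
  by apply: span_lin sy => z az; apply: spanU; apply: admissible_cone.
have e : lin (@bgen R m k) (lin (@contr k) (bgen m x)) =
    bgen m x - lin (@kappa k) (bgen m x) - lin (@lower k) (bgen m x).
  apply: (freeg_ext (A := lin (@bgen R m k) \o lin (@contr k))
    (B := (idfun \- lin (@kappa k)) \- lin (@lower k))) (span_bgen gx) => z gz /=.
  by rewrite !linU; have [_ ->] := IH z gz.
have dy : lin (@bgen R m k) y = 0.
  rewrite /y; set u := lin (@contr k) _ in e *.
  rewrite raddfB /= raddfB /= e linU kappa_boundary // lower_bgen; last by have [[]] := gx.
  by rewrite subr0 subrr.
rewrite -[contr x]/(lin (cgen m x.2) y) boundary_coneS // dy raddf0 subr0.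
by [].
Qed.

Lemma act_contr k h (x : S k * G) : in_lab h -> good_pair x ->
  act h (contr x) = contr (shift h x).
Proof.
move=> lh; elim: k x => [|k IH] x gx.
  by rewrite /= /cgen actU shift_cone /shift /= profreeM (quotM _ lh).
rewrite /= act_cone; congr (lin _ _).
have e : act h (lin (@contr k) (bgen m x)) = lin (@contr k) (act h (bgen m x)).
  apply: (freeg_ext (A := @act _ h \o lin (@contr k)) (B := lin (@contr k) \o @act _ h))
    (span_bgen gx) => z gz.
  rewrite -[LHS]/(act h (lin (@contr k) << z >>)) -[RHS]/(lin (@contr k) (act h << z >>)).
  by rewrite actU !linU IH.
rewrite raddfB /= raddfB /= e actU (act_kappa x lh) act_bgen.
by [].
Qed.

Local Notation C k := (singular_chain R X k).

Definition proj k : KC k -> C k := lin (fun x => << x.1 >>).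
HB.instance Definition _ k := GRing.isAdditive.Build _ _ (@proj k) (lin_is_additive _).

Lemma proj_act k h (c : KC k) : proj (act h c) = proj c.
Proof.
apply: (freeg_ext (A := @proj k \o @act _ h) (B := @proj k) (P := fun=> True)) => // x _.
by rewrite -[LHS]/(proj (act h << x >>)) -[RHS]/(proj << x >>) actU /proj !linU.
Qed.

Lemma boundaryU k (s : S k.+1) :
  boundary (<< s >> : C k.+1) = \sum_(i < k.+2) alt i << singular_face i s >>.
Proof.
by rewrite /boundary liftU scale1r; apply: eq_bigr => i _; rewrite scale_sign.
Qed.

Lemma boundary_proj k (c : KC k.+1) : boundary (proj c) = proj (lin (@bgen R m k) c).
Proof.
apply: (freeg_ext (A := @boundary R X k \o @proj k.+1)
  (B := @proj k \o lin (@bgen R m k)) (P := fun=> True)) => // x _.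
rewrite -[LHS]/(boundary (proj << x >>)) -[RHS]/(proj (lin (@bgen R m k) << x >>)).
rewrite linU /proj linU boundaryU /bgen raddf_sum; apply: eq_bigr => i _.
by rewrite altr /= linU.
Qed.

Definition low k : C k -> C k.+1 := lin (fun s : S k => proj (contr (s, 1%g))).
HB.instance Definition _ k := GRing.isAdditive.Build _ _ (@low k) (lin_is_additive _).

(** Simplices are lifted with word 1 at the first vertex. The faces of the lift carry other words,
    but by equivariance these disappear under [proj]. In this degree [kappa] is 0. *)
Lemma low_boundary k (c : C k.+2) : span (@good_s k.+2) c ->
  boundary (low c) = c - low (boundary c).
Proof.
move=> sc; apply: (freeg_ext (A := @boundary R X k.+2 \o @low k.+2)
  (B := idfun \- (@low k.+1 \o @boundary R X k.+1))) sc => s gs.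
rewrite -[LHS]/(boundary (low << s >>))
  -[RHS]/(<< s >> - low (boundary (<< s >> : C k.+2))).
have gx : good_pair (s, 1%g : G) by split=> //; exact: in_lab1.
rewrite /low linU boundary_proj; have [_ ->] := contrP gx.
rewrite subr0 raddfB /= /proj linU -/(@proj k.+2) /=; congr (_ - _).
rewrite boundaryU /bgen !raddf_sum; apply: eq_bigr => i _.
rewrite !altr /= !linU -/(@proj k.+2).
have gf : good_pair (singular_face i s, 1%g : G).
  by split; [exact: good_s_face|exact: in_lab1].
have li : in_lab (label m s (coface i (vertex R ord0))).
  by rewrite vertex_lift; have [_] := gs.
have -> : face m i (s, 1%g : G) =
    shift (label m s (coface i (vertex R ord0))) (singular_face i s, 1%g : G).
  by rewrite /face /shift /= mul1g mulg1.
congr (alt _ _); move: (congr1 (@proj k.+2) (act_contr li gf)).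
by rewrite proj_act => ->.
Qed.

End Contraction.

Section Acyclicity.
Local Open Scope classical_set_scope.
Local Open Scope ring_scope.
Variable R : realType.
Notation X := (harmonic_archipelago R).
Notation Delta n := (set_type (std_simplex R n)).
Notation S n := (singular_simplex R X n).
Notation C k := (singular_chain R X k).

(* A peak has height 1, so near the origin, where the height is small, there
   are none, and away from it there are finitely many of them. *)
Lemma eventually_tame k (s : S k) : exists M, forall m, (M <= m)%N -> tame m (s : Delta k -> X).
Proof.
have cs : continuous (s : Delta k -> X) := @cts_fun _ _ s.
pose P (m : nat) (x : 'rV[R]_k.+1) :=
  forall t : Delta k, \val t = x -> forall m', (m <= m')%N -> good m' (s t).
have nc := (compact_near_coveringP _).1 (@compact_simplex R k).
have : \forall m \near \oo, std_simplex R k `<=` P m.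
  apply: nc => x Kx; pose t0 : Delta k := exist _ x (mem_set Kx).
  have peak n : (0 < n)%N -> height (0, centre R n) = 1 :> R.
    move=> n0; have hn : hill n (0, centre R n).
      by rewrite /hill /= /euclid_dist /= !subrr expr0n addr0 sqrtr0 ltW ?hill_radius_gt0.
    rewrite (height_hill (conj n0 hn)) bump_hill //.
    by rewrite /euclid_dist /= !subrr expr0n addr0 sqrtr0 mul0r subr0.
  have [N [A nA AP]] : exists N : nat, exists2 A : set X, nbhs (s t0) A &
      forall q, A q -> forall m', (N <= m')%N -> good m' q.
    have [y0|y0] := eqVneq (py (s t0)) 0.
      exists 1%N, [set q | height (pxy q) < 1 / 2].
        have h0 : height (pxy (s t0)) < 1 / 2.
          have -> : s t0 = origin R by apply: py_eq0.
          by rewrite pxy_origin height0; lra.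
        by have := @pz_continuous R (s t0) _ (lt_nbhsl h0); rewrite /=.
      move=> q /= hq m' m1 n mn xq yq; move: hq; rewrite pxyE xq yq peak; first lra.
      by apply: leq_trans mn.
    have yp : 0 < py (s t0) by rewrite lt_def y0 py_ge0.
    have [N NP] := inv_nat_small (divr_gt0 yp (ltr0Sn R 7)).
    exists N.+1, [set q | py (s t0) / 2 < py q].
      have h0 : py (s t0) / 2 < py (s t0) by lra.
      exact: (@py_continuous R (s t0) _ (lt_nbhsr h0)).
    move=> q /= hq m' Nm n mn _ yq; have n0 : (0 < n)%N by apply: leq_trans mn; apply: leq_trans Nm.
    have /andP[_ cl] := centre_bounds R n0.
    have := NP n (leq_trans (leq_trans (leqnSn N) Nm) mn).
    by move: cl hq yp; rewrite yq /ell; lra.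
  have /nbhs_simplex[e e0 eA] : nbhs t0 ((s : Delta k -> X) @^-1` A) by apply: cs.
  exists ([set y | `|x - y| < e], [set m | (N <= m)%N]).
    split; last by exists N.
    by apply: (iffRL (nbhs_normP (x : 'rV[R]_k.+1) _)); exists e.
  move=> [y m] [/= xy Nm] t ty m' mm'; apply: (AP _ _ m'); last exact: leq_trans mm'.
  by apply: eA; rewrite /sdist /= ty.
move=> [M _ MP]; exists M => m Mm; split=> // t.
by apply: (MP M _ (\val t)) => //=; exact/set_mem/valP.
Qed.

Theorem boundary_divisible k (c : C k.+2) (y : C k.+1) (p : nat) :
  boundary c = y *+ p -> exists d e, c = boundary d + e *+ p.
Proof.
move=> cy; have [M MP] : exists M, forall s, s \in dom c -> forall m, (M <= m)%N ->
    tame m (s : Delta k.+2 -> X).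
  elim: (dom c) => [|s ss [M MP]]; first by exists 0%N.
  have [M' M'P] := eventually_tame s; exists (maxn M M') => s'.
  rewrite inE => /predU1P[->|s's] m; rewrite geq_max => /andP[Mm M'm]; first exact: M'P.
  exact: MP.
pose m := maxn 8 M; have m8 : (8 <= m)%N by apply: leq_maxl.
have tm s : s \in dom c -> tame_s m s by move=> sc; apply: MP => //; apply: leq_maxr.
pose lab (s : S k.+2) j := label m (s : Delta k.+2 -> X) (vertex R j).
(* The words at all vertices of the simplices of [c]: finitely many, as the tower argument
   requires. *)
pose ls := flatten [seq [seq lab s j | j <- enum 'I_k.+3] | s <- dom c].
pose t j := nth (1%g : profree) ls j.
have t_gen j : (size ls <= j)%N -> t j = 1%g by move=> h; rewrite /t nth_default.
have t_real j : realizable R m (t j).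
  have [jl|/t_gen ->] := ltnP j (size ls); last exact: realizable1.
  have : t j \in ls by apply: mem_nth.
  move: (t j) => u /flattenP[l /mapP[s sc ->] /mapP[i _ ->]].
  by apply: realizable_label => //; apply: tm.
have gc : span (@good_s R m t k.+2) c.
  move=> s; rewrite -mem_dom => sc; split; first exact: tm.
  move=> j; have : lab s j \in ls.
    apply/flattenP; exists [seq lab s j | j <- enum 'I_k.+3].
      by apply: map_f.
    by apply: map_f; rewrite mem_enum.
  move=> /(nth_index (1%g : profree)) e.
  by have := in_lab_gen t (index (lab s j) ls); rewrite {2}/t e.
(* The simplices of [y] may lie outside the scope of [low_boundary]; on them only the additivity of
   [low] is used. *)
have := low_boundary m8 t_gen t_real gc; rewrite cy raddfMn /= => e.
by exists (low m t c), (low m t y); rewrite e subrK.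
Qed.

End Acyclicity.

(** * Labels of word paths *)

Section WordPathLabels.
Local Open Scope classical_set_scope.
Local Open Scope ring_scope.
Variable R : realType.
Notation X := (harmonic_archipelago R).
Notation Delta n := (set_type (std_simplex R n)).
Implicit Types (gam : R -> X) (a b c s : R).

Definition aff2 gam a b (t : Delta 1) : X := gam (a * bary t ord0 + b * bary t ord_max).
Definition aff3 gam a b c (t : Delta 2) : X :=
  gam (a * bary t ord0 + b * bary t (inord 1) + c * bary t ord_max).

Lemma bary1E (t : Delta 1) : bary t ord0 + bary t ord_max = 1.
Proof.
have := simplex_sum t; rewrite !big_ord_recl big_ord0 addr0.
by rewrite (_ : fintype.lift ord0 ord0 = ord_max :> 'I_2) //; apply: val_inj.
Qed.

Lemma aff_range a b (t : Delta 1) : a <= b -> a <= a * bary t ord0 + b * bary t ord_max <= b.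
Proof.
move=> ab; have e := bary1E t; have t0 : 0 <= bary t ord0 := simplex_ge0 t ord0.
have t1 : 0 <= bary t ord_max := simplex_ge0 t ord_max.
have -> : bary t ord0 = 1 - bary t ord_max by lra.
apply/andP; split; first by have := mulr_ge0 t1 (_ : 0 <= b - a); nra.
by have := mulr_ge0 t0 (_ : 0 <= b - a); nra.
Qed.

Variable m : nat.
Hypothesis m8 : (8 <= m)%N.

Definition tame_path gam := continuous gam /\ forall s, good m (gam s).

Section Path.
Variable gam : R -> X.
Hypothesis tg : tame_path gam.

Lemma aff2_tame a b : tame m (aff2 gam a b).
Proof.
have [cg gg] := tg; split=> t; last exact: gg.
have c : a * bary s ord0 + b * bary s ord_max @[s --> t] -->
    a * bary t ord0 + b * bary t ord_max.
  exact: (cvgD (cvg_scale (nbhs_filter t) (@coord_cvg _ _ t ord0))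
    (cvg_scale (nbhs_filter t) (@coord_cvg _ _ t ord_max))).
exact: (cvg_comp _ _ c (cg _)).
Qed.

Lemma aff3_tame a b c : tame m (aff3 gam a b c).
Proof.
have [cg gg] := tg; split=> t; last exact: gg.
have h : a * bary s ord0 + b * bary s (inord 1) + c * bary s ord_max @[s --> t] -->
    a * bary t ord0 + b * bary t (inord 1) + c * bary t ord_max.
  exact: (cvgD (cvgD (cvg_scale (nbhs_filter t) (@coord_cvg _ _ t ord0))
    (cvg_scale (nbhs_filter t) (@coord_cvg _ _ t (inord 1))))
    (cvg_scale (nbhs_filter t) (@coord_cvg _ _ t ord_max))).
exact: (cvg_comp _ _ h (cg _)).
Qed.

Definition plab a b : profree := label m (aff2 gam a b) (vertex R ord_max).

(** The triangle [aff3] factors through the line, and its three edges are the three paths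
    compared. *)
Lemma plabM a b c : plab a c = (plab a b * plab b c)%g.
Proof.
have ta := aff3_tame a b c.
have o1 : inord 1 = fintype.lift ord0 ord0 :> 'I_3 by apply: val_inj; rewrite /= inordK.
have o2 : ord_max = fintype.lift ord0 ord_max :> 'I_3 by apply: val_inj.
have p0 : ord0 = fintype.lift ord_max ord0 :> 'I_3 by apply: val_inj.
have p1 : inord 1 = fintype.lift ord_max ord_max :> 'I_3 by apply: val_inj; rewrite /= inordK.
have q0 : ord0 = fintype.lift (inord 1) ord0 :> 'I_3.
  by apply: val_inj; rewrite /= /fintype.bump inordK.
have q2 : ord_max = fintype.lift (inord 1) ord_max :> 'I_3.
  by apply: val_inj; rewrite /= /fintype.bump inordK.
have bl (i : 'I_3) j (t : Delta 1) : bary (coface i t) (fintype.lift i j) = bary t j.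
  by rewrite /bary /= mxE liftK.
have b0 (i : 'I_3) (t : Delta 1) : bary (coface i t) i = 0 by rewrite /bary /= mxE unlift_none.
have f0 : aff3 gam a b c \o coface ord0 = aff2 gam b c.
  apply/funext => t; rewrite /aff3 /aff2 /= b0 {1}o1 {1}o2 !bl.
  by rewrite mulr0 add0r.
have f1 : aff3 gam a b c \o coface (inord 1) = aff2 gam a c.
  apply/funext => t; rewrite /aff3 /aff2 /= b0 [in X in gam (a * X + _ + _)]q0.
  by rewrite [in X in gam (_ + c * X)]q2 !bl mulr0 addr0.
have f2 : aff3 gam a b c \o coface ord_max = aff2 gam a b.
  apply/funext => t; rewrite /aff3 /aff2 /= b0 [in X in gam (a * X + _ + _)]p0.
  by rewrite [in X in gam (_ + b * X + _)]p1 !bl mulr0 addr0.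
have e0 := label_face m8 ord0 (vertex R ord_max) ta.
have e1 := label_face m8 (inord 1) (vertex R ord_max) ta.
have e2 := label_face m8 ord_max (vertex R ord_max) ta.
move: e0 e1 e2; rewrite f0 f1 f2 !vertex_lift /plab => -> -> ->.
rewrite -q0 -q2 -p0 -p1 -o1 -o2 label0 // invg1 !mul1g mulVKg //.
Qed.

Lemma plab_along (P : free_group -> Prop) M a b : a <= b ->
  P 1%g -> (forall x y, P x -> P y -> P (x * y)%g) ->
  (forall s s', a <= s <= b -> a <= s' <= b -> P (trans m M (gam s) (gam s'))) ->
  P (plab a b M).
Proof.
move=> ab P1 PM Pt; have ta := aff2_tame a b.
have := @label_along R m m8 1 _ ta P M (vertex R ord0) (vertex R ord_max) P1 PM.
rewrite label0 // profree1 invg1 mul1g; apply=> r r'.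
by apply: Pt; apply: aff_range.
Qed.

Lemma plab_triv M a b : a <= b ->
  (forall s s', a <= s <= b -> a <= s' <= b -> trans m M (gam s) (gam s') = 1%g) ->
  plab a b M = 1%g.
Proof.
move=> ab h; apply: (plab_along (P := fun x => x = 1%g)) => // x y -> ->.
by rewrite mulg1.
Qed.

Lemma aff2_0 a b : aff2 gam a b (vertex R ord0) = gam a.
Proof. by rewrite /aff2 /bary /= !mxE !eqxx /= mulr1 mulr0 addr0. Qed.

Lemma aff2_1 a b : aff2 gam a b (vertex R ord_max) = gam b.
Proof. by rewrite /aff2 /bary /= !mxE !eqxx /= mulr1 mulr0 add0r. Qed.

Lemma plab_band M n a b : a <= b ->
  (forall s, a <= s <= b -> band m n (py (gam s))) ->
  plab a b M = if (n < M)%N then cross n (right_side (gam a)) (right_side (gam b)) else 1%g.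
Proof.
move=> ab bn; have ta := aff2_tame a b.
have zP t : sdist (vertex R ord0) t < 2 -> in_zone m 0 (Band n) (aff2 gam a b t).
  by move=> _; apply: bn; apply: aff_range.
have d2 : sdist (vertex R ord0) (vertex R ord_max : Delta 1) < 2.
  by apply: le_lt_trans (sdist_le1 _ _) _; rewrite ltr1n.
have := label_zone m8 ta zP d2 M; rewrite aff2_0 aff2_1 label0 // profree1 mul1g.
exact.
Qed.

End Path.

Lemma rho_sided n u : (2 <= n)%N -> sided (1 / 2 <= u) (rho n u : X).
Proof.
move=> n2; have l0 : 0 < ell R n by apply: ell_gt0; apply: ltnW.
have [/andP[b0 _] _] := bend_bounds u.
rewrite /sided /right_side px_rho // py_rho //; case: (leP (1 / 2) u) => h.
  by left; rewrite mulr_ge0 // mulr_ge0 ?(ltW l0) //; lra.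
move: b0; rewrite le_eqVlt => /orP[/eqP <-|b0]; first by right; rewrite mul0r.
by left; apply/negbTE; rewrite -ltNge pmulr_rlt0 // pmulr_llt0 //; lra.
Qed.

Lemma rho_mid n u : (2 <= n)%N -> 1 / 4 <= u <= 3 / 4 ->
  py (rho n u : X) = ell R n /\ right_side (rho n u : X) = (1 / 2 <= u).
Proof.
move=> n2 /andP[u1 u2]; have l0 : 0 < ell R n by apply: ell_gt0; apply: ltnW.
have b1 : bend u = 1.
  have h : `|2 * u - 1| <= 1 / 2 by rewrite ler_norml; lra.
  by rewrite /bend /chi min_l ?max_r //; lra.
rewrite /right_side px_rho // py_rho // b1 !mul1r; split=> //.
by rewrite pmulr_lge0 //; apply/idP/idP; lra.
Qed.

(** With the peaks from [m] on removed, everything above peak [m] is one band; so loops of index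
    below [m] are all read as the letter [m]. *)
Definition merged (i : nat) : nat := maxn i m.

Lemma merged_band n : (2 <= n)%N -> band m (merged n) (ell R n).
Proof.
move=> n2; rewrite /merged; have [mn|nm] := leqP m n.
  by apply: band_ell.
split=> //; last by left.
have m0 : (0 < m)%N by apply: leq_trans m8.
have /andP[_ h] := centre_bounds R m0; apply: lt_le_trans h _.
by apply: ell_le; [exact: ltnW|exact: ltnW].
Qed.

(** The first and the last quarter of the loop each stay on one side of the axis. The middle half
    runs at ordinate [ell n], inside one band, and crosses the axis once. *)
Lemma plab_rho gam M n (b : bool) a w : tame_path gam -> (2 <= n)%N -> 0 < w ->
  (forall s, a <= s <= a + w ->
    gam s = rho n (if b then (s - a) / w else 1 - (s - a) / w)) ->
  plab gam a (a + w) M = if (merged n < M)%N then fletter (merged n, b) else 1%g.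
Proof.
move=> tg n2 w0 gE; pose x s := (s - a) / w.
have xE y : x (a + y * w) = y by rewrite /x addrAC subrr add0r mulfK // gt_eqF.
have xle s s' : (x s <= x s') = (s <= s').
  by rewrite /x ler_pM2r ?invr_gt0 // lerD2r.
have e1 : a + 1 / 4 * w = a + w / 4 by lra.
have e3 : a + 3 / 4 * w = a + 3 * w / 4 by lra.
have x0 : x a = 0 by rewrite /x subrr mul0r.
have x1 : x (a + w / 4) = 1 / 4 by rewrite -e1 xE.
have x3 : x (a + 3 * w / 4) = 3 / 4 by rewrite -e3 xE.
have xw : x (a + w) = 1 by rewrite -[w in a + w]mul1r xE.
have l01 : a <= a + w / 4 by lra.
have l13 : a + w / 4 <= a + 3 * w / 4 by lra.
have l3w : a + 3 * w / 4 <= a + w by lra.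
rewrite (plabM tg a (a + w / 4)) (plabM tg (a + w / 4) (a + 3 * w / 4)) !profreeM.
have gs s : a <= s -> s <= a + w -> gam s = rho n (if b then x s else 1 - x s).
  by move=> h1 h2; apply: gE; rewrite h1 h2.
have T1 : plab gam a (a + w / 4) M = 1%g.
  apply: plab_triv => // s s' /andP[h1 h2] /andP[h1' h2'].
  have g1 : gam s = rho n (if b then x s else 1 - x s) by apply: gs => //; lra.
  have g2 : gam s' = rho n (if b then x s' else 1 - x s') by apply: gs => //; lra.
  move: h2 h2'; rewrite -[s <= _]xle -[s' <= _]xle x1 => h2 h2'.
  rewrite g1 g2; apply: (@trans_sided R m m8 (~~ b)).
    by rewrite (_ : ~~ b = (1 / 2 <= if b then x s else 1 - x s)); [exact: rho_sided|];
      case: b {gE gs g1 g2} => /=; apply/esym; [apply/negbTE; rewrite -ltNge|]; lra.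
  by rewrite (_ : ~~ b = (1 / 2 <= if b then x s' else 1 - x s')); [exact: rho_sided|];
    case: b {gE gs g1 g2} => /=; apply/esym; [apply/negbTE; rewrite -ltNge|]; lra.
have T3 : plab gam (a + 3 * w / 4) (a + w) M = 1%g.
  apply: plab_triv => // s s' /andP[h1 h2] /andP[h1' h2'].
  have g1 : gam s = rho n (if b then x s else 1 - x s) by apply: gs => //; lra.
  have g2 : gam s' = rho n (if b then x s' else 1 - x s') by apply: gs => //; lra.
  move: h1 h1'; rewrite -[_ <= s]xle -[_ <= s']xle x3 => h1 h1'.
  rewrite g1 g2; apply: (@trans_sided R m m8 b).
    by rewrite [X in sided X](_ : b = (1 / 2 <= if b then x s else 1 - x s)); [exact: rho_sided|];
      case: b {gE gs g1 g2} => /=; apply/esym; [|apply/negbTE; rewrite -ltNge]; lra.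
  by rewrite [X in sided X](_ : b = (1 / 2 <= if b then x s' else 1 - x s')); [exact: rho_sided|];
    case: b {gE gs g1 g2} => /=; apply/esym; [|apply/negbTE; rewrite -ltNge]; lra.
have mid s : a + w / 4 <= s <= a + 3 * w / 4 ->
    gam s = rho n (if b then x s else 1 - x s) /\ 1 / 4 <= (if b then x s else 1 - x s) <= 3 / 4.
  move=> /andP[h1 h3]; split; first by apply: gs => //; lra.
  by move: h1 h3; rewrite -[_ <= s]xle -[s <= _]xle x1 x3; case: b {gE gs T1 T3} => *; lra.
rewrite T1 T3 mul1g mulg1 (@plab_band gam tg M (merged n)) //; last first.
  by move=> s /mid[-> u]; have [-> _] := rho_mid n2 u; apply: merged_band.
case: ifP => // _.
have [g1 u1] := mid (a + w / 4) (introT andP (conj (lexx _) l13)).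
have [g3 u3] := mid (a + 3 * w / 4) (introT andP (conj l13 (lexx _))).
rewrite g1 g3 (rho_mid n2 u1).2 (rho_mid n2 u3).2 x1 x3 /cross.
case: b {gE gs T1 T3 mid g1 g3 u1 u3} => /=.
  rewrite (_ : (1 / 2 <= 1 / 4 :> R) = false); last by apply/negbTE; rewrite -ltNge; lra.
  by rewrite (_ : (1 / 2 <= 3 / 4 :> R) = true) //; lra.
rewrite (_ : (1 / 2 <= 1 - 1 / 4 :> R) = true); last by lra.
by rewrite (_ : (1 / 2 <= 1 - 3 / 4 :> R) = false) //; apply/negbTE; rewrite -ltNge; lra.
Qed.

Lemma tame_word_path g : nice g -> tame_path (word_path g : R -> X).
Proof.
move=> ng; split=> s.
  move=> A nA; have [I nI] := word_path_near ng nA.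
  by apply: (@filterS _ _ (nbhs_filter s) _ _ _ nI) => s' /= h; apply: h.
have o : rho 2 0 = origin R by rewrite rho_out //; left.
by case: (word_path_rho s ng) => [->|[n [u [n2 ->]]]]; rewrite -?o; apply: rho_good.
Qed.

(** At a large level the order of letters in the word is the order of their windows. Only finitely
    many letters have index below [M], so one level serves them all. *)
Lemma starts_sorted g M : nice g -> \forall M' \near \oo, forall i k i' k',
  (i < M)%N -> (i' < M)%N -> (k < count_label i (g M'))%N -> (k' < count_label i' (g M'))%N ->
  (exists u, before i k (word (g M')) = u ++ upto i' k' (word (g M'))) ->
  start R g i' k' + width R i' k' <= start R g i k.
Proof.
move=> ng; have [cg /choice[B BP] _] := ng.
pose Q (i k i' k' : nat) : set nat := [set M' | (k < count_label i (g M'))%N ->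
  (k' < count_label i' (g M'))%N ->
  (exists u, before i k (word (g M')) = u ++ upto i' k' (word (g M'))) ->
  start R g i' k' + width R i' k' <= start R g i k].
have H i k i' k' : \forall M' \near \oo, Q i k i' k' M'.
  have [h|h] := leP (start R g i' k' + width R i' k') (start R g i k).
    by near=> M' => _ _ _.
  have [hl|nhl] := pselect (has_letter g i k); last by near=> M' => kM; case: nhl; exists M'.
  have [hl'|nhl] := pselect (has_letter g i' k'); last by near=> M' => _ kM; case: nhl; exists M'.
  have E1 : \forall M' \near \oo, - width R i' k' <
      extent R M' (before i' k' (word (g M'))) - extent R M' (before i k (word (g M'))).
    apply: (cvgr_gt (start R g i' k' - start R g i k)); last by move: h; lra.
    exact: cvgB (start_cvg ng hl') (start_cvg ng hl).
  near=> M' => kM kM' [u uE].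
  have e' : extent R M' (upto i' k' (word (g M'))) =
      extent R M' (before i' k' (word (g M'))) + width R i' k'.
    have [-> eq] := uptoP kM'; rewrite extent_cons /= ?eq //.
    exact: cnt_lt kM'.
  have : extent R M' (upto i' k' (word (g M'))) <= extent R M' (before i k (word (g M'))).
    by rewrite uE; apply: extent_mono => j; rewrite count_cat leq_addl.
  have : - width R i' k' <
      extent R M' (before i' k' (word (g M'))) - extent R M' (before i k (word (g M'))) by near: M'.
  by rewrite e'; move: (extent _ _ _) (extent _ _ _) (width _ _ _) => x y z; lra.
have H2 : \forall M' \near \oo, forall i : 'I_M, forall k : 'I_(B i), forall i' : 'I_M,
    forall k' : 'I_(B i'), Q i k i' k' M'.
  have F1 (i : 'I_M) (k : 'I_(B i)) (i' : 'I_M) :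
      \forall M' \near \oo, forall k' : 'I_(B i'), Q i k i' k' M'.
    have := @filter_forall nat 'I_(B i') (fun k' : 'I_(B i') => Q i k i' k') \oo _.
    by apply=> k'; apply: H.
  have F2 (i : 'I_M) (k : 'I_(B i)) :
      \forall M' \near \oo, forall (i' : 'I_M) (k' : 'I_(B i')), Q i k i' k' M'.
    have := @filter_forall nat 'I_M
      (fun i' : 'I_M => [set M' | forall k' : 'I_(B i'), Q i k i' k' M']) \oo _.
    by apply=> i'; apply: F1.
  have F3 (i : 'I_M) : \forall M' \near \oo,
      forall (k : 'I_(B i)) (i' : 'I_M) (k' : 'I_(B i')), Q i k i' k' M'.
    have := @filter_forall nat 'I_(B i) (fun k : 'I_(B i) =>
      [set M' | forall (i' : 'I_M) (k' : 'I_(B i')), Q i k i' k' M']) \oo _.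
    by apply=> k; apply: F2.
  have := @filter_forall nat 'I_M (fun i : 'I_M =>
      [set M' | forall (k : 'I_(B i)) (i' : 'I_M) (k' : 'I_(B i')), Q i k i' k' M']) \oo _.
  by apply=> i; apply: F3.
apply: filterS H2 => M' H2 i k i' k' iM i'M kM kM'.
have kB : (k < B i)%N := leq_trans kM (BP i M').
have kB' : (k' < B i')%N := leq_trans kM' (BP i' M').
exact: (H2 (Ordinal iM) (Ordinal kB) (Ordinal i'M) (Ordinal kB')).
Unshelve. all: by end_near. Qed.

Lemma letters_ready g M : nice g -> \forall M' \near \oo, forall i k,
  (i < M)%N -> has_letter g i k ->
  (k < count_label i (g M'))%N /\ sign_of g i k = sign_at i k (word (g M')).
Proof.
move=> ng; have [cg /choice[B BP] _] := ng.
pose Q (i k : nat) : set nat := [set M' | has_letter g i k ->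
  (k < count_label i (g M'))%N /\ sign_of g i k = sign_at i k (word (g M'))].
have H i k : \forall M' \near \oo, Q i k M'.
  have [hl|nhl] := pselect (has_letter g i k); last by near=> M' => /nhl.
  have [N NP] := window_stable R ng hl; exists N => // M' /= NM' _.
  by have [kM e _] := NP M' NM'; split=> //; rewrite /sign_at e.
have F1 (i : 'I_M) : \forall M' \near \oo, forall k : 'I_(B i), Q i k M'.
  have := @filter_forall nat 'I_(B i) (fun k : 'I_(B i) => Q i k) \oo _.
  by apply=> k; apply: H.
have F2 : \forall M' \near \oo, forall (i : 'I_M) (k : 'I_(B i)), Q i k M'.
  have := @filter_forall nat 'I_M (fun i : 'I_M => [set M' | forall k : 'I_(B i), Q i k M']) \oo _.
  by apply=> i; apply: F1.
apply: filterS F2 => M' F2 i k iM hl.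
have kB : (k < B i)%N by have [M1 kM1] := hl; apply: leq_trans kM1 (BP i M1).
exact: (F2 (Ordinal iM) (Ordinal kB) hl).
Unshelve. all: by end_near. Qed.

Lemma word_path_closed g i k s : nice g -> has_letter g i k ->
  start R g i k <= s <= start R g i k + width R i k ->
  word_path g s = rho i (par g i k s) :> X.
Proof.
move=> ng hl /andP[s1 s2]; have [win|nwin] := pselect (in_window g s (i, k)).
  exact: word_pathE.
rewrite rho_out; last exact: par_out.
apply: word_path_out => -[i' k'] win; have [/= hl' /andP[h1 h2]] := win.
case: (start_ordered R ng hl hl') => [[e1 e2]|h|h].
- by apply: nwin; rewrite e1 e2.
- by have := lt_le_trans h2 (le_trans h s1); rewrite ltxx.
- by have := lt_le_trans h1 (le_trans s2 h); rewrite ltxx.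
Qed.

Lemma deep_word_path g M s : (m < M)%N -> nice g ->
  (forall i k, (i < M)%N -> has_letter g i k ->
    s <= start R g i k \/ start R g i k + width R i k <= s) ->
  deep m M (word_path g s : X).
Proof.
move=> mM ng h; have M1 : (0 < M.-1)%N by move: mM m8; clear; lia.
have /andP[c0 _] := centre_bounds R M1.
have c1 := lt_trans (ell_gt0 R (ltn0Sn _)) c0.
have [[[i k] win]|no] := pselect (exists ik, in_window g s ik); last first.
  rewrite word_path_out => [_|ik win]; last by apply: no; exists ik.
  by rewrite py_origin.
have [/= hl /andP[s1 s2]] := win; have i2 := letter_ge2 ng hl.
have [iM|Mi] := ltnP i M.
  case: (h i k iM hl) => h'; first by have := lt_le_trans s1 h'; rewrite ltxx.
  by have := lt_le_trans s2 h'; rewrite ltxx.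
rewrite (word_pathE ng win) => _.
have [_ /andP[_ yl]] := rho_bound (par g i k s) i2; apply: le_lt_trans yl _.
apply: le_lt_trans (ell_le R _ Mi) _; first exact: leq_ltn_trans mM.
by rewrite prednK in c0 => //; apply: leq_ltn_trans mM.
Qed.

Definition merge_letter M i : free_group :=
  if (merged i < M)%N then fletter (merged i, true) else 1%g.

Lemma upto_at (a : letter) (u v : seq letter) :
  upto a.1 (count (fun b : letter => b.1 == a.1) v) (u ++ a :: v) = a :: v.
Proof.
elim: u => /= [|b u ->]; first by rewrite !eqxx.
case: ifP => // /andP[_ /eqP]; rewrite count_cat /= eqxx => e.
by exfalso; move: e; lia.
Qed.

(** Induction on initial segments [v] of the word: at time [T] the windows of the letters of [v] of
    index below [M] are over and those of the others have not begun; between windows the path is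
    deep. A large level [M'] is needed because at level [M] letters that the path does read may have
    cancelled. *)
Lemma word_path_lab g M : (m < M)%N -> nice g -> \forall M' \near \oo,
  plab (word_path g) 0 1 M = eval_word (merge_letter M) (word (g M')).
Proof.
move=> mM ng; have tg := tame_word_path ng.
have near1 := starts_sorted M ng; have near2 := letters_ready M ng.
apply: filterS2 near1 near2 => M' so lr; set w := word (g M').
rewrite -/w in so lr.
have vis i : (merged i < M)%N = (i < M)%N by rewrite /merged gtn_max mM andbT.
pose c i (v : seq letter) := count (fun b : letter => b.1 == i) v.
have triv a b : a <= b -> (forall s, a <= s <= b -> deep m M (word_path g s : X)) ->
    plab (word_path g) a b M = 1%g.
  move=> ab h; apply: plab_triv => // s s' sab _.
  by apply: trans_deep_low; [exact: m8|exact: (h s sab)|].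
have key v : (exists u, w = u ++ v) -> exists T, [/\ 0 <= T <= 1,
    forall i k, (i < M)%N -> has_letter g i k -> (k < c i v)%N -> start R g i k + width R i k <= T,
    forall i k, (i < M)%N -> has_letter g i k -> (c i v <= k)%N -> T <= start R g i k &
    plab (word_path g) 0 T M = eval_word (merge_letter M) v].
  elim: v => [|a v IH] [u wE].
    exists 0; split=> //; [by rewrite lexx ler01| |].
      by move=> i k _ hl _; have [] := start_bounds R ng hl.
    by apply: triv => // s; rewrite -eq_le => /eqP <-; rewrite word_path_le0 // /deep py_origin => _;
      have M1 : (0 < M.-1)%N by [move: mM m8; clear; lia]; have /andP[c0 _] := centre_bounds R M1;
      apply: lt_trans c0; apply: ell_gt0.
  have [|T [T01 Tl Tr Tp]] := IH; first by exists (rcons u a); rewrite cat_rcons.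
  have [Ma|aM] := leqP M a.1.
    have cE i : (i < M)%N -> c i (a :: v) = c i v.
      by move=> iM; rewrite /c /=; case: eqP => // e; move: iM; rewrite -e ltnNge Ma.
    exists T; split=> // [i k iM hl|i k iM hl|]; rewrite ?cE //; [exact: Tl|exact: Tr|].
    by rewrite Tp /= /eval_letter /merge_letter vis ltnNge Ma /=; case: a.2; rewrite ?invg1 mulg1.
  set k0 := c a.1 v.
  have uE : upto a.1 k0 w = a :: v by rewrite wE; apply: upto_at.
  have kM0 : (k0 < count_label a.1 (g M'))%N.
    by rewrite /count_label -/w wE count_cat /= eqxx; move: (count _ u) => x; rewrite -/(c a.1 v) -/k0; lia.
  have hl0 : has_letter g a.1 k0 by exists M'.
  have [_ sg] := lr _ _ aM hl0; rewrite /sign_at uE /= in sg.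
  have [st0 st1] := start_bounds R ng hl0; have w0 := width_gt0 R a.1 k0.
  have Ts := Tr _ _ aM hl0 (leqnn _).
  have after i k : (i < M)%N -> has_letter g i k -> (c i (a :: v) <= k)%N ->
      start R g a.1 k0 + width R a.1 k0 <= start R g i k.
    move=> iM hl ck; have [kM _] := lr _ _ iM hl.
    case: (upto_total kM kM0) => [[e1 e2]|h|[u' h]].
    - by move: ck; rewrite e2 e1 /c /= eqxx /k0 /c; lia.
    - exact: so h.
    - move: h; rewrite {1}/before uE /= => vE.
      have [eu eb] := uptoP kM; move: ck; rewrite /c /= vE count_cat eu /= eqxx eb; lia.
  exists (start R g a.1 k0 + width R a.1 k0); split.
  - by rewrite st1 andbT; lra.
  - move=> i k iM hl; rewrite /c /=; have [e|ne] := eqVneq a.1 i.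
      rewrite add1n ltnS leq_eqVlt => /orP[/eqP e'|kv].
        by move: e'; rewrite -e -/(c a.1 v) -/k0 => ->.
      by have := Tl i k iM hl kv; lra.
    by rewrite add0n => kv; have := Tl i k iM hl kv; lra.
  - exact: after.
  rewrite (plabM tg 0 T) profreeM Tp (plabM tg T (start R g a.1 k0)) profreeM triv //; last first.
    move=> s /andP[s1 s2]; apply: deep_word_path => // i k iM hl.
    have [kv|vk] := ltnP k (c i v); first by right; apply: le_trans s1; apply: Tl.
    have [kv|vk'] := ltnP k (c i (a :: v)); last first.
      by left; have := after i k iM hl vk'; lra.
    move: kv vk; rewrite /c /=; have [e|ne] := eqVneq a.1 i; last by rewrite add0n => h1 h2; exfalso; lia.
    by rewrite add1n ltnS => h1 h2; left; rewrite -e (_ : k = k0) // /k0 /c; apply/eqP; rewrite eqn_leq -e in h1 h2 *; rewrite h1 h2.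
  rewrite mul1g (plab_rho M (b := a.2) tg (letter_ge2 ng hl0) w0) => [|s sab].
    rewrite vis aM /= /eval_letter /merge_letter vis aM; case: a.2 => //.
  by rewrite (word_path_closed ng hl0 sab) /par sg.
have [|T [/andP[T0 T1] Tl Tr Tp]] := key w; first by exists [::].
rewrite (plabM tg 0 T) profreeM Tp triv ?mulg1 //.
move=> s /andP[s1 s2]; apply: deep_word_path => // i k iM hl; right.
by apply: le_trans s1; apply: Tl => //; have [] := lr _ _ iM hl.
Unshelve. all: by end_near. Qed.

Lemma edge_origin g t : nice g -> edge m (origin R) g t = word_path g (3 * bary t ord_max - 1).
Proof.
move=> ng; have b0 : bary t 0 = 1 - bary t ord_max by rewrite -(bary1E t) addrK.
have nd : ~ in_diamond m (origin R).
  move=> [n [[mn cy _] _]]; have n0 : (0 < n)%N by apply: leq_trans mn; apply: leq_trans m8.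
  have /andP[h _] := centre_bounds R n0; have := lt_trans (lt_trans (ell_gt0 R (ltn0Sn n)) h) cy.
  by rewrite py_origin ltxx.
have go : good m (origin R).
  have o : rho 2 0 = origin R by rewrite rho_out //; left.
  by rewrite -o; apply: rho_good.
rewrite /edge /cone_map b0 subKr; case: ifP => h.
  rewrite /geodesic asboolF // /lam (simplex0 (base_pt t)) label0 ?mulg1 //.
  exact: tame_cst.
rewrite push_origin // word_path_ge1 //; move/negbT: h; rewrite -ltNge; lra.
Qed.

Lemma edge_aff2 g : nice g -> edge m (origin R) g = aff2 (word_path g) (- 1) 2.
Proof.
move=> ng; apply/funext => t; rewrite edge_origin // /aff2; congr (word_path _ _).
have -> : bary t ord0 = 1 - bary t ord_max by rewrite -(bary1E t) addrK.
by lra.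
Qed.

Lemma edge_label_word g M : (m < M)%N -> nice g -> \forall M' \near \oo,
  edge_label m (origin R) g M = eval_word (merge_letter M) (word (g M')).
Proof.
move=> mM ng; have tg := tame_word_path ng; apply: filterS (word_path_lab mM ng) => M' <-.
rewrite /edge_label edge_aff2 // -/(plab _ _ _) (plabM tg (- 1) 0) (plabM tg 0 1) !profreeM.
have lo : plab (word_path g) (- 1) 0 M = 1%g.
  apply: plab_triv; [exact: tg|by lra|].
  by move=> s s' /andP[_ s0] /andP[_ s0']; rewrite !word_path_le0 // trans_side.
have hi : plab (word_path g) 1 2 M = 1%g.
  apply: plab_triv; [exact: tg|by lra|].
  by move=> s s' /andP[s0 _] /andP[s0' _]; rewrite !word_path_ge1 // trans_side.
by rewrite lo hi mul1g mulg1.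
Qed.

Lemma high_trivial g M : coherent g -> labels_in (leq m) (g M) -> (M <= m)%N -> g M = 1%g.
Proof.
move=> cg lg Mm; apply: word_inj; rewrite /=.
case E : (word (g M)) => [|a v] //.
have aw : a \in word (g M) by rewrite E mem_head.
have := label_ltM cg aw; have /(_ _ aw)/= := allP lg; lia.
Qed.

(** Without letters below [m] nothing is merged, and [merge_letter] acts as the projection to level
    [M]. *)
Lemma edge_label_high g : nice g -> (forall M, labels_in (leq m) (g M)) ->
  edge_label m (origin R) g = g.
Proof.
move=> ng lg; apply/funext => M; have [cg _ _] := ng.
have go : good m (origin R).
  have o : rho 2 0 = origin R by rewrite rho_out //; left.
  by rewrite -o; apply: rho_good.
have te := edge_tame m8 go ng.
have [Mm|mM] := leqP M m.
  rewrite (high_trivial cg (lg M) Mm) high_trivial //.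
    exact: label_coherent.
  exact: label_labels.
have [N _ NP] := edge_label_word mM ng.
rewrite (NP (maxn N M)) /=; last exact: leq_maxl.
rewrite -(coherent_pr cg (leq_maxr N M)) /pr /eval.
have := lg (maxn N M); rewrite /labels_in; elim: (word _) => //= a v IH /andP[am /IH ->].
congr (_ * _)%g; rewrite /eval_letter /merge_letter /kill_from /merged (maxn_idPl am).
by case: ltnP.
Qed.

End WordPathLabels.

(** * Classes of loops *)

Section Quotients.
Local Open Scope ring_scope.
Local Open Scope quotient_scope.
Variables (V : zmodType) (I : zmodClosed V).
Local Notation Q := (Quotient.quot I).

Lemma quot_eq (x y : V) : \pi_Q x = \pi_Q y <-> x - y \in I.
Proof. by rewrite Quotient.idealrBE; split=> [->|/eqP]. Qed.

Lemma quotD (x y : V) : \pi_Q (x + y) = \pi_Q x + \pi_Q y.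
Proof. exact: (Quotient.pi_add I x y). Qed.

Lemma quotN (x : V) : \pi_Q (- x) = - \pi_Q x.
Proof. exact: (Quotient.pi_opp I x). Qed.

Lemma quot0 : \pi_Q (0 : V) = 0.
Proof. by apply: (addrI (\pi_Q (0 : V))); rewrite -quotD !addr0. Qed.

Lemma quotMn (x : V) n : \pi_Q (x *+ n) = \pi_Q x *+ n.
Proof. by elim: n => [|n IH]; rewrite ?mulr0n ?quot0 // !mulrS quotD IH. Qed.

Lemma quotP (q : Q) : exists x, q = \pi_Q x.
Proof. by exists (repr q); rewrite reprK. Qed.

End Quotients.

Lemma additive_freegE (K : choiceType) (V : zmodType) (A : {additive {freeg K / int} -> V})
    (c : {freeg K / int}) :
  (A c = \sum_(x <- dom c) A << x >> *~ coeff x c)%R.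
Proof.
rewrite -[in LHS](freeg_sumE c) raddf_sum /=; apply: eq_bigr => x _.
have -> : << coeff x c *g x >> = (<< x >> *~ coeff x c)%R by rewrite freegU_mulz intz.
by rewrite raddfMz.
Qed.

(** * Homology relations between loops, and exponent sums *)

Section WordHomology.
Local Open Scope classical_set_scope.
Local Open Scope ring_scope.
Variable R : realType.
Notation X := (harmonic_archipelago R).
Notation Delta n := (set_type (std_simplex R n)).
Notation S n := (singular_simplex R X n).
Notation C k := (singular_chain R X k).
Implicit Types (g h : profree).

Lemma rearrange1 (V : zmodType) (a b c : V) : a - b + c = c + a - b.
Proof. by rewrite addrAC [a + c]addrC. Qed.

Lemma rearrange2 (V : zmodType) (a b c d : V) :
  - ((c - a) + ((a + b - d) + d)) = - c - b.
Proof. by rewrite subrK addrA subrK opprD. Qed.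

Lemma rearrange3 (V : zmodType) (s a b v l : V) :
  (s - a + b) - (v - a + l) = s - (v - b) - l.
Proof. by rewrite opprD !opprB [s - _ + _]addrAC addrA subrKA addrA. Qed.

Lemma rearrange4 (V : zmodType) (a b c d : V) : - (a + b - c) + (b - d) = c - (a + d).
Proof. by rewrite opprB !opprD !addrA subrK. Qed.

(** Remembers the tameness of the bounding chain: for [m >= 8] the [index_map] of such a boundary
    vanishes from [m] on, not merely eventually. *)
Definition is_bd m k (c : C k) :=
  exists2 d, span (fun s : S k.+1 => tame_s m s) d & boundary d = c.

Lemma is_bdD m k (c d : C k) : is_bd m c -> is_bd m d -> is_bd m (c + d).
Proof. by move=> [x sx <-] [y sy <-]; exists (x + y); [exact: spanD|rewrite raddfD]. Qed.

Lemma is_bdN m k (c : C k) : is_bd m c -> is_bd m (- c).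
Proof. by move=> [x sx <-]; exists (- x); [exact: spanN|rewrite raddfN]. Qed.

Lemma tame_le m m' k (s : S k) : (m <= m')%N -> tame_s m s -> tame_s m' s.
Proof. by move=> mm [cs gs]; split=> // t n mn; apply: gs; apply: leq_trans mn. Qed.

Lemma boundary_boundary k (c : C k.+2) : boundary (boundary c) = 0.
Proof.
have -> : 0 = lin (fun=> 0 : C k) c.
  rewrite -[c]freeg_sumE raddf_sum /= big1 // => s _.
  by rewrite /lin liftU scaler0.
apply: (freeg_ext (A := @boundary R X k \o @boundary R X k.+1)
  (B := lin (fun=> 0 : C k)) (P := fun=> True)) => // s _.
rewrite -[LHS]/(boundary (boundary (<< s >> : C k.+2))) -[RHS]/(lin (fun=> 0 : C k) << s >>).
rewrite linU boundaryU raddf_sum.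
pose F (i j : nat) : C k :=
  << singular_face (inord j : 'I_k.+2) (singular_face (inord i : 'I_k.+3) s) >>.
transitivity (\sum_(i < k.+3) alt i (\sum_(j < k.+2) alt j (F i j))).
  apply: eq_bigr => i _; rewrite altr /= boundaryU; congr (alt _ _).
  by apply: eq_bigr => j _; rewrite /F !inord_val.
apply: alt_double => i j /andP[ji ik]; rewrite /F; congr << _ >>.
have i0 : (0 < i)%N by apply: leq_ltn_trans ji.
have jk : (j < k.+2)%N by apply: leq_trans ji ik.
apply: simplex_ext; apply/funext => t; congr (s _).
by apply: coface_coface; rewrite ?inordK //; move: ji ik i0 jk; clear; lia.
Qed.

Definition high m g := nice g /\ forall M, labels_in (leq m) (g M).

Lemma high1 m : high m 1%g. Proof. by split=> //; apply: nice1. Qed.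

Lemma highM m g h : high m g -> high m h -> high m (g * h)%g.
Proof. by move=> [ng lg] [nh lh]; split=> [|M]; [exact: niceM|exact: labels_inM]. Qed.

Lemma highV m g : high m g -> high m g^-1%g.
Proof. by move=> [ng lg]; split=> [|M]; [exact: niceV|exact: labels_inV]. Qed.

Lemma highS m m' g : (m <= m')%N -> high m' g -> high m g.
Proof.
move=> mm [ng lg]; split=> // M; apply: labels_inS (lg M) => i /=.
exact: leq_trans.
Qed.

Lemma good_origin m : (8 <= m)%N -> good m (origin R).
Proof.
move=> m8; have o : rho 2 0 = origin R by rewrite rho_out //; left.
by rewrite -o; apply: rho_good.
Qed.

Definition bedge m v g : S 1 := bundle (edge m v g).

Lemma bedgeE m v g : (8 <= m)%N -> good m v -> nice g ->
  (bedge m v g : Delta 1 -> X) = edge m v g.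
Proof. by move=> m8 gv ng; apply: bundleE; have [] := edge_tame m8 gv ng. Qed.

(** [loopE] gives the same loop for every [m >= 8], since at the origin the edge is just the word
    path. *)
Definition loop g : S 1 := bedge 8 (origin R) g.

Lemma loopE m g : (8 <= m)%N -> nice g -> loop g = bedge m (origin R) g.
Proof.
move=> m8 ng; apply: simplex_ext; rewrite !bedgeE //; try exact: good_origin.
by apply/funext => t; rewrite !edge_origin.
Qed.

Lemma cone_relation m (tau : S 1) g : (8 <= m)%N -> tame_s m tau -> nice g ->
  is_bd m (<< tau >>
    - << bedge m (tau (vertex R ord_max)) (g * label m tau (vertex R ord_max))%g >>
    + << bedge m (tau (vertex R ord0)) g >> : C 1).
Proof.
move=> m8 tt ng; have [ct gt] := tt.
have nl : nice (g * label m tau (vertex R ord_max))%g by apply: niceM => //; apply: nice_label.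
have [cc gc] := cone_tame m8 tt ng; have bE := bundleE cc.
have l0 : fintype.lift ord0 ord0 = ord_max :> 'I_2 by apply: val_inj.
have l1 : fintype.lift ord_max ord0 = ord0 :> 'I_2 by apply: val_inj.
have o2 : fintype.lift ord0 (fintype.lift ord0 ord0) = fintype.lift ord0 ord_max :> 'I_3.
  by apply: val_inj.
exists << bundle (cone_map m tau g) >>.
  by apply: spanU; rewrite /tame_s bE.
rewrite boundaryU !big_ord_recl big_ord0 addr0 /alt /= addrA.
congr (_ - _ + _); congr << _ >>; apply: simplex_ext; apply/funext => t /=.
- by rewrite bE cone_coface0.
- rewrite bedgeE // bE cone_coface // vertex_lift l0; congr (cone_map m _ _ t).
  by apply/funext => t'; rewrite /= (simplex0 t') vertex_lift l0.
- rewrite bedgeE // bE o2 cone_coface // vertex_lift l1 label0 // mulg1.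
  congr (cone_map m _ _ t).
  by apply/funext => t'; rewrite /= (simplex0 t') vertex_lift l1.
Qed.

(** [cone_relation] with [tau = loop h]. That [h] is [high] ensures that the label of this loop is
    [h] itself. *)
Lemma loopM m g h : (8 <= m)%N -> nice g -> high m h ->
  is_bd m (<< loop g >> + << loop h >> - << loop (g * h)%g >> : C 1).
Proof.
move=> m8 ng [nh lh]; have go := good_origin m8.
have lE := loopE m8 nh.
have th : tame_s m (loop h) by rewrite lE /tame_s bedgeE //; apply: edge_tame.
have := cone_relation m8 th ng.
have -> : label m (loop h) (vertex R ord_max) = h.
  by rewrite lE bedgeE // -/(edge_label _ _ _) edge_label_high.
have e0 : loop h (vertex R ord0) = origin R by rewrite lE bedgeE // edge0.
have e1 : loop h (vertex R ord_max) = origin R by rewrite lE bedgeE // edge1.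
rewrite e0 e1 -!(loopE m8) //; last exact: niceM.
by rewrite rearrange1.
Qed.

Lemma loop1 m : (8 <= m)%N -> is_bd m (<< loop 1%g >> : C 1).
Proof. by move=> m8; have := loopM m8 nice1 (high1 m); rewrite mulg1 addrK. Qed.

Lemma boundary_loop g : nice g -> boundary (<< loop g >> : C 1) = 0.
Proof.
move=> ng; have go := good_origin (leqnn 8).
rewrite boundaryU !big_ord_recl big_ord0 addr0 /alt /=; apply/eqP; rewrite subr_eq0; apply/eqP.
congr << _ >>; apply: simplex_ext; apply/funext => t /=.
rewrite (simplex0 t) !vertex_lift bedgeE //.
have l0 : fintype.lift ord0 ord0 = ord_max :> 'I_2 by apply: val_inj.
have l1 : fintype.lift ord_max ord0 = ord0 :> 'I_2 by apply: val_inj.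
by rewrite l0 l1 edge0 // edge1.
Qed.

Definition loop_like m (c : C 1) := exists2 h, high m h & is_bd m (c - << loop h >>).

Lemma loop_likeD m c d : (8 <= m)%N -> loop_like m c -> loop_like m d -> loop_like m (c + d).
Proof.
move=> m8 [g hg cg] [h hh dh]; exists (g * h)%g; first exact: highM.
have := loopM m8 hg.1 hh => e.
have := is_bdD (is_bdD cg dh) e; congr (is_bd _).
by rewrite [c - _ + (d - _)]addrACA -opprD addrA subrK.
Qed.

Lemma loop_likeN m c : (8 <= m)%N -> loop_like m c -> loop_like m (- c).
Proof.
move=> m8 [g hg cg]; exists g^-1%g; first exact: highV.
have e := loopM m8 hg.1 (highV hg); rewrite mulgV in e.
have := is_bdN (is_bdD cg (is_bdD e (loop1 m8))); congr (is_bd _).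
exact: rearrange2.
Qed.

Lemma loop_like0 m : (8 <= m)%N -> loop_like m 0.
Proof. by move=> m8; exists 1%g; [exact: high1|rewrite sub0r; apply/is_bdN/loop1]. Qed.

Lemma cycle_loop (z : C 1) m0 : boundary z = 0 ->
  exists2 m, (m0 <= m)%N & (8 <= m)%N /\ loop_like m z.
Proof.
move=> bz; have [M MP] : exists M, forall s, s \in dom z -> forall m, (M <= m)%N ->
    tame m (s : Delta 1 -> X).
  elim: (dom z) => [|s ss [M MP]]; first by exists 0%N.
  have [M' M'P] := eventually_tame s; exists (maxn M M') => s'.
  rewrite inE => /predU1P[->|s's] m; rewrite geq_max => /andP[Mm M'm]; first exact: M'P.
  exact: MP.
pose m := maxn m0 (maxn 8 M).
have m8 : (8 <= m)%N by rewrite /m !leq_max leqnn orbT.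
have Mm : (M <= m)%N by rewrite /m !leq_max leqnn !orbT.
exists m; [exact: leq_maxl|split=> //].
have sz : span (fun s : S 1 => tame_s m s) z by move=> s; rewrite -mem_dom => /MP; apply.
have go := good_origin m8.
(* Joins each vertex to the origin by the edge of the trivial word. On a cycle these edges cancel,
   and a simplex closed up by them is homologous to the loop of its word. *)
pose cap : C 0 -> C 1 := lin (fun p : S 0 => << bedge m (p (vertex R ord0)) 1%g >>).
have step (s : S 1) : tame_s m s -> loop_like m (<< s >> - cap (boundary (<< s >> : C 1))).
  move=> ts; have [_ gs] := ts; set v0 := s (vertex R ord0); set v1 := s (vertex R ord_max).
  set la := label m s (vertex R ord_max).
  have nla : nice la by apply: nice_label.
  exists la; first by split=> // M'; apply: label_labels.
  have -> : cap (boundary (<< s >> : C 1)) = << bedge m v1 1%g >> - << bedge m v0 1%g >>.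
    rewrite boundaryU !big_ord_recl big_ord0 addr0 /alt /= /cap raddfB /= !linU /= !vertex_lift.
    rewrite (_ : fintype.lift ord0 ord0 = ord_max :> 'I_2); last exact: val_inj.
    by rewrite (_ : fintype.lift ord_max ord0 = ord0 :> 'I_2); last exact: val_inj.
  have r1 := cone_relation m8 ts nice1; rewrite mul1g -/v0 -/v1 -/la in r1.
  have gv1 : good m v1 := gs _.
  have bE := bedgeE m8 gv1 nice1.
  have tv : tame_s m (bedge m v1 1%g) by rewrite /tame_s bE; apply: edge_tame nice1.
  have r2 := cone_relation m8 tv nla.
  have e0 : bedge m v1 1%g (vertex R ord0) = origin R by rewrite bE edge0 //; apply: nice1.
  have e1 : bedge m v1 1%g (vertex R ord_max) = v1 by rewrite bE edge1.
  have e2 : label m (bedge m v1 1%g) (vertex R ord_max) = 1%g by rewrite bE edge_label1.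
  rewrite e0 e1 e2 mulg1 -(loopE m8 nla) in r2.
  have := is_bdD r1 (is_bdN r2); congr (is_bd _).
  exact: rearrange3.
have mulz c (k : int) : loop_like m c -> loop_like m (c *~ k).
  move=> hc; have nat n : loop_like m (c *+ n).
    by elim: n => [|n IH]; rewrite ?mulr0n ?mulrS; [exact: loop_like0|exact: loop_likeD].
  by case: k => n; rewrite ?NegzE ?mulrNz; [exact: nat|apply: loop_likeN => //; exact: nat].
have E : z - cap (boundary z) =
    \sum_(s <- dom z) (<< s >> - cap (boundary (<< s >> : C 1))) *~ coeff s z.
  exact: (additive_freegE (idfun \- (lin _ \o @boundary R X 0)) z).
suff: loop_like m (z - cap (boundary z)) by rewrite bz /cap raddf0 subr0.
rewrite E big_seq.
elim/big_ind: _ => [|c d hc hd|s sz']; [exact: loop_like0|exact: loop_likeD|].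
by apply/mulz/step; apply: sz; rewrite -mem_dom.
Qed.

(** With the peaks from [j] on removed, band [j] is everything above peak [j], and at level [j.+1]
    no other letter is visible. So this counts signed crossings above peak [j]; on a loop it is a
    partial sum of exponents ([index_loop]). *)
Definition index_sum j (s : S 1) : int := expsum j (label j s (vertex R ord_max) j.+1).

Definition index_map (c : C 1) (j : nat) : int := lin (index_sum j : S 1 -> int^o) c.

Lemma index_mapD c d : index_map (c + d) = index_map c + index_map d.
Proof. by apply/funext => j; rewrite /index_map raddfD. Qed.

Lemma index_mapN c : index_map (- c) = - index_map c.
Proof. by apply/funext => j; rewrite /index_map raddfN. Qed.

Lemma expsumV j (x : free_group) : expsum j x^-1%g = - expsum j x.
Proof. by apply: (addrI (expsum j x)); rewrite -expsumM mulgV expsum1 subrr. Qed.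

Lemma index_boundary_tame j (d : C 2) : (8 <= j)%N -> span (fun s : S 2 => tame_s j s) d ->
  index_map (boundary d) j = 0.
Proof.
move=> j8 sd.
have -> : 0 = lin (fun=> 0 : int^o) d.
  by rewrite -[d]freeg_sumE raddf_sum /= big1 // => s _; rewrite /lin liftU scaler0.
apply: (freeg_ext (A := lin (index_sum j : S 1 -> int^o) \o @boundary R X 1)
  (B := lin (fun=> 0 : int^o))) sd => s ts.
rewrite -[LHS]/(lin (index_sum j : S 1 -> int^o) (boundary (<< s >> : C 2)))
  -[RHS]/(lin (fun=> 0 : int^o) << s >>) linU.
rewrite boundaryU !big_ord_recl big_ord0 addr0 /alt /= raddfD raddfD raddfN /= !linU /index_sum.
rewrite !label_vertex // !profreeM !profreeV !expsumM !expsumV.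
rewrite (_ : fintype.lift ord0 ord_max = ord_max :> 'I_3); last exact: val_inj.
rewrite (_ : fintype.lift (fintype.lift ord0 ord0) ord0 = ord0 :> 'I_3); last exact: val_inj.
rewrite (_ : fintype.lift (fintype.lift ord0 ord0) ord_max = ord_max :> 'I_3); last exact: val_inj.
rewrite (_ : fintype.lift (fintype.lift ord0 (fintype.lift ord0 ord0)) ord0 = ord0 :> 'I_3);
  last exact: val_inj.
rewrite (_ : fintype.lift (fintype.lift ord0 (fintype.lift ord0 ord0)) ord_max
    = fintype.lift ord0 ord0 :> 'I_3); last exact: val_inj.
by rewrite label0 // profree1 expsum1; lia.
Qed.

Lemma index_boundary (d : C 2) : exists J, forall j, (J <= j)%N -> index_map (boundary d) j = 0.
Proof.
have [M MP] : exists M, forall s, s \in dom d -> forall m, (M <= m)%N ->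
    tame m (s : Delta 2 -> X).
  elim: (dom d) => [|s ss [M MP]]; first by exists 0%N.
  have [M' M'P] := eventually_tame s; exists (maxn M M') => s'.
  rewrite inE => /predU1P[->|s's] m; rewrite geq_max => /andP[Mm M'm]; first exact: M'P.
  exact: MP.
exists (maxn 8 M) => j; rewrite geq_max => /andP[j8 Mj].
apply: index_boundary_tame => // s; rewrite -mem_dom => /MP; apply.
exact: Mj.
Qed.

Definition exponent g i : int := expsum i (g i.+1).

Lemma expsum_labels i x : labels_in (fun l => l != i) x -> expsum i x = 0.
Proof.
rewrite /labels_in /expsum /potential; elim: (word x) => //= a w IH /andP[ai /IH ->].
by rewrite (negPf ai) mul0r addr0.
Qed.

Lemma expsum_pr i M x : (i < M)%N -> expsum i (pr M x) = expsum i x.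
Proof.
move=> iM; elim/free_group_ind: x => [|x a IH]; first by rewrite pr1.
rewrite prM expsumM pr_letter IH expsum_letter; congr (_ + _).
case: ltnP => aM; first by rewrite -[fletter a]mul1g expsum_letter expsum1 add0r.
rewrite expsum1; case: eqP => [e|_]; last by rewrite mul0r.
by move: iM; rewrite -e ltnNge aM.
Qed.

Lemma exponentE g i M : coherent g -> (i < M)%N -> expsum i (g M) = exponent g i.
Proof. by move=> cg iM; rewrite /exponent -(coherent_pr cg iM) expsum_pr. Qed.

Lemma exponent_level g i M : coherent g -> exponent g i = 0 -> expsum i (g M) = 0.
Proof.
move=> cg e; have [iM|Mi] := ltnP i M; first by rewrite exponentE.
apply: expsum_labels; apply/allP => a ag /=.
by have := label_ltM cg ag => aM; rewrite neq_ltn (leq_trans aM Mi).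
Qed.

Lemma index_loop g j : nice g -> (8 <= j)%N ->
  index_map << loop g >> j = \sum_(i < j.+1) exponent g i.
Proof.
move=> ng j8; have [cg _ _] := ng; have go := good_origin j8.
rewrite /index_map linU /index_sum (loopE j8 ng) bedgeE // -/(edge_label _ _ _).
have [N _ NP] := edge_label_word R j8 (ltnSn j) ng.
pose M' := maxn N j.+1; rewrite (NP M') /=; last exact: leq_maxl.
have -> : \sum_(i < j.+1) exponent g i = \sum_(i < j.+1) expsum i (g M').
  by apply: eq_bigr => i _; rewrite exponentE // leq_max ltn_ord orbT.
move: (g M') => x; rewrite -[eval_word _ _]/(eval (merge_letter j j.+1) x).
elim/free_group_ind: x => [|x a IH]; first by rewrite big1 ?expsum1.
rewrite evalM expsumM IH eval_fletter.
under [RHS]eq_bigr do rewrite expsum_letter.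
rewrite big_split /=; congr (_ + _).
have lE b : expsum j (fletter (j, b)) = letter_sign (j, b).
  by rewrite -[fletter _]mul1g expsum_letter expsum1 eqxx mul1r add0r.
rewrite /eval_letter /merge_letter /merged; have [aj|ja] := leqP a.1 j.
  rewrite ltnSn (bigD1 (Ordinal (aj : a.1 < j.+1)%N)) //= eqxx mul1r big1 => [|i ia].
    by rewrite addr0; case: a aj => ai [] /= _; rewrite ?expsumV lE /letter_sign /= ?opprK.
  have -> : (a.1 == i :> nat) = false.
    by apply/negbTE; apply: contra ia => /eqP e; apply/eqP/val_inj.
  by rewrite mul0r.
rewrite ltnNge ja /= big1 => [|i _].
  by case: a.2; rewrite ?invg1 expsum1.
have -> : (a.1 == i :> nat) = false by rewrite gtn_eqF // (leq_ltn_trans _ ja) // -ltnS.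
by rewrite mul0r.
Qed.

Lemma loopX m g n : (8 <= m)%N -> high m g -> is_bd m (<< loop (g ^+ n)%g >> - << loop g >> *+ n : C 1).
Proof.
move=> m8 hg; elim: n => [|n IH]; first by rewrite mulr0n subr0; apply: loop1.
have hn : high m (g ^+ n)%g by elim: n {IH} => [|n IH]; rewrite ?expgS; [exact: high1|exact: highM].
have e := is_bdN (loopM m8 hg.1 hn); rewrite -expgS in e.
have := is_bdD e IH; congr (is_bd _).
by rewrite mulrS; apply: rearrange4.
Qed.

End WordHomology.

(** * Torsion-free cotorsion groups *)

Section Subgroups.
Local Open Scope ring_scope.

Record subgroup (V : zmodType) := Subgroup {
  carrier :> {pred V};
  carrier_closed : zmod_closed carrier
}.

HB.instance Definition _ V (S : subgroup V) :=
  GRing.isZmodClosed.Build V (carrier S) (carrier_closed S).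

Record subgroup_elt (V : zmodType) (S : subgroup V) := SubgroupElt {
  elt_val :> V;
  elt_in : elt_val \in carrier S
}.

HB.instance Definition _ V (S : subgroup V) := [isSub for @elt_val V S].
HB.instance Definition _ V (S : subgroup V) := [Choice of subgroup_elt S by <:].
HB.instance Definition _ V (S : subgroup V) :=
  [SubChoice_isSubZmodule of subgroup_elt S by <:].

Lemma subgroup_of (V : zmodType) (D : V -> Prop) : D 0 -> (forall x y, D x -> D y -> D (x - y)) ->
  exists S : subgroup V, forall x, x \in carrier S <-> D x.
Proof.
move=> D0 DB; have cl : zmod_closed [pred x | `[< D x >]].
  by split=> [|x y /asboolP Dx /asboolP Dy]; apply/asboolP => //; apply: DB.
by exists (Subgroup cl) => x; split=> [/asboolP|Dx] //; apply/asboolP.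
Qed.

Definition torsion_free (V : zmodType) :=
  forall (x : V) n, (0 < n)%N -> x *+ n = 0 -> x = 0.

(** The vanishing of lim^1 for towers of multiplications, equivalently the splitting of extensions
    by direct limits of copies of Z. These limits include the torsion-free groups of rank one. *)
Definition cotorsion (V : zmodType) := forall (g : nat -> V) (q : nat -> nat),
  (forall n, 0 < q n)%N -> exists x, forall n, x n = g n + x n.+1 *+ q n.

Lemma torsion_free_mulz (V : zmodType) (x : V) (k : int) :
  torsion_free V -> x *~ k = 0 -> k = 0 \/ x = 0.
Proof.
move=> tf; case: k => [[|n]|n]; first by left.
  by move/(tf _ _ (ltn0Sn n)); right.
by rewrite NegzE mulrNz => /eqP; rewrite oppr_eq0 => /eqP /(tf _ _ (ltn0Sn n)); right.
Qed.

Lemma pure_of_prime (V : zmodType) (D : V -> Prop) :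
  (forall q x, prime q -> D (x *+ q) -> D x) -> forall n x, (0 < n)%N -> D (x *+ n) -> D x.
Proof.
move=> h; elim/ltn_ind => n IH x n0; have [n1|n1] := leqP n 1.
  by have -> : n = 1%N by apply/eqP; rewrite eqn_leq n1.
have pp := pdiv_prime n1; rewrite -(divnK (pdiv_dvd n)) mulrnA => /(h _ _ pp); apply: IH.
  by rewrite ltn_Pdiv // prime_gt1.
by rewrite divn_gt0 ?pdiv_leq // prime_gt0.
Qed.

(* Every natural number occurs infinitely often as [logn 2 n], so that each divisibility which
   holds at some stage of the chain is eventually used. *)
Lemma rank_one_chain (Q : zmodType) (x : Q) : torsion_free Q ->
  exists z q, [/\ z 0%N = x, forall n, (0 < q n)%N /\ z n = z n.+1 *+ q n &
    forall y n m (k : int), (0 < n)%N -> y *+ n = z m *~ k -> exists m' k', y = z m' *~ k'].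
Proof.
move=> tf; pose s n := logn 2 n.
pose next n (u : Q) : Q * nat :=
  if pselect (exists y, u = y *+ s n /\ (0 < s n)%N) is left h then (projT1 (cid h), s n)
  else (u, 1%N).
have nextP n u : u = (next n u).1 *+ (next n u).2 /\ (0 < (next n u).2)%N.
  by rewrite /next; case: pselect => [h|_] //=; case: (cid h).
pose z := fix z n := if n is i.+1 then (next i (z i)).1 else x.
exists z, (fun n => (next n (z n)).2); split=> // [n|y n m k n0 e]; first by have [] := nextP n (z n).
pose P i := (0 < i)%N && `[< exists j k, y *+ i = z j *~ k >].
have exP : exists i, P i by exists n; rewrite /P n0; apply/asboolP; exists m, k.
case: (ex_minnP exP) => i /andP[i0 /asboolP[j [l yj]]] imin.
have adv d : exists l', y *+ i = z (j + d)%N *~ l'.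
  elim: d => [|d [l' E]]; first by exists l; rewrite addn0.
  exists ((next (j + d) (z (j + d))).2%:Z * l'); rewrite addnS E.
  by rewrite {1}(nextP (j + d)%N (z (j + d)%N)).1 pmulrn mulrzA.
(* A stage not before [j] at which division by [i] is tried, since [logn 2 a = i]. *)
pose a := (2 ^ i * j.*2.+1)%N.
have ja : (j <= a)%N.
  by apply: leq_trans (leq_pmull _ (expn_gt0 2 i)); rewrite -addnn -addnS leq_addr.
have sa : s a = i.
  rewrite /s /a lognM ?expn_gt0 // pfactorK // lognE /= dvdn2 /= odd_double /= addn0 //.
have [l' E] := adv (a - j)%N; rewrite subnKC // in E.
(* By torsion freeness a common factor could be cancelled, against the minimality of [i]. *)
have cop : coprimez i l'.
  rewrite /coprimez; set g := gcdz i l'.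
  have g0 : g != 0 by rewrite gcdz_eq0 negb_and eqz_nat -lt0n i0.
  have [gi gl] : (g %| i%:Z)%Z /\ (g %| l')%Z by split; [exact: dvdz_gcdl|exact: dvdz_gcdr].
  have gE : g = `|g|%N by rewrite gez0_abs.
  have gN : (`|g| %| i)%N by [].
  have gp : (0 < `|g|)%N by rewrite absz_gt0.
  have /imin : P (i %/ `|g|)%N.
    rewrite /P divn_gt0 // dvdn_leq //=; apply/asboolP; exists a, (l' %/ g)%Z.
    apply/eqP; rewrite -subr_eq0; apply/eqP/(tf _ `|g|%N) => //.
    rewrite mulrnBl -mulrnA divnK // E pmulrn -gE -mulrzA divzK // subrr //.
  move=> le; rewrite gE; apply/eqP; congr Posz; apply/eqP; rewrite eqn_leq gp andbT leqNgt.
  by apply/negP => g1; move: le; rewrite leqNgt ltn_Pdiv.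
have [[u v] /= uv] := coprimezP _ _ cop.
(* By Bezout, [z a] is [i] times a combination of [z a] and [y], so the division tried at this stage
   succeeds. *)
have nx : z a = (z a.+1) *+ i.
  have h : exists y0, z a = y0 *+ s a /\ (0 < s a)%N.
    exists (z a *~ u + y *~ v); rewrite sa; split=> //.
    rewrite -[LHS]mulr1z -uv mulrzDr mulrnDl !pmulrn -!mulrzA; congr (_ + _).
    transitivity (z a *~ l' *~ v); first by rewrite -mulrzA mulrC.
    by rewrite -E pmulrn -!mulrzA mulrC.
  rewrite /= /next; case: pselect => [h'|]; last by case.
  by rewrite /= -[in RHS]sa; case: (cid h') => y0 [].
exists a.+1, l'; apply/eqP; rewrite -subr_eq0; apply/eqP/(tf _ i) => //.
by rewrite mulrnBl E {1}nx !pmulrn -!mulrzA mulrC subrr.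
Qed.

End Subgroups.

(** * Extension of homomorphisms into cotorsion groups *)

Section Extension.
Local Open Scope classical_set_scope.
Local Open Scope ring_scope.
Variables H E : zmodType.
Implicit Types (G : set (H * E)%type).

(** Graph of a homomorphism to [E] from a subgroup of [H]. *)
Definition graph G :=
  [/\ G 0, forall p p', G p -> G p' -> G (p - p') & forall e, G (0, e) -> e = 0].

Definition pure_graph G :=
  graph G /\ forall x n e, (0 < n)%N -> G (x *+ n, e) -> exists e', G (x, e').

Lemma graphN G p : graph G -> G p -> G (- p).
Proof. by move=> [G0 GB _] Gp; rewrite -sub0r; apply: GB. Qed.

Lemma graphD G p p' : graph G -> G p -> G p' -> G (p + p').
Proof.
move=> gG Gp Gp'; rewrite -[p']opprK; have [_ GB _] := gG.
by apply: GB => //; apply: graphN.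
Qed.

Lemma graph_mulz G p (k : int) : graph G -> G p -> G (p *~ k).
Proof.
move=> gG Gp; have nat n : G (p *+ n).
  by elim: n => [|n IH]; rewrite ?mulr0n ?mulrS; [case: gG|exact: graphD].
by case: k => n; rewrite ?NegzE ?mulrNz; [exact: nat|apply: graphN => //; exact: nat].
Qed.

Lemma graph_uniq G x e e' : graph G -> G (x, e) -> G (x, e') -> e = e'.
Proof.
move=> [_ GB G1] h h'; apply/eqP; rewrite -subr_eq0; apply/eqP/G1.
by have := GB _ _ h h'; rewrite -[_ - _]/(x - x, e - e') subrr.
Qed.

Lemma pairMn (x : H) (e : E) n : (x, e) *+ n = (x *+ n, e *+ n).
Proof. by elim: n => // n IH; rewrite !mulrS IH. Qed.

Lemma pairE (x : H) (e : E) k : (x, e) *~ k = (x *~ k, e *~ k).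
Proof.
by case: k => n; rewrite ?NegzE ?mulrNz; rewrite -?pmulrn pairMn.
Qed.

(** Modulo the domain, [x0] lies in a pure subgroup of rank one, the union of a chain of cyclic
    groups. Choosing values on their generators is a system that [cotorsion] solves. *)
Lemma extend_rank_one G x0 : cotorsion E -> pure_graph G -> (forall e, ~ G (x0, e)) ->
  exists2 G', pure_graph G' & G `<=` G' /\ exists e, G' (x0, e).
Proof.
move=> ct [gG pG] x0G; have [G0 GB G1] := gG.
have [D DP] : exists S : subgroup H, forall x, x \in carrier S <-> exists e, G (x, e).
  apply: subgroup_of; first by exists 0.
  by move=> x y [e xe] [e' ye']; exists (e - e'); exact: (GB _ _ xe ye').
pose Q : zmodType := Quotient.quot (carrier D).
have piD x y : \pi_Q%qT x = \pi_Q%qT y <-> exists e, G (x - y, e).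
  by rewrite quot_eq DP.
have pi0 x : \pi_Q%qT x = 0 <-> exists e, G (x, e) by rewrite -quot0 piD subr0.
have tfQ : torsion_free Q.
  move=> u n n0; have [x ->] := quotP u; rewrite -quotMn !pi0 => -[e xe].
  exact: pG xe.
have [z [q [z0 zq zE]]] := rank_one_chain (\pi_Q%qT x0) tfQ.
pose w n : H := repr (z n).
have wz n : \pi_Q%qT (w n) = z n by rewrite /w reprK.
have piZ x (k : int) : \pi_Q%qT (x *~ k) = \pi_Q%qT x *~ k.
  by case: k => n; rewrite ?NegzE ?mulrNz ?quotN -!pmulrn quotMn.
have /choice[g gP] n : exists e, G (w n - w n.+1 *+ q n, e).
  by apply/piD; rewrite quotMn !wz; have [] := zq n.
have [e eP] := ct g q (fun n => (zq n).1).
have we n : G ((w n, e n) - (w n.+1, e n.+1) *+ q n).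
  have -> : (w n, e n) - (w n.+1, e n.+1) *+ q n = (w n - w n.+1 *+ q n, e n - e n.+1 *+ q n).
    by rewrite pairMn.
  by rewrite [e n]eP addrK.
have up n (k : int) j : exists k', forall p, G (p - (w n, e n) *~ k) ->
    G (p - (w (n + j)%N, e (n + j)%N) *~ k').
  elim: j => [|j [k' IH]]; first by exists k; rewrite addn0.
  exists ((q (n + j)%N)%:Z * k') => p /IH h; rewrite addnS.
  have := graphD gG h (graph_mulz k' gG (we (n + j)%N)); congr G.
  by rewrite mulrzBl addrA subrK pmulrn mulrzA.
pose G' := [set p | exists n (k : int), G (p - (w n, e n) *~ k)].
have GG' : G `<=` G' by move=> p Gp; exists 0%N, 0; rewrite mulr0z subr0.
have zn0 n : z n != 0.
  apply/eqP; elim: n => [|n IH]; first by rewrite z0 pi0 => -[e' /x0G].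
  by move=> e'; apply: IH; rewrite (zq n).2 e' mul0rn.
have gG' : graph G'.
  split=> [|p p' [n [k pk]] [n' [k' pk']]|e' [n [k h]]]; first exact: GG'.
    have [a ha] := up n k n'; have [b hb] := up n' k' n.
    exists (n + n')%N, (a - b); have := GB _ _ (ha _ pk) (hb _ pk'); congr G.
    by rewrite [(n' + n)%N]addnC mulrzBr !opprD addrACA.
  move: h; rewrite pairE -[_ - _]/(0 - _, e' - _) sub0r => h.
  have : \pi_Q%qT (- (w n *~ k)) = 0 by apply/pi0; exists (e' - e n *~ k).
  rewrite quotN => /eqP; rewrite oppr_eq0 piZ wz => /eqP /(torsion_free_mulz tfQ) [k0|e0].
    by move: h; rewrite k0 !mulr0z oppr0 subr0 => /G1.
  by have := zn0 n; rewrite e0 eqxx.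
exists G'; first split=> // x n e' n0 [m [k]].
  rewrite pairE -[_ - _]/(x *+ n - _, e' - _) => h.
  have : \pi_Q%qT x *+ n = z m *~ k.
    by rewrite -quotMn -wz -piZ; apply/piD; exists (e' - e m *~ k).
  case/(zE _ _ _ _ n0) => m' [k' xz].
  have [e'' h''] : exists e'', G (x - w m' *~ k', e'') by apply/piD; rewrite piZ wz.
  by exists (e'' + e m' *~ k'), m', k'; rewrite pairE -[_ - _]/(x - _, _ - _) addrK.
split=> //; have [e' h] : exists e', G (x0 - w 0%N, e') by apply/piD; rewrite wz z0.
by exists (e' + e 0%N), 0%N, 1; rewrite mulr1z -[_ - _]/(x0 - _, _ - _) addrK.
Qed.

Lemma extend_pure G : cotorsion E -> pure_graph G ->
  exists F : {additive H -> E}, forall x e, G (x, e) -> F x = e.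
Proof.
(* Zorn is applied to the sets added to [G], so that the empty chain is bounded. *)
move=> ct pG; pose P X := pure_graph (G `|` X).
have [A [PA maxA]] : exists A, P A /\ forall B, A `<` B -> ~ P B.
  apply: Zorn_bigcup => F FP tF.
  have two a b : (G `|` \bigcup_(X in F) X) a -> (G `|` \bigcup_(X in F) X) b ->
      exists2 Y, pure_graph Y & [/\ Y a, Y b & Y `<=` G `|` \bigcup_(X in F) X].
    have sub X : F X -> G `|` X `<=` G `|` \bigcup_(X in F) X.
      by move=> FX p [Gp|Xp]; [left|right; exists X].
    move=> [Ga|[X FX Xa]] [Gb|[Y FY Yb]].
    - by exists G; [|split=> // p Gp; left].
    - by exists (G `|` Y); [exact: FP|split; [left|right|exact: sub]].
    - by exists (G `|` X); [exact: FP|split; [right|left|exact: sub]].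
    - have [XY|YX] := tF _ _ FX FY.
        by exists (G `|` Y); [exact: FP|split; [right; apply: XY|right|exact: sub]].
      by exists (G `|` X); [exact: FP|split; [right|right; apply: YX|exact: sub]].
  split; first split.
  - by left; case: pG => -[].
  - by move=> p p' hp hp'; have [Y [[_ YB _] _] [Yp Yp' sY]] := two _ _ hp hp'; apply/sY/YB.
  - by move=> e he; have [Y [[_ _ Y1] _] [Ye _ _]] := two _ _ he he; apply: Y1.
  - move=> x n e n0 he; have [Y [_ pY] [Ye _ sY]] := two _ _ he he.
    by have [e' h] := pY _ _ _ n0 Ye; exists e'; apply: sY.
set M := G `|` A in PA; have [gM _] := PA; have [M0 MB M1] := gM.
have total x : exists e, M (x, e).
  apply: contrapT => nx; have nM e : ~ M (x, e) by move=> h; apply: nx; exists e.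
  have [G' pG' [MG' [e xe]]] := extend_rank_one ct PA nM.
  apply: (maxA G').
    split=> [p Ap|G'A]; first by apply: MG'; right.
    by apply: (nM e); right; apply: G'A.
  rewrite /P (_ : G `|` G' = G') //; apply/seteqP; split=> p; last by right.
  by case=> // Gp; apply: MG'; left.
have /choice[F FP] := total.
have Fadd : additive F.
  move=> x y; apply: (graph_uniq gM (FP _)).
  exact: (MB _ _ (FP x) (FP y)).
pose FA := HB.pack_for {additive H -> E} F (GRing.isAdditive.Build _ _ F Fadd).
by exists FA => x e xe; apply: (graph_uniq gM (FP _)); left.
Qed.

(** The domain is first enlarged by dividing by the primes that divide [E]; the values are unique
    since [E] is torsion free, and the new domain is pure. *)
Lemma extend_divisible G : cotorsion E -> torsion_free E -> graph G ->
  (forall q, prime q -> (forall e : E, exists e', e = e' *+ q) \/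
    forall x e, G (x *+ q, e) -> exists e', G (x, e')) ->
  exists F : {additive H -> E}, forall x e, G (x, e) -> F x = e.
Proof.
move=> ct tf gG dv; have [G0 GB G1] := gG.
pose dm m := (0 < m)%N /\ forall e : E, exists e', e = e' *+ m.
have dmM m n : dm m -> dm n -> dm (m * n)%N.
  move=> [m0 hm] [n0 hn]; split=> [|e]; first by rewrite muln_gt0 m0.
  by have [a ->] := hn e; have [b ->] := hm a; exists b; rewrite mulrnA.
pose G' := [set p | exists2 m, dm m & G (p *~ m)].
have GG' p : G p -> G' p.
  by move=> Gp; exists 1%N; rewrite ?mulr1z //; split=> // e; exists e.
suff pG' : pure_graph G'.
  by have [F FP] := extend_pure ct pG'; exists F => x e /GG' /FP.
split; first split; first exact: GG'.
- move=> p p' [m hm pm] [n hn pn]; exists (m * n)%N; first exact: dmM.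
  have := GB _ _ (graph_mulz n gG pm) (graph_mulz m gG pn); congr G.
  by rewrite -!mulrzA [X in _ - _ *~ X]mulrC -mulrzBl PoszM.
- move=> e [m [m0 _]]; rewrite pairE mul0rz => /G1; rewrite -pmulrn; exact: tf.
- move=> x n e n0 h.
  have := @pure_of_prime _ (fun x => exists e, G' (x, e)); apply; [|exact: n0|by exists e; exact: h].
  move=> q y pq [e1 [m hm]]; rewrite pairE -!pmulrn => xe.
  have [dq|pu] := dv q pq.
    have [e' ee'] := dq e1; exists e', (q * m)%N; first by apply: dmM => //; split=> //; apply: prime_gt0.
    by rewrite pairE -!pmulrn !mulrnA -ee'.
  rewrite mulrnAC in xe; have [e3 xe3] := pu _ _ xe; have [e2 e2E] := hm.2 e3.
  by exists e2, m => //; rewrite pairE -!pmulrn -e2E.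
Qed.

End Extension.

Section Evaluation.
Local Open Scope ring_scope.
Variables (K : choiceType) (V : zmodType) (F : K -> V).

Definition ev (c : {freeg K / int}) : V := lin (F : K -> zmodule V) c.

Lemma ev_is_additive : additive ev.
Proof. by move=> c d; apply: (raddfB (lin (F : K -> zmodule V))). Qed.

HB.instance Definition _ := GRing.isAdditive.Build _ _ ev ev_is_additive.

Lemma evU x : ev << x >> = F x.
Proof. exact: (linU (F : K -> zmodule V)). Qed.

Lemma evE c : ev c = \sum_(x <- dom c) F x *~ coeff x c.
Proof. by rewrite (additive_freegE ev c); apply: eq_bigr => x _; rewrite /= evU. Qed.

Lemma span_divide (P : K -> Prop) (c : {freeg K / int}) (p : nat) :
  span P c -> (forall x, (p %| coeff x c)%Z) -> exists2 c', c = c' *+ p & span P c'.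
Proof.
move=> sc pc; exists (\sum_(x <- dom c) << x >> *~ (coeff x c %/ p)%Z).
  rewrite -[LHS]freeg_sumE -sumrMnl; apply: eq_bigr => x _.
  by rewrite pmulrn -mulrzA divzK // freegU_mulz intz.
by rewrite big_seq; apply: span_sum => x; rewrite mem_dom => /sc Px; apply: span_mulz; apply: spanU.
Qed.

Lemma coeffMn (c : {freeg K / int}) (p : nat) x : (p %| coeff x (c *+ p))%Z.
Proof. by rewrite raddfMn /= -mulr_natr dvdz_mull // natz. Qed.

End Evaluation.

Section SequenceQuotient.
Local Open Scope ring_scope.
Local Open Scope classical_set_scope.
Notation A := product_mod_sum.
Definition seq_class (u : nat -> int) : A := \pi_A%qT u.

Lemma finitely_supportedP u :
  u \in finitely_supported <-> exists N, forall n, (N <= n)%N -> u n = 0.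
Proof.
split=> [/asboolP /finite_seqP[s sE]|[N NP]].
  exists (\max_(i <- s) i).+1 => n sn; apply/eqP/negP => /negP un.
  have : [set i | u i != 0] n by [].
  rewrite sE /= => ns; move: sn; rewrite ltnNge => /negP; apply.
  exact: (@leq_bigmax_seq _ s xpredT id).
apply/asboolP/(sub_finite_set _ (finite_II N)) => n /= /eqP un.
by rewrite ltnNge; apply/negP => /NP.
Qed.

Lemma seq_classP u v : seq_class u = seq_class v <-> exists N, forall n, (N <= n)%N -> u n = v n.
Proof.
rewrite (quot_eq finitely_supported) finitely_supportedP.
split=> -[N NP]; exists N => n /NP; rewrite !fctE; last by move=> ->; rewrite subrr.
by move/eqP; rewrite subr_eq0 => /eqP.
Qed.

Lemma seq_classD u v : seq_class (u + v) = seq_class u + seq_class v.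
Proof. exact: (quotD finitely_supported). Qed.
Lemma seq_classMn u n : seq_class (u *+ n) = seq_class u *+ n.
Proof. exact: (quotMn finitely_supported). Qed.
Lemma seq_class0 : seq_class 0 = 0. Proof. exact: (quot0 finitely_supported). Qed.
Lemma seq_class_surj (a : A) : exists u, a = seq_class u.
Proof. exact: (@quotP _ finitely_supported a). Qed.

HB.instance Definition _ := GRing.isAdditive.Build _ _ seq_class
  (fun u v => etrans (quotD finitely_supported u (- v))
    (congr1 (+%R (seq_class u)) (quotN finitely_supported v))).

Lemma product_mod_sum_torsion_free : torsion_free A.
Proof.
move=> a n n0; have [u ->] := seq_class_surj a.
rewrite -seq_classMn -seq_class0 => /seq_classP[N NP]; apply/seq_classP; exists N => i /NP.
by rewrite natmulfctE => /eqP; rewrite mulrn_eq0 (gtn_eqF n0) => /eqP.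
Qed.

(* If [g l m = 0] for [l > rho m], finite sums solve the system exactly. *)
Lemma diagonal_solution (T : Type) (rho : T -> nat) (g : nat -> T -> int) (q : nat -> nat) :
  (forall l m, (rho m < l)%N -> g l m = 0) ->
  exists x : nat -> T -> int, (forall k m, x k m = g k m + x k.+1 m *+ q k) /\
    forall k m, (forall l, g l m = 0) -> x k m = 0.
Proof.
move=> g0; pose y m := fix y n k := if n is n'.+1 then g k m + y n' k.+1 *+ q k else 0.
have yS m n k : (rho m < k + n)%N -> y m n.+1 k = y m n k.
  elim: n k => [|n IH] k; first by rewrite addn0 => km; rewrite /= g0 // mul0rn.
  by rewrite addnS -addSn => /IH E; rewrite /= -/(y m n.+1 k.+1) -[in RHS]E.
have ys m n k : (rho m < k + n)%N -> forall d, y m (n + d)%N k = y m n k.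
  move=> h; elim=> [|d IH]; first by rewrite addn0.
  by rewrite addnS yS // addnA (leq_trans h) // leq_addr.
exists (fun k m => y m (rho m).+1 k); split=> k m.
  by rewrite /= -/(y m (rho m).+1 k.+1) yS // addSn ltnS addnC leq_addr.
by move=> gm; elim: (rho m).+1 k => //= n IH k; rewrite gm IH mul0rn.
Qed.

(** Changing finitely many entries of each right-hand side makes the system triangular. *)
Lemma product_mod_sum_cotorsion : cotorsion A.
Proof.
move=> g q _; have /choice[u uP] n : exists u, g n = seq_class u by apply: seq_class_surj.
pose v l m := if (m < l)%N then 0 else u l m.
have vP l : g l = seq_class (v l).
  by rewrite uP; apply/seq_classP; exists l => m; rewrite /v ltnNge => ->.
have v0 l m : (m < l)%N -> v l m = 0 by rewrite /v => ->.
have [x [xE _]] := diagonal_solution (rho := id) q v0.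
exists (fun n => seq_class (x n)) => n; rewrite vP -seq_classMn -seq_classD.
by congr seq_class; apply/funext => m; rewrite xE fctE natmulfctE.
Qed.

End SequenceQuotient.

Section Small.
Local Open Scope ring_scope.

(** At most the cardinality of the continuum. The injection also supplies the indices of an almost
    disjoint family. *)
Definition small (T : Type) := exists f : T -> nat -> bool, injective f.

Lemma small_inj T T' (f : T -> T') : injective f -> small T' -> small T.
Proof. by move=> fi [g gi]; exists (g \o f); apply: inj_comp. Qed.

Lemma small_pow T : small T -> small (nat -> T).
Proof.
move=> [f fi]; exists (fun u n => if unpickle n is Some (i, j) then f (u i) j else false) => u v uv.
apply/funext => i; apply: fi; apply/funext => j.
by have := congr1 (fun h => h (pickle (i, j))) uv; rewrite pickleK.
Qed.

Lemma small_count (T : countType) : small T.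
Proof.
exists (fun x n => unpickle n == Some x) => x y xy.
have := congr1 (fun h => h (pickle x)) xy; rewrite pickleK eqxx => /esym /eqP[].
by move=> ->.
Qed.

Lemma product_mod_sum_small : small product_mod_sum.
Proof.
apply: (@small_inj _ (nat -> int) (fun a => repr a)).
  by move=> a b ab; rewrite -[a]reprK -[b]reprK ab.
exact/small_pow/small_count.
Qed.

End Small.

(** * The p-local part of the product modulo the sum *)

Section DivisiblePart.
Local Open Scope ring_scope.
Notation A := product_mod_sum.
Variable p : nat.
Hypothesis pP : (p == 0)%N || prime p.
Notation unitary m := (p^'.-nat m).

Lemma unitary_dvd m (k : int) : unitary m -> (p %| k * m%:Z)%Z -> (p %| k)%Z.
Proof.
move=> um; have m0 : (0 < m)%N by case/andP: um.
case/orP: pP => [/eqP ->|pr].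
  by rewrite !dvd0z mulf_eq0 => /orP[//|/eqP[m0']]; rewrite m0' in m0.
have cop : coprimez p m by apply: (pnat_coprime (pnat_id pr)).
by rewrite Gauss_dvdzl.
Qed.

Lemma unitary_divisible_closed :
  exists S : subgroup A, forall a, a \in carrier S <->
    forall m, unitary m -> exists b, a = b *+ m.
Proof.
apply: subgroup_of => [m _|x y hx hy m um]; first by exists 0; rewrite mul0rn.
by have [[b ->] [c ->]] := (hx m um, hy m um); exists (b - c); rewrite mulrnBl.
Qed.

Definition unitary_divisible := projT1 (cid unitary_divisible_closed).
Notation E := (subgroup_elt unitary_divisible).

Lemma unitary_divisibleP a : a \in carrier unitary_divisible <->
  forall m, unitary m -> exists b, a = b *+ m.
Proof. exact: (projT2 (cid unitary_divisible_closed) a). Qed.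

Lemma subgroup_torsion_free (V : zmodType) (S : subgroup V) :
  torsion_free V -> torsion_free (subgroup_elt S).
Proof.
move=> tf x n n0 e; apply: val_inj; apply: (tf _ n) => //.
by rewrite -[LHS](raddfMn val) e raddf0.
Qed.

Lemma E_divisible q : prime q -> q != p -> forall e : E, exists e', e = e' *+ q.
Proof.
move=> pq qp e; have /unitary_divisibleP eP := elt_in e.
have uq : unitary q by rewrite pnatE // inE /= inE.
have [b bE] := eP q uq.
have bP : b \in carrier unitary_divisible.
  apply/unitary_divisibleP => m um; have umq : unitary (m * q) by rewrite pnatM um.
  have [c cE] := eP _ umq; exists c; apply/eqP; rewrite -subr_eq0; apply/eqP.
  apply: (product_mod_sum_torsion_free (prime_gt0 pq)).
  by rewrite mulrnBl -bE cE mulrnA subrr.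
exists (SubgroupElt bP); apply: val_inj.
by rewrite -[RHS]/(val (SubgroupElt bP *+ q)) (raddfMn val).
Qed.

Definition unitary_fact n := ((n`!)`_p^')%N.

Lemma unitary_factP n : unitary (unitary_fact n). Proof. exact: part_pnat. Qed.

Lemma unitary_fact_gt0 n : (0 < unitary_fact n)%N.
Proof. by have /andP[] := unitary_factP n. Qed.

Lemma unitary_fact_dvd m n : unitary m -> (m <= n)%N -> (m %| unitary_fact n)%N.
Proof.
move=> um mn; have m0 : (0 < m)%N by case/andP: um.
by rewrite -(part_pnat_id um); apply: partn_dvd; rewrite ?fact_gt0 // dvdn_fact ?m0.
Qed.

Lemma unitary_factS n : unitary_fact n.+1 = ((n.+1)`_p^' * unitary_fact n)%N.
Proof. by rewrite /unitary_fact factS partnM ?fact_gt0. Qed.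

(** A solution in the whole group may leave the subgroup. It is sought in the form [z k *+ d k],
    with [d k] the prime-to-[p] part of [k!]; the rescaled system has coefficients [q n * s n], and
    unfolding it [n] times exhibits divisibility by [d (k + n)]. *)
Lemma E_cotorsion : cotorsion E.
Proof.
move=> g q q0; pose d := unitary_fact; pose s n := ((n.+1)`_p^')%N.
have s0 n : (0 < s n)%N by apply: part_gt0.
have /choice[r rP] k : exists r : nat -> A, forall j, val (g k) = r j *+ d j.
  have /unitary_divisibleP gP := elt_in (g k).
  by have /choice[r rP] j := gP _ (unitary_factP j); exists r.
have rS k j : r k j = r k j.+1 *+ s j.
  apply/eqP; rewrite -subr_eq0; apply/eqP.
  apply: (product_mod_sum_torsion_free (unitary_fact_gt0 j)).
  by rewrite mulrnBl -rP -mulrnA -unitary_factS -rP subrr.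
have qs n : (0 < q n * s n)%N by rewrite muln_gt0 q0 s0.
have [z zE] := product_mod_sum_cotorsion (fun n => r n n) qs.
(* [y n k] is the part of [x k] divided by [d (k + n)]. *)
pose y := fix y n k := if n is n'.+1 then r k (k + n)%N + y n' k.+1 *+ q k else z k.
have yS n k : y n k = y n.+1 k *+ s (k + n)%N.
  elim: n k => [|n IH] k.
    by rewrite /= addn0 addn1 mulrnDl -rS zE -!mulrnA.
  rewrite [in LHS]/= -/(y n k.+1) [in RHS]/= -/(y n.+1 k.+1) mulrnDl; congr (_ + _).
    by rewrite [(k + n.+2)%N]addnS -rS.
  by rewrite IH -!mulrnA mulnC addSnnS.
have yd k n : z k *+ d k = y n k *+ d (k + n)%N.
  elim: n => [|n IH]; first by rewrite addn0.
  by rewrite IH yS -mulrnA addnS /d unitary_factS.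
have xP k : z k *+ d k \in carrier unitary_divisible.
  apply/unitary_divisibleP => m um; rewrite (yd k m).
  have /dvdnP[c ->] : (m %| d (k + m))%N by apply: unitary_fact_dvd => //; apply: leq_addl.
  by exists (y m k *+ c); rewrite mulrnA.
exists (fun k => SubgroupElt (xP k)) => k; apply: val_inj.
transitivity (val (g k) + (z k.+1 *+ d k.+1) *+ q k); last first.
  by rewrite -[RHS]/(val (g k + SubgroupElt (xP k.+1) *+ q k)) raddfD (raddfMn val).
rewrite -[LHS]/(z k *+ d k) zE mulrnDl (rP k k); congr (_ + _).
by rewrite -!mulrnA /d unitary_factS; congr (_ *+ _); rewrite /s; lia.
Qed.

(* The sets [{n | prefix r n}] are infinite, and almost disjoint for distinct [r]. *)
Definition prefix (r : nat -> bool) (n : nat) : bool :=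
  if (unpickle n : option (seq bool)) is Some s then s == mkseq r (size s) else false.

(** The factor makes the class divisible by every [m] prime to [p], while staying prime to [p]
    itself. *)
Definition almost_disjoint r : A :=
  seq_class (fun n => (prefix r n * unitary_fact n)%:Z).

Lemma almost_disjoint_divisible r : almost_disjoint r \in carrier unitary_divisible.
Proof.
apply/unitary_divisibleP => m um.
exists (seq_class (fun n => (prefix r n * (unitary_fact n %/ m))%:Z)).
rewrite -seq_classMn; apply/seq_classP; exists m => n mn.
by rewrite natmulfctE pmulrn mulrzz -PoszM -mulnA divnK // unitary_fact_dvd.
Qed.

Lemma prefix_pickle r r' k : prefix r (pickle (mkseq r' k)) = (mkseq r k == mkseq r' k).
Proof. by rewrite /prefix pickleK size_mkseq eq_sym. Qed.

(** The relation is evaluated at the code of a long prefix of [rho x]: the other sequences vanish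
    there, and the remaining factor is prime to [p]. *)
Lemma almost_disjoint_free (K : choiceType) (rho : K -> nat -> bool) (c : {freeg K / int}) :
  injective rho -> (exists a, ev (almost_disjoint \o rho) c = a *+ p) ->
  forall x, (p %| coeff x c)%Z.
Proof.
move=> rhoI [a]; have [u ->] := seq_class_surj a; rewrite evE -seq_classMn => e x.
have [k0 k0P] : exists k0, forall k y, (k0 <= k)%N -> y \in dom c -> y != x ->
    mkseq (rho y) k != mkseq (rho x) k.
  elim: (dom c) => [|y s [k0 k0P]]; first by exists 0%N.
  have [->|yx] := eqVneq y x.
    by exists k0 => k y' kk; rewrite inE => /predU1P[->|y's]; [rewrite eqxx|exact: k0P].
  have [i ri] : exists i, rho y i != rho x i.
    apply: contrapT => h; move/eqP: yx; apply; apply: rhoI; apply/funext => i.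
    by apply/eqP/negPn/negP => ne; apply: h; exists i.
  exists (maxn k0 i.+1) => k y'; rewrite geq_max => /andP[kk ik].
  rewrite inE => /predU1P[->|y's y'x]; last exact: k0P.
  move=> _; apply/negP => /eqP E; move/eqP: ri; apply.
  by have := congr1 (fun s => nth false s i) E; rewrite !nth_mkseq.
have [N NP] : exists N, forall n, (N <= n)%N ->
    \sum_(y <- dom c) (prefix (rho y) n * unitary_fact n)%:Z *~ coeff y c = u n *+ p.
  have : seq_class (\sum_(y <- dom c)
      (fun n => (prefix (rho y) n * unitary_fact n)%:Z) *~ coeff y c) = seq_class (u *+ p).
    by rewrite -e raddf_sum /=; apply: eq_bigr => y _; rewrite raddfMz.
  move=> /seq_classP[N NP]; exists N => n /NP; rewrite natmulfctE => <-.
  have evn : additive (fun f : nat -> int => f n) by move=> f f'; rewrite !fctE.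
  pose F := HB.pack_for {additive (nat -> int) -> int} (fun f : nat -> int => f n)
    (GRing.isAdditive.Build _ _ (fun f : nat -> int => f n) evn).
  rewrite -[RHS]/(F (\sum_(y <- dom c)
      (fun n => (prefix (rho y) n * unitary_fact n)%:Z) *~ coeff y c)) raddf_sum.
  by apply: eq_bigr => y _; rewrite raddfMz.
(* Prefixes of different lengths have different codes, so one of these codes is at least [N]. *)
have [k kk Nk] : exists2 k, (k0 <= k)%N & (N <= pickle (mkseq (rho x) k))%N.
  apply: contrapT => h.
  have lt (i : 'I_N.+1) : (pickle (mkseq (rho x) (k0 + i)) < N)%N.
    by rewrite ltnNge; apply/negP => le; apply: h; exists (k0 + i)%N => //; apply: leq_addr.
  pose f' (i : 'I_N.+1) : 'I_N := Ordinal (lt i).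
  have f'I : injective f'.
    move=> i j /(congr1 val) /= /(pcan_inj pickleK) /(congr1 size); rewrite !size_mkseq.
    by move=> /addnI; apply: val_inj.
  by have := leq_card f' f'I; rewrite !card_ord ltnn.
have [cx|] := eqVneq (coeff x c) 0; first by rewrite cx dvdz0.
rewrite -mem_dom => xd; have := NP _ Nk; set n := pickle _.
rewrite (bigD1_seq x) ?uniq_dom //= big1_seq => [|y /andP[yx yd]].
  rewrite addr0 prefix_pickle eqxx mul1n mulrzz => e'.
  apply: (unitary_dvd (unitary_factP n)).
  by rewrite mulrC e' -mulr_natr natz dvdz_mull.
by rewrite /n prefix_pickle (negPf (k0P _ _ kk yd yx)) mul0n mul0rz.
Qed.

End DivisiblePart.

(** * Absorption *)

Section Isomorphisms.
Local Open Scope ring_scope.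

Lemma iso_of_bij (A B : zmodType) (f : A -> B) : additive f -> injective f ->
  (forall b, exists a, f a = b) -> zmod_isomorphic A B.
Proof.
move=> fA fI /choice[g gP]; exists (HB.pack_for {additive A -> B} f (GRing.isAdditive.Build _ _ f fA)).
by exists g => [a|b]; [apply: fI; exact: gP|exact: gP].
Qed.

Lemma iso_refl (A : zmodType) : zmod_isomorphic A A.
Proof. by apply: (@iso_of_bij _ _ id) => // a; exists a. Qed.

Lemma iso_sym (A B : zmodType) : zmod_isomorphic A B -> zmod_isomorphic B A.
Proof.
move=> [f [g fK gK]]; apply: (@iso_of_bij _ _ g) => [x y||a]; last by exists (f a).
- by apply: (can_inj fK); rewrite raddfB !gK.
- exact: can_inj gK.
Qed.

Lemma iso_trans (A B C : zmodType) :
  zmod_isomorphic A B -> zmod_isomorphic B C -> zmod_isomorphic A C.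
Proof.
move=> [f [f' fK f'K]] [g [g' gK g'K]].
apply: (@iso_of_bij _ _ (g \o f)) => [x y||c]; first by rewrite /= !raddfB.
- by apply: inj_comp; [exact: can_inj gK|exact: can_inj fK].
- by exists (f' (g' c)); rewrite /= f'K.
Qed.

Lemma iso_prod (A A' B B' : zmodType) : zmod_isomorphic A A' -> zmod_isomorphic B B' ->
  zmod_isomorphic (A * B)%type (A' * B')%type.
Proof.
move=> [f [f' fK f'K]] [g [g' gK g'K]].
apply: (@iso_of_bij _ _ (fun x : A * B => (f x.1, g x.2))) => [x y|x y [e1 e2]|[a b]].
- by rewrite !raddfB.
- by apply: injective_projections; [exact: (can_inj fK)|exact: (can_inj gK)].
- by exists (f' a, g' b); rewrite /= f'K g'K.
Qed.

Lemma iso_prodA (A B C : zmodType) :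
  zmod_isomorphic ((A * B) * C)%type (A * (B * C))%type.
Proof.
apply: (@iso_of_bij _ _ (fun x : (A * B) * C => (x.1.1, (x.1.2, x.2)))) => //.
  by move=> [[a b] c] [[a' b'] c'] [-> -> ->].
by move=> [a [b c]]; exists (a, b, c).
Qed.

Lemma iso_pow (K : zmodType) : zmod_isomorphic (nat -> K) (K * (nat -> K))%type.
Proof.
apply: (@iso_of_bij _ _ (fun u : nat -> K => (u 0%N, fun n => u n.+1))) => //.
  by move=> u v [e0 e]; apply/funext => -[|n] //; exact: (congr1 (fun h => h n) e).
by move=> [a u]; exists (fun n => if n is m.+1 then u m else a).
Qed.

Lemma kernel_closed (G B : zmodType) (f : {additive G -> B}) :
  zmod_closed [pred x | f x == 0].
Proof.
split=> [|x y]; rewrite !inE ?raddf0 // => /eqP fx /eqP fy.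
by rewrite raddfB fx fy subr0.
Qed.

Definition kernel (G B : zmodType) (f : {additive G -> B}) := Subgroup (kernel_closed f).

Lemma retract_iso (G K : zmodType) (i : {additive K -> G}) (r : {additive G -> K}) :
  cancel i r -> exists C : zmodType, zmod_isomorphic G (K * C)%type.
Proof.
move=> ir; exists (subgroup_elt (kernel r)); apply: iso_sym.
apply: (@iso_of_bij _ _ (fun x : K * subgroup_elt (kernel r) => i x.1 + val x.2)).
- by move=> x y; rewrite !raddfB /= addrACA opprD.
- move=> [k [c c0]] [k' [c' c0']] /= e; have /eqP rc := c0; have /eqP rc' := c0'.
  have kk : k = k' by have := congr1 r e; rewrite !raddfD /= !ir rc rc' !addr0.
  by rewrite kk in e *; congr pair; apply: val_inj; apply: addrI e.
- move=> x; have h : x - i (r x) \in kernel r by rewrite inE raddfB ir subrr.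
  by exists (r x, SubgroupElt h); rewrite /= addrC subrK.
Qed.

Lemma split_iso (G B : zmodType) (f : {additive G -> B}) :
  (forall b, exists a, f a = b) -> torsion_free B -> cotorsion (subgroup_elt (kernel f)) ->
  zmod_isomorphic G (subgroup_elt (kernel f) * B)%type.
Proof.
move=> fS tB ct; pose K := subgroup_elt (kernel f).
pose Gr : set (G * K)%type := fun p => val p.2 = p.1.
have pGr : pure_graph Gr.
  split; first split=> //.
  - by move=> p p' hp hp'; rewrite /Gr !raddfB /= hp hp'.
  - by move=> e e0; apply: val_inj; exact: e0.
  - move=> x n e n0 h; have xk : x \in kernel f.
      have e1 : val e = x *+ n := h.
      rewrite inE; apply/eqP/(tB _ _ n0); rewrite -raddfMn -e1.
      by apply/eqP; exact: (elt_in e).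
    by exists (SubgroupElt xk).
have [r rP] := extend_pure ct pGr.
have rK (k : K) : r (val k) = k by apply: rP.
have fK (k : K) : f (val k) = 0 by apply/eqP; exact: elt_in k.
apply: (@iso_of_bij _ _ (fun x => (r x, f x))) => [x y|x y [e1 e2]|[k b]].
- by rewrite !raddfB.
- have xk : x - y \in kernel f by rewrite inE raddfB e2 subrr.
  have := rK (SubgroupElt xk); rewrite /= raddfB e1 subrr => /(congr1 val) /= /esym /eqP.
  by rewrite subr_eq0 => /eqP.
- have [x0 <-] := fS b; exists (x0 - val (r x0) + val k).
  by rewrite !raddfD !raddfN /= !rK subrr add0r !fK oppr0 !addr0.
Qed.

End Isomorphisms.

(** * Pure embeddings into a power of the product modulo the sum *)

Section Embedding.
Local Open Scope ring_scope.
Local Open Scope classical_set_scope.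
Notation A := product_mod_sum.
Variable K : zmodType.
Hypothesis tfK : torsion_free K.

Section OnePrime.
Variable p : nat.
Hypothesis pP : (p == 0)%N || prime p.
Variable rho : K -> nat -> bool.
Hypothesis rhoI : injective rho.
Notation E := (subgroup_elt (unitary_divisible p)).

(** Linear independence modulo [p]; for [p = 0] it is independence over the integers. *)
Definition independent (B : set K) := forall c : {freeg K / int}, span B c ->
  (exists y, ev id c = y *+ p) -> forall x, (p %| coeff x c)%Z.

(* For [p = 0] only the divisible part of [K] is detected. *)
Definition detected (x : K) := (0 < p)%N \/ forall m, (0 < m)%N -> exists y, x = y *+ m.

Lemma independent_eq0 B c : independent B -> span B c -> ev id c = 0 -> c = 0.
Proof.
move=> iB sc c0; have pw n : forall c, span B c -> ev id c = 0 ->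
    forall x, ((p ^ n)%N %| coeff x c)%Z.
  elim: n => [|n IH] {}c {}sc {}c0 x; first by rewrite expn0 dvd1z.
  have pc : forall x, (p %| coeff x c)%Z by apply: (iB _ sc); exists 0; rewrite mul0rn.
  have [c' cE sc'] := span_divide sc pc.
  case/orP: (pP) => [/eqP p0|pr].
    by rewrite cE p0 mulr0n coeff0 dvdz0.
  have c'0 : ev id c' = 0 by apply: (tfK (prime_gt0 pr)); rewrite -raddfMn -cE.
  by rewrite cE raddfMn /= -mulr_natr natz expnSr PoszM dvdz_mul // IH.
apply/eqP/freeg_eqP => x; rewrite coeff0; apply/eqP/negP => /negP cx.
have := pw `|coeff x c|%N.+1 _ sc c0 x; case/orP: (pP) => [/eqP p0|pr].
  by rewrite p0 exp0n // dvd0z (negPf cx).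
rewrite dvdzE /= => /dvdn_leq; rewrite absz_gt0 cx => /(_ isT); rewrite leqNgt.
by rewrite (ltn_trans (ltnSn _)) // ltn_expl // prime_gt1.
Qed.

Lemma maximal_independent : exists B : set K, [/\ B `<=` detected, independent B &
  forall x, detected x -> B x \/ exists c y z, [/\ span (fun u => B u \/ u = x) c,
    ev id c = y *+ p & ~~ (p %| coeff z c)%Z]].
Proof.
pose P B := B `<=` detected /\ independent B.
have [B [[BD iB] maxB]] : exists B, P B /\ forall B', B `<` B' -> ~ P B'.
  apply: Zorn_bigcup => F FP tF; split=> [x [X FX Xx]|c sc].
    by have [XD _] := FP _ FX; apply: XD.
  have [d0|[X FX sX]] : dom c = [::] \/ exists2 X, F X & forall x, x \in dom c -> X x.
    have : forall x, x \in dom c -> (\bigcup_(X in F) X) x by move=> x; rewrite mem_dom; apply: sc.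
    elim: (dom c) => [|x s IH] h; first by left.
    right; have [X FX Xx] := h x (mem_head _ _).
    case: IH => [y ys|s0|[Y FY Ys]]; first by apply: h; rewrite inE ys orbT.
      by exists X => // y; rewrite s0 inE => /eqP ->.
    have [XY|YX] := tF _ _ FX FY.
      by exists Y => // y; rewrite inE => /predU1P[->|/Ys //]; apply: XY.
    by exists X => // y; rewrite inE => /predU1P[-> //|/Ys]; apply: YX.
  - move=> _ x; have [->|] := eqVneq (coeff x c) 0; first exact: dvdz0.
    by rewrite -mem_dom d0.
  - by have [_] := FP _ FX; apply=> x; rewrite -mem_dom; apply: sX.
exists B; split=> // x Dx; have [Bx|nBx] := pselect (B x); first by left.
right; apply: contrapT => h; apply: (maxB (fun u => B u \/ u = x)).
  by split=> [u Bu|/(_ x) H]; [left|apply: nBx; apply: H; right].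
split=> [u [/BD //|-> //]|c sc [y cy] z]; apply/negPn/negP => nz; apply: h.
by exists c, y, z.
Qed.

(** A maximal independent set goes to almost disjoint sequences. The map extends because the other
    primes divide the target and, by independence, the span is pure at [p]. If [F x] is divisible by
    [p], maximality gives a relation involving [x]; its image shows that the part without [x] is
    divisible by [p], hence so is [x]. *)
Lemma detecting_map : cotorsion E -> torsion_free E -> exists F : {additive K -> A},
  forall x, detected x -> (exists y, F x = y *+ p) -> exists x', x = x' *+ p.
Proof.
move=> ctE tfE; have [B [BD iB maxB]] := maximal_independent.
pose e (x : K) : E := SubgroupElt (almost_disjoint_divisible p (rho x)).
pose Gr : set (K * E)%type := fun q => exists2 c, span B c & q = (ev id c, ev e c).
have gGr : graph Gr.
  split.
  - by exists 0; rewrite ?raddf0 //; apply: span0.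
  - by move=> q q' [c sc ->] [c' sc' ->]; exists (c - c'); [exact: spanB|rewrite !raddfB].
  - by move=> a [c sc [/esym c0 ->]]; rewrite (independent_eq0 iB sc c0) raddf0.
have [F FP] : exists F : {additive K -> E}, forall x a, Gr (x, a) -> F x = a.
  apply: extend_divisible => // q pq; have [qp|qp] := eqVneq q p.
    right=> x a [c sc [xc _]]; have pc : forall x, (p %| coeff x c)%Z.
      by apply: (iB _ sc); exists x; rewrite -xc qp.
    have [c' cE sc'] := span_divide sc pc; exists (ev e c'), c' => //.
    congr pair; apply/eqP; rewrite -subr_eq0; apply/eqP/(tfK (prime_gt0 pq)).
    by rewrite mulrnBl xc cE raddfMn qp subrr.
  by left; apply: E_divisible.
pose V : {additive K -> A} := val \o F; exists V => x Dx [y Fx].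
have evF c : span B c -> F (ev id c) = ev e c by move=> sc; apply: FP; exists c.
have free c : span B c -> (exists a, V (ev id c) = a *+ p) -> forall x, (p %| coeff x c)%Z.
  move=> sc [a]; rewrite /V /= evF // => ea.
  apply: (almost_disjoint_free pP rhoI); exists a; rewrite -ea.
  rewrite -[RHS]/((val \o ev e) c).
  by apply: (freeg_ext (P := B) (B := val \o ev e)) => // u _; rewrite /= !evU.
have [Bx|[c [k [z [sc ck nz]]]]] := maxB _ Dx.
  have pd : (p %| 1)%Z.
    have := free << x >> (spanU Bx); rewrite evU => /(_ (ex_intro _ y Fx)) /(_ x).
    by rewrite coeffU eqxx.
  have p1 : p = 1%N by move: pd; rewrite dvdzE /= dvdn1 => /eqP.
  by move: (pP); rewrite p1.
pose l := coeff x c; pose c0 := c - << x >> *~ l.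
have sc0 : span B c0.
  move=> u; rewrite /c0 coeffB raddfMz /= coeffU mul1r; have [<-|xu] := eqVneq x u.
    by rewrite mulr1n intz subrr eqxx.
  by rewrite mulr0n mul0rz subr0 => /sc [//|ux]; rewrite ux eqxx in xu.
have evc0 : ev id c0 = k *+ p - x *~ l by rewrite /c0 raddfB raddfMz /= evU ck.
have [c1 c1E sc1] : exists2 c1, c0 = c1 *+ p & span B c1.
  apply: (span_divide sc0); apply: (free _ sc0); exists (V k - y *~ l).
  by rewrite evc0 raddfB raddfMn raddfMz Fx mulrnBl !pmulrn -!mulrzA [l * _]mulrC.
have xl : x *~ l = (k - ev id c1) *+ p.
  have e1 : ev id c0 = ev id c1 *+ p by rewrite [in LHS]c1E raddfMn.
  by rewrite mulrnBl -e1 evc0 subKr.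
have npl : ~~ (p %| l)%Z.
  apply: contra nz => pl; have cE : c = c0 + << x >> *~ l by rewrite subrK.
  have d0 : (p %| coeff z c0)%Z by rewrite c1E; apply: coeffMn.
  have d1 : (p %| coeff z (<< x >> *~ l))%Z by rewrite raddfMz /= -mulrzr intz; apply: dvdz_mull.
  by rewrite cE coeffD rpredD.
case/orP: (pP) => [/eqP p0|pr].
  have l0 : l != 0 by move: npl; rewrite p0 dvd0z.
  exists 0; rewrite p0 mulr0n; move: xl; rewrite p0 mulr0n => /(torsion_free_mulz tfK)[|//].
  by move/eqP: l0.
have cop : coprimez p l by rewrite /coprimez /gcdz /=; have := npl; rewrite dvdzE /= -prime_coprime.
have [[u v] /= uv] := coprimezP _ _ cop.
exists (x *~ u + (k - ev id c1) *~ v).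
rewrite -[LHS]mulr1z -uv mulrzDr mulrnDl; congr (_ + _); first by rewrite pmulrn -mulrzA.
transitivity (x *~ l *~ v); first by rewrite -mulrzA mulrC.
by rewrite xl !pmulrn -!mulrzA mulrC.
Qed.

End OnePrime.

(** The coordinates are the detecting maps for all primes and for [p = 0]. The primes give purity,
    so an element of the kernel is divisible by every positive integer and is then caught by the
    coordinate 0. A pure embedding of a cotorsion group splits. *)
Lemma pow_retract : cotorsion K -> small K ->
  exists (i : {additive K -> (nat -> A)}) (r : {additive (nat -> A) -> K}), cancel i r.
Proof.
move=> ctK [rho rhoI].
have /choice[F FP] p : exists F : {additive K -> A}, (p == 0)%N || prime p ->
    forall x, detected p x -> (exists y, F x = y *+ p) -> exists x', x = x' *+ p.
  have [pP|nP] := boolP ((p == 0)%N || prime p); last by exists \0.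
  have [F FP] := detecting_map pP rhoI (E_cotorsion pP)
    (subgroup_torsion_free (S := unitary_divisible p) product_mod_sum_torsion_free).
  by exists F.
pose f (x : K) (p : nat) : A := F p x.
have fA : additive f by move=> x y; apply/funext => p; rewrite /f raddfB.
pose i := HB.pack_for {additive K -> (nat -> A)} f (GRing.isAdditive.Build _ _ f fA).
have tfM (a : nat -> A) n : (0 < n)%N -> a *+ n = 0 -> a = 0.
  move=> n0 e; apply/funext => j; apply: (product_mod_sum_torsion_free n0).
  by have := congr1 (fun h => h j) e; rewrite natmulfctE.
have pure q x a : prime q -> f x = a *+ q -> exists x', x = x' *+ q /\ f x' = a.
  move=> pq e; have [|||x' xE] := FP q _ x.
  - by rewrite pq orbT.
  - by left; apply: prime_gt0.
  - by exists (a q); have := congr1 (fun h => h q) e; rewrite natmulfctE.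
  exists x'; split=> //; apply/eqP; rewrite -subr_eq0; apply/eqP/(tfM _ q (prime_gt0 pq)).
  by rewrite mulrnBl -e xE -(raddfMn i) subrr.
have f0 x : f x = 0 -> x = 0.
  move=> fx; have dv : forall n x, (0 < n)%N -> f x = 0 -> exists y, x = y *+ n.
    elim/ltn_ind => n IH {fx} {}x n0 fx; have [n1|n1] := leqP n 1.
      by exists x; have -> : n = 1%N by apply/eqP; rewrite eqn_leq n1.
    have pp := pdiv_prime n1; have [|x' [-> fx']] := pure (pdiv n) x 0 pp; first by rewrite fx mul0rn.
    have [||y ->] := IH (n %/ pdiv n)%N _ x' _ fx'.
    - by rewrite ltn_Pdiv // prime_gt1.
    - by rewrite divn_gt0 ?pdiv_leq // prime_gt0.
    by exists y; rewrite -mulrnA divnK // pdiv_dvd.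
  have [||x' ->] := FP 0%N isT x; last by rewrite mulr0n.
    by right=> m m0; apply: dv.
  by exists 0; rewrite mulr0n; exact: (congr1 (fun h => h 0%N) fx).
pose Gr : set ((nat -> A) * K)%type := fun q => f q.2 = q.1.
have pGr : pure_graph Gr.
  split; first split.
  - exact: (raddf0 i).
  - by move=> q q' hq hq'; rewrite /Gr [LHS](raddfB i) /= [f _]hq [f q'.2]hq'.
  - by move=> e; apply: f0.
  - move=> a n x n0 h; apply: (@pure_of_prime _ (fun a => exists x, Gr (a, x)) _ n) => //; last by exists x.
    move=> q b pq [y hy]; have [x' [_ fx']] := pure q y b pq hy.
    by exists x'.
have [r rP] := extend_pure ctK pGr.
by exists i, r => x; apply: rP.
Qed.

End Embedding.

Section Absorption.
Local Open Scope ring_scope.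
Notation A := product_mod_sum.

(** Eilenberg swindle: [nat -> K] is a direct factor of [nat -> A], and it absorbs one more copy of
    [K]. *)
Lemma absorb (K : zmodType) : torsion_free K -> cotorsion K -> small K ->
  zmod_isomorphic (K * (nat -> A))%type (nat -> A).
Proof.
move=> tf ct sm.
have tfP : torsion_free (nat -> K).
  move=> u n n0 e; apply/funext => i; apply: (tf _ n n0).
  by have := congr1 (fun h => h i) e; rewrite natmulfctE.
have ctP : cotorsion (nat -> K).
  move=> g q q0; have /choice[x xP] i := ct (fun n => g n i) q q0.
  by exists (fun n i => x i n) => n; apply/funext => i; rewrite xP fctE natmulfctE.
have [i [r ir]] := pow_retract tfP ctP (small_pow sm).
have [C eC] := retract_iso ir; apply: iso_sym; apply: (iso_trans eC).
apply: (iso_trans (iso_prod (iso_pow K) (iso_refl C))).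
apply: (iso_trans (iso_prodA _ _ _)).
by apply: iso_prod (iso_refl _) (iso_sym eC).
Qed.

(* Rows of a doubly indexed sequence; the entry [(i, n)] is stored at [pickle (i, n)]. *)
Definition rows_fun (a : A) (i : nat) : A := seq_class (fun n => repr a (pickle (i, n))).

Lemma rows_class u i : rows_fun (seq_class u) i = seq_class (fun n => u (pickle (i, n))).
Proof.
apply/seq_classP; have /seq_classP[N NP] : seq_class (repr (seq_class u)) = seq_class u.
  by rewrite /seq_class reprK.
exists (\max_(m < N) (if (unpickle m : option (nat * nat)) is Some (_, n) then n.+1 else 0)%N) => n mn; apply: NP.
rewrite leqNgt; apply/negP => lt; move: mn => /bigmax_leqP /(_ (Ordinal lt) isT).
by rewrite /= pickleK ltnn.
Qed.

Lemma rows_additive : additive rows_fun.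
Proof.
move=> a b; have [[u ->] [v ->]] := (seq_class_surj a, seq_class_surj b).
by apply/funext => i; rewrite !fctE -raddfB !rows_class -raddfB.
Qed.

HB.instance Definition _ := GRing.isAdditive.Build _ _ rows_fun rows_additive.

Lemma rows_surj b : exists a, rows_fun a = b.
Proof.
have /choice[u uP] i := seq_class_surj (b i).
exists (seq_class (fun m => if unpickle m is Some (i, n) then u i n else 0)).
apply/funext => i; rewrite rows_class uP; congr seq_class.
by apply/funext => n; rewrite pickleK.
Qed.

(** A number that codes no pair is its own row, so for each [l] only finitely many of these lie in
    rows below [l]. *)
Definition row_index (m : nat) : nat :=
  if (pickle_inv m : option (nat * nat)) is Some (i, _) then i else m.

Lemma row_index_pickle (i n : nat) : row_index (pickle (i, n)) = i.
Proof. by rewrite /row_index pickleK_inv. Qed.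

(** Representatives of kernel elements have finitely many nonzero entries in each row. So clearing
    the rows below [l] in the [l]-th right-hand side keeps its class. Afterwards each row of a
    solution involves finitely many right-hand sides and is finite as well. *)
Lemma rows_kernel_cotorsion : cotorsion (subgroup_elt (kernel rows_fun)).
Proof.
move=> g q q0.
have /choice[u uP] l : exists u, val (g l) = seq_class u by apply: seq_class_surj.
have /choice[T TP] l : exists T : nat -> nat, forall i n : nat, (T i <= n)%N -> u l (pickle (i, n)) = 0.
  have h : rows_fun (val (g l)) = 0 by apply/eqP; exact: elt_in (g l).
  have /choice[T TP] (i : nat) : exists T : nat, forall n : nat, (T <= n)%N -> u l (pickle (i, n)) = 0.
    have : rows_fun (val (g l)) i = 0 by rewrite h.
    by rewrite uP rows_class -seq_class0 => /seq_classP[N NP]; exists N => n /NP.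
  by exists T.
pose v l m := if (row_index m < l)%N then 0 else u l m.
have v0 l m : (row_index m < l)%N -> v l m = 0 by rewrite /v => ->.
have vP l : val (g l) = seq_class (v l).
  rewrite uP; apply/seq_classP.
  exists (maxn l (\max_(i < l) \max_(n < T l i) (pickle (val i, val n)).+1)) => m.
  rewrite geq_max /v => /andP[lm hm]; case: ifP => // ml.
  move: ml hm; rewrite /row_index; case e : (pickle_inv m) => [[i n]|]; last by rewrite ltnNge lm.
  have := @pickle_invK (nat * nat)%type m; rewrite /oapp e => <- il hm.
  apply: TP; rewrite leqNgt; apply/negP => nT; move: hm.
  move=> /bigmax_leqP /(_ (Ordinal il) isT) /bigmax_leqP /(_ (Ordinal nT) isT).
  by rewrite /= ltnn.
have [x [xE x0]] := diagonal_solution q v0.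
have xP k : seq_class (x k) \in kernel rows_fun.
  suff h : rows_fun (seq_class (x k)) = 0 by apply/eqP.
  apply/funext => i; rewrite rows_class; transitivity (seq_class 0); last exact: seq_class0.
  apply/seq_classP; exists (\max_(l < i.+1) T l i) => n /bigmax_leqP nT.
  apply: x0 => l; rewrite /v row_index_pickle; case: ltnP => // li.
  by apply: TP; apply: (nT (Ordinal (li : l < i.+1)%N)).
exists (fun k => SubgroupElt (xP k)) => k; apply: val_inj.
transitivity (val (g k) + seq_class (x k.+1) *+ q k); last first.
  by rewrite -[RHS]/(val (g k + SubgroupElt (xP k.+1) *+ q k)) raddfD (raddfMn val).
rewrite vP -seq_classMn -seq_classD -[LHS]/(seq_class (x k)).
by congr seq_class; apply/funext => m; rewrite xE fctE natmulfctE.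
Qed.

Lemma subgroup_small (V : zmodType) (S : subgroup V) : small V -> small (subgroup_elt S).
Proof. exact: small_inj val_inj. Qed.

(** Reading rows splits the group into a kernel and its own countable power, and the power absorbs
    the kernel. *)
Lemma product_mod_sum_pow : zmod_isomorphic A (nat -> A).
Proof.
have tfA := product_mod_sum_torsion_free.
have tfP : torsion_free (nat -> A).
  move=> u n n0 e; apply/funext => i; apply: (tfA _ n n0).
  by have := congr1 (fun h => h i) e; rewrite natmulfctE.
apply: (iso_trans (split_iso rows_surj tfP rows_kernel_cotorsion)).
apply: absorb; [exact: subgroup_torsion_free|exact: rows_kernel_cotorsion|].
exact/subgroup_small/product_mod_sum_small.
Qed.

Lemma extension_of_product_mod_sum (H : zmodType) (f : {additive H -> A}) :
  (forall a, exists x, f x = a) -> torsion_free H -> small (subgroup_elt (kernel f)) ->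
  cotorsion (subgroup_elt (kernel f)) -> zmod_isomorphic H A.
Proof.
move=> fS tf sm ct; have e := product_mod_sum_pow.
apply: (iso_trans (split_iso fS product_mod_sum_torsion_free ct)).
apply: (iso_trans (iso_prod (iso_refl _) e)); apply: (iso_trans _ (iso_sym e)).
by apply: absorb => //; apply: subgroup_torsion_free.
Qed.

End Absorption.

(** * Homology of the archipelago *)

Section InfiniteWords.
Local Open Scope ring_scope.
Implicit Types (g h : profree).

Lemma profreeX g n M : (g ^+ n)%g M = (g M ^+ n)%g.
Proof. by elim: n => // n IH; rewrite !expgS profreeM IH. Qed.

Lemma prX M x n : pr M (x ^+ n)%g = (pr M x ^+ n)%g.
Proof. by elim: n => [|n IH]; rewrite ?pr1 // !expgS prM IH. Qed.

Lemma labels_inX P x n : labels_in P x -> labels_in P (x ^+ n)%g.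
Proof. by move=> h; elim: n => // n IH; rewrite expgS; apply: labels_inM. Qed.

Lemma count_labelX i x n : (count_label i (x ^+ n)%g <= n * count_label i x)%N.
Proof.
elim: n => // n IH; rewrite expgS mulSn; apply: leq_trans (count_labelM _ _ _) _.
by rewrite leq_add2l.
Qed.

Lemma expsumX i x n : expsum i (x ^+ n)%g = expsum i x *+ n.
Proof. by elim: n => [|n IH]; rewrite ?expsum1 // expgS expsumM IH mulrS. Qed.

Lemma expsum_fletter i a : expsum i (fletter a) = (a.1 == i)%:R * letter_sign a.
Proof. by rewrite -[fletter a]mul1g expsum_letter expsum1 add0r. Qed.

Lemma count_label_high i m x : labels_in (leq m) x -> (i < m)%N -> count_label i x = 0%N.
Proof.
move=> lx im; apply/eqP; rewrite -leqn0 leqNgt -has_count; apply/hasP => -[a aw /eqP ai].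
by move/allP: lx => /(_ _ aw); rewrite ai leqNgt im.
Qed.

Definition letter_power n (k : int) : free_group := (fletter (n, (0 <= k)%R) ^+ `|k|%N)%g.

Lemma expsum_letter_power i n k : expsum i (letter_power n k) = if n == i then k else 0.
Proof.
rewrite /letter_power expsumX expsum_fletter /=; case: eqP => _; last by rewrite mul0r mul0rn.
by case: k => k; rewrite mul1r /letter_sign /= ?mulNrn -?NegzE // natz.
Qed.

Fixpoint product_word (k : nat -> int) (M : nat) : free_group :=
  if M is M'.+1 then (product_word k M' * if (8 <= M')%N then letter_power M' (k M') else 1)%g
  else 1%g.

Lemma expsum_product_word k i M : expsum i (product_word k M) =
  if (8 <= i < M)%N then k i else 0.
Proof.
elim: M => [|M IH]; first by rewrite expsum1 andbF.
rewrite /= expsumM IH; have [M8|M8] := leqP 8 M; last first.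
  by rewrite expsum1 addr0; congr (if _ then _ else _); lia.
rewrite expsum_letter_power; case: eqP => [<-|Mi]; first by rewrite ltnn andbF add0r M8 ltnSn.
by rewrite addr0; congr (if _ then _ else _); lia.
Qed.

Lemma high_product_word k : high 8 (product_word k).
Proof.
have lp M : labels_in (leq M) (letter_power M (k M)).
  by apply: labels_inX; rewrite /labels_in /= leqnn.
have lw M : labels_in (leq 8) (product_word k M).
  elim: M => // M IH /=; apply: labels_inM => //; case: ifP => // M8.
  by apply: labels_inS (lp M) => l /=; apply: leq_trans.
have prl M n : pr M (letter_power n (k n)) = if (n < M)%N then letter_power n (k n) else 1%g.
  by rewrite prX pr_letter /=; case: ifP => // _; rewrite expg1n.
have prw M N : (N <= M)%N -> pr M (product_word k N) = product_word k N.
  elim: N => [|N IH] NM; first exact: pr1.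
  rewrite /= prM IH ?(ltnW NM) //; congr (_ * _)%g; case: ifP => // _.
  by rewrite prl NM.
split=> //; split=> [M|i|M].
- rewrite /= prM prw // -[RHS]mulg1; congr (_ * _)%g; case: ifP => // _.
  by rewrite prl ltnn.
- exists `|k i|%N => M; elim: M => // M IH; have [Mi|Mi] := eqVneq M i; last first.
    rewrite /=; apply: leq_trans (count_labelM _ _ _) _; rewrite [X in (_ + X)%N](_ : _ = 0%N) ?addn0 //.
    case: ifP => // _; apply/eqP; rewrite -leqn0; apply: leq_trans (count_labelX _ _ _) _.
    by rewrite /count_label /= (negPf Mi) muln0.
  rewrite /=; apply: leq_trans (count_labelM _ _ _) _.
  have -> : count_label i (product_word k M) = 0%N.
    apply/eqP; rewrite -leqn0 leqNgt -has_count; apply/hasP => -[a aw /eqP ai].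
    have := labels_in_pr M (product_word k M); rewrite prw // => /allP /(_ _ aw) /=.
    by rewrite ai Mi ltnn.
  case: ifP => // _; apply: leq_trans (count_labelX _ _ _) _.
  by rewrite /count_label /= Mi eqxx muln1.
- by apply: labels_inS (lw M) => l /=; apply: leq_trans.
Qed.

Section Nested.
Variables (h : nat -> profree) (q : nat -> nat).
Hypothesis hh : forall n, high (n + 8)%N (h n).

(* [nested n] is the infinite word [h_n (h_(n+1) (h_(n+2) ...)^(q_(n+1)))^(q_n)]. *)
Fixpoint nested_upto f n M : free_group :=
  if f is f'.+1 then (h n M * nested_upto f' n.+1 M ^+ q n)%g else 1%g.

Definition nested n : profree := fun M => nested_upto M n M.

(** [h n] has no letter below [n + 8], so deeper factors are trivial at level [M]; depth [M] is
    therefore enough in [nested]. *)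
Lemma nested_upto_stable f n M : (M <= n + f)%N ->
  nested_upto f.+1 n M = nested_upto f n M.
Proof.
elim: f n => [|f IH] n Mn.
  have [[cg _ _] lg] := hh n; rewrite /= expg1n mulg1 (high_trivial (leq_addl n 8) cg (lg M)) //.
  by move: Mn; lia.
have E : nested_upto f.+1 n.+1 M = nested_upto f n.+1 M by apply: IH; rewrite addSnnS.
by rewrite -[LHS]/(h n M * nested_upto f.+1 n.+1 M ^+ q n)%g E.
Qed.

Lemma nestedE n : nested n = (h n * nested n.+1 ^+ q n)%g.
Proof.
apply/funext => M; rewrite profreeM profreeX /nested -nested_upto_stable //; exact: leq_addl.
Qed.

Lemma nested_upto_labels f n M : labels_in (leq (n + 8)) (nested_upto f n M).
Proof.
elim: f n => //= f IH n; have [_ lg] := hh n; apply: labels_inM => //.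
by apply: labels_inX; apply: labels_inS (IH n.+1) => l /=; lia.
Qed.

Lemma high_nested n : high 8 (nested n).
Proof.
have lw f M : labels_in (leq 8) (nested_upto f n M).
  by apply: labels_inS (nested_upto_labels f n M) => l /=; lia.
split=> [|M]; last exact: lw.
split=> [M|i|M].
- have prW f k : pr M (nested_upto f k M.+1) = nested_upto f k M.
    elim: f k => [|f IH] k; first exact: pr1.
    by have [[cg _ _] _] := hh k; rewrite /= prM prX IH cg.
  by rewrite /nested prW nested_upto_stable // leq_addl.
- suff [B BP] : exists B, forall f M, (count_label i (nested_upto f n M) <= B)%N by exists B => M; apply: BP.
  have : (i < n + (i.+1 - n) + 8)%N by lia.
  move: (i.+1 - n)%N => d; elim: d n {lw} => [|d IH] k hd.
    exists 0%N => f M; rewrite (count_label_high (nested_upto_labels f k M)) //.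
    by rewrite addn0 in hd.
  have [|C CP] := IH k.+1; first by move: hd; lia.
  have [[_ bg _] _] := hh k; have [B BP] := bg i.
  exists (B + q k * C)%N => -[|f] M //=.
  apply: leq_trans (count_labelM _ _ _) (leq_add (BP M) _).
  by apply: leq_trans (count_labelX _ _ _) _; rewrite leq_mul2l CP orbT.
- by apply: labels_inS (lw M M) => l /=; apply: leq_trans.
Qed.

Lemma exponent_nested : (forall n i, exponent (h n) i = 0) -> forall n i, exponent (nested n) i = 0.
Proof.
move=> e0 n i; rewrite /exponent /nested; move: i.+1 => M.
elim: {1}M n => [|f IH] n; first exact: expsum1.
have [[cg _ _] _] := hh n.
by rewrite /= expsumM expsumX IH mul0rn addr0 (exponent_level _ cg).
Qed.

End Nested.
End InfiniteWords.

Section HomologyClasses.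
Local Open Scope classical_set_scope.
Local Open Scope ring_scope.
Variable R : realType.
Notation X := (harmonic_archipelago R).
Notation C k := (singular_chain R X k).
Notation H k := (homology R X k).
Notation cyc k := (cycle_group R X k).

Lemma rearrange5 (V : zmodType) (a b c e : V) : (a + b - c) - (b - e) = a + e - c.
Proof. by rewrite opprB [e - b]addrC addrA [a + b - c]addrAC addrK addrAC. Qed.

Definition hclass k (z : C k.+1) : H k.+1 := \pi_(H k.+1)%qT (insubd (0 : cyc k.+1) z).

Lemma hclass_val k (z : C k.+1) : boundary z = 0 -> val (insubd (0 : cyc k.+1) z) = z.
Proof. by move=> bz; rewrite val_insubd; have -> : z \in @is_cycle R X k.+1 by apply/eqP. Qed.

Lemma hclass_eq k (z w : C k.+1) : boundary z = 0 -> boundary w = 0 ->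
  hclass z = hclass w <-> exists d, boundary d = z - w.
Proof.
move=> bz bw; rewrite /hclass (quot_eq (@is_boundary R X k.+1)).
have <- : val (insubd (0 : cyc k.+1) z - insubd (0 : cyc k.+1) w) = z - w.
  by rewrite (raddfB val) /= !hclass_val.
by split=> [/asboolP|h] //; apply/asboolP.
Qed.

Lemma hclass_surj k (x : H k.+1) : exists2 z, boundary z = 0 & x = hclass z.
Proof.
have [z ->] := quotP x; exists (val z); first by case: z => z /= /eqP.
by rewrite /hclass valKd.
Qed.

Lemma hclassB k (z w : C k.+1) : boundary z = 0 -> boundary w = 0 ->
  hclass (z - w) = hclass z - hclass w.
Proof.
move=> bz bw; rewrite /hclass -quotN -quotD; congr (\pi_(H k.+1)%qT _); apply: val_inj.
by rewrite raddfB /= !hclass_val // raddfB /= bz bw subrr.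
Qed.

Lemma hclassD k (z w : C k.+1) : boundary z = 0 -> boundary w = 0 ->
  hclass (z + w) = hclass z + hclass w.
Proof.
move=> bz bw; rewrite /hclass -quotD; congr (\pi_(H k.+1)%qT _); apply: val_inj.
by rewrite raddfD /= !hclass_val // raddfD /= bz bw addr0.
Qed.

Lemma hclass0 k : hclass (0 : C k.+1) = 0.
Proof. by have := @hclassB k 0 0; rewrite !subrr => -> //; rewrite raddf0. Qed.

Lemma hclassMn k (z : C k.+1) n : boundary z = 0 -> hclass (z *+ n) = hclass z *+ n.
Proof.
move=> bz; rewrite /hclass -quotMn; congr (\pi_(H k.+1)%qT _); apply: val_inj.
by rewrite raddfMn /= !hclass_val // raddfMn /= bz mul0rn.
Qed.

Lemma hclass_eq0 k (z : C k.+1) : boundary z = 0 ->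
  hclass z = 0 <-> exists d, boundary d = z.
Proof.
move=> bz; have b0 : boundary (0 : C k.+1) = 0 by rewrite raddf0.
by have := hclass_eq bz b0; rewrite hclass0 subr0.
Qed.

Lemma homology_ge2 n : (2 <= n)%N -> zmod_isomorphic (H n) unit.
Proof.
case: n => [|[|k]] // _.
have x0 (x : H k.+2) : x = 0.
  have [z bz ->] := hclass_surj x; apply/hclass_eq0 => //.
  (* The divisor 0 expresses that [z] is a cycle and leaves no remainder. *)
  have [|d [e E]] := @boundary_divisible R k z 0 0; first by rewrite bz mulr0n.
  by exists d; rewrite E mulr0n addr0.
apply: (@iso_of_bij _ _ (fun=> tt)) => // [x y|[]]; first by rewrite (x0 x) (x0 y).
by exists 0.
Qed.

Lemma chain_torsion_free k : torsion_free (C k).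
Proof.
move=> c n n0 e; apply/eqP/freeg_eqP => x; rewrite coeff0.
have : coeff x (c *+ n) = 0 by rewrite e coeff0.
by rewrite raddfMn => /eqP; rewrite mulrn_eq0 (gtn_eqF n0) => /eqP.
Qed.

Lemma homology_torsion_free : torsion_free (H 1).
Proof.
move=> x n n0; have [z bz ->] := hclass_surj x.
have bn : boundary (z *+ n) = 0 by rewrite raddfMn /= bz mul0rn.
rewrite -hclassMn // => /(hclass_eq0 bn)[c cE].
have [d [e E]] := boundary_divisible cE; apply/hclass_eq0 => //; exists e.
apply/eqP; rewrite -subr_eq0; apply/eqP/(chain_torsion_free n0).
by rewrite mulrnBl -cE E raddfD /= boundary_boundary add0r raddfMn subrr.
Qed.

Definition index_class (x : H 1) : product_mod_sum :=
  seq_class (index_map (val (repr x))).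

Lemma index_hclass z : boundary z = 0 -> index_class (hclass z) = seq_class (index_map z).
Proof.
move=> bz; rewrite /index_class; set w := val _.
have bw : boundary w = 0 by rewrite /w; case: (repr _) => u /= /eqP.
have /(hclass_eq bw bz)[d dE] : hclass w = hclass z by rewrite /hclass /w valKd reprK.
have [J JP] := index_boundary d; apply/seq_classP; exists J => j /JP.
by rewrite dE index_mapD index_mapN !fctE => /eqP; rewrite subr_eq0 => /eqP.
Qed.

Lemma index_class_additive : additive index_class.
Proof.
move=> x y; have [[z bz ->] [w bw ->]] := (hclass_surj x, hclass_surj y).
rewrite -hclassB // !index_hclass ?raddfB /= ?[boundary z]bz ?[boundary w]bw ?subrr //.
by rewrite -raddfB index_mapD index_mapN.
Qed.

HB.instance Definition _ := GRing.isAdditive.Build _ _ index_class index_class_additive.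

Lemma index_class_surj a : exists x, index_class x = a.
Proof.
have [b ->] := seq_class_surj a.
(* [index_map] of a loop consists of the partial sums of the exponents, so these are the differences
   of [b], beginning with the first available letter 8. *)
pose k i : int := b i - (if i == 8%N then 0 else b i.-1).
have hw := high_product_word k.
exists (hclass << loop R (product_word k) >>).
rewrite index_hclass ?boundary_loop //; last by case: hw.
apply/seq_classP; exists 8%N => j j8; rewrite index_loop //; last by case: hw.
rewrite -(subnKC j8); elim: (j - 8)%N => [|d IH].
  rewrite addn0 big_ord_recr /= big1 ?add0r => [|i _]; rewrite /exponent expsum_product_word.
    by rewrite ltnSn /= /k eqxx subr0.
  by rewrite [(8 <= i)%N]leqNgt ltn_ord.
rewrite addnS big_ord_recr /= IH /exponent expsum_product_word ltnSn leqW ?leq_addr //= /k.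
by rewrite eqn_leq leqNgt ltnS leq_addr /= subrKC.
Qed.

(** [m] is taken beyond the index from which [index_map z] vanishes, and the bounding chain is tame
    from [m] on, so all partial sums of exponents from [m] on vanish. As [h] has no letter below
    [m], every single exponent is 0. *)
Lemma loop_class x m0 : exists m h, [/\ (m0 <= m)%N, high m h, x = hclass << loop R h >> &
  index_class x = 0 -> forall i, exponent h i = 0].
Proof.
have [z bz ->] := hclass_surj x.
have [J JP] : exists J, index_class (hclass z) = 0 -> forall j, (J <= j)%N -> index_map z j = 0.
  have [e|ne] := pselect (index_class (hclass z) = 0); last by exists 0%N.
  move: (e); rewrite index_hclass // -seq_class0 => /seq_classP[J JP].
  by exists J => _ j /JP.
have [m m0m [m8 [h hh [d sd dE]]]] := cycle_loop (maxn m0 J) bz.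
have [nh lh] := hh; have bh := boundary_loop R nh.
exists m, h; split=> //; first by apply: leq_trans m0m; apply: leq_maxl.
  by apply/hclass_eq => //; exists d.
move=> e; have s0 j : (m <= j)%N -> \sum_(i < j.+1) exponent h i = 0.
  move=> mj; have j8 := leq_trans m8 mj; rewrite -(index_loop R nh j8).
  have := index_boundary_tame j8 (spanS (fun s => tame_le mj) sd).
  rewrite dE index_mapD index_mapN !fctE JP //; last first.
    by apply: leq_trans mj; apply: leq_trans m0m; apply: leq_maxr.
  by rewrite sub0r => /eqP; rewrite oppr_eq0 => /eqP.
have lt i : (i < m)%N -> exponent h i = 0.
  move=> im; apply: expsum_labels; apply: labels_inS (lh _) => l /= ml.
  suff : l != i by [].
  by rewrite neq_ltn orbC (leq_trans im ml).
move=> i; have [im|mi] := ltnP i m; first exact: lt.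
case: (ltngtP m i) mi => // [mi _|<- _].
  have i0 : (0 < i)%N := leq_ltn_trans (leq0n m) mi.
  have e0 : \sum_(j < i) exponent h j = 0.
    by have := s0 i.-1; rewrite prednK // => -> //; rewrite -ltnS prednK.
  by have := s0 i (ltnW mi); rewrite big_ord_recr /= e0 add0r.
by have := s0 m (leqnn m); rewrite big_ord_recr /= big1 ?add0r // => i0 _; apply: lt.
Qed.

(** Representing [g n] by a loop with letters from [n + 8] on makes the nested words well defined.
    Their recursion becomes the system by [loopM] and [loopX], and their exponents vanish, so their
    classes stay in the kernel. *)
Lemma index_kernel_cotorsion : cotorsion (subgroup_elt (kernel index_class)).
Proof.
move=> g q _.
have /choice[h hP] n : exists h, [/\ high (n + 8)%N h, val (g n) = hclass << loop R h >> &
    forall i, exponent h i = 0].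
  have [m [h [nm hm xE e]]] := loop_class (val (g n)) (n + 8).
  exists h; split=> //; first exact: highS hm.
  by apply: e; apply/eqP; exact: (elt_in (g n)).
have hh n : high (n + 8)%N (h n) by case: (hP n).
have ny n : nice (nested h q n) by case: (high_nested q hh n).
have by_ n := boundary_loop R (ny n).
have yP n : hclass << loop R (nested h q n) >> \in kernel index_class.
  suff e : index_class (hclass << loop R (nested h q n) >>) = 0 by apply/eqP.
  rewrite index_hclass //; transitivity (seq_class 0); last exact: seq_class0.
  apply/seq_classP; exists 8%N => j j8; rewrite index_loop // big1 // => i _.
  by apply: exponent_nested => // k l; case: (hP k).
exists (fun n => SubgroupElt (yP n)) => n; apply: val_inj.
transitivity (val (g n) + hclass << loop R (nested h q n.+1) >> *+ q n); last first.
  by rewrite -[RHS]/(val (g n + SubgroupElt (yP n.+1) *+ q n)) raddfD (raddfMn val).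
have [_ -> _] := hP n; rewrite -[LHS]/(hclass << loop R (nested h q n) >>).
have [nh _] := hh n; have bh := boundary_loop R nh.
have hy := high_nested q hh n.+1.
have hX : high 8 (nested h q n.+1 ^+ q n)%g.
  by elim: (q n) => [|k IH]; rewrite ?expgS; [exact: high1|exact: highM].
have [d _ dE] := is_bdD (loopM R (leqnn 8) nh hX) (is_bdN (loopX R (q n) (leqnn 8) hy)).
have bY := by_ n.+1; have bYn : boundary (<< loop R (nested h q n.+1) >> *+ q n : C 1) = 0.
  by rewrite raddfMn /= bY mul0rn.
rewrite -(hclassMn (q n) bY) -(hclassD bh bYn); apply: esym.
have bs : boundary (<< loop R (h n) >> + << loop R (nested h q n.+1) >> *+ q n : C 1) = 0.
  by rewrite raddfD /= bh bYn addr0.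
apply/(hclass_eq bs (by_ n)); exists d; rewrite [nested h q n in RHS]nestedE //.
exact: etrans dE (rearrange5 _ _ _ _).
Qed.

Lemma first_homology : zmod_isomorphic (H 1) product_mod_sum.
Proof.
apply: (extension_of_product_mod_sum index_class_surj homology_torsion_free).
  apply: subgroup_small.
  have /choice[h hP] (x : H 1) : exists h, x = hclass << loop R h >>.
    by have [_ [h [_ _ xE _]]] := loop_class x 0; exists h.
  apply: (@small_inj _ (nat -> seq letter) (fun x M => word (h x M))).
    move=> x y e; rewrite (hP x) (hP y); congr (hclass << loop R _ >>).
    by apply/funext => M; apply: word_inj; exact: (congr1 (fun u => u M) e).
  exact/small_pow/small_count.
exact: index_kernel_cotorsion.
Qed.

End HomologyClasses.

Theorem theorem1p2 (R : realType) :
  zmod_isomorphic (homology R (harmonic_archipelago R) 1) product_mod_sum /\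
  (forall n : nat, (2 <= n)%N ->
    zmod_isomorphic (homology R (harmonic_archipelago R) n) unit).
Proof. by split; [exact: first_homology|exact: homology_ge2]. Qed.
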